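(* Let $n\geq 2$ and $\delta\in(0,1)$. Provide $\mathbb{C}P^n$ with the Fubini--Study form $\omega_{\mathrm{FS}}$ normalized such that the complement of $\mathbb{C}P^{n-1}$ in $\mathbb{C}P^n$ is the symplectic image of the open unit ball $B_1\subset\mathbb{R}^{2n}$, and identify both sets. For $\varepsilon\in(0,1)$ let $V_{\varepsilon}=\mathbb{C}P^n\setminus\overline{B_{1-\varepsilon}}$, equipped with the restriction of $\omega_{\mathrm{FS}}$. Then the function $(0,1)\ni\varepsilon\mapsto c_{\delta}(V_{\varepsilon})$, where $c_\delta$ is the $\delta$-shell capacity, is discontinuous at $\varepsilon=\delta$.
   Context: $\mathbb{R}^{2n}$ has coordinates $(x_1,y_1,\ldots,x_n,y_n)$ and standard symplectic form $\omega_{\mathrm{st}}=\sum_j \mathrm{d}x_j\wedge \mathrm{d}y_j$; $B_r\subset\mathbb{R}^{2n}$ is the open ball of radius $r$ centred at $0$. With the stated normalization a complex line in $\mathbb{C}P^n$ has symplectic area $\pi$; via the symplectic identification $B_1\cong\mathbb{C}P^n\setminus\mathbb{C}P^{n-1}$ the balls $B_{1-\varepsilon}\subset B_1$ are regarded as subsets of $\mathbb{C}P^n$. For $\delta\in(0,1)$ let $A_{\delta}=\overline{B_1}\setminus B_{1-\delta}\subset\mathbb{R}^{2n}$ be the closed spherical shell, and $rA_\delta=\overline{B_r}\setminus B_{r(1-\delta)}$ for $r>0$. The $\delta$-shell capacity of a symplectic manifold $(V,\omega)$ of dimension $2n$ is $$c_{\delta}(V,\omega)=\sup\{\pi r^2\mid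 \text{there is a symplectic embedding } rA_{\delta}\hookrightarrow (V,\omega)\}.$$ A symplectic embedding of the closed shell $rA_\delta$ means a symplectic embedding of some open neighbourhood of $rA_\delta$ in $\mathbb{R}^{2n}$ into $(V,\omega)$. *)

(* Defs.v *)
From HB Require Import structures.
From mathcomp Require Import all_boot all_order all_algebra.
From mathcomp Require Import complex.
From mathcomp Require Import all_classical all_reals all_analysis.
Import Order.TTheory GRing.Theory Num.Theory.
Import numFieldNormedType.Exports.

Set Implicit Arguments.
Unset Strict Implicit.
Unset Printing Implicit Defensive.

Local Open Scope classical_set_scope.
Local Open Scope complex_scope.
Local Open Scope ring_scope.

Section Smooth.
Context {R : realType} {U V : normedModType R}.

(* Only used for [U] finite-dimensional and [A] open, where it is the usual
   notion of a C^k map on [A]: all iterated directional derivatives up to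
   order k exist and are continuous on [A].  The values of [f] outside [A]
   are irrelevant. *)
Fixpoint Ck (k : nat) (A : set U) (f : U -> V) : Prop :=
  {in A, continuous f} /\
  if k is k'.+1 then
    forall v, (forall x, A x -> derivable f x v) /\ Ck k' A ('D_v f)
  else True.

Definition smooth_on (A : set U) (f : U -> V) : Prop := forall k, Ck k A f.

End Smooth.

Section Euclidean.
Context {R : realType} {n : nat}.

(* R^2n is 'M[R]_(n, 2): row k of a point is (x_k, y_k).  The library norm on
   matrices is the sup norm, hence the explicit Euclidean norm. *)
Definition xcoord (z : 'M[R]_(n, 2)) (k : 'I_n) : R := z k ord0.
Definition ycoord (z : 'M[R]_(n, 2)) (k : 'I_n) : R := z k ord_max.

Definition enorm (z : 'M[R]_(n, 2)) : R :=
  Num.sqrt (\sum_(k < n) (xcoord z k ^+ 2 + ycoord z k ^+ 2)).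

Definition eball (r : R) : set 'M[R]_(n, 2) := [set z | enorm z < r].

Definition omega_st (u v : 'M[R]_(n, 2)) : R :=
  \sum_(k < n) (xcoord u k * ycoord v k - ycoord u k * xcoord v k).

Definition shell (r delta : R) : set 'M[R]_(n, 2) :=
  closure (eball r) `\` eball (r * (1 - delta)).

Definition cvec (z : 'M[R]_(n, 2)) : 'rV[R[i]]_n :=
  \row_k (xcoord z k +i* ycoord z k).

Definition rmat (w : 'rV[R[i]]_n) : 'M[R]_(n, 2) :=
  \matrix_(k < n, b < 2) (if b == ord0 then complex.Re (w 0 k) else complex.Im (w 0 k)).

Definition herm (a b : 'rV[R[i]]_n) : R[i] := \sum_(k < n) (a 0 k)^*%C * b 0 k.

(* The Fubini-Study form in an affine chart with coordinate w,
     (i/2) ddbar log(1 + |w|^2)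
       = (i/2) (sum_k dw_k /\ dwbar_k / (1 + |w|^2)
                - (sum_k wbar_k dw_k) /\ (sum_k w_k dwbar_k) / (1 + |w|^2)^2),
   using (i/2) (a /\ abar)(u, v) = Im (conj (a u) * a v) for a complex linear.
   A complex line has area pi. *)
Definition omega_FS (w u v : 'M[R]_(n, 2)) : R :=
  let W := cvec w in let X := cvec u in let Y := cvec v in
  complex.Im (herm X Y / (1 + herm W W)
              - herm X W * herm W Y / (1 + herm W W) ^+ 2).

End Euclidean.

Section ProjectiveSpace.
Context {R : realType} {n : nat}.

Definition CP : Type := {L : {vspace 'rV[R[i]]_n.+1} | \dim L == 1%N}.

(* Homogeneous coordinates: the components of a nonzero vector of the line. *)
Definition hcoords (L : CP) : 'rV[R[i]]_n.+1 := vpick (sval L).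

Definition chart_dom (j : 'I_n.+1) : set CP :=
  [set L | hcoords L 0 j != 0].

(* [z_0 : ... : z_n] |-> (z_k / z_j)_(k != j), a bijection from [chart_dom j]
   onto R^2n; it does not depend on the nonzero vector of the line chosen by
   [hcoords]. *)
Definition chart (j : 'I_n.+1) (L : CP) : 'M[R]_(n, 2) :=
  rmat (\row_k (hcoords L 0 (lift j k) / hcoords L 0 j)).

Definition open_CP (O : set CP) : Prop :=
  forall j, open (chart j @` (O `&` chart_dom j)).

Lemma homog_neq0 (z : 'M[R]_(n, 2)) :
  row_mx (Num.sqrt (1 - enorm z ^+ 2))%:C%:M (cvec z) != 0 :> 'rV[R[i]]_(1 + n).
Proof.
apply/negP => /eqP h.
have /rowP hl := congr1 lsubmx h; have /rowP hr := congr1 rsubmx h.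
have z0 k : xcoord z k = 0 /\ ycoord z k = 0.
  move: (hr k); rewrite row_mxKr !mxE => /eqP.
  by rewrite eq_complex /= => /andP[/eqP-> /eqP->].
have e0 : enorm z = 0.
  rewrite /enorm big1 ?sqrtr0// => k _.
  by have [-> ->] := z0 k; rewrite expr0n addr0.
move: (hl ord0); rewrite row_mxKl !mxE e0 expr0n subr0 sqrtr1 mulr1n => /eqP.
by rewrite eq_complex /= oner_eq0.
Qed.

Lemma dim_homog (z : 'M[R]_(n, 2)) :
  \dim (<[row_mx (Num.sqrt (1 - enorm z ^+ 2))%:C%:M (cvec z) : 'rV[R[i]]_n.+1]>)%VS
    == 1%N.
Proof. by rewrite dim_vline homog_neq0. Qed.

(* z |-> [sqrt (1 - |z|^2) : z_1 : ... : z_n], the symplectic identification of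
   [eball 1] with the complement of the hyperplane z_0 = 0.  Only its
   restriction to [eball 1] is used. *)
Definition ball_embed (z : 'M[R]_(n, 2)) : CP :=
  exist (fun L : {vspace 'rV[R[i]]_n.+1} => \dim L == 1%N) _ (dim_homog z).

Definition smooth_to_CP (W : set 'M[R]_(n, 2)) (f : 'M[R]_(n, 2) -> CP) : Prop :=
  forall j, open (W `&` f @^-1` chart_dom j) /\
            smooth_on (W `&` f @^-1` chart_dom j) (chart j \o f).

Definition embedding_on (W : set 'M[R]_(n, 2)) (f : 'M[R]_(n, 2) -> CP) : Prop :=
  [/\ smooth_to_CP W f,
      set_inj W f,
      forall p j, W p -> chart_dom j (f p) ->
        injective ('d (chart j \o f) p) &
      forall A, open A -> A `<=` W ->
        exists2 O, open_CP O & f @` A = f @` W `&` O].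

Definition symplectic_on (W : set 'M[R]_(n, 2)) (f : 'M[R]_(n, 2) -> CP) : Prop :=
  forall p j, W p -> chart_dom j (f p) -> forall u v,
    omega_FS (chart j (f p)) ('d (chart j \o f) p u) ('d (chart j \o f) p v)
    = omega_st u v.

Definition shell_embeds (r delta : R) (V : set CP) : Prop :=
  exists W (f : 'M[R]_(n, 2) -> CP),
    [/\ open W, shell r delta `<=` W, f @` W `<=` V,
        embedding_on W f & symplectic_on W f].

(* The capacity of an open subset of CP^n with the restricted form. *)
Definition shell_capacity (delta : R) (V : set CP) : \bar R :=
  ereal_sup [set (pi * r ^+ 2)%:E | r in [set r | 0 < r /\ shell_embeds r delta V]].

Definition V_eps (eps : R) : set CP :=
  ~` (ball_embed @` closure (eball (1 - eps))).

End ProjectiveSpace.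

Arguments CP : clear implicits.

(* Main.v *)
Require Import Defs.
From HB Require Import structures.
From mathcomp Require Import all_boot all_order all_algebra.
From mathcomp Require Import complex.
From mathcomp Require Import all_classical all_reals all_analysis.
From mathcomp Require Import ring lra zify.
Import Order.TTheory GRing.Theory Num.Theory.
Import numFieldNormedType.Exports.

Local Open Scope classical_set_scope.
Local Open Scope ring_scope.

(* For eps > delta all shells of radius r < 1 close to 1 lie in V_eps as subsets
   of B_1, so the capacity of V_eps is at least pi.  At eps = delta it is
   bounded away from pi, by a volume comparison.

   Let f embed a neighbourhood of the shell of radius r into V_delta.  Lift to
   the cone of nonzero Z in C^(n+1), where omega_FS pulls back to a form Omega,
   and let G be the inverse of f on the cone over its image.  A cutoff
   chi (|G|^2) of the shell extends to a function Phi on Z' != 0,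
   Z = (Z_0, Z'), which is locally constant off the image.  With alpha a
   primitive of (Phi - c) Omega + d(chi) /\ lambda for a constant c, the Stokes
   identities for alpha, alpha /\ d alpha and Phi (1 - Phi) lambda show that
   c = 0, hence that n times the mean of Phi is minus the mean of
   chi'(|G|^2) |G|^2: although nothing is known about the side of the image, the
   region which it bounds in CP^n has the volume of a ball.

   Off the image Phi is 0 or 1, and it is constant on B_(1-delta).  If it is 0
   there, the region and the ball are disjoint, so r^(2n) + (1-delta)^(2n) <= 1.
   If it is 1, the region bounded by a sphere of radius less than r (1-delta)
   contains B_(1-delta), so r > 1, which the total volume excludes.

   Integrals are ultralimits of averages over finite grids; this is enough for
   the divergence theorem, for exchanging integrals and for differentiating
   under them. *)

Set Implicit Arguments.
Unset Strict Implicit.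
Unset Printing Implicit Defensive.

(** * Continuously differentiable maps between normed spaces *)

Section C1.
Context {R : realType}.
Implicit Types U V W : normedModType R.

(** The three Stokes identities say that c is idempotent. The closed form Phi Omega + d(chi) /\
    lambda has c times the class of Omega on CP^n minus the centre of the ball. Its product with its
    complement in Omega lives in the collar, where the two factors are d(chi lambda) and d((1 - chi)
    lambda); so the product integrates to 0 and c (1 - c) = 0. If c were 1, the mean of n (Phi - 1),
    which is at most 0, and the strictly negative mean of chi'(|G|^2) |G|^2 would add up to 0.
    Multiplying two 2-forms is what requires n at least 2. On the cone, forms that vanish on the
    complex line through Z are integrated by the flat divergence theorem. To vanish on the circle
    direction, alpha is averaged over rotations; this needs a rotation-invariant domain on which
    segments from (1, 0, ..., 0) avoid 0, and therefore the line Z' = 0 is removed. The line has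
    real codimension 2n, at least 4, whereas alpha grows at most like |Z'|^-2, so cutting it out
    costs nothing in the limit. Volumes in different symplectic coordinates are compared by
    translation invariance of the push-forward and a blow-up at one point. *)

Lemma is_diff_linear U W (f : U -> W) df x : is_diff x f df -> linear df.
Proof. by case=> _ <- a u v; rewrite linearP. Qed.

(** The epsilon form avoids little-o notation and bundled linear maps; differentiability is proved
    through it below. *)
Lemma is_diffP U W (f : U -> W) df x : is_diff x f df <-> [/\ linear df, continuous df &
    forall e, 0 < e -> \forall h \near (0 : U), `|f (h + x) - f x - df h| <= e * `|h|].
Proof.
split=> [d|[dl dc de]].
  have dl := is_diff_linear d; have [d1 d2] := d; split=> //.
    by rewrite -d2; apply: diff_continuous.
  move=> e e0; have := diff_locally d1. move=> /eqaddoP /(_ e e0); apply: filterS => h /=.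
  by rewrite d2 /shift/= opprD addrA /cst; apply.
pose scallM := GRing.isLinear.Build _ _ _ _ df dl.
pose L : {linear U -> W} := HB.pack df scallM.
have E : f \o shift x = cst (f x) + L +o_ (nbhs (0 : U)) id.
  apply/eqaddoP => e e0; have := de e e0; apply: filterS => h /=. by rewrite /shift/= opprD addrA /cst.
have dfE : 'd f x = L :> (U -> W) by apply: diff_unique.
split; last exact: dfE.
by apply/diff_locallyP; rewrite dfE.
Qed.

(** The derivative is a parameter, so that explicit formulas are carried along. Continuity is asked
    for each fixed direction, which in finite dimension amounts to continuity in operator norm. *)
Definition C1 {U W} (A : set U) (f : U -> W) (df : U -> U -> W) : Prop :=
  forall x, A x -> is_diff x f (df x) /\ forall v, {for x, continuous (df^~ v)}.

Lemma C1_subset U W (A B : set U) (f : U -> W) df : A `<=` B -> C1 B f df -> C1 A f df.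
Proof. by move=> AB h x /AB /h. Qed.

Lemma C1_cont U W (A : set U) (f : U -> W) df x : C1 A f df -> A x -> {for x, continuous f}.
Proof. by move=> h /h[[d _] _]; exact: differentiable_continuous. Qed.

Lemma near_cont U W (f g : U -> W) x : (\forall y \near x, f y = g y) -> {for x, continuous f} -> {for x, continuous g}.
Proof.
move=> fg cf; rewrite /prop_for /continuous_at -(nbhs_singleton fg).
apply: cvg_trans cf; apply: near_eq_cvg; by apply: filterS fg => y ->.
Qed.

Lemma near_is_diff U W (f g : U -> W) df x : (\forall y \near x, f y = g y) -> is_diff x f df -> is_diff x g df.
Proof.
move=> fg /is_diffP[dl dc de]; apply/is_diffP; split=> // e e0.
have fg0 : \forall h \near (0 : U), f (h + x) = g (h + x).
  by have := fg; rewrite (near_shift 0 x); apply: filterS => h /=; rewrite subr0.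
rewrite -(nbhs_singleton fg); near=> h.
by rewrite -(near fg0 h)//; near: h; exact: de.
Unshelve. all: by end_near. Qed.

Lemma near_C1 U W (A : set U) (f g : U -> W) df dg :
  (forall x, A x -> \forall y \near x, f y = g y /\ forall v, df y v = dg y v) -> C1 A f df -> C1 A g dg.
Proof.
move=> fg h x Ax; have [d c] := h x Ax; split.
  have -> : dg x = df x by apply/funext => v; have [_ ->] := nbhs_singleton (fg x Ax).
  by apply: near_is_diff d; apply: filterS (fg x Ax) => y [].
by move=> v; apply: near_cont (c v); apply: filterS (fg x Ax) => y [_ ->].
Qed.

Lemma eq_C1 U W (A : set U) (f g : U -> W) df dg :
  open A -> (forall x, A x -> f x = g x) -> (forall x v, A x -> df x v = dg x v) -> C1 A f df -> C1 A g dg.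
Proof.
move=> oA fg dfg; apply: near_C1 => x Ax.
near=> y; have Ay : A y by near: y; exact: open_nbhs_nbhs.
by split=> [|v]; [exact: fg|exact: dfg].
Unshelve. all: by end_near. Qed.

Lemma C1_ext U W (A : set U) (f g : U -> W) df dg : C1 A f df -> f =1 g -> df =2 dg -> C1 A g dg.
Proof. by move=> h /funext<- E; have <- : df = dg by apply/funext => x; apply/funext. Qed.

Lemma C1_linear U W (A : set U) (f : U -> W) df x : C1 A f df -> A x -> linear (df x).
Proof. by move=> h /h[d _]; exact: is_diff_linear d. Qed.

Lemma C1_Z U W (A : set U) (f : U -> W) df x a v : C1 A f df -> A x -> df x (a *: v) = a *: df x v.
Proof.
move=> h Ax; have L := C1_linear h Ax.
have z : df x 0 = 0 by have := L (-1) 0 0; rewrite !scaleN1r oppr0 addr0 addNr.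
by have := L a v 0; rewrite z !addr0.
Qed.

Lemma C1_derive U W (A : set U) (f : U -> W) df x v : C1 A f df -> A x -> is_derive x v f (df x v).
Proof.
move=> h /h[[d1 d2] _]; split; first exact: diff_derivable.
by rewrite deriveE// d2.
Qed.

Lemma C1_cst U W (A : set U) (a : W) : C1 A (fun=> a) (fun _ _ => 0).
Proof. by move=> x _; split=> [|v]; [exact: is_diff_cst|exact: cvg_cst]. Qed.

Arguments C1_cst {U W} A a.

Lemma C1_add U W (A : set U) (f g : U -> W) df dg :
  C1 A f df -> C1 A g dg -> C1 A (fun x => f x + g x) (fun x v => df x v + dg x v).
Proof.
move=> hf hg x Ax; have [? c1] := hf x Ax; have [? c2] := hg x Ax; split.
  exact: is_diffD.
by move=> v; exact: (continuousD (c1 v) (c2 v)).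
Qed.

Lemma C1_opp U W (A : set U) (f : U -> W) df : C1 A f df -> C1 A (fun x => - f x) (fun x v => - df x v).
Proof.
move=> hf x Ax; have [? c1] := hf x Ax; split; first exact: is_diffN.
by move=> v; exact: (continuousN (c1 v)).
Qed.

Lemma C1_sub U W (A : set U) (f g : U -> W) df dg :
  C1 A f df -> C1 A g dg -> C1 A (fun x => f x - g x) (fun x v => df x v - dg x v).
Proof. by move=> hf /C1_opp; exact: C1_add. Qed.

Lemma C1_mul U (A : set U) (f g : U -> R) df dg : C1 A f df -> C1 A g dg ->
  C1 A (fun x => f x * g x) (fun x v => df x v * g x + f x * dg x v).
Proof.
move=> hf hg x Ax; have [d1 c1] := hf x Ax; have [d2 c2] := hg x Ax; split.
  have := is_diffM d1 d2; congr (is_diff_def _ _ _); apply/funext => v /=. by rewrite [LHS]addrC [df x v * _]mulrC.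
have [[e1 _] [e2 _]] := (d1, d2).
move=> v; apply: (@continuousD _ _ _ (fun x => df x v * g x) (fun x => f x * dg x v)).
  by apply: (continuousM (c1 v)); exact: differentiable_continuous.
by apply: (continuousM _ (c2 v)); exact: differentiable_continuous.
Qed.

Lemma C1_scale U (A : set U) k (f : U -> R) df : C1 A f df -> C1 A (fun x => k * f x) (fun x v => k * df x v).
Proof.
move=> hf; apply: (C1_ext (C1_mul (C1_cst A (k : R)) hf)) => // x v /=.
by rewrite mul0r add0r.
Qed.

Lemma C1_inv U (A : set U) (f : U -> R) df : (forall x, A x -> f x != 0) ->
  C1 A f df -> C1 A (fun x => (f x)^-1) (fun x v => - (f x) ^- 2 * df x v).
Proof.
move=> f0 hf x Ax; have [d1 c1] := hf x Ax; have [e1 e2] := d1; split.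
  split; first by apply: differentiableV => //; exact: f0. by rewrite diffV ?f0//; apply/funext => v /=; rewrite e2.
have cf : {for x, continuous f} by exact: differentiable_continuous.
move=> v; apply: (@continuousM _ _ (fun x => - f x ^- 2)); last exact: c1.
apply: (@continuousN _ _ _ (fun x => f x ^- 2)).
apply: (@continuousV _ _ (fun x => f x ^+ 2)); first by rewrite expf_neq0// f0.
rewrite (_ : (fun x1 : U => f x1 ^+ 2) = f \* f); first exact: continuousM.
by apply/funext => y; rewrite expr2.
Qed.

Lemma C1_sum U W (A : set U) (I : Type) (r : seq I) (P : pred I) (f : I -> U -> W) df : (forall i, C1 A (f i) (df i)) ->
  C1 A (fun x => \sum_(i <- r | P i) f i x) (fun x v => \sum_(i <- r | P i) df i x v).
Proof.
move=> h; elim: r => [|i r ih].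
  by apply: (C1_ext (C1_cst A (0 : W))) => [x|x v]; rewrite big_nil.
have [Pi|Pi] := boolP (P i); last first.
  by apply: (C1_ext ih) => [x|x v]; rewrite big_cons (negbTE Pi).
by apply: (C1_ext (C1_add (h i) ih)) => [x|x v]; rewrite big_cons Pi.
Qed.

Lemma C1_lin U W (A : set U) (f : U -> W) : linear f -> continuous f -> C1 A f (fun _ v => f v).
Proof.
move=> lf cf x _; split; last by move=> v; exact: cvg_cst.
apply/is_diffP; split=> // e e0; near=> h.
have := lf 1 h x; rewrite !scale1r => ->.
by rewrite addrK subrr normr0 mulr_ge0// ltW.
Unshelve. all: by end_near. Qed.

Lemma is_derive_line U W (f : U -> W) x v t df :
  is_derive (x + t *: v) v f df -> is_derive t 1 (fun s : R => f (x + s *: v)) df.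
Proof.
have E : (fun h : R => h^-1 *: ((f \o shift (x + t *: v)) (h *: v) - f (x + t *: v))) =
   (fun h : R => h^-1 *: (((fun s : R => f (x + s *: v)) \o shift t) (h *: 1)
       - (fun s : R => f (x + s *: v)) t)).
  apply/funext => h /=; congr (_ *: (f _ - _)). by rewrite scalerDl addrCA -scalerA scale1r.
by case; rewrite /derivable /derive E => h1 h2; split.
Qed.

Lemma MVT_line U (f : U -> R) (x v : U) df : (forall t : R, 0 <= t <= 1 -> is_derive (x + t *: v) v f (df t)) ->
  exists2 t, 0 <= t <= 1 & f (x + v) - f x = df t.
Proof.
move=> h; have h' (t : R) : 0 <= t <= 1 -> is_derive t 1 (fun s : R => f (x + s *: v)) (df t).
  by move=> /h; exact: is_derive_line.
have [||c c01] := @MVT_segment R (fun s => f (x + s *: v)) df 0 1 ler01.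
- by move=> t; rewrite in_itv/= => /andP[/ltW t0 /ltW t1]; apply: h'; rewrite t0.
- apply: derivable_within_continuous => t; rewrite in_itv/= => /h'[+ _]; exact.
rewrite scale1r scale0r addr0 subr0 mulr1 => E; exists c => //.
Qed.

Lemma normM_le1 (t c : R) : 0 <= t <= 1 -> `|t * c| <= `|c|.
Proof. by move=> /andP[t0 t1]; rewrite normrM ger0_norm// ler_piMl. Qed.

(** Serves to pass to the limit in error estimates valid for all sufficiently small positive
    parameters. *)
Lemma le_small_eq0 (x D s0 : R) : 0 < s0 -> (forall s, 0 < s -> s <= s0 -> `|x| <= D * s) -> x = 0.
Proof.
move=> s00 h; apply/eqP; rewrite -normr_le0; apply/ler_addgt0Pl => e e0; rewrite addr0.
pose s := Num.min s0 (e / (`|D| + 1)); have D1 : 0 < `|D| + 1 by rewrite ltr_wpDl.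
have sp : 0 < s by rewrite lt_min s00 divr_gt0.
have hs : s <= s0 by rewrite ge_min lexx.
apply: (le_trans (h s sp hs)); have : s * (`|D| + 1) <= e by rewrite -ler_pdivlMr// ge_min lexx orbT.
have : D * s <= `|D| * s by rewrite ler_wpM2r ?ler_norm// ltW.
by lra.
Qed.

Lemma C1_MVT U (A : set U) (f : U -> R) df x v : C1 A f df -> (forall t : R, 0 <= t <= 1 -> A (x + t *: v)) ->
  exists2 t, 0 <= t <= 1 & f (x + v) - f x = df (x + t *: v) v.
Proof. by move=> h hA; apply: MVT_line => t /hA At; exact: C1_derive h At. Qed.

Lemma C1_segment_cst U (A : set U) (f : U -> R) df x v : C1 A f df -> (forall t : R, 0 <= t <= 1 -> A (x + t *: v)) ->
  (forall t : R, 0 <= t <= 1 -> df (x + t *: v) v = 0) -> f (x + v) = f x.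
Proof.
move=> h hA h0; have [t t01 E] := C1_MVT h hA.
by apply/eqP; rewrite -subr_eq0 E h0.
Qed.

End C1.

Arguments C1_cst {R U W} A a.

(** * Calculus on matrix spaces by coordinates *)

Section MatrixCalculus.
Context {R : realType}.
Implicit Types U V W : normedModType R.

Definition mxb p q (i : 'I_p) (j : 'I_q) : 'M[R]_(p, q) := delta_mx i j.

Lemma coord_norm p q (x : 'M[R]_(p, q)) i j : `|x i j| <= `|x|.
Proof. by rewrite [leRHS]/Num.norm/= mx_normrE; apply: (le_bigmax _ _ (i, j)). Qed.

Lemma mx_norm_le p q (x : 'M[R]_(p, q)) c : 0 <= c -> (forall i j, `|x i j| <= c) -> `|x| <= c.
Proof. by move=> c0 h; rewrite /Num.norm/= mx_normrE bigmax_le//= => -[i j] _; exact: h. Qed.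

Lemma linear_coord_sum p q W (f : 'M[R]_(p, q) -> W) v : linear f -> f v = \sum_i \sum_j v i j *: f (mxb i j).
Proof.
move=> lf; pose F : {linear _ -> _} := HB.pack f (GRing.isLinear.Build _ _ _ _ f lf).
rewrite -[f]/(F : _ -> _) {1}(matrix_sum_delta v) linear_sum; apply: eq_bigr => i _.
by rewrite linear_sum; apply: eq_bigr => j _; rewrite linearZ.
Qed.

Lemma mxb_norm p q i j : `|mxb i j : 'M[R]_(p, q)| <= 1.
Proof. by apply: mx_norm_le => // i' j'; rewrite mxE; case: (_ && _); rewrite ?normr1 ?normr0. Qed.

Lemma cont_cst (T S : topologicalType) (a : S) (x : T) : {for x, continuous (fun _ : T => a)}.
Proof. exact: cvg_cst. Qed.

Lemma cont_pair (T S Q : topologicalType) (f : T -> S) (g : T -> Q) (x : T) :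
  {for x, continuous f} -> {for x, continuous g} -> {for x, continuous (fun y => (f y, g y))}.
Proof. exact: cvg_pair. Qed.

Lemma cont_id (T : topologicalType) (x : T) : {for x, continuous (fun y : T => y)}.
Proof. exact: cvg_id. Qed.

Lemma cont_ext (T S : topologicalType) (f g : T -> S) (x : T) :
  {for x, continuous f} -> f =1 g -> {for x, continuous g}.
Proof. by move=> h /funext <-. Qed.

Lemma cont_sum (T : topologicalType) W (I : Type) (r : seq I) (P : pred I) (f : I -> T -> W) x :
  (forall i, {for x, continuous (f i)}) -> {for x, continuous (fun y => \sum_(i <- r | P i) f i y)}.
Proof.
move=> h; elim: r => [|i r ih].
  by apply: (@cont_ext _ _ (fun=> 0)) => [|y]; [exact: cont_cst|rewrite big_nil].
have [Pi|/negbTE Pi] := boolP (P i); last by apply: (cont_ext ih) => y; rewrite big_cons Pi.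
apply: (cont_ext (@continuousD _ _ _ (f i) (fun y => \sum_(i <- r | P i) f i y) x (h i) ih)).
by move=> y; rewrite big_cons Pi.
Qed.

Lemma cont_coord p q (i : 'I_p) (j : 'I_q) (x : 'M[R]_(p, q)) : {for x, continuous (fun y : 'M[R]_(p, q) => y i j)}.
Proof. exact: coord_continuous. Qed.

Lemma cont_comp (S T Q : topologicalType) (f : S -> T) (g : T -> Q) x :
  {for x, continuous f} -> {for (f x), continuous g} -> {for x, continuous (fun y => g (f y))}.
Proof. by move=> cf cg; exact: continuous_comp. Qed.

Lemma cont_slice (S T Q : topologicalType) (g : S -> T -> Q) s y :
  {for (s, y), continuous (fun z => g z.1 z.2)} -> {for y, continuous (g s)}.
Proof.
move=> h; apply: (@cont_comp _ _ _ (fun y => (s, y)) (fun z => g z.1 z.2)); last exact: h.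
by apply: cont_pair; [exact: cont_cst|exact: cont_id].
Qed.

Lemma cont_mulc (T : topologicalType) (c : R) (f : T -> R) x :
  {for x, continuous f} -> {for x, continuous (fun y => c * f y)}.
Proof. by apply: (@continuousM _ _ (fun=> c)); exact: cont_cst. Qed.

Lemma cont_entry (T : topologicalType) p q (f : T -> 'M[R]_(p, q)) x i j :
  {for x, continuous f} -> {for x, continuous (fun y => f y i j)}.
Proof. by move=> cf; apply: (@cont_comp _ _ _ f (fun M => M i j)); last exact: cont_coord. Qed.

Lemma linear_cont p q W (f : 'M[R]_(p, q) -> W) : linear f -> continuous f.
Proof.
move=> lf x; rewrite (_ : f = fun v => \sum_i \sum_j v i j *: f (mxb i j)).
  apply: cont_sum => i; apply: cont_sum => j.
  by apply: (@continuousZ _ _ _ (fun v : 'M[R]_(p, q) => v i j) (fun=> f (mxb i j)));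
    [exact: cont_coord|exact: cont_cst].
by apply/funext => v; exact: linear_coord_sum.
Qed.

Lemma cont_mx (T : topologicalType) p q (f : T -> 'M[R]_(p, q)) x :
  (forall i j, {for x, continuous (fun y => f y i j)}) -> {for x, continuous f}.
Proof.
move=> h; rewrite /prop_for /continuous_at.
rewrite [f](_ : _ = fun y => \sum_i \sum_j f y i j *: mxb i j); last first.
  by apply/funext => y; exact: matrix_sum_delta.
apply: cont_sum => i; apply: cont_sum => j.
by apply: (@continuousZ _ _ _ (fun y => f y i j) (fun=> mxb i j)); [exact: h|exact: cont_cst].
Qed.

Lemma C1_coord p q (A : set 'M[R]_(p, q)) i j : C1 A (fun x => x i j) (fun _ v => v i j).
Proof.
apply: (@C1_lin _ _ _ A (fun x : 'M[R]_(p, q) => x i j)); last exact: coord_continuous.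
by move=> a u v; rewrite !mxE.
Qed.

Lemma C1_entry U p q (A : set U) (f : U -> 'M[R]_(p, q)) df i j :
  C1 A f df -> C1 A (fun x => f x i j) (fun x v => df x v i j).
Proof.
move=> h x Ax; have [/is_diffP[dl dc de] c] := h x Ax; split.
  apply/is_diffP; split.
  - by move=> a u v; rewrite dl !mxE.
  - by move=> v; apply: (@cont_entry _ _ _ (df x) v); exact: dc.
  - move=> e e0; have := de e e0; apply: filterS => k; apply: le_trans.
    by rewrite (le_trans _ (coord_norm _ i j))// !mxE.
by move=> v; apply: (@cont_entry _ _ _ (df^~ v)); exact: c.
Qed.

Lemma C1_mx U p q (A : set U) (f : U -> 'M[R]_(p, q)) (df : U -> U -> 'M[R]_(p, q)) :
  (forall i j, C1 A (fun x => f x i j) (fun x v => df x v i j)) -> C1 A f df.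
Proof.
move=> h x Ax; split; last first.
  by move=> v; apply: cont_mx => i j; have [_] := h i j x Ax; exact.
apply/is_diffP; split.
- by move=> a u v; apply/matrixP => i j; rewrite (C1_linear (h i j) Ax) !mxE.
- move=> v; apply: cont_mx => i j. by have [/is_diffP[_ dc _] _] := h i j x Ax; exact: dc.
- move=> e e0; near=> k; apply: mx_norm_le => [|i j]; first by rewrite mulr_ge0// ltW. rewrite !mxE; move: i j; near: k.
  apply: filter_forall => i; apply: filter_forall => j. by have [/is_diffP[_ _ de] _] := h i j x Ax; exact: de.
Unshelve. all: by end_near. Qed.

(** A linear map on matrices is a finite combination of its values on the [mxb i j], so continuity
    in each fixed direction gives joint continuity. *)
Lemma cont_bil (T : topologicalType) p q W (B : T -> 'M[R]_(p, q) -> W) (g : T -> 'M[R]_(p, q)) x :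
  (forall y, linear (B y)) -> (forall v, {for x, continuous (B^~ v)}) ->
  {for x, continuous g} -> {for x, continuous (fun y => B y (g y))}.
Proof.
move=> lB cB cg.
apply: (@cont_ext _ _ (fun y => \sum_i \sum_j g y i j *: B y (mxb i j))) => [|y]; last first.
  by rewrite -linear_coord_sum.
apply: cont_sum => i; apply: cont_sum => j.
apply: (@continuousZ _ _ _ (fun y => g y i j) (fun y => B y (mxb i j))); last exact: cB.
exact: cont_entry.
Qed.

Lemma cont_bil_in (T : topologicalType) p q W (B : T -> 'M[R]_(p, q) -> W) (g : T -> 'M[R]_(p, q)) x :
  (\forall y \near x, linear (B y)) -> (forall v, {for x, continuous (B^~ v)}) ->
  {for x, continuous g} -> {for x, continuous (fun y => B y (g y))}.
Proof.
move=> lB cB cg.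
have E : \forall y \near x, \sum_i \sum_j g y i j *: B y (mxb i j) = B y (g y).
  by apply: filterS lB => y; move=> /linear_coord_sum ->.
have cE : {for x, continuous (fun y => \sum_i \sum_j g y i j *: B y (mxb i j))}.
  apply: cont_sum => i; apply: cont_sum => j.
  apply: (@continuousZ _ _ _ (fun y => g y i j) (fun y => B y (mxb i j))); last exact: cB. exact: cont_entry.
rewrite /prop_for /continuous_at -(nbhs_singleton E).
by apply: cvg_trans cE; apply: near_eq_cvg; apply: filterS E => y ->.
Qed.

Lemma C1_comp U p q W (A : set U) (B : set 'M[R]_(p, q)) (f : U -> 'M[R]_(p, q)) (g : 'M[R]_(p, q) -> W) df dg :
  open B -> C1 A f df -> C1 B g dg -> (forall x, A x -> B (f x)) ->
  C1 A (fun x => g (f x)) (fun x v => dg (f x) (df x v)).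
Proof.
move=> oB hf hg AB x Ax; have [d1 c1] := hf x Ax.
have [d2 c2] := hg _ (AB x Ax).
have cf := C1_cont hf Ax.
split; first exact: (@is_diff_comp _ _ _ _ f (df x) g (dg (f x)) x d1 d2).
move=> v; apply: (@cont_bil_in _ _ _ _ (fun y => dg (f y)) (df^~ v)).
- have nB : nbhs (f x) B by apply: open_nbhs_nbhs; split => //; exact: AB.
  have nB' : \forall y \near x, B (f y) by exact: cf. by apply: filterS nB' => y; exact: C1_linear hg.
- by move=> w; apply: (@cont_comp _ _ _ f (dg^~ w)) => //; exact: c2.
- exact: c1.
Qed.

Lemma C1_comp1 U W (A : set U) (B : set R) (f : U -> R) (g : R -> W) df dg :
  open B -> C1 A f df -> C1 B g dg -> (forall x, A x -> B (f x)) ->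
  C1 A (fun x => g (f x)) (fun x v => df x v *: dg (f x) 1).
Proof.
move=> oB hf hg AB x Ax; have [d1 c1] := hf x Ax.
have [d2 c2] := hg _ (AB x Ax).
have cf := C1_cont hf Ax.
split.
  have := @is_diff_comp _ _ _ _ f (df x) g (dg (f x)) x d1 d2. congr (is_diff_def _ _ _); apply/funext => v /=.
  by rewrite -{1}[df x v]mulr1; exact: (C1_Z _ _ hg (AB x Ax)).
move=> v; apply: (@continuousZ _ _ _ (df^~ v) (fun y => dg (f y) 1)); first exact: c1.
by apply: (@cont_comp _ _ _ f (dg^~ 1)); last exact: c2.
Qed.

End MatrixCalculus.

(** * Compactness and uniform continuity *)

Section Compactness.
Context {R : realType}.

(** Vectorization preserves the sup norm and reduces the claim to row vectors. *)
Lemma compact_ball_mx p q (c : R) : compact [set x : 'M[R]_(p, q) | `|x| <= c].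
Proof.
have K : compact [set v : 'rV[R]_(p * q) | `|v| <= c].
  apply: bounded_closed_compact.
    exists c; split; first exact: num_real. by move=> d cd v /= /le_trans; apply; exact: ltW.
  apply: (@preimage_closed _ _ (fun v : 'rV[R]_(p * q) => `|v|) [set y | y <= c]).
    by move=> v _; exact: norm_continuous.
  exact: closed_le.
rewrite (_ : [set x | _] = vec_mx @` [set v : 'rV[R]_(p * q) | `|v| <= c]).
  apply: continuous_compact K; apply: continuous_subspaceT. by apply: linear_cont => a u v; exact: linearP.
apply/seteqP; split=> [x /= xc|_ [v /= vc <-]].
  exists (mxvec x); last by rewrite mxvecK. apply: mx_norm_le => [|i j]; first exact: le_trans xc.
  by rewrite ord1; case/mxvec_indexP: j => i' j'; rewrite mxvecE (le_trans (coord_norm _ _ _)).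
apply: mx_norm_le => [|i j]; first exact: le_trans vc.
by rewrite mxE (le_trans (coord_norm _ _ _)).
Qed.

Lemma compact_bdd (T : topologicalType) (K : set T) (f : T -> R) : compact K ->
  (forall x, K x -> {for x, continuous f}) -> exists2 B : R, 0 < B & forall x, K x -> `|f x| <= B.
Proof.
move=> cK cf; have cw : {within K, continuous f}.
  by apply: continuous_in_subspaceT => x /set_mem; exact: cf.
have /compact_bounded[B [_ hB]] := continuous_compact cw cK.
exists (`|B| + 1) => [|x Kx]; first by rewrite ltr_wpDl.
apply: (hB (`|B| + 1)); first by rewrite (le_lt_trans (ler_norm B))// ltrDl.
by exists x.
Qed.

(** The tube lemma: around each point of [K] a product neighbourhood controls the oscillation, and
    compactness makes the neighbourhood of [x] uniform. All exchanges of a limit with a mean rest on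
    this. *)
Lemma compact_unif (S T : topologicalType) (K : set T) (g : S -> T -> R) (x : S) (e : R) :
  compact K -> 0 < e -> (forall y, K y -> {for (x, y), continuous (fun z => g z.1 z.2)}) ->
  \forall x' \near x, forall y, K y -> `|g x' y - g x y| < e.
Proof.
move=> /compact_near_coveringP cK e0 cg.
apply: (cK S (nbhs x) (fun x' y => `|g x' y - g x y| < e)) => y Ky.
have := cg y Ky; move=> /cvgrPdist_lt /(_ (e / 2)); rewrite divr_gt0// => /(_ isT).
move=> [[P Q] /= [nP nQ] PQ].
exists (Q, P) => // -[y' x'] /= [Qy' Px'].
have h1 := PQ (x', y') (conj Px' Qy'); have h2 := PQ (x, y') (conj (nbhs_singleton nP) Qy').
rewrite /= in h1 h2; rewrite (splitr e) -(subrKA (g x y)) (le_lt_trans (ler_normD _ _))//.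
by rewrite ltrD// distrC.
Qed.

Lemma compact_uniform_cont p q (h : 'M[R]_(p, q) -> R) (c e : R) : 0 < e ->
  continuous h -> (forall x, c < `|x| -> h x = 0) ->
  \forall k \near (0 : 'M[R]_(p, q)), forall y, `|h (y + k) - h y| < e.
Proof.
move=> e0 ch h0.
(* Beyond radius [c + 1] both values vanish as soon as [|k| < 1], so the larger ball is compact
   enough. *)
have := @compact_unif 'M[R]_(p, q) 'M[R]_(p, q) [set x | `|x| <= c + 1]
  (fun k y => h (y + k)) 0 e (@compact_ball_mx p q (c + 1)) e0.
have cc y : {for (0, y), continuous (fun z : 'M[R]_(p, q) * 'M[R]_(p, q) => h (z.2 + z.1))}.
  apply: (@cont_comp ('M[R]_(p, q) * 'M[R]_(p, q))%type 'M[R]_(p, q) R (fun z => z.2 + z.1) h); last exact: ch.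
  by apply: (@continuousD _ _ _ (fun z => z.2) (fun z => z.1)); [exact: cvg_snd|exact: cvg_fst].
move=> /(_ (fun y _ => cc y)) H; near=> k => y.
have [yc|yc] := leP `|y| (c + 1).
  have : forall y, `|y| <= c + 1 -> `|h (y + k) - h (y + 0)| < e by near: k. by move=> /(_ y yc); rewrite addr0.
rewrite (h0 y); last by rewrite (le_lt_trans _ yc)// lerDl.
rewrite h0 ?subrr ?normr0//.
have k1 : `|k| < 1 by near: k; exact: (@nbhs0_lt _ 'M[R]_(p, q) _ ltr01).
have : `|y| <= `|y + k| + `|k| by rewrite -{1}(addrK k y) (le_trans (ler_normD _ _))// normrN.
by move=> ?; lra.
Unshelve. all: by end_near. Qed.

End Compactness.

(** * Partial derivatives and symmetry of second derivatives *)

Section Partials.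
Context {R : realType} (p q : nat).
Implicit Types (A : set 'M[R]_(p, q)) (x u v : 'M[R]_(p, q)).

Lemma is_derive_mulr (g : R -> R) (t c d : R) : is_derive t 1 g d -> is_derive t c g (c * d).
Proof.
move=> [d0 <-]; have dg : differentiable g t by apply/derivable1_diffP.
split; first exact: diff_derivable.
rewrite (deriveE _ dg) (deriveE _ dg) -[in LHS](mulr1 c); exact: linearZ.
Qed.

Lemma MVT_dir (U : normedModType R) (f : U -> R) (x v : U) (c : R) df :
  (forall t : R, 0 <= t <= 1 -> is_derive (x + (t * c) *: v) v f (df (t * c))) ->
  exists2 t : R, 0 <= t <= 1 & f (x + c *: v) - f x = c * df (t * c).
Proof.
move=> h; have h1 (t : R) : 0 <= t <= 1 -> is_derive (0 + t *: c : R) c (fun s : R => f (x + s *: v)) (c * df (t * c)).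
  by move=> /h/is_derive_line/is_derive_mulr; rewrite add0r; exact.
have [t t0 E] := MVT_line (x := 0 : R) h1.
by exists t => //; move: E; rewrite add0r scale0r addr0.
Qed.

(** The increment is split into coordinate steps, each handled by the mean value theorem. This gives
    a differential [L] built from the partials; uniqueness of directional derivatives identifies it
    with [df x], whose linearity is thereby a conclusion. *)
Lemma C1_partials A (f : 'M[R]_(p, q) -> R) df : open A -> (forall x v, A x -> is_derive x v f (df x v)) ->
  (forall x v, A x -> {for x, continuous (df^~ v)}) -> C1 A f df.
Proof.
move=> oA hd hc x Ax; split; last by move=> v; exact: hc.
pose L v := \sum_i \sum_j v i j *: df x (mxb i j).
have lL : linear L.
  move=> a u v; rewrite /L scaler_sumr -big_split/=; apply: eq_bigr => i _.
  rewrite scaler_sumr -big_split/=; apply: eq_bigr => j _. by rewrite !mxE scalerDl scalerA.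
have dL : is_diff x f L.
  apply/is_diffP; split=> //; first exact: linear_cont.
  (* The successor keeps the quotient meaningful when the matrix has no entries. *)
  move=> e e0; pose N := #|{: 'I_p * 'I_q}|; pose e' := e / N.+1%:R. have e'0 : 0 < e' by rewrite divr_gt0.
  have : \forall y \near x, A y /\ forall i j, `|df y (mxb i j) - df x (mxb i j)| <= e'.
    near=> y; split; first by near: y; exact: open_nbhs_nbhs.
    near: y; apply: filter_forall => i; apply: filter_forall => j.
    by have := hc x (mxb i j) Ax; move=> /cvgrPdist_le /(_ e' e'0); apply: filterS => y; rewrite distrC.
  move=> /nbhs_normP[r r0 hr]; near=> h. have hr' : `|h| < r by near: h; exact: (@nbhs0_lt _ 'M[R]_(p, q) _ r0).
  (* [S s] keeps the entries of [h] listed in [s]. Adding one entry at a time walks from 0 to [h]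
     parallel to the axes and never leaves the sup-norm ball of radius [|h|]. *)
  pose S (s : seq ('I_p * 'I_q)) : 'M[R]_(p, q) := \matrix_(i, j) if (i, j) \in s then h i j else 0.
  have main s : uniq s -> `|f (x + S s) - f x - \sum_(a <- s) h a.1 a.2 * df x (mxb a.1 a.2)|
      <= (size s)%:R * (e' * `|h|).
    elim: s => [|[i j] s ih] /=.
      have -> : S [::] = 0 by apply/matrixP => i j; rewrite !mxE. by rewrite big_nil addr0 subrr subr0 normr0 mul0r.
    move=> /andP[ijs us]; rewrite big_cons/=. have SE : S ((i, j) :: s) = S s + h i j *: mxb i j.
      apply/matrixP => i' j'; rewrite !mxE inE xpair_eqE.
      case: eqP => [->|_]; case: eqP => [->|_] /=; rewrite ?mulr0 ?addr0 ?mulr1//. by rewrite (negbTE ijs) add0r.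
    have near_x t : 0 <= t <= 1 -> `|x - (x + S s + (t * h i j) *: mxb i j)| < r.
      move=> /(normM_le1 (h i j)) th; rewrite -addrA opprD addNKr normrN; apply: le_lt_trans hr'.
      apply: mx_norm_le => // i' j'; rewrite !mxE.
      have [->|ii] := eqVneq i' i; have [->|jj] := eqVneq j' j; rewrite /= ?mulr0 ?addr0 ?mulr1;
        rewrite ?(negbTE ijs) ?add0r ?(le_trans th) ?coord_norm//; by case: ifP => _; rewrite ?normr0 ?coord_norm.
    have [|t th E] := @MVT_dir _ f (x + S s) (mxb i j) (h i j) (fun t => df (x + S s + t *: mxb i j) (mxb i j)).
      by move=> t /near_x/hr[At _]; exact: hd.
    rewrite SE addrA -(subrK (f (x + S s)) (f (x + S s + _))) E. have [_ /(_ i j) b] := hr _ (near_x _ th).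
    set D := df (x + S s + _) _ in b *; set D0 := df x _ in b *.
    rewrite (_ : _ - _ = h i j * (D - D0) + (f (x + S s) - f x - \sum_(a <- s) h a.1 a.2 * df x (mxb a.1 a.2))).
      rewrite (le_trans (ler_normD _ _))// -natr1 mulrDl mul1r addrC lerD ?ih//.
      by rewrite normrM mulrC ler_pM// coord_norm.
    ring.
  have := main (enum {: 'I_p * 'I_q}) (enum_uniq _).
  have -> : S (enum {: 'I_p * 'I_q}) = h by apply/matrixP => i j; rewrite mxE mem_enum.
  have -> : \sum_(a <- enum {: 'I_p * 'I_q}) h a.1 a.2 * df x (mxb a.1 a.2) = L h.
    by rewrite /L big_enum pair_bigA.
  rewrite [x + h]addrC => /le_trans; apply; rewrite -cardE.
  rewrite mulrA ler_wpM2r// /e' mulrCA ger_pMr// ler_pdivrMr// mul1r ler_nat. exact: leqnSn.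
have -> // : df x = L.
apply/funext => v; have [_ <-] := hd x v Ax.
by have [dd <-] := dL; rewrite deriveE.
Unshelve. all: by end_near. Qed.

(** The mean value theorem is applied to the increment in direction [v] as a function of the
    displacement along [u], then to [df]. The left side is symmetric in [u] and [v], which is the
    source of [C2_sym]. *)
Lemma C2_diff2 A (f : 'M[R]_(p, q) -> R) df d2 x u v (r s : R) : C1 A f df -> (forall v, C1 A (df^~ v) (d2 v)) ->
  (forall y, `|x - y| < r -> A y) -> 0 < s -> s * (`|u| + `|v|) < r -> exists2 y, `|x - y| < r &
    f (x + s *: u + s *: v) - f (x + s *: u) - (f (x + s *: v) - f x) = s ^+ 2 * d2 u y v.
Proof.
move=> hf hd rA s0 sr.
have bnd (t t' : R) : 0 <= t <= 1 -> 0 <= t' <= 1 -> `|x - (x + t *: (s *: u) + t' *: (s *: v))| < r.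
  move=> /andP[t0 t1] /andP[t'0 t'1]; rewrite -addrA opprD addNKr normrN; apply: le_lt_trans sr.
  rewrite (le_trans (ler_normD _ _))// !normrZ (ger0_norm (ltW s0)) !ger0_norm// mulrDr.
  by rewrite lerD// ler_piMl// mulr_ge0// ltW.
pose A' := [set y | A y /\ A (y + s *: v)].
have C1s : C1 A' (fun y => f (y + s *: v) - f y) (fun y w => df (y + s *: v) w - df y w).
  apply: C1_sub; last by apply: C1_subset hf => y []. move=> y [Ay Asy]; have [[d1 d2'] c1] := hf _ Asy; split.
    apply/is_diffP; have /is_diffP[l c e] : is_diff (y + s *: v) f (df (y + s *: v)) by split.
    by split=> // e' /e; apply: filterS => h; rewrite addrA.
  move=> w; apply: (@cont_comp 'M[R]_(p, q) 'M[R]_(p, q) R (fun y => y + s *: v) (df^~ w)); last exact: c1.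
  by apply: (@continuousD _ _ _ id (fun=> s *: v)); [exact: cvg_id|exact: cont_cst].
have i0 : 0 <= (0 : R) <= 1 by rewrite lexx ler01.
have i1 : 0 <= (1 : R) <= 1 by rewrite lexx ler01.
have [|t t01 E] := C1_MVT (v := s *: u) (x := x) C1s.
  move=> t t01; split; apply: rA.
    by have := bnd t 0 t01 i0; rewrite scale0r addr0.
  by have := bnd t 1 t01 i1; rewrite scale1r.
set z := x + t *: (s *: u) in E.
have zA (t' : R) : 0 <= t' <= 1 -> A (z + t' *: (s *: v)) by move=> t'01; exact/rA/bnd.
have Az : A z by have := zA 0 i0; rewrite scale0r addr0.
have Azv : A (z + s *: v) by have := zA 1 i1; rewrite scale1r.
have [|t' t'01 E'] := C1_MVT (v := s *: v) (x := z) (hd u); first exact: zA.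
exists (z + t' *: (s *: v)); first exact: bnd.
rewrite [LHS]E (C1_Z _ _ hf)// (C1_Z _ _ hf)// -scalerBr E' (C1_Z _ _ (hd u)); last exact: zA.
by rewrite scalerA expr2.
Qed.

Lemma C2_sym A (f : 'M[R]_(p, q) -> R) df d2 x u v : open A ->
  C1 A f df -> (forall v, C1 A (df^~ v) (d2 v)) -> A x -> d2 v x u = d2 u x v.
Proof.
move=> oA hf hd Ax; apply/eqP; rewrite -subr_eq0 -normr_le0; apply/ler_addgt0Pl => e e0.
rewrite addr0.
have : \forall y \near x, [/\ A y, `|d2 v x u - d2 v y u| <= e / 2 & `|d2 u x v - d2 u y v| <= e / 2].
  have e2 : 0 < e / 2 by rewrite divr_gt0. near=> y; split; near: y; first exact: open_nbhs_nbhs.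
    by have [_ /(_ u) /cvgrPdist_le /(_ _ e2)] := hd v x Ax.
  by have [_ /(_ v) /cvgrPdist_le /(_ _ e2)] := hd u x Ax.
move=> /nbhs_normP[r r0 hr].
have rA y : `|x - y| < r -> A y by move=> /hr[].
pose s := r / (2 * (`|u| + `|v| + 1)).
have d0 : 0 < 2 * (`|u| + `|v| + 1) by rewrite mulr_gt0// addr_ge0_gt0// addr_ge0.
have s0 : 0 < s by rewrite divr_gt0.
have sr : s * (`|u| + `|v|) < r.
  rewrite /s mulrAC ltr_pdivrMr// ltr_pM2l//; move: (normr_ge0 u) (normr_ge0 v) => *; lra.
have [y yr E] := C2_diff2 hf hd rA s0 sr.
have [|z zr E'] := C2_diff2 (u := v) (v := u) hf hd rA s0; first by rewrite addrC.
have EE : d2 u y v = d2 v z u.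
  have s2 : s ^+ 2 != 0 by rewrite expf_neq0// gt_eqF. apply: (mulfI s2); rewrite -E -E' [x + s *: v + _]addrAC; ring.
have [_ _ b1] := hr y yr; have [_ b2 _] := hr z zr.
rewrite -(subrKA (d2 v z u)) -EE (splitr e) (le_trans (ler_normD _ _))// lerD//.
  by rewrite EE.
by rewrite distrC.
Unshelve. all: by end_near. Qed.

End Partials.

(** * Positive functionals as ultralimits of finite averages *)

Section Ultralimit.
Context {R : realType}.

Lemma exists_ultra : exists G : set_system nat, UltraFilter G /\ (\oo : set_system nat) `<=` G.
Proof. by have [G [GU GP]] := @ultraFilterLemma nat \oo _; exists G. Qed.

Definition ultra : set_system nat := projT1 (cid exists_ultra).

Lemma ultra_ultra : UltraFilter ultra.
Proof. by have [] := projT2 (cid exists_ultra). Qed.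

Lemma ultra_oo : (\oo : set_system nat) `<=` ultra.
Proof. by have [] := projT2 (cid exists_ultra). Qed.

Global Instance ultra_proper : ProperFilter ultra.
Proof. exact: (@ultra_proper _ _ ultra_ultra). Qed.

(** A bounded sequence lives in a compact interval, where every ultrafilter converges. Hence every
    bounded function has a mean, and the mean is linear on bounded functions. *)
Lemma ultra_bounded_cvg (u : nat -> R) (c : R) : (forall k, `|u k| <= c) -> cvg (u @ ultra).
Proof.
move=> uc; have := @segment_compact R (- c) c; rewrite compact_ultra => H.
have Fu : UltraFilter (u @ ultra).
  apply: Build_UltraFilter. move=> G PG uG; apply/seteqP; split=> // A GA.
  have [//|nA] := in_ultra_setVsetC (u @^-1` A) ultra_ultra. have GnA : G (~` A) by apply: uG.
  by have [x []] := filter_ex (filterI GA GnA).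
have [|l [_ ul]] := H _ Fu; last by apply/cvg_ex; exists l.
have : ultra (u @^-1` `[- c, c]%classic).
  by apply: filterE => k; rewrite /= in_itv/= -ler_norml.
exact.
Qed.

(** A sequence of finite nonempty samples of [net_dom]. Means depend only on values there; for the
    equidistant samples used below they are normalized integrals. *)
Record net (T : Type) := Net { net_pts : nat -> seq T; net_dom : set T;
  net_in : forall k i, (i < size (net_pts k))%N -> forall x0, net_dom (nth x0 (net_pts k) i);
  net_gt0 : forall k, (0 < size (net_pts k))%N }.

Variable T : Type.
Implicit Types (N : net T) (f g : T -> R).

Definition avg (s : seq T) f : R := (\sum_(x <- s) f x) / (size s)%:R.

Definition mean N f : R := lim ((fun k => avg (net_pts N k) f) @ ultra).

Definition bdd N f := exists c, forall x, net_dom N x -> `|f x| <= c.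

Lemma avg_le N k f g : (forall x, net_dom N x -> f x <= g x) -> avg (net_pts N k) f <= avg (net_pts N k) g.
Proof.
move=> fg; rewrite ler_wpM2r ?invr_ge0//.
have [->|[x0 _]] : net_pts N k = [::] \/ exists x0 : T, True.
- by case: (net_pts N k) => [|x ?]; [left|right; exists x].
- by rewrite !big_nil.
rewrite !(big_nth x0) big_nat [leRHS]big_nat ler_sum// => i /andP[_ ik].
by apply: fg; exact: net_in.
Qed.

Lemma avg_cst N k c : avg (net_pts N k) (fun=> c) = c.
Proof.
rewrite /avg big_const_seq count_predT iter_addr_0 -[_ *+ _]mulr_natr mulfK//.
by rewrite pnatr_eq0 -lt0n net_gt0.
Qed.

Lemma avgD s f g : avg s (fun x => f x + g x) = avg s f + avg s g.
Proof. by rewrite /avg big_split/= mulrDl. Qed.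

Lemma avgZ s c f : avg s (fun x => c * f x) = c * avg s f.
Proof. by rewrite /avg -mulr_sumr mulrA. Qed.

Lemma avg_norm N k f (c : R) : (forall x, net_dom N x -> `|f x| <= c) -> `|avg (net_pts N k) f| <= c.
Proof.
move=> fc; rewrite ler_norml; apply/andP; split.
  by rewrite -[leLHS](avg_cst N k); apply: avg_le => x /fc; rewrite ler_norml => /andP[].
by rewrite -[leRHS](avg_cst N k); apply: avg_le => x /fc; rewrite ler_norml => /andP[].
Qed.

Lemma mean_cvg N f : bdd N f -> avg (net_pts N k) f @[k --> ultra] --> mean N f.
Proof.
move=> [c fc]; apply: (@ultra_bounded_cvg _ c) => k; exact: avg_norm.
Qed.

Lemma mean_eqP N f l : bdd N f -> avg (net_pts N k) f @[k --> ultra] --> l -> mean N f = l.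
Proof. by move=> _ fl; apply: cvg_lim. Qed.

Lemma mean_cst N c : mean N (fun=> c) = c.
Proof.
apply: cvg_lim => //; under eq_fun do rewrite avg_cst; exact: cvg_cst.
Qed.

Lemma bdd_cst N c : bdd N (fun=> c). Proof. by exists `|c|. Qed.

Lemma bddD N f g : bdd N f -> bdd N g -> bdd N (fun x => f x + g x).
Proof.
move=> [c fc] [d gd]; exists (c + d) => x Nx.
by rewrite (le_trans (ler_normD _ _))// lerD ?fc ?gd.
Qed.

Lemma bddM N f g : bdd N f -> bdd N g -> bdd N (fun x => f x * g x).
Proof.
move=> [c fc] [d gd]; exists (c * d) => x Nx.
by rewrite normrM ler_pM ?fc ?gd.
Qed.

Lemma bddZ N a f : bdd N f -> bdd N (fun x => a * f x).
Proof. by apply: bddM; exact: bdd_cst. Qed.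

Lemma bddN N f : bdd N f -> bdd N (fun x => - f x).
Proof. by move=> [c fc]; exists c => x; rewrite normrN; exact: fc. Qed.

Lemma bddB N f g : bdd N f -> bdd N g -> bdd N (fun x => f x - g x).
Proof. by move=> bf /bddN; exact: bddD. Qed.

Lemma bdd_sum N (I : Type) (r : seq I) (F : I -> T -> R) :
  (forall i, bdd N (F i)) -> bdd N (fun x => \sum_(i <- r) F i x).
Proof.
move=> h; elim: r => [|i r ih]; first by under eq_fun do rewrite big_nil; exact: bdd_cst.
by under eq_fun do rewrite big_cons; exact: bddD.
Qed.

Lemma bdd_eq N f g : (forall x, net_dom N x -> f x = g x) -> bdd N f -> bdd N g.
Proof. by move=> fg [c fc]; exists c => x Nx; rewrite -fg// fc. Qed.

Lemma mean_eq N f g : (forall x, net_dom N x -> f x = g x) -> mean N f = mean N g.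
Proof.
move=> fg; rewrite /mean.
suff -> : (fun k => avg (net_pts N k) f) = (fun k => avg (net_pts N k) g) by [].
apply/funext => k; apply/eqP; rewrite eq_le.
by apply/andP; split; apply: avg_le => x Nx; rewrite fg.
Qed.

Lemma meanD N f g : bdd N f -> bdd N g -> mean N (fun x => f x + g x) = mean N f + mean N g.
Proof.
move=> bf bg; apply: mean_eqP; first exact: bddD.
by under eq_fun do rewrite avgD; apply: cvgD; exact: mean_cvg.
Qed.

Lemma meanZ N c f : bdd N f -> mean N (fun x => c * f x) = c * mean N f.
Proof.
move=> bf; apply: mean_eqP; first exact: bddZ.
by under eq_fun do rewrite avgZ; apply: cvgM; [exact: cvg_cst|exact: mean_cvg].
Qed.

Lemma meanN N f : bdd N f -> mean N (fun x => - f x) = - mean N f.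
Proof.
move=> bf; rewrite -mulN1r -meanZ//; congr mean; apply/funext => x; rewrite mulN1r//.
Qed.

Lemma meanB N f g : bdd N f -> bdd N g -> mean N (fun x => f x - g x) = mean N f - mean N g.
Proof. by move=> bf bg; rewrite meanD ?meanN//; exact: bddN. Qed.

Lemma mean_sum N (I : Type) (r : seq I) (F : I -> T -> R) : (forall i, bdd N (F i)) ->
  mean N (fun x => \sum_(i <- r) F i x) = \sum_(i <- r) mean N (F i).
Proof.
move=> h; elim: r => [|i r ih].
  by rewrite big_nil -[RHS](mean_cst N 0); congr mean; apply/funext => x; rewrite big_nil.
rewrite big_cons -ih -meanD//; last exact: bdd_sum.
by congr mean; apply/funext => x; rewrite big_cons.
Qed.

Lemma mean_le N f g : bdd N f -> bdd N g -> (forall x, net_dom N x -> f x <= g x) -> mean N f <= mean N g.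
Proof.
move=> bf bg fg; rewrite -subr_ge0 -meanB//; apply: limr_ge.
  by apply: (cvgP (mean N (fun x => g x - f x))); apply: mean_cvg; exact: bddB.
apply: filterE => k; rewrite -[leLHS](avg_cst N k); apply: avg_le => x Nx.
by rewrite subr_ge0 fg.
Qed.

Lemma mean_norm N f (c : R) : (forall x, net_dom N x -> `|f x| <= c) -> `|mean N f| <= c.
Proof.
move=> fc; have bf : bdd N f by exists c.
rewrite ler_norml; apply/andP; split.
  rewrite -[leLHS](mean_cst N); apply: mean_le => //; first exact: bdd_cst.
  by move=> x /fc; rewrite ler_norml => /andP[].
rewrite -[leRHS](mean_cst N); apply: mean_le => //; first exact: bdd_cst.
by move=> x /fc; rewrite ler_norml => /andP[].
Qed.

Lemma mean_ge0 N f : bdd N f -> (forall x, net_dom N x -> 0 <= f x) -> 0 <= mean N f.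
Proof. by move=> bf f0; rewrite -(mean_cst N 0); apply: mean_le => //; exact: bdd_cst. Qed.

End Ultralimit.

(** * Exchanging two means *)

Section Exchange.
Context {R : realType} (S T : topologicalType) (N1 : @net S) (N2 : @net T).
Hypothesis c1 : compact (net_dom N1).
Hypothesis c2 : compact (net_dom N2).

Lemma bdd_cont (T' : topologicalType) (N : net T') (f : T' -> R) : compact (net_dom N) ->
  (forall x, net_dom N x -> {for x, continuous f}) -> bdd N f.
Proof. by move=> cN cf; have [c _ hc] := compact_bdd cN cf; exists c. Qed.

(** Iterated ultralimits do not commute in general. Here joint continuity on a compact product makes
    the averages over [N2] converge uniformly in [x]; a finite average commutes with [mean N1], and
    the exchange follows. *)
Lemma mean_exchange (f : S -> T -> R) :
  (forall x y, net_dom N1 x -> net_dom N2 y -> {for (x, y), continuous (fun z => f z.1 z.2)}) ->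
  mean N1 (fun x => mean N2 (f x)) = mean N2 (fun y => mean N1 (f^~ y)).
Proof.
move=> cf.
have [C fC] : exists C : R, forall x y, net_dom N1 x -> net_dom N2 y -> `|f x y| <= C.
  have [|C _ h] := compact_bdd (compact_setX c1 c2) (f := fun z => f z.1 z.2).
    by move=> [x y] [Nx Ny]; exact: cf.
  by exists C => x y Nx Ny; exact: (h (x, y)).
have b1 y : net_dom N2 y -> bdd N1 (f^~ y) by move=> Ny; exists C => x Nx; exact: fC.
have b2 x : net_dom N1 x -> bdd N2 (f x) by move=> Nx; exists C => y Ny; exact: fC.
have bb1 : bdd N1 (fun x => mean N2 (f x)).
  by exists C => x Nx; apply: mean_norm => y; exact: fC.
have bb2 : bdd N2 (fun y => mean N1 (f^~ y)).
  by exists C => y Ny; apply: mean_norm => x Nx; exact: fC.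
apply/eqP; rewrite -subr_eq0 -normr_le0; apply/ler_addgt0Pl => e e0; rewrite addr0.
have e2 : 0 < e / 2 by rewrite divr_gt0.
have e4 : 0 < e / 2 / 4 by rewrite divr_gt0.
have U : \forall k \near ultra, net_dom N1 `<=` (fun x => `|avg (net_pts N2 k) (f x) - mean N2 (f x)| <= e / 2).
  have /compact_near_coveringP nc := c1.
  apply: (nc nat ultra (fun k x => `|avg (net_pts N2 k) (f x) - mean N2 (f x)| <= e / 2)) => x Nx.
  have h1 : \forall x' \near x, forall y, net_dom N2 y -> `|f x' y - f x y| < e / 2 / 4.
    by apply: compact_unif => // y Ny; exact: cf.
  have h2 : \forall k \near ultra, `|mean N2 (f x) - avg (net_pts N2 k) (f x)| < e / 2 / 4.
    by have /cvgrPdist_lt := mean_cvg (b2 x Nx); apply.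
  have h1' : \forall x' \near x & k \near ultra, forall y, net_dom N2 y -> `|f x' y - f x y| < e / 2 / 4.
    by exists ([set x' | forall y, net_dom N2 y -> `|f x' y - f x y| < e / 2 / 4], setT) => /=;
      [split => //; exact: filterT|move=> z []].
  exists ([set x' | forall y, net_dom N2 y -> `|f x' y - f x y| < e / 2 / 4],
    [set k | `|mean N2 (f x) - avg (net_pts N2 k) (f x)| < e / 2 / 4]) => // -[x' k] /= [hx' hk].
  have bx' : bdd N2 (f x').
    exists (C + e / 2 / 4) => y Ny; rewrite -(subrK (f x y) (f x' y)) addrC.
    by rewrite (le_trans (ler_normD _ _))// lerD ?fC// ltW ?hx'.
  have a1 : `|avg (net_pts N2 k) (f x') - avg (net_pts N2 k) (f x)| <= e / 2 / 4.
    have -> : avg (net_pts N2 k) (f x') - avg (net_pts N2 k) (f x) = avg (net_pts N2 k) (fun y => f x' y + (-1) * f x y).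
      by rewrite avgD avgZ mulN1r.
    by apply: avg_norm => y Ny; rewrite mulN1r ltW ?hx'.
  have a2 : `|mean N2 (f x') - mean N2 (f x)| <= e / 2 / 4.
    rewrite -meanB//; last exact: b2. by apply: mean_norm => y Ny; rewrite ltW ?hx'.
  move: a1 a2 hk; rewrite ler_norml ler_norml ltr_norml => /andP[? ?] /andP[? ?] /andP[? ?].
  by rewrite ler_norml; apply/andP; split; lra.
have [k [Uk /ltW Vk]] : exists k, (net_dom N1 `<=` (fun x => `|avg (net_pts N2 k) (f x) - mean N2 (f x)| <= e / 2))
    /\ `|mean N2 (fun y => mean N1 (f^~ y)) - avg (net_pts N2 k) (fun y => mean N1 (f^~ y))| < e / 2.
  have V : \forall k \near ultra,
      `|mean N2 (fun y => mean N1 (f^~ y)) - avg (net_pts N2 k) (fun y => mean N1 (f^~ y))| < e / 2.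
    by have /cvgrPdist_lt := mean_cvg bb2; apply.
  by have [k []] := filter_ex (filterI U V); exists k.
have bA : bdd N1 (fun x => avg (net_pts N2 k) (f x)).
  by exists C => x Nx; apply: avg_norm => y; exact: fC.
have E : avg (net_pts N2 k) (fun y => mean N1 (f^~ y)) = mean N1 (fun x => avg (net_pts N2 k) (f x)).
  have [x0 _] : exists x0 : T, True by have := net_gt0 N2 k; case: (net_pts N2 k) => // x; exists x.
  rewrite /avg !(big_nth x0) !big_mkord mulrC. under [in RHS]eq_fun do rewrite (big_nth x0) big_mkord mulrC.
  have bi (i : 'I_(size (net_pts N2 k))) : bdd N1 (f^~ (nth x0 (net_pts N2 k) i)).
    by apply: b1; exact: net_in.
  by rewrite meanZ; [rewrite mean_sum|apply: bdd_sum].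
rewrite -(subrKA (avg (net_pts N2 k) (fun y => mean N1 (f^~ y)))) (splitr e).
rewrite (le_trans (ler_normD _ _))// lerD//; last by rewrite distrC.
by rewrite E -meanB//; apply: mean_norm => x /Uk; rewrite distrC.
Qed.

End Exchange.

(** * Differentiation under the mean *)

Section DeriveMean.
Context {R : realType} (T : topologicalType) (N : @net T).
Hypothesis cN : compact (net_dom N).

Lemma mean_near_cont (S : topologicalType) (f : S -> T -> R) x :
  (\forall x' \near x, forall y, net_dom N y -> {for y, continuous (f x')}) ->
  (forall y, net_dom N y -> {for (x, y), continuous (fun z => f z.1 z.2)}) ->
  {for x, continuous (fun x' => mean N (f x'))}.
Proof.
move=> cf jf; apply/cvgrPdist_le => e e0.
have := @compact_unif _ _ _ _ f x e cN e0 jf => h.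
near=> x'; have cx' : forall y, net_dom N y -> {for y, continuous (f x')} by near: x'.
have cx := nbhs_singleton cf.
rewrite distrC -meanB//; try (by apply: bdd_cont); apply: mean_norm => y Ny.
by apply/ltW; move: y Ny; near: x'.
Unshelve. all: by end_near. Qed.

(** Each difference quotient is a derivative at an intermediate point, and these derivatives are
    uniformly close to [df x] because [net_dom N] is compact. *)
Lemma mean_derive (U : normedModType R) (A : set U) (f df : U -> T -> R) (x v : U) : open A -> A x ->
  (forall x' y, A x' -> net_dom N y -> is_derive x' v (f^~ y) (df x' y)) ->
  (forall x' y, A x' -> net_dom N y -> {for y, continuous (f x')}) ->
  (forall x' y, A x' -> net_dom N y -> {for y, continuous (df x')}) ->
  (forall y, net_dom N y -> {for (x, y), continuous (fun z => df z.1 z.2)}) ->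
  is_derive x v (fun x' => mean N (f x')) (mean N (df x)).
Proof.
move=> oA Ax hd cf cdf jdf.
have bf x' : A x' -> bdd N (f x') by move=> Ax'; apply: bdd_cont => // y; exact: cf.
have bdf x' : A x' -> bdd N (df x') by move=> Ax'; apply: bdd_cont => // y; exact: cdf.
suff L : h^-1 *: (((fun x' => mean N (f x')) \o shift x) (h *: v) - mean N (f x)) @[h --> 0^'] --> mean N (df x).
  by split; [apply/cvg_ex; exists (mean N (df x))|exact: cvg_lim].
apply/cvgrPdist_le => e e0.
have := @compact_unif _ _ _ _ df x e cN e0 jdf => h.
have : \forall x' \near x, A x' /\ forall y, net_dom N y -> `|df x' y - df x y| < e.
  by apply: filterI h; exact: open_nbhs_nbhs.
move=> /nbhs_normP[r r0 hr].
near=> t.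
have t0 : t != 0 by near: t; exact: nbhs_dnbhs_neq.
have tr : `|t| * `|v| < r.
  near: t; exists (r / (`|v| + 1)) => [/=|t /=]; first by rewrite divr_gt0// ltr_wpDl.
  rewrite sub0r normrN => tt _; rewrite (le_lt_trans (y := `|t| * (`|v| + 1)))//.
    by rewrite ler_wpM2l// lerDl.
  by rewrite -ltr_pdivlMr// ltr_wpDl.
have B s : `|s| <= `|t| -> A (x + s *: v) /\ forall y, net_dom N y -> `|df (x + s *: v) y - df x y| < e.
  move=> st; apply: hr => /=; rewrite opprD addNKr normrN normrZ (le_lt_trans _ tr)//. by rewrite ler_wpM2r.
have At : A (t *: v + x) by rewrite addrC; have [] := B t (lexx _).
rewrite /= -meanB; [|exact: bf|exact: bf].
have bfB : bdd N (fun y => f (t *: v + x) y - f x y) by apply: bddB; exact: bf.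
rewrite [t^-1 *: _](_ : _ = mean N (fun y => t^-1 * (f (t *: v + x) y - f x y))); last by rewrite meanZ.
rewrite -meanB; [|exact: bdf|exact: bddZ].
apply: mean_norm => y Ny.
have [|s st E] := @MVT_dir R U (f^~ y) x v t (fun s => df (x + s *: v) y).
  by move=> s /(normM_le1 t)/B[As _]; exact: hd.
rewrite [t *: v + x]addrC E mulKf// distrC.
by have [_ /(_ y Ny)/ltW] := B _ (normM_le1 t st).
Unshelve. all: by end_near. Qed.

Lemma mean_C1 p q (A : set 'M[R]_(p, q)) (f : 'M[R]_(p, q) -> T -> R) df : open A ->
  (forall y, net_dom N y -> C1 A (f^~ y) (df y)) -> (forall x y, A x -> net_dom N y -> {for y, continuous (f x)}) ->
  (forall x y v, A x -> net_dom N y -> {for (x, y), continuous (fun z => df z.2 z.1 v)}) ->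
  C1 A (fun x => mean N (f x)) (fun x v => mean N (fun y => df y x v)).
Proof.
move=> oA hd cf jdf.
have cdf x y v : A x -> net_dom N y -> {for y, continuous (fun y => df y x v)}.
  by move=> Ax Ny; apply: (@cont_slice _ _ _ (fun x y => df y x v)); exact: jdf.
apply: C1_partials => // x v Ax.
  apply: (@mean_derive _ A f (fun x y => df y x v)) => //.
  - by move=> x' y Ax' Ny; apply: C1_derive (hd y Ny) Ax'.
  - by move=> x' y; exact: cdf.
  - by move=> y Ny; exact: jdf.
apply: mean_near_cont; last by move=> y; exact: jdf.
have : nbhs x A by exact: open_nbhs_nbhs.
by apply: filterS => x' Ax' y; exact: cdf.
Qed.

End DeriveMean.

(** * The mean over the unit interval *)

Section UnitInterval.
Context {R : realType}.

(** Left endpoints of a subdivision into [k.+1] equal parts: the increments of a function over them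
    telescope exactly from 0 to 1. *)
Definition I01_pts (k : nat) : seq R := [seq i%:R / k.+1%:R | i <- iota 0 k.+1].

Fact I01_in k i : (i < size (I01_pts k))%N -> forall x0, (`[0, 1]%classic : set R) (nth x0 (I01_pts k) i).
Proof.
move=> ik x0; have /mapP[j] := mem_nth x0 ik.
rewrite mem_iota add0n /= => jk ->; rewrite in_itv/= divr_ge0//=.
by rewrite ler_pdivrMr// mul1r ler_nat ltnW.
Qed.

Fact I01_gt0 k : (0 < size (I01_pts k))%N.
Proof. by rewrite size_map size_iota. Qed.

Definition I01 : net R := Net I01_in I01_gt0.

Lemma I01_compact : compact (net_dom I01). Proof. exact: segment_compact. Qed.

Lemma I01_bdd (f : R -> R) : (forall t : R, net_dom I01 t -> {for t, continuous f}) -> bdd I01 f.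
Proof. exact: bdd_cont I01_compact. Qed.

Lemma I01_domP (t : R) : net_dom I01 t = (0 <= t <= 1) :> Prop.
Proof. by rewrite /= in_itv. Qed.

Lemma I01_FTC (f g : R -> R) : (forall t : R, 0 <= t <= 1 -> is_derive t 1 f (g t)) ->
  (forall t : R, 0 <= t <= 1 -> {for t, continuous g}) -> mean I01 g = f 1 - f 0.
Proof.
move=> fd cg.
have bg : bdd I01 g by apply: bdd_cont; [exact: I01_compact|move=> t; rewrite I01_domP; exact: cg].
apply: mean_eqP => //; apply/cvgrPdist_le => e e0.
have uc : \forall h \near (0 : R), forall t, 0 <= t <= 1 -> 0 <= t + h <= 1 -> `|g (t + h) - g t| <= e.
  (* [g] is continuous only on the interval; clamping the argument produces a function to which
     compactness applies. *)
  have cg' t : 0 <= t <= 1 -> {for (0, t), continuous (fun z : R * R => g (Num.max 0 (Num.min 1 (z.2 + z.1))))}.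
    move=> t01; apply: (@cont_comp _ _ _ (fun z : R * R => Num.max 0 (Num.min 1 (z.2 + z.1))) g).
      have c1 : {for (0 : R, t), continuous (fun z : R * R => z.2 + z.1)}.
        by apply: (@continuousD _ _ _ (fun z : R * R => z.2) (fun z => z.1)); [exact: cvg_snd|exact: cvg_fst].
      apply: (@continuous_max _ _ (fun=> 0) (fun z : R * R => Num.min 1 (z.2 + z.1))); first exact: cont_cst.
      by apply: (@continuous_min _ _ (fun=> 1) (fun z : R * R => z.2 + z.1)); first exact: cont_cst.
    by rewrite /= addr0; case/andP: t01 => ? ?; rewrite min_r// max_r//; apply: cg; apply/andP.
  have := @compact_unif R R R `[0, 1]%classic (fun h t => g (Num.max 0 (Num.min 1 (t + h)))) 0 e
     (@segment_compact R 0 1) e0.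
  move=> /(_ _)/wrap[t|]; first by rewrite /= in_itv; exact: cg'.
  apply: filterS => h H t t01 /andP[th0 th1]; have := H t; rewrite /= in_itv => /(_ t01).
  by case/andP: t01 => ? ?; rewrite addr0 !min_r// !max_r// => /ltW.
have [d d0 hd] : exists2 d : R, 0 < d & forall h, `|h| < d -> forall t, 0 <= t <= 1 -> 0 <= t + h <= 1 -> `|g (t + h) - g t| <= e.
  by move/nbhs_normP: uc => [d d0 hd]; exists d => // h hh; apply: hd; rewrite /= sub0r normrN.
have : \forall k \near (\oo : set_system nat), k.+1%:R^-1 < d.
  by have := near_infty_natSinv_lt (PosNum d0).
move=> /ultra_oo; apply: filterS => k kd.
set n := k.+1 in kd *; have n0 : 0 < n%:R :> R by rewrite ltr0n.
have -> : f 1 - f 0 = avg (net_pts I01 k) (fun t => n%:R * (f (t + n%:R^-1) - f t)).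
  rewrite avgZ /avg size_map size_iota mulrC divfK ?gt_eqF//.
  rewrite big_map -[iota 0 k.+1]/(index_iota 0 n) (eq_bigr (fun i => f (i.+1%:R / n%:R) - f (i%:R / n%:R))).
    by rewrite (telescope_sumr (fun i => f (i%:R / n%:R)))// mul0r divff ?gt_eqF.
  by move=> i _; rewrite -[i.+1%:R]natr1 mulrDl mul1r.
rewrite -mulN1r -avgZ -avgD /avg size_map size_iota big_map -/n normrM.
have -> : `|n%:R^-1| = n%:R^-1 :> R by rewrite ger0_norm// invr_ge0 ltW.
rewrite ler_pdivrMr//.
rewrite (le_trans (ler_norm_sum _ _ _))//.
rewrite (le_trans (y := \sum_(i <- iota 0 n) e))//; last first.
  by rewrite big_const_seq count_predT size_iota iter_addr_0 mulr_natr.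
rewrite big_seq [leRHS]big_seq ler_sum// => i; rewrite mem_iota add0n => /= iN.
set t := i%:R / n%:R.
have t0 : 0 <= t by rewrite divr_ge0.
have t1 : t + n%:R^-1 <= 1.
  by rewrite /t -{2}[n%:R^-1]mul1r -mulrDl ler_pdivrMr// mul1r natr1 ler_nat.
have n1 : 0 <= n%:R^-1 :> R by rewrite invr_ge0 ltW.
have [u /andP[u0 u1]|u /andP[u0 u1] E] := @MVT_dir R R f t 1 n%:R^-1 (fun u => g (t + u)).
  by rewrite [_ *: 1]mulr1; apply: fd; rewrite addr_ge0 ?mulr_ge0//= (le_trans _ t1)// lerD2l ler_piMl.
have un : u * n%:R^-1 <= n%:R^-1 by rewrite ler_piMl.
rewrite [_ *: 1]mulr1 in E; rewrite E mulVKf ?gt_eqF// mulN1r; apply: hd.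
- by rewrite ger0_norm ?mulr_ge0// (le_lt_trans un).
- by rewrite t0 (le_trans _ t1)// lerDl.
- by rewrite addr_ge0 ?mulr_ge0//= (le_trans _ t1)// lerD2l.
Qed.

End UnitInterval.

(** * The mean over a cube and the divergence theorem *)

Section Grid.
Context {R : realType} (p q : nat) (M : R).
Hypothesis M0 : 0 < M.

Definition grid_pt k (g : {ffun 'I_p * 'I_q -> 'I_k.+1}) : 'M[R]_(p, q) :=
  \matrix_(i, j) (- M + 2 * M * (g (i, j))%:R / k.+1%:R).

Definition grid_pts k : seq 'M[R]_(p, q) := [seq grid_pt g | g : {ffun 'I_p * 'I_q -> 'I_k.+1}].

Lemma grid_pt_norm k g : `|@grid_pt k g| <= M.
Proof.
apply: mx_norm_le => [|i j]; first exact: ltW.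
have a0 : 0 <= (g (i, j))%:R / k.+1%:R :> R by rewrite divr_ge0.
have a1 : (g (i, j))%:R / k.+1%:R <= 1 :> R.
  by rewrite ler_pdivrMr// mul1r ler_nat ltnW.
rewrite mxE -mulrA; set a := _ / _ in a0 a1 *.
have b0 : 0 <= 2 * M * a by rewrite !mulr_ge0// ltW.
have b1 : 2 * M * a <= 2 * M by rewrite ger_pMr// mulr_gt0.
by rewrite ler_norml; apply/andP; split; lra.
Qed.

Fact grid_in k i : (i < size (grid_pts k))%N -> forall x0, [set x : 'M[R]_(p, q) | `|x| <= M] (nth x0 (grid_pts k) i).
Proof. by move=> ik x0; have /mapP[g _ ->] := mem_nth x0 ik; exact: grid_pt_norm. Qed.

Fact grid_gt0 k : (0 < size (grid_pts k))%N.
Proof. by rewrite size_image; apply/card_gt0P; exists [ffun=> ord0]. Qed.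

Definition grid : net 'M[R]_(p, q) := Net grid_in grid_gt0.

Lemma grid_compact : compact (net_dom grid). Proof. exact: compact_ball_mx. Qed.

Lemma grid_bdd (f : 'M[R]_(p, q) -> R) : continuous f -> bdd grid f.
Proof. by move=> cf; apply: bdd_cont grid_compact _ => x _; exact: cf. Qed.

Lemma grid_avgE k (f : 'M[R]_(p, q) -> R) : avg (net_pts grid k) f =
  (\sum_(g : {ffun 'I_p * 'I_q -> 'I_k.+1}) f (grid_pt g)) / #|{ffun 'I_p * 'I_q -> 'I_k.+1}|%:R.
Proof. by rewrite /avg /= size_image big_image. Qed.

(** Moving one coordinate index cyclically permutes the grid. For functions vanishing near the faces
    this is invariance under translation by one mesh width. *)
Lemma grid_shift k (a : 'I_p * 'I_q) (F : {ffun 'I_p * 'I_q -> 'I_k.+1} -> R) :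
  \sum_g F g = \sum_(g : {ffun 'I_p * 'I_q -> 'I_k.+1}) F [ffun b => if b == a then ordS (g b) else g b].
Proof.
rewrite (reindex_inj (h := fun g : {ffun 'I_p * 'I_q -> 'I_k.+1} => [ffun b => if b == a then ordS (g b) else g b]))//.
move=> g g' /ffunP gg'; apply/ffunP => b; have := gg' b; rewrite !ffunE.
by case: ifP => // _; exact: ordS_inj.
Qed.

(** The increments of [h] over one mesh width sum to 0 by [grid_shift], and by uniform continuity of
    [d] each quotient of such an increment by the mesh is close to the derivative. *)
Lemma grid_div i j (h d : 'M[R]_(p, q) -> R) M' : M' < M -> (forall x, is_derive x (mxb i j) h (d x)) -> continuous d ->
  (forall x, M' < `|x| -> h x = 0) -> (forall x, M' < `|x| -> d x = 0) -> mean grid d = 0.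
Proof.
move=> M'M hd cd h0 d0.
have bd := grid_bdd cd.
apply: mean_eqP => //; apply/cvgrPdist_le => e e0.
have := @compact_uniform_cont R p q d M' e e0 cd d0.
move=> /nbhs_normP[r r0 hr].
have r1 : 0 < Num.min (r / (2 * M)) ((M - M') / (2 * M)).
  by rewrite lt_min !divr_gt0 ?subr_gt0 ?mulr_gt0.
have : \forall k \near (\oo : set_system nat), k.+1%:R^-1 < Num.min (r / (2 * M)) ((M - M') / (2 * M)).
  by have := near_infty_natSinv_lt (PosNum r1).
move=> /ultra_oo; apply: filterS => k; rewrite lt_min => /andP[kr kM].
rewrite sub0r normrN grid_avgE.
set D := #|_|%:R; set n : R := k.+1%:R; have n0 : 0 < n by rewrite ltr0n.
have M2 : 0 < 2 * M by rewrite mulr_gt0.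
pose c := 2 * M / n; have c0 : 0 < c by rewrite divr_gt0.
have cr : c < r by move: kr; rewrite -/n ltr_pdivlMr// mulrC.
have cM : c < M - M' by move: kM; rewrite -/n ltr_pdivlMr// mulrC.
have S0 : \sum_(g : {ffun 'I_p * 'I_q -> 'I_k.+1}) (h (grid_pt g + c *: mxb i j) - h (grid_pt g)) = 0.
  rewrite sumrB [X in _ - X](grid_shift (i, j)); apply/eqP; rewrite subr_eq0; apply/eqP. apply: eq_bigr => g _.
  have [gk|gk] := ltnP (g (i, j)) k.
    congr h; apply/matrixP => a b; rewrite !mxE ffunE xpair_eqE /=. case: eqP => [->|_] /=; last by rewrite mulr0 addr0.
    case: eqP => [->|_] /=; last by rewrite mulr0 addr0.
    rewrite modn_small ?ltnS// -natr1 mulr1 /c -/n; field; exact: lt0r_neq0.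
  (* Wrap-around: the translated point lies on the face [M], its cyclic counterpart on the face
     [- M], and [h] vanishes on both. *)
  have gE : g (i, j) = k :> nat by apply/eqP; rewrite eqn_leq gk -ltnS ltn_ord.
  have big (x : 'M[R]_(p, q)) : M' < `|x i j| -> h x = 0.
    by move=> hx; apply: h0; exact: lt_le_trans (coord_norm x i j).
  rewrite !big// !mxE.
    by rewrite ffunE eqxx /= gE modnn mulr0 mul0r addr0 normrN gtr0_norm.
  rewrite !eqxx mulr1 gE (_ : - M + 2 * M * k%:R / k.+1%:R + c = M); first by rewrite gtr0_norm.
  have kk : k%:R = n - 1 :> R by rewrite /n -natr1 addrK. rewrite kk /c -/n; field; exact: lt0r_neq0.
rewrite normrM [`|D^-1|]ger0_norm ?invr_ge0 ?ler0n//.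
have D0 : 0 < D by rewrite ltr0n; apply/card_gt0P; exists [ffun=> ord0].
rewrite ler_pdivrMr//.
have -> : \sum_(g : {ffun 'I_p * 'I_q -> 'I_k.+1}) d (grid_pt g) =
  \sum_(g : {ffun 'I_p * 'I_q -> 'I_k.+1}) (d (grid_pt g) - c^-1 * (h (grid_pt g + c *: mxb i j) - h (grid_pt g))).
  by rewrite sumrB -mulr_sumr S0 mulr0 subr0.
rewrite (le_trans (ler_norm_sum _ _ _))//.
rewrite (le_trans (y := \sum_(g : {ffun 'I_p * 'I_q -> 'I_k.+1}) e))//; last first.
  by rewrite sumr_const mulr_natr.
apply: ler_sum => g _.
have [t tc ->] := @MVT_dir R _ h (grid_pt g) (mxb i j) c (fun t => d (grid_pt g + t *: mxb i j)) (fun t _ => hd _).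
rewrite mulKf ?gt_eqF// distrC; apply/ltW/hr => /=.
rewrite sub0r normrN normrZ (le_lt_trans _ cr)// (le_trans (ler_piMr _ (mxb_norm i j)))//.
by rewrite (le_trans (normM_le1 c tc))// gtr0_norm.
Qed.

End Grid.

(** * Linear algebra of the Fubini-Study form in homogeneous coordinates *)

Section LinearForms.
Context {R : realType} (m : nat).
Local Notation V := 'M[R]_(m, 2).
Implicit Types (u v w Z : V) (L : V -> R) (g : V -> V -> R).

Lemma linD L u v : linear L -> L (u + v) = L u + L v.
Proof. by move=> l; have := l 1 u v; rewrite !scale1r. Qed.

Lemma lin0 L : linear L -> L 0 = 0.
Proof. by move=> l; have := linD 0 0 l; rewrite addr0 -[LHS]addr0 => /addrI. Qed.

Lemma linZ L a v : linear L -> L (a *: v) = a * L v.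
Proof. by move=> l; have := l a v 0; rewrite (lin0 l) !addr0. Qed.

Lemma linN L v : linear L -> L (- v) = - L v.
Proof. by move=> l; rewrite -scaleN1r linZ// mulN1r. Qed.

Lemma linB L u v : linear L -> L (u - v) = L u - L v.
Proof. by move=> l; rewrite linD// linN. Qed.

Definition ip u v : R := \sum_k (u k ord0 * v k ord0 + u k ord_max * v k ord_max).

(** Multiplication by the imaginary unit on C^m. *)
Definition Jm u : V := \matrix_(k, b) if b == ord0 then - u k ord_max else u k ord0.

Lemma Jm0 u k : Jm u k ord0 = - u k ord_max. Proof. by rewrite mxE. Qed.
Lemma Jm1 u k : Jm u k ord_max = u k ord0. Proof. by rewrite mxE. Qed.

Lemma ord2P (b : 'I_2) : b = ord_max \/ b = ord0.
Proof. by case: b => [[|[|]]]// ?; [right|left]; exact: val_inj. Qed.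

Lemma mx2P u v : (forall k, u k ord0 = v k ord0 /\ u k ord_max = v k ord_max) -> u = v.
Proof.
move=> h; apply/matrixP => k b; have [h0 h1] := h k.
by case: (ord2P b) => ->.
Qed.

Lemma Jm_linear : linear Jm.
Proof.
by move=> a u v; apply: mx2P => k; rewrite !(mxE, eqxx)/=; split; rewrite ?mxE//; ring.
Qed.

Lemma JmD u v : Jm (u + v) = Jm u + Jm v.
Proof. by have := Jm_linear 1 u v; rewrite !scale1r. Qed.
Lemma JmZ a v : Jm (a *: v) = a *: Jm v.
Proof. by apply: mx2P => k; rewrite !mxE/=; split; rewrite ?mxE//; ring. Qed.
Lemma JmJ u : Jm (Jm u) = - u.
Proof. by apply: mx2P => k; rewrite !(mxE)/= ?mxE. Qed.
Lemma JmN u : Jm (- u) = - Jm u. Proof. by apply: mx2P => k; rewrite !mxE. Qed.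
Lemma JmB u v : Jm (u - v) = Jm u - Jm v. Proof. by rewrite JmD JmN. Qed.

Lemma ip_linr u : linear (ip u).
Proof.
move=> a v w; rewrite /ip scaler_sumr -big_split; apply: eq_bigr => k _.
by rewrite !mxE /GRing.scale/=; ring.
Qed.

Lemma ipC u v : ip u v = ip v u.
Proof. by apply: eq_bigr => k _; ring. Qed.

Lemma ip_linl v : linear (ip^~ v).
Proof. by move=> a u w; rewrite !(ipC _ v) ip_linr. Qed.

Lemma ipDr u v w : ip u (v + w) = ip u v + ip u w. Proof. exact: linD (ip_linr u). Qed.
Lemma ipDl u v w : ip (v + w) u = ip v u + ip w u. Proof. by rewrite !(ipC _ u) ipDr. Qed.
Lemma ipZr a u v : ip u (a *: v) = a * ip u v. Proof. exact: linZ (ip_linr u). Qed.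
Lemma ipZl a u v : ip (a *: v) u = a * ip v u. Proof. by rewrite !(ipC _ u) ipZr. Qed.
Lemma ipNr u v : ip u (- v) = - ip u v. Proof. exact: linN (ip_linr u). Qed.
Lemma ipNl u v : ip (- v) u = - ip v u. Proof. by rewrite !(ipC _ u) ipNr. Qed.
Lemma ip0r u : ip u 0 = 0. Proof. exact: lin0 (ip_linr u). Qed.
Lemma ip0l u : ip 0 u = 0. Proof. by rewrite ipC ip0r. Qed.

Lemma ip_JJ u v : ip (Jm u) (Jm v) = ip u v.
Proof. by apply: eq_bigr => k _; rewrite !mxE/=; ring. Qed.

Lemma ip_Jl u v : ip (Jm u) v = - ip u (Jm v).
Proof. by rewrite /ip -sumrN; apply: eq_bigr => k _; rewrite !mxE/=; ring. Qed.

Lemma ip_J u : ip u (Jm u) = 0.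
Proof. by rewrite /ip big1// => k _; rewrite !mxE/=; ring. Qed.

Lemma ip_Jself u : ip (Jm u) u = 0. Proof. by rewrite ip_Jl ip_J oppr0. Qed.

Lemma omega_ip u v : omega_st u v = ip (Jm u) v.
Proof. by apply: eq_bigr => k _; rewrite /xcoord /ycoord !mxE/=; ring. Qed.

Lemma ip_ge0 u : 0 <= ip u u.
Proof. by apply: sumr_ge0 => k _; rewrite -!expr2 addr_ge0 ?sqr_ge0. Qed.

Lemma ip_eq0 u : ip u u = 0 -> u = 0.
Proof.
move=> u0; apply: mx2P => k; rewrite !mxE.
have h : u k ord0 ^+ 2 + u k ord_max ^+ 2 = 0.
  apply/eqP; rewrite eq_le -{1}u0 addr_ge0 ?sqr_ge0// andbT /ip (bigD1 k)//= -!expr2 lerDl.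
  by apply: sumr_ge0 => k' _; rewrite -!expr2 addr_ge0 ?sqr_ge0.
have /eqP : u k ord0 ^+ 2 = 0 by apply/eqP; rewrite eq_le sqr_ge0 andbT -h lerDl sqr_ge0.
have /eqP : u k ord_max ^+ 2 = 0 by apply/eqP; rewrite eq_le sqr_ge0 andbT -h lerDr sqr_ge0.
by rewrite !sqrf_eq0 => /eqP -> /eqP ->.
Qed.

Lemma ip_gt0 u : u != 0 -> 0 < ip u u.
Proof. by move=> u0; rewrite lt_neqAle ip_ge0 andbT eq_sym; apply: contra u0 => /eqP/ip_eq0/eqP. Qed.

Definition ex (k : 'I_m) : V := mxb k ord0.
Definition ey (k : 'I_m) : V := mxb k ord_max.

Lemma Jm_ex k : Jm (ex k) = ey k.
Proof. by apply: mx2P => l; rewrite !mxE/= ?andbF ?andbT ?oppr0. Qed.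
Lemma Jm_ey k : Jm (ey k) = - ex k.
Proof. by apply: mx2P => l; rewrite !mxE/= ?andbF ?andbT ?oppr0. Qed.

Lemma lin_basis L u : linear L -> L u = \sum_k (u k ord0 * L (ex k) + u k ord_max * L (ey k)).
Proof.
move=> l; rewrite (linear_coord_sum u l); apply: eq_bigr => k _.
rewrite !big_ord_recl big_ord0 addr0 (_ : lift _ _ = ord_max)//; exact: val_inj.
Qed.

Lemma ip_ex u k : ip u (ex k) = u k ord0.
Proof.
rewrite /ip (bigD1 k)//= big1 => [|l lk]; rewrite !mxE ?eqxx/= ?mulr0 ?mulr1 ?addr0//.
by rewrite (negbTE lk)/= !mulr0 addr0.
Qed.

Lemma ip_ey u k : ip u (ey k) = u k ord_max.
Proof.
rewrite /ip (bigD1 k)//= big1 => [|l lk]; rewrite !mxE ?eqxx/= ?mulr0 ?mulr1 ?addr0 ?add0r//.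
by rewrite (negbTE lk)/= !mulr0 addr0.
Qed.

Definition bilin g := (forall u, linear (g u)) /\ (forall v, linear (g^~ v)).

(** Up to a constant, the coefficient of [g /\ omega_st ^ (m - 1)] in the volume form; integrals of
    2-forms against powers of the Kaehler form thus become means of traces. *)
Definition tr g : R := \sum_k g (ex k) (ey k).

Definition sumB (F : V -> R) : R := \sum_k (F (ex k) + F (ey k)).

Lemma eq_sumB F G : F =1 G -> sumB F = sumB G.
Proof. by move=> h; apply: eq_bigr => k _; rewrite !h. Qed.

Lemma sumBD F G : sumB (fun a => F a + G a) = sumB F + sumB G.
Proof. by rewrite /sumB -big_split; apply: eq_bigr => k _ /=; ring. Qed.

Lemma sumBZ c F : sumB (fun a => c * F a) = c * sumB F.
Proof. by rewrite /sumB mulr_sumr; apply: eq_bigr => k _ /=; ring. Qed.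

Lemma sumBN F : sumB (fun a => - F a) = - sumB F.
Proof. by rewrite -mulN1r -sumBZ; apply: eq_sumB => a; rewrite mulN1r. Qed.

Lemma sumB_exchange (F : V -> V -> R) : sumB (fun a => sumB (F a)) = sumB (fun b => sumB (F^~ b)).
Proof.
rewrite /sumB; under eq_bigr => k _ do rewrite -big_split/=.
rewrite exchange_big/=; apply: eq_bigr => k _; rewrite -big_split/=.
by apply: eq_bigr => l _; ring.
Qed.

Lemma sumB_J (h : V -> V -> R) : bilin h -> sumB (fun a => h (Jm a) (Jm a)) = sumB (fun a => h a a).
Proof.
move=> [l1 l2]; apply: eq_bigr => k _.
by rewrite Jm_ex Jm_ey (linN _ (l1 _)) (linN _ (l2 _)) opprK addrC.
Qed.

Lemma sumB_Jl (h : V -> V -> R) : bilin h -> sumB (fun a => h (Jm a) a) = - sumB (fun a => h a (Jm a)).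
Proof.
move=> [l1 l2]; rewrite /sumB -sumrN; apply: eq_bigr => k _.
by rewrite Jm_ex Jm_ey (linN _ (l1 _)) (linN _ (l2 _)); ring.
Qed.

Lemma sumB_riesz w L : linear L -> sumB (fun a => ip w a * L a) = L w.
Proof. by move=> l; rewrite (lin_basis w l); apply: eq_bigr => k _; rewrite ip_ex ip_ey. Qed.

Lemma sumB_tr g : bilin g -> (forall u v, g u v = - g v u) -> sumB (fun a => g a (Jm a)) = 2 * tr g.
Proof.
move=> [l1 l2] as_; rewrite /sumB /tr mulr_sumr; apply: eq_bigr => k _.
rewrite Jm_ex Jm_ey (linN _ (l1 _)) [g (ey k) _]as_; ring.
Qed.

Lemma sumB_ip Z : sumB (fun a => ip a Z * ip a Z) = ip Z Z.
Proof.
rewrite -{3}[Z]/(id Z) -(sumB_riesz Z (L := ip Z)); last exact: ip_linr.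
by apply: eq_sumB => a; rewrite (ipC a Z).
Qed.

(** The pullback of the Fubini-Study form to the nonzero vectors, see [FS_chart]. It is invariant
    under complex scaling and annihilates the complex line through [Z]. *)
Definition Omega Z u v : R := ip (Jm u) v / ip Z Z
  - (ip u Z * ip (Jm Z) v + ip (Jm u) Z * ip Z v) / ip Z Z ^+ 2.

Lemma Omega_lin Z : bilin (Omega Z).
Proof.
split=> [u|v] a x y; rewrite /Omega ?JmD ?JmZ.
  by rewrite !ip_linr /GRing.scale/=; ring.
by rewrite !ip_linl /GRing.scale/=; ring.
Qed.

Lemma Omega_anti Z u v : Omega Z u v = - Omega Z v u.
Proof. by rewrite /Omega (ip_Jl u v) (ip_Jl u Z) (ip_Jl Z v) (ipC (Jm v)) (ipC (Jm v) Z)(ipC u Z) (ipC v Z) (ipC u (Jm v)) (ipC u (Jm Z)); rewrite (ip_Jl Z u); ring. Qed.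

Lemma Omega_Z Z v : Z != 0 -> Omega Z Z v = 0.
Proof.
by move=> /ip_gt0 z0; rewrite /Omega ip_Jself; field; exact: lt0r_neq0.
Qed.

Lemma Omega_JZ Z v : Z != 0 -> Omega Z (Jm Z) v = 0.
Proof.
move=> /ip_gt0 z0; rewrite /Omega JmJ ip_Jself (linN _ (ip_linl _)) (linN _ (ip_linl _)).
by field; exact: lt0r_neq0.
Qed.

Definition sharp Z u : V := (ip Z Z)^-1 *: Jm u - (ip Z Z ^- 2) *: (ip u Z *: Jm Z + ip (Jm u) Z *: Z).

Lemma sharpE Z u v : ip (sharp Z u) v = Omega Z u v.
Proof.
rewrite /sharp (linB _ _ (ip_linl v)) !(linZ _ _ (ip_linl v)) (linD _ _ (ip_linl v)) !(linZ _ _ (ip_linl v)).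
by rewrite /Omega; ring.
Qed.

(** On covectors vanishing on the complex line through [Z] the correction terms drop out, and
    [Jm \o sharp Z] acts as the scalar [- 1 / |Z|^2]. The contractions with [Omega] below reduce to
    this. *)
Lemma Jsharp Z u L : linear L -> L Z = 0 -> L (Jm Z) = 0 -> L (Jm (sharp Z u)) = - (ip Z Z)^-1 * L u.
Proof.
move=> l L0 LJ; rewrite /sharp JmB !JmZ JmD !JmZ !JmJ (linB _ _ l) !(linZ _ _ l) (linD _ _ l) !(linZ _ _ l).
by rewrite !(linN _ l) L0 LJ; ring.
Qed.

Definition wedge (L K : V -> R) u v : R := L u * K v - L v * K u.

Lemma wedge_lin L K : linear L -> linear K -> bilin (wedge L K).
Proof. by move=> l k; split=> [u|v] a x y; rewrite /wedge l k /GRing.scale/=; ring. Qed.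

Lemma wedge_anti L K u v : wedge L K u v = - wedge L K v u.
Proof. by rewrite /wedge; ring. Qed.

Lemma tr_wedge L w : linear L -> tr (wedge L (ip w)) = - L (Jm w).
Proof.
move=> l; rewrite (lin_basis (Jm w) l) /tr -sumrN; apply: eq_bigr => k _.
by rewrite /wedge ip_ex ip_ey !mxE/=; ring.
Qed.

Lemma tr_wedge_Omega Z Y L : linear L -> L Z = 0 -> L (Jm Z) = 0 -> tr (wedge L (Omega Z Y)) = L Y / ip Z Z.
Proof.
move=> l L0 LJ; rewrite (_ : Omega Z Y = ip (sharp Z Y)).
  by rewrite tr_wedge// Jsharp// mulNr opprK mulrC.
by apply/funext => v; rewrite sharpE.
Qed.

(** Chosen so that [2 * tr g ^+ 2 - CC g g] is, up to a constant, the coefficient of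
    [g /\ g /\ omega_st ^ (m - 2)]. [CC_wedge] is its vanishing on decomposable forms. *)
Definition CC g g' : R := sumB (fun a => sumB (fun b => g a b * g' (Jm a) (Jm b))).

Lemma CC_Omega Z g : bilin g -> (forall u v, g u v = - g v u) ->
  (forall v, g Z v = 0) -> (forall v, g (Jm Z) v = 0) -> CC (Omega Z) g = 2 * tr g / ip Z Z.
Proof.
move=> [l1 l2] as_ g0 gJ; rewrite /CC.
have E a : sumB (fun b => Omega Z a b * g (Jm a) (Jm b)) = (ip Z Z)^-1 * g a (Jm a).
  under eq_sumB => b do rewrite -sharpE. rewrite (@sumB_riesz (sharp Z a) (fun b => g (Jm a) (Jm b))); last first.
    by move=> c x y; rewrite JmD JmZ l1.
  rewrite Jsharp//; [|by rewrite as_ g0 oppr0|by rewrite as_ gJ oppr0]. by rewrite [g (Jm a) a]as_; ring.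
by rewrite (eq_sumB E) sumBZ sumB_tr//; ring.
Qed.

Lemma tr_Omega Z : Z != 0 -> tr (Omega Z) = (m%:R - 1) / ip Z Z.
Proof.
move=> /ip_gt0 z0.
have E k : Omega Z (ex k) (ey k) = (ip Z Z)^-1
    - (ip (ex k) Z * ip (ex k) Z + ip (ey k) Z * ip (ey k) Z) / ip Z Z ^+ 2.
  rewrite /Omega -Jm_ex ip_JJ ip_JJ ip_ex !mxE !eqxx/= (ipC Z (ex k)) (ipC Z (Jm (ex k))). by rewrite mul1r.
rewrite /tr (eq_bigr _ (fun k _ => E k)) sumrB sumr_const card_ord -mulr_suml.
rewrite -/(sumB (fun a => ip a Z * ip a Z)) sumB_ip -[_ *+ m]mulr_natr; field; exact: lt0r_neq0.
Qed.

Lemma CC_wedge L K : linear L -> linear K -> CC (wedge L K) (wedge L K) = 2 * tr (wedge L K) ^+ 2.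
Proof.
move=> l k.
have LJ : linear (fun v => L (Jm v)) by move=> c x y; rewrite JmD JmZ l.
have KJ : linear (fun v => K (Jm v)) by move=> c x y; rewrite JmD JmZ k.
have o (P Q : V -> R) : linear P -> linear Q -> bilin (fun u v => P u * Q v).
  by move=> p q; split=> [u|v] c x y; rewrite ?p ?q /GRing.scale/=; ring.
have z (P : V -> R) : linear P -> sumB (fun a => P a * P (Jm a)) = 0.
  move=> p; have := sumB_Jl (o _ _ p p); under eq_sumB => a do rewrite mulrC.
  by move/eqP; rewrite -addr_eq0 -mulr2n mulrn_eq0 /= => /eqP.
have s : sumB (fun a => L a * K (Jm a)) = tr (wedge L K).
  have := sumB_tr (wedge_lin l k) (wedge_anti L K); rewrite /wedge. under eq_sumB => a do rewrite -mulrN; rewrite sumBD.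
  under [X in _ + X]eq_sumB => a do rewrite mulrN; rewrite sumBN (sumB_Jl (o _ _ l k)) opprK => E.
  have -> : tr (wedge L K) = 2^-1 * (2 * tr (wedge L K)) by field. by rewrite -/(wedge L K) -E; field.
have s' : sumB (fun a => K a * L (Jm a)) = - tr (wedge L K).
  by rewrite -s -(sumB_Jl (o _ _ l k)); apply: eq_sumB => a; rewrite mulrC.
have E a : sumB (fun b => wedge L K a b * wedge L K (Jm a) (Jm b)) =
   (- tr (wedge L K)) * (L a * K (Jm a)) * (-1) * (-1) * 0 + (K a * L (Jm a) * (-1) * tr (wedge L K) + L a * K (Jm a) * tr (wedge L K)).
  rewrite mulr0 add0r. have -> : sumB (fun b => wedge L K a b * wedge L K (Jm a) (Jm b)) =
    L a * L (Jm a) * sumB (fun b => K b * K (Jm b)) + K a * K (Jm a) * sumB (fun b => L b * L (Jm b))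
    + (- (L a * K (Jm a)) * sumB (fun b => K b * L (Jm b)) + (- (K a * L (Jm a))) * sumB (fun b => L b * K (Jm b))).
    by rewrite -!sumBZ -!sumBD; apply: eq_sumB => b; rewrite /wedge; ring.
  by rewrite (z K k) (z L l) s s'; ring.
rewrite /CC (eq_sumB E).
have -> : 2 * tr (wedge L K) ^+ 2 = - tr (wedge L K) * sumB (fun a => K a * L (Jm a)) + tr (wedge L K) * sumB (fun a => L a * K (Jm a)).
  by rewrite s s'; ring.
by rewrite -!sumBZ -!sumBD; apply: eq_sumB => b; ring.
Qed.

Lemma CC_sym g g' : bilin g -> bilin g' -> CC g g' = CC g' g.
Proof.
move=> [l1 l2] [l1' l2']; rewrite /CC.
have E a : sumB (fun b => g a b * g' (Jm a) (Jm b)) = - sumB (fun b => g a (Jm b) * g' (Jm a) b).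
  rewrite -[LHS]opprK -(@sumB_Jl (fun x y => g a x * g' (Jm a) y))//.
  by split=> [u|v] c x y; rewrite ?l1 ?l1' /GRing.scale/=; ring.
have E' b : sumB (fun a => g a (Jm b) * g' (Jm a) b) = - sumB (fun a => g (Jm a) (Jm b) * g' a b).
  rewrite -[LHS]opprK -(@sumB_Jl (fun x y => g x (Jm b) * g' y b))//.
  by split=> [u|v] c x y; rewrite ?l2 ?l2' /GRing.scale/=; ring.
rewrite (eq_sumB E) sumBN sumB_exchange (eq_sumB E') sumBN opprK sumB_exchange.
by apply: eq_sumB => a; apply: eq_sumB => b; rewrite mulrC.
Qed.

(** The square of [L /\ K] vanishes, so only the term in [phi ^+ 2] and the cross term survive. The
    common factor [m - 2], which is [n - 1] on the cone, is nonzero exactly because projective space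
    has dimension at least two. *)
Lemma quadratic_trace Z (phi : R) L K : Z != 0 -> linear L -> linear K ->
  L Z = 0 -> L (Jm Z) = 0 -> K Z = 0 -> K (Jm Z) = 0 -> let g := fun u v => phi * Omega Z u v + wedge L K u v in
  2 * tr g ^+ 2 - CC g g = 2 * (m%:R - 2) / ip Z Z * (phi ^+ 2 * (m%:R - 1) / ip Z Z + 2 * phi * tr (wedge L K)).
Proof.
move=> Z0 l k LZ LJ KZ KJ g.
have z0 := lt0r_neq0 (ip_gt0 Z0).
have bO := Omega_lin Z; have bw := wedge_lin l k.
have trg : tr g = phi * tr (Omega Z) + tr (wedge L K).
  by rewrite /tr /g mulr_sumr -big_split.
have CCg : CC g g = phi ^+ 2 * CC (Omega Z) (Omega Z) + 2 * phi * CC (Omega Z) (wedge L K)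
    + CC (wedge L K) (wedge L K).
  rewrite (_ : 2 * phi * CC (Omega Z) (wedge L K) = phi * CC (Omega Z) (wedge L K) + phi * CC (wedge L K) (Omega Z)).
    rewrite /CC -!sumBZ -!sumBD; apply: eq_sumB => a; rewrite -!sumBZ -!sumBD. by apply: eq_sumB => b; rewrite /g; ring.
  by rewrite (CC_sym bw bO); ring.
have w0 v : wedge L K Z v = 0 by rewrite /wedge LZ KZ; ring.
have wJ v : wedge L K (Jm Z) v = 0 by rewrite /wedge LJ KJ; ring.
rewrite trg CCg CC_wedge// (CC_Omega bw (wedge_anti L K) w0 wJ).
rewrite (CC_Omega bO (Omega_anti Z)) ?tr_Omega//; first by field.
- by move=> v; rewrite Omega_Z.
- by move=> v; rewrite Omega_JZ.
Qed.

End LinearForms.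

Notation sq x := (ip x x).

(** * Differential forms and Stokes identities *)

Section Forms.
Context {R : realType} (m : nat).
Local Notation V := 'M[R]_(m, 2).
Implicit Types (A F : set V) (al : V -> V -> R) (da : V -> V -> V -> R)
  (sg : V -> V -> V -> R) (ds : V -> V -> V -> V -> R).

Lemma C1_unique (U W : normedModType R) (B : set U) (f : U -> W) df dg x v :
  C1 B f df -> C1 B f dg -> B x -> df x v = dg x v.
Proof.
move=> h1 h2 Bx; have [_ <-] := C1_derive v h1 Bx.
by have [_ <-] := C1_derive v h2 Bx.
Qed.

(* [da v x u] is the derivative at [x], in direction [u], of [al ^~ v]. *)
Definition form1 A al da := (forall x, A x -> linear (al x)) /\ (forall v, C1 A (al^~ v) (da v)).

Definition ext1 da x u v : R := da v x u - da u x v.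

Definition form2 A sg ds := [/\ forall x, A x -> bilin (sg x), forall x u v, A x -> sg x u v = - sg x v u &
      forall u v, C1 A (fun x => sg x u v) (ds u v)].

Definition closed2 A ds := forall x u v w, A x -> ds u v x w + ds v w x u + ds w u x v = 0.

Lemma form1_lin A al da x u : open A -> form1 A al da -> A x -> linear (fun v => da v x u).
Proof.
move=> oA [l h] Ax a v w.
have e x' : A x' -> a * al x' v + al x' w = al x' (a *: v + w) by move=> /l ->.
have h' := eq_C1 oA e (fun _ _ _ => erefl) (C1_add (C1_scale a (h v)) (h w)).
exact: (C1_unique _ (h _) h' Ax).
Qed.

Lemma form1_bilin A al da x : open A -> form1 A al da -> A x -> bilin (fun v u => da v x u).
Proof.
move=> oA h Ax; split=> [v|u]; first by have [_ /(_ v) h'] := h; exact: C1_linear h' Ax.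
exact: (@form1_lin A al).
Qed.

Lemma form2_lin2 A sg ds x u w : open A -> form2 A sg ds -> A x -> linear (fun v => ds u v x w).
Proof.
move=> oA [l _ h] Ax; apply: (@form1_lin A (fun x => sg x u) (ds u)) => //.
by split=> // x' Ax'; have [] := l x' Ax'.
Qed.

Lemma form2_anti A sg ds x u v w : open A -> form2 A sg ds -> A x -> ds u v x w = - ds v u x w.
Proof.
move=> oA [_ a h] Ax.
have h' := @eq_C1 _ _ _ A (fun x => - sg x v u) (fun x => sg x u v)
  (fun x w => - ds v u x w) (fun x w => - ds v u x w) oA.
apply: (C1_unique _ (h u v) (h' _ _ (C1_opp (h v u))) Ax) => // x' Ax'.
by rewrite (a x' u v).
Qed.

Lemma C1_sumB A (f : V -> V -> R) (df : V -> V -> V -> R) :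
  (forall a, C1 A (f a) (df a)) -> C1 A (fun x => sumB (f^~ x)) (fun x v => sumB (fun a => df a x v)).
Proof. by move=> h; apply: C1_sum => k; exact: C1_add. Qed.

(** Only the behaviour of [f] on [A] is known. The support of [s] is closed and contained in [A], so
    the product is locally 0 around every point outside [A]. *)
Lemma C1_mul_supp A F (s : V -> R) (f : V -> R) (dsc : V -> V -> R) df :
  open A -> closed F -> F `<=` A -> C1 setT s dsc -> C1 A f df ->
  (forall x, ~ F x -> s x = 0) -> (forall x v, ~ F x -> dsc x v = 0) ->
  C1 setT (fun x => s x * f x) (fun x v => dsc x v * f x + s x * df x v).
Proof.
move=> oA cF FA hs hf s0 ds0 x _.
have [Ax|nA] := pselect (A x).
  by apply: (C1_mul _ hf Ax); exact: C1_subset hs.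
have nF : \forall y \near x, ~ F y.
  have : nbhs x (~` F).
    by apply: open_nbhs_nbhs; split; [rewrite openC|move=> /FA].
  by [].
apply: (@near_C1 _ _ _ [set x] (fun=> 0) _ (fun _ _ => 0) _ _ _ x erefl); last exact: C1_cst.
by move=> _ ->; apply: filterS nF => y nFy; split=> [|v]; rewrite s0// ?ds0// !mul0r ?addr0.
Qed.

Lemma div_theorem A F M M' (M0 : 0 < M) (s : V -> R) dsc (X : V -> V -> R) (dX : V -> V -> V -> R) :
  open A -> closed F -> F `<=` A -> M' < M -> (forall x, F x -> `|x| <= M') ->
  C1 setT s dsc -> (forall x, ~ F x -> s x = 0) -> (forall x v, ~ F x -> dsc x v = 0) ->
  (forall a, C1 A (fun x => X x a) (dX a)) ->
  mean (grid m 2 M0) (fun x => s x * sumB (fun a => dX a x a) + sumB (fun a => dsc x a * X x a)) = 0.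
Proof.
move=> oA cF FA M'M FM hs s0 ds0 hX.
pose D (a : V) (x v : V) := dsc x v * X x a + s x * dX a x v.
have cX a : C1 setT (fun x => s x * X x a) (D a) by exact: (@C1_mul_supp A F).
have cD a v : continuous (D a ^~ v) by move=> x; have [_ ] := cX a x I; exact.
have bD a v : bdd (grid m 2 M0) (D a ^~ v) by exact: grid_bdd.
have far x : M' < `|x| -> ~ F x by move=> Mx /FM; rewrite leNgt Mx.
have z k b : mean (grid m 2 M0) (D (mxb k b) ^~ (mxb k b)) = 0.
  apply: (@grid_div R m 2 M M0 k b (fun x => s x * X x (mxb k b)) _ M') => //.
  - by move=> x; exact: C1_derive (cX _) I.
  - by move=> x /far nF; rewrite s0// mul0r.
  - by move=> x /far nF; rewrite /D s0// ds0// !mul0r addr0.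
rewrite [LHS](_ : _ = mean (grid m 2 M0) (fun x => \sum_k (D (ex k) x (ex k) + D (ey k) x (ey k)))).
  rewrite mean_sum => [|k]; last by apply: bddD; exact: bD.
  by rewrite big1// => k _; rewrite meanD ?z ?addr0//; exact: bD.
apply: mean_eq => x _; rewrite /sumB mulr_sumr -big_split; apply: eq_bigr => k _ /=.
by rewrite /D; ring.
Qed.

Lemma sumB_ext1 A al da x : open A -> form1 A al da -> A x -> sumB (fun a => da (Jm a) x a) = tr (ext1 da x).
Proof.
move=> oA h Ax; apply: eq_bigr => k _; rewrite /ext1 Jm_ex Jm_ey.
by rewrite (linN (L := fun v => da v x (ey k)))//; exact: (@form1_lin A al).
Qed.

Lemma sumB_wedge (L K : V -> R) : linear L -> linear K -> sumB (fun a => L a * K (Jm a)) = tr (wedge L K).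
Proof.
move=> l k; apply: eq_bigr => i _.
by rewrite Jm_ex Jm_ey (linN _ k) /wedge mulrN.
Qed.

(** The divergence theorem for the field with components [al (Jm a)], whose divergence is the trace
    of [d al]. It integrates [d (s al) /\ omega_st ^ (m - 1)]. *)
Lemma stokes1 A F M M' (M0 : 0 < M) (s : V -> R) dsc al da :
  open A -> closed F -> F `<=` A -> M' < M -> (forall x, F x -> `|x| <= M') ->
  C1 setT s dsc -> (forall x, ~ F x -> s x = 0) -> (forall x v, ~ F x -> dsc x v = 0) -> form1 A al da ->
  mean (grid m 2 M0) (fun x => s x * tr (ext1 da x) + tr (wedge (dsc x) (al x))) = 0.
Proof.
move=> oA cF FA M'M FM hs s0 ds0 hal.
rewrite -(@div_theorem A F M M' M0 s dsc (fun x a => al x (Jm a)) (fun a => da (Jm a)))//; last first.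
  by move=> a; have [_] := hal; exact.
apply: mean_eq => x _.
have [Fx|nF] := pselect (F x); last first.
  rewrite s0// /tr/= !mul0r !add0r /sumB; apply: eq_bigr => k _. by rewrite /wedge !ds0// !mul0r subrr addr0.
have Ax := FA _ Fx; rewrite (sumB_ext1 oA hal Ax) sumB_wedge//.
  exact: C1_linear hs I.
by have [/(_ x Ax)] := hal.
Qed.

(** Components of the vector field dual to [al /\ sg /\ omega_st ^ (m - 2)]. For closed [sg] its
    divergence is the polarized quadratic trace. *)
Definition trfield al sg x a : R := 2 * al x (Jm a) * tr (sg x) - 2 * sumB (fun b => al x b * sg x (Jm a) (Jm b)).

(** The cyclic identity is contracted over the pairs [c], [Jm c]; of the three sums that arise, two
    are equal by [sumB_Jl]. *)
Lemma closed_trace A sg ds x a : open A -> form2 A sg ds -> closed2 A ds -> A x ->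
  \sum_k ds (ex k) (ey k) x a = - sumB (fun c => ds (Jm c) a x c).
Proof.
move=> oA h cl Ax.
have bil : bilin (fun y z => ds a y x z).
  split=> [u|w]; first by have [_ _ /(_ a u) h'] := h; exact: C1_linear h' Ax. exact: (@form2_lin2 A sg).
have E : sumB (fun c => ds c (Jm c) x a) = 2 * \sum_k ds (ex k) (ey k) x a.
  rewrite mulr_sumr; apply: eq_bigr => k _; rewrite Jm_ex Jm_ey.
  rewrite (linN (L := fun v => ds (ey k) v x a)); last exact: (@form2_lin2 A sg).
  by rewrite (form2_anti (ey k) _ _ oA h Ax); ring.
have E2 : sumB (fun c => ds c (Jm c) x a) = - 2 * sumB (fun c => ds (Jm c) a x c).
  have J := sumB_Jl bil. rewrite mulNr mulrC mulrDr mulr1 opprD -{1}sumBN.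
  have -> : - sumB (fun c => ds (Jm c) a x c) = - sumB (fun c => ds a c x (Jm c)).
    rewrite -J -sumBN; apply: eq_sumB => c. by rewrite (form2_anti (Jm c) a _ oA h Ax) opprK.
  rewrite -sumBN -sumBD; apply: eq_sumB => c.
  have := cl x c (Jm c) a Ax => /eqP; rewrite -addrA addr_eq0 => /eqP ->; ring.
have -> : \sum_k ds (ex k) (ey k) x a = 2^-1 * (2 * \sum_k ds (ex k) (ey k) x a) by field.
by rewrite -E E2; field.
Qed.

(** Integrates [d (s al /\ sg) /\ omega_st ^ (m - 2)]. The terms containing derivatives of [sg]
    cancel by [closed_trace]. *)
Lemma stokes2 A F M M' (M0 : 0 < M) (s : V -> R) dsc al da sg ds :
  open A -> closed F -> F `<=` A -> M' < M -> (forall x, F x -> `|x| <= M') ->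
  C1 setT s dsc -> (forall x, ~ F x -> s x = 0) -> (forall x v, ~ F x -> dsc x v = 0) ->
  form1 A al da -> form2 A sg ds -> closed2 A ds ->
  mean (grid m 2 M0) (fun x => s x * (2 * tr (ext1 da x) * tr (sg x) - CC (ext1 da x) (sg x))
    + sumB (fun a => dsc x a * trfield al sg x a)) = 0.
Proof.
move=> oA cF FA M'M FM hs s0 ds0 hal hsg hcl.
pose dX a x w := 2 * (da (Jm a) x w * tr (sg x) + al x (Jm a) * \sum_k ds (ex k) (ey k) x w)
  - 2 * sumB (fun b => da b x w * sg x (Jm a) (Jm b) + al x b * ds (Jm a) (Jm b) x w).
have [la ha] := hal; have [lsg asg hs2] := hsg.
have hX a : C1 A (fun x => trfield al sg x a) (dX a).
  apply: C1_sub; last by apply/C1_scale/C1_sumB => b; exact: C1_mul.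
  apply: (C1_ext (C1_scale 2 (C1_mul (ha (Jm a)) (C1_sum _ _ (fun k => hs2 (ex k) (ey k)))))) => // x.
  by rewrite /tr mulrA.
rewrite -(@div_theorem A F M M' M0 s dsc (fun x a => trfield al sg x a) dX)//.
apply: mean_eq => x _; congr (_ + _).
have [Fx|nF] := pselect (F x); last by rewrite s0// !mul0r.
have Ax := FA _ Fx; congr (_ * _).
have bda := form1_bilin oA hal Ax.
have [lsg1 lsg2] := lsg x Ax.
pose S3 := sumB (fun a => sumB (fun b => da b x a * sg x (Jm a) (Jm b))).
have E3 : CC (ext1 da x) (sg x) = 2 * S3.
  have -> : 2 * S3 = S3 - sumB (fun a => sumB (fun b => da a x b * sg x (Jm a) (Jm b))).
    rewrite sumB_exchange -sumBN mulrDl mul1r; congr (_ + _). apply: eq_sumB => a; rewrite -sumBN; apply: eq_sumB => b.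
    by rewrite (asg x (Jm b))// mulrN opprK.
  rewrite -sumBN -sumBD; apply: eq_sumB => a; rewrite -sumBN -sumBD. by apply: eq_sumB => b; rewrite /ext1; ring.
have E4 : sumB (fun a => al x (Jm a) * \sum_k ds (ex k) (ey k) x a) =
   sumB (fun a => sumB (fun b => al x b * ds (Jm a) (Jm b) x a)).
  rewrite sumB_exchange. under eq_sumB => a do rewrite (closed_trace a oA hsg hcl Ax). rewrite -[LHS]opprK -sumBN.
  under eq_sumB => a do rewrite mulrN opprK.
  rewrite (@sumB_Jl _ _ (fun y z => al x y * sumB (fun c => ds (Jm c) z x c))).
    by rewrite opprK; apply: eq_sumB => a; rewrite -sumBZ.
  split=> [u|w] c y z; last by rewrite la// /GRing.scale/=; ring.
  rewrite (_ : sumB (fun c0 => ds (Jm c0) (c *: y + z) x c0) =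
    c * sumB (fun c0 => ds (Jm c0) y x c0) + sumB (fun c0 => ds (Jm c0) z x c0)). by rewrite /GRing.scale/=; ring.
  rewrite -sumBZ -sumBD; apply: eq_sumB => d. have := @form2_lin2 A sg ds x (Jm d) d oA hsg Ax => l. by rewrite l.
rewrite E3 -(sumB_ext1 oA hal Ax).
have dXE a : dX a x a = (2 * tr (sg x)) * da (Jm a) x a
   + 2 * (al x (Jm a) * \sum_k ds (ex k) (ey k) x a)
   + ((-2) * sumB (fun b => da b x a * sg x (Jm a) (Jm b))
      + (-2) * sumB (fun b => al x b * ds (Jm a) (Jm b) x a)).
  by rewrite /dX sumBD; ring.
by rewrite (eq_sumB dXE) !sumBD !sumBZ E4 /S3; ring.
Qed.

End Forms.

(** * Smooth functions *)

Section SmoothFunctions.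
Context {R : realType} (p q : nat).
Implicit Types (A : set 'M[R]_(p, q)) (f g : 'M[R]_(p, q) -> R).

(** A syntactic class closed under directional derivatives ([sm_C1]), so that membership gives
    smoothness of every order at once ([sm_Ck]). Square roots enter through the ball embedding;
    [sm_eq] permits rewriting on [A]. *)
Inductive sm A : ('M[R]_(p, q) -> R) -> Prop :=
| sm_cst c : sm A (fun=> c)
| sm_coord i j : sm A (fun x => x i j)
| sm_add f g : sm A f -> sm A g -> sm A (fun x => f x + g x)
| sm_mul f g : sm A f -> sm A g -> sm A (fun x => f x * g x)
| sm_inv f : (forall x, A x -> f x != 0) -> sm A f -> sm A (fun x => (f x)^-1)
| sm_sqrt f : (forall x, A x -> 0 < f x) -> sm A f -> sm A (fun x => Num.sqrt (f x))
| sm_eq f g : (forall x, A x -> f x = g x) -> sm A f -> sm A g.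

Lemma sm_opp A f : sm A f -> sm A (fun x => - f x).
Proof. by move=> h; apply: sm_eq (sm_mul (sm_cst A (-1)) h) => x _; rewrite mulN1r. Qed.

Lemma sm_sub A f g : sm A f -> sm A g -> sm A (fun x => f x - g x).
Proof. by move=> hf /sm_opp; exact: sm_add. Qed.

Lemma sm_sum A (I : Type) (r : seq I) (F : I -> 'M[R]_(p, q) -> R) :
  (forall i, sm A (F i)) -> sm A (fun x => \sum_(i <- r) F i x).
Proof.
move=> h; elim: r => [|i r ih].
  by apply: sm_eq (sm_cst A 0) => x _; rewrite big_nil.
by apply: sm_eq (sm_add (h i) ih) => x _; rewrite big_cons.
Qed.

Lemma sm_subset A B f : A `<=` B -> sm B f -> sm A f.
Proof.
move=> AB; elim=> {f} [c|i j|f g _ hf _ hg|f g _ hf _ hg|f f0 _ hf|f f0 _ hf|f g fg _ hf].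
- exact: sm_cst.
- exact: sm_coord.
- exact: sm_add.
- exact: sm_mul.
- by apply: sm_inv => // x /AB/f0.
- by apply: sm_sqrt => // x /AB/f0.
- by apply: sm_eq hf => x /AB/fg.
Qed.

Lemma C1_sqrt : C1 [set y : R | 0 < y] Num.sqrt (fun y v => v * (2 * Num.sqrt y)^-1).
Proof.
move=> y /= y0; split.
  have h := is_derive1_sqrt y0. have [h1 h2] := h. split; first exact/derivable1_diffP.
  rewrite deriv1E//; apply/funext => v; rewrite derive1E h2; by [].
move=> v; apply: (@continuousM _ _ (fun=> v) (fun y => (2 * Num.sqrt y)^-1)); first exact: cont_cst.
apply: (@continuousV _ _ (fun y => 2 * Num.sqrt y)).
  by rewrite mulf_neq0// gt_eqF// sqrtr_gt0.
apply: (@continuousM _ _ (fun=> 2) Num.sqrt); first exact: cont_cst.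
exact: sqrt_continuous.
Qed.

Lemma sm_C1 A f : open A -> sm A f -> exists2 df, C1 A f df & forall v, sm A (df^~ v).
Proof.
move=> oA; elim=> {f} [c|i j|f g sf [df hf h1] sg [dg hg h2]|f g sf [df hf h1] sg [dg hg h2]
  |f f0 sf [df hf h1]|f f0 sf [df hf h1]|f g fg sf [df hf h1]].
- by exists (fun _ _ => 0); [exact: C1_cst|move=> v; exact: sm_cst].
- by exists (fun _ (v : 'M[R]_(p, q)) => v i j); [exact: C1_coord|move=> v; exact: sm_cst].
- by exists (fun x v => df x v + dg x v); [exact: C1_add|move=> v; exact: sm_add].
- exists (fun x v => df x v * g x + f x * dg x v); first exact: C1_mul. by move=> v; apply: sm_add; exact: sm_mul.
- exists (fun x v => - (f x) ^- 2 * df x v); first exact: C1_inv. move=> v; apply: sm_mul => //; apply: sm_opp.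
  apply: (@sm_eq _ (fun x => (f x * f x)^-1)) => [x _|]; first by rewrite expr2.
  by apply: sm_inv; [move=> x Ax; rewrite mulf_neq0 ?f0|exact: sm_mul].
- exists (fun x v => df x v *: (1 * (2 * Num.sqrt (f x))^-1)).
    by have := C1_comp1 (@open_gt _ 0) hf C1_sqrt f0.
  move=> v; apply: sm_mul => //; apply: sm_mul; first exact: sm_cst.
  apply: sm_inv; last by apply: sm_mul; [exact: sm_cst|exact: sm_sqrt].
  by move=> x Ax; rewrite mulf_neq0// gt_eqF// sqrtr_gt0 f0.
- exists df => //; exact: eq_C1 hf.
Qed.

Lemma sm_cont A f x : open A -> sm A f -> A x -> {for x, continuous f}.
Proof. by move=> oA /(sm_C1 oA)[df h _] Ax; exact: C1_cont h Ax. Qed.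

Lemma sm_Ck r s k A (F : 'M[R]_(p, q) -> 'M[R]_(r, s)) : open A -> (forall i j, sm A (fun x => F x i j)) -> Ck k A F.
Proof.
move=> oA; elim: k F => [|k ih] F hF; split => //.
- by move=> x; rewrite inE => Ax; apply: cont_mx => i j; exact: sm_cont (hF i j) Ax.
- by move=> x; rewrite inE => Ax; apply: cont_mx => i j; exact: sm_cont (hF i j) Ax.
move=> v.
have dF x : A x -> derivable F x v.
  move=> Ax; apply/derivable_mxP => i j; have [df h _] := sm_C1 oA (hF i j). by have [] := C1_derive v h Ax.
split=> //; apply: ih => i j; have [df h h'] := sm_C1 oA (hF i j).
apply: sm_eq (h' v) => x Ax; rewrite derive_mx ?mxE; last exact: dF.
by have [_ <-] := C1_derive v h Ax.
Qed.

Lemma Ck_cont (U W : normedModType R) k (A : set U) (F : U -> W) : Ck k A F -> {in A, continuous F}.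
Proof. by case: k => [|k] []. Qed.

Lemma Ck_C1 r s k A (F : 'M[R]_(p, q) -> 'M[R]_(r, s)) : open A -> Ck k.+1 A F -> C1 A F (fun x v => 'D_v F x).
Proof.
move=> oA [cF dF]; apply: C1_mx => i j.
have E x v : A x -> 'D_v (fun y => F y i j) x = 'D_v F x i j.
  by move=> Ax; have [/(_ x Ax) h _] := dF v; rewrite derive_mx// mxE.
apply: C1_partials => // x v Ax.
  have [/(_ x Ax)/derivable_mxP/(_ i j) h _] := dF v. by split=> //; exact: E.
by apply: cont_entry; have [_ /Ck_cont h] := dF v; apply: h; rewrite inE.
Qed.

Lemma Ck_deriv r s k A (F : 'M[R]_(p, q) -> 'M[R]_(r, s)) v : Ck k.+1 A F -> Ck k A ('D_v F).
Proof. by move=> [_ /(_ v)[]]. Qed.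

End SmoothFunctions.

(** * Homogeneous coordinates and affine charts *)

Section Charts.
Context {R : realType} (n : nat).
Local Notation V := 'M[R]_(n.+1, 2).
Local Notation E := 'M[R]_(n, 2).
Implicit Types (Z u v : V) (w : E) (j : 'I_n.+1) (L : CP R n).

(** Multiplication by the complex number [a + i b]. *)
Definition cs m (a b : R) (u : 'M[R]_(m, 2)) : 'M[R]_(m, 2) := a *: u + b *: Jm u.

Lemma addmxE m (u v : 'M[R]_(m, 2)) i b : (u + v) i b = u i b + v i b.
Proof. by rewrite mxE. Qed.
Lemma oppmxE m (u : 'M[R]_(m, 2)) i b : (- u) i b = - u i b.
Proof. by rewrite mxE. Qed.

Lemma cs0E m a b (u : 'M[R]_(m, 2)) k : cs a b u k ord0 = a * u k ord0 - b * u k ord_max.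
Proof. by rewrite !mxE/= mulrN. Qed.
Lemma cs1E m a b (u : 'M[R]_(m, 2)) k : cs a b u k ord_max = a * u k ord_max + b * u k ord0.
Proof. by rewrite !mxE/=. Qed.

Lemma cs_cs m a b c d (u : 'M[R]_(m, 2)) : cs a b (cs c d u) = cs (a * c - b * d) (a * d + b * c) u.
Proof. by apply: mx2P => k; rewrite !(cs0E, cs1E); split; ring. Qed.

Lemma cs1 m (u : 'M[R]_(m, 2)) : cs 1 0 u = u.
Proof. by apply: mx2P => k; rewrite !(cs0E, cs1E); split; ring. Qed.

Lemma cs_linear m a b : linear (@cs m a b).
Proof. by move=> c u v; apply: mx2P => k; rewrite !(cs0E, cs1E, mxE)/=; split; ring. Qed.

Lemma csJ m a b (u : 'M[R]_(m, 2)) : cs a b (Jm u) = Jm (cs a b u).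
Proof. by apply: mx2P => k; rewrite !(cs0E, cs1E, mxE)/=; split; ring. Qed.

Definition hN (u : V) j : R := u j ord0 ^+ 2 + u j ord_max ^+ 2.

Lemma hN_eq0 (u : V) j : (hN u j == 0) = (u j ord0 == 0) && (u j ord_max == 0).
Proof. by rewrite paddr_eq0 ?sqr_ge0// !sqrf_eq0. Qed.

Lemma abs_gt0 (a b : R) : (a != 0) || (b != 0) -> 0 < a ^+ 2 + b ^+ 2.
Proof.
rewrite -negb_and -(sqrf_eq0 a) -(sqrf_eq0 b) -paddr_eq0 ?sqr_ge0// => h.
by rewrite lt_neqAle eq_sym h addr_ge0// sqr_ge0.
Qed.

Lemma hN_gt0 u j : hN u j != 0 -> 0 < hN u j.
Proof. by rewrite hN_eq0 negb_and; exact: abs_gt0. Qed.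

Lemma hN_cs a b u j : hN (cs a b u) j = (a ^+ 2 + b ^+ 2) * hN u j.
Proof. by rewrite /hN cs0E cs1E; ring. Qed.

Lemma ip_cs m a b (u v : 'M[R]_(m, 2)) : ip (cs a b u) (cs a b v) = (a ^+ 2 + b ^+ 2) * ip u v.
Proof. by rewrite /ip mulr_sumr; apply: eq_bigr => k _; rewrite !(cs0E, cs1E); ring. Qed.

Lemma ip_J_cs m a b (u v : 'M[R]_(m, 2)) : ip (Jm (cs a b u)) (cs a b v) = (a ^+ 2 + b ^+ 2) * ip (Jm u) v.
Proof. by rewrite -csJ ip_cs. Qed.

Lemma Omega_cs m (Z u v : 'M[R]_(m, 2)) a b : a ^+ 2 + b ^+ 2 != 0 -> Z != 0 ->
  Omega (cs a b Z) (cs a b u) (cs a b v) = Omega Z u v.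
Proof.
move=> ab /ip_gt0/lt0r_neq0 z0; rewrite /Omega !ip_J_cs !ip_cs; field.
by rewrite ab z0.
Qed.

Lemma Omega_cs_dir m (Z u v : 'M[R]_(m, 2)) a b : Z != 0 -> Omega Z (u + cs a b Z) v = Omega Z u v.
Proof.
move=> Z0; have [_ l] := Omega_lin Z.
by rewrite (linD _ _ (l v)) (linD _ _ (l v)) !(linZ _ _ (l v)) Omega_Z// Omega_JZ// !mulr0 !addr0.
Qed.

(* [Z |-> (Z_k / Z_j)_(k != j)] in real coordinates. *)
Definition cj j Z : E := \matrix_(k, b)
  if b == ord0 then (Z (lift j k) ord0 * Z j ord0 + Z (lift j k) ord_max * Z j ord_max) / hN Z j
  else (Z (lift j k) ord_max * Z j ord0 - Z (lift j k) ord0 * Z j ord_max) / hN Z j.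

Lemma cj0E j Z k : cj j Z k ord0 = (Z (lift j k) ord0 * Z j ord0 + Z (lift j k) ord_max * Z j ord_max) / hN Z j.
Proof. by rewrite mxE. Qed.
Lemma cj1E j Z k : cj j Z k ord_max = (Z (lift j k) ord_max * Z j ord0 - Z (lift j k) ord0 * Z j ord_max) / hN Z j.
Proof. by rewrite mxE. Qed.

Definition ins j (w : E) : V := \matrix_(i, b) if unlift j i is Some k then w k b else 0.
Definition ej j : V := ex j.
Definition aff j (w : E) : V := \matrix_(i, b) if unlift j i is Some k then w k b else (b == ord0)%:R.
Definition del j (u : V) : E := \matrix_(k, b) u (lift j k) b.

Lemma delE j u k b : del j u k b = u (lift j k) b. Proof. by rewrite mxE. Qed.
Lemma ins_lift j w k b : ins j w (lift j k) b = w k b.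
Proof. by rewrite mxE liftK. Qed.
Lemma ins_j j w b : ins j w j b = 0.
Proof. by rewrite mxE unlift_none. Qed.
Lemma ej_lift j k b : ej j (lift j k) b = 0.
Proof. by rewrite mxE eq_sym (negbTE (neq_lift _ _)). Qed.
Lemma ej_j0 j : ej j j ord0 = 1. Proof. by rewrite mxE !eqxx. Qed.
Lemma ej_j1 j : ej j j ord_max = 0. Proof. by rewrite mxE eqxx. Qed.
Lemma aff_lift j w k b : aff j w (lift j k) b = w k b.
Proof. by rewrite mxE liftK. Qed.
Lemma aff_j0 j w : aff j w j ord0 = 1. Proof. by rewrite mxE unlift_none. Qed.
Lemma aff_j1 j w : aff j w j ord_max = 0. Proof. by rewrite mxE unlift_none. Qed.

Lemma mx2liftP j u v : u j ord0 = v j ord0 -> u j ord_max = v j ord_max ->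
  (forall k, u (lift j k) ord0 = v (lift j k) ord0 /\ u (lift j k) ord_max = v (lift j k) ord_max) -> u = v.
Proof. by move=> h0 h1 h; apply: mx2P => i; case: (unliftP j i) => [k ->|->]. Qed.

Lemma hN_aff j w : hN (aff j w) j = 1.
Proof. by rewrite /hN aff_j0 aff_j1; ring. Qed.

Lemma cj_aff j w : cj j (aff j w) = w.
Proof. by apply: mx2P => k; rewrite cj0E cj1E hN_aff !aff_lift aff_j0 aff_j1; split; field. Qed.

Lemma cs_aff_cj j Z : hN Z j != 0 -> cs (Z j ord0) (Z j ord_max) (aff j (cj j Z)) = Z.
Proof.
move=> h; apply: (@mx2liftP j) => [||k]; rewrite !(cs0E, cs1E) ?aff_j0 ?aff_j1 ?aff_lift ?cj0E ?cj1E; [ring|ring|].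
by move: h; rewrite /hN => h; split; field.
Qed.

Lemma cj_cs j Z a b : a ^+ 2 + b ^+ 2 != 0 -> hN Z j != 0 -> cj j (cs a b Z) = cj j Z.
Proof.
move=> ab h; apply: mx2P => k; rewrite !(cj0E, cj1E) hN_cs !(cs0E, cs1E).
by split; field; rewrite ab h.
Qed.

Lemma hN_neq0_Z Z j : hN Z j != 0 -> Z != 0.
Proof. by apply: contraNneq => ->; rewrite /hN !mxE expr0n addr0. Qed.

Lemma aff_neq0 j w : aff j w != 0.
Proof. by apply: (@hN_neq0_Z _ j); rewrite hN_aff oner_neq0. Qed.

Definition cinv (u : V) j : R * R := (u j ord0 / hN u j, - u j ord_max / hN u j).

(* Derivative of [cj j]: remove the component along [Z] and rescale. *)
Definition dcj j Z u : E := del j (cs (cinv Z j).1 (cinv Z j).2 (u - cs (u j ord0) (u j ord_max) (aff j (cj j Z)))).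

Lemma dcjE j Z u k : hN Z j != 0 -> dcj j Z u k ord0 = ((u (lift j k) ord0 * Z j ord0 + Z (lift j k) ord0 * u j ord0 +
      (u (lift j k) ord_max * Z j ord_max + Z (lift j k) ord_max * u j ord_max)) * (hN Z j)^-1
    + (Z (lift j k) ord0 * Z j ord0 + Z (lift j k) ord_max * Z j ord_max) *
      (- (hN Z j) ^- 2 * (u j ord0 * Z j ord0 + Z j ord0 * u j ord0 + (u j ord_max * Z j ord_max + Z j ord_max * u j ord_max)))) /\
  dcj j Z u k ord_max = ((u (lift j k) ord_max * Z j ord0 + Z (lift j k) ord_max * u j ord0 -
      (u (lift j k) ord0 * Z j ord_max + Z (lift j k) ord0 * u j ord_max)) * (hN Z j)^-1
    + (Z (lift j k) ord_max * Z j ord0 - Z (lift j k) ord0 * Z j ord_max) *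
      (- (hN Z j) ^- 2 * (u j ord0 * Z j ord0 + Z j ord0 * u j ord0 + (u j ord_max * Z j ord_max + Z j ord_max * u j ord_max)))).
Proof.
move=> h; rewrite /dcj !delE !(cs0E, cs1E, addmxE, oppmxE) !aff_lift cj0E cj1E /cinv/=.
by move: h; rewrite /hN => h; split; field.
Qed.

Lemma C1_hN A j : C1 A (fun Z => hN Z j) (fun Z u => u j ord0 * Z j ord0 + Z j ord0 * u j ord0
   + (u j ord_max * Z j ord_max + Z j ord_max * u j ord_max)).
Proof. by rewrite /hN; under eq_fun do rewrite !expr2; apply: C1_add; apply: C1_mul; exact: C1_coord. Qed.

Lemma C1_cj j : C1 [set Z | hN Z j != 0] (cj j) (dcj j).
Proof.
apply: C1_mx => k b.
have hi := C1_inv (fun x (Ax : [set Z | hN Z j != 0] x) => Ax) (@C1_hN _ j).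
have oA : open [set Z | hN Z j != 0].
  have c : continuous (fun Z => hN Z j) by move=> Z; exact: C1_cont (@C1_hN setT j) I.
  have : open (~` [set (0 : R)]) by rewrite openC; exact: closed_eq.
  by move=> /(open_comp (fun Z _ => c Z)); congr open; apply/seteqP; split=> Z /=; [move=> /eqP|move/eqP].
have cc i c := @C1_coord R n.+1 2 [set Z | hN Z j != 0] i c.
case: (ord2P b) => ->.
  apply: (eq_C1 oA _ _ (C1_mul (C1_sub (C1_mul (cc (lift j k) ord_max) (cc j ord0))
     (C1_mul (cc (lift j k) ord0) (cc j ord_max))) hi)) => [Z _|Z u AZ]; first by rewrite cj1E.
  by have [_ ->] := dcjE u k AZ.
apply: (eq_C1 oA _ _ (C1_mul (C1_add (C1_mul (cc (lift j k) ord0) (cc j ord0))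
     (C1_mul (cc (lift j k) ord_max) (cc j ord_max))) hi)) => [Z _|Z u AZ]; first by rewrite cj0E.
by have [-> _] := dcjE u k AZ.
Qed.

Lemma ip_lift j u v : ip u v = u j ord0 * v j ord0 + u j ord_max * v j ord_max + ip (del j u) (del j v).
Proof.
rewrite /ip (bigD1_ord j)//=; congr (_ + _); apply: eq_bigr => k _.
by rewrite !mxE.
Qed.

Lemma del_J j u : del j (Jm u) = Jm (del j u).
Proof. by apply: mx2P => k; rewrite !mxE/= ?mxE. Qed.

Lemma del_aff j w : del j (aff j w) = w.
Proof. by apply/matrixP => k b; rewrite mxE aff_lift. Qed.
Lemma del_ins j w : del j (ins j w) = w.
Proof. by apply/matrixP => k b; rewrite mxE ins_lift. Qed.

Lemma herm_ip m (u v : 'M[R]_(m, 2)) : herm (cvec u) (cvec v) = (ip u v +i* ip (Jm u) v)%C.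
Proof.
rewrite /herm; apply/eqP; rewrite eq_complex /=.
have reD (I : finType) (F : I -> R[i]) : complex.Re (\sum_i F i) = \sum_i complex.Re (F i).
  by elim/big_rec2: _ => // i x y _ <-; case: (F i); case: y.
have imD (I : finType) (F : I -> R[i]) : complex.Im (\sum_i F i) = \sum_i complex.Im (F i).
  by elim/big_rec2: _ => // i x y _ <-; case: (F i); case: y.
rewrite reD imD; apply/andP; split; apply/eqP; apply: eq_bigr => k _; by rewrite !mxE/= /xcoord /ycoord; ring.
Qed.

Lemma omega_FSE m (w u v : 'M[R]_(m, 2)) : omega_FS w u v = ip (Jm u) v / (1 + sq w)
  - (ip u w * ip (Jm w) v + ip (Jm u) w * ip w v) / (1 + sq w) ^+ 2.
Proof.
have d0 : 1 + sq w != 0 by rewrite gt_eqF// ltr_wpDr// ip_ge0.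
rewrite /omega_FS !herm_ip ip_Jself.
have -> : (1 + (sq w +i* 0) = (1 + sq w)%:C)%C by apply/eqP; rewrite eq_complex /= addr0 !eqxx.
have -> : ((1 + sq w)%:C ^+ 2 = ((1 + sq w) ^+ 2)%:C)%C by rewrite rmorphXn.
have q (a b c : R) : ((a +i* b) / c%:C = (a / c) +i* (b / c))%C.
  by rewrite -fmorphV; apply/eqP; rewrite eq_complex /= !mulr0 subr0 add0r !eqxx.
have pm (a b c d : R) : ((a +i* b) * (c +i* d) = (a * c - b * d) +i* (a * d + b * c))%C by [].
by rewrite pm !q.
Qed.

Lemma FS_Omega_aff j w (u v : E) : omega_FS w u v = Omega (aff j w) (ins j u) (ins j v).
Proof.
rewrite omega_FSE /Omega !(ip_lift j) !del_J !del_aff !del_ins !Jm0 !Jm1 !ins_j aff_j0 aff_j1 ?oppr0.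
rewrite !mul0r !mulr0 !mul1r !addr0 !add0r.
by [].
Qed.

Lemma ins_dcj j Z u : hN Z j != 0 ->
  ins j (dcj j Z u) = cs (cinv Z j).1 (cinv Z j).2 u + cs (- ((cinv Z j).1 * u j ord0 - (cinv Z j).2 * u j ord_max))
   (- ((cinv Z j).1 * u j ord_max + (cinv Z j).2 * u j ord0)) (aff j (cj j Z)).
Proof.
move=> h; apply: (@mx2liftP j) => [||k]; rewrite ?ins_j ?ins_lift.
- by rewrite mxE !cs0E aff_j0 aff_j1; ring.
- by rewrite mxE !cs1E aff_j0 aff_j1; ring.
- rewrite /dcj !delE !(cs0E, cs1E, addmxE, oppmxE). by split; ring.
Qed.

(** By [ins_dcj] the chart derivative of [u], put back into homogeneous coordinates, is a complex
    multiple of [u] plus a multiple of the base vector. [Omega] ignores the latter and is invariant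
    under simultaneous scaling. *)
Lemma FS_chart j Z u v : hN Z j != 0 -> omega_FS (cj j Z) (dcj j Z u) (dcj j Z v) = Omega Z u v.
Proof.
move=> h; have h' := lt0r_neq0 (hN_gt0 h).
rewrite (FS_Omega_aff j) !ins_dcj// Omega_cs_dir ?aff_neq0//.
rewrite Omega_anti Omega_cs_dir ?aff_neq0// -Omega_anti.
have ab : (cinv Z j).1 ^+ 2 + (cinv Z j).2 ^+ 2 != 0.
  rewrite (_ : _ + _ = (hN Z j)^-1) ?invr_neq0//. by rewrite /cinv/= /hN; move: h; rewrite /hN => ?; field.
have -> : aff j (cj j Z) = cs (cinv Z j).1 (cinv Z j).2 Z.
  have -> : cs (cinv Z j).1 (cinv Z j).2 Z =
    cs (cinv Z j).1 (cinv Z j).2 (cs (Z j ord0) (Z j ord_max) (aff j (cj j Z))) by rewrite cs_aff_cj.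
  rewrite cs_cs. have -> : (cinv Z j).1 * Z j ord0 - (cinv Z j).2 * Z j ord_max = 1.
    by rewrite /cinv/=; move: h; rewrite /hN => ?; field.
  have -> : (cinv Z j).1 * Z j ord_max + (cinv Z j).2 * Z j ord0 = 0.
    by rewrite /cinv/=; move: h; rewrite /hN => ?; field.
  by rewrite cs1.
by rewrite Omega_cs// (@hN_neq0_Z _ j).
Qed.

Lemma hcoords_neq0 L : hcoords L != 0.
Proof. by rewrite vpick0 -dimv_eq0 (eqP (proj2_sig L)). Qed.

Lemma vline_hcoords L : sval L = <[hcoords L]>%VS.
Proof.
apply/esym/eqP; rewrite eqEdim -memvE memv_pick/= dim_vline hcoords_neq0.
by rewrite (eqP (proj2_sig L)).
Qed.

Definition hZ L : V := rmat (hcoords L).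

Lemma rmatK m (w : 'rV[R[i]]_m) : cvec (rmat w) = w.
Proof.
by apply/rowP => k; rewrite !mxE /xcoord /ycoord !mxE/=; case: (w 0 k).
Qed.

Lemma cvecK m (u : 'M[R]_(m, 2)) : rmat (cvec u) = u.
Proof. by apply: mx2P => k; rewrite !mxE/= /xcoord /ycoord. Qed.

Lemma rmatZ m (c : R[i]) (w : 'rV[R[i]]_m) : rmat (c *: w) = cs (complex.Re c) (complex.Im c) (rmat w).
Proof.
by apply: mx2P => k; rewrite cs0E cs1E !mxE/=; case: c; case: (w 0 k) => *; split=> //=; ring.
Qed.

Lemma rmat0 m : rmat (0 : 'rV[R[i]]_m) = 0.
Proof. by apply: mx2P => k; rewrite !mxE. Qed.

Lemma hZ_neq0 L : hZ L != 0.
Proof.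
apply: contra (hcoords_neq0 L) => /eqP h; rewrite -(rmatK (hcoords L)) -/(hZ L) h.
by apply/eqP/rowP => k; rewrite !mxE /xcoord /ycoord !mxE.
Qed.

Lemma chart_domP j L : chart_dom j L <-> hN (hZ L) j != 0.
Proof.
rewrite /chart_dom /= hN_eq0 !mxE/=; split; first by apply: contra; rewrite eq_complex/=.
by apply: contra; rewrite eq_complex/=.
Qed.

Lemma chartE j L : hN (hZ L) j != 0 -> chart j L = cj j (hZ L).
Proof.
move=> h; apply: mx2P => k; rewrite cj0E cj1E /hN !mxE/=.
move: h; rewrite /hN !mxE/=; case: (hcoords L 0 j) => a b; case: (hcoords L 0 (lift j k)) => c d /= h.
by split; field.
Qed.

(** The point of projective space below [Z]; the default value of [insubd] is reached only for
    [Z = 0]. *)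
Definition cpt Z : CP R n := insubd (ball_embed 0 : {U : {vspace 'rV[R[i]]_n.+1} | \dim U == 1%N}) <[cvec Z]>%VS.

Lemma cvec_neq0 m (u : 'M[R]_(m, 2)) : u != 0 -> cvec u != 0.
Proof. by apply: contra => /eqP h; rewrite -(cvecK u) h rmat0. Qed.

Lemma cptE Z : Z != 0 -> sval (cpt Z) = <[cvec Z]>%VS.
Proof.
by move=> Z0; have := val_insubd (ball_embed 0 : {U : {vspace 'rV[R[i]]_n.+1} | \dim U == 1%N}) <[cvec Z]>%VS;
  rewrite dim_vline (cvec_neq0 Z0).
Qed.

Lemma CP_eq L L' : sval L = sval L' -> L = L'.
Proof. by move=> h; exact: val_inj. Qed.

Lemma cpt_hZ L : cpt (hZ L) = L.
Proof. by apply: CP_eq; rewrite cptE ?hZ_neq0// rmatK -vline_hcoords. Qed.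

Lemma hZ_cpt Z : Z != 0 -> exists a b, a ^+ 2 + b ^+ 2 != 0 /\ hZ (cpt Z) = cs a b Z.
Proof.
move=> Z0; have : hcoords (cpt Z) \in <[cvec Z]>%VS by rewrite -(cptE Z0); exact: memv_pick.
move=> /vlineP[c hc]; exists (complex.Re c), (complex.Im c).
have E : hZ (cpt Z) = cs (complex.Re c) (complex.Im c) Z by rewrite /hZ hc rmatZ cvecK.
split=> //; apply: contra (hZ_neq0 (cpt Z)); rewrite paddr_eq0 ?sqr_ge0// !sqrf_eq0.
by rewrite E => /andP[/eqP-> /eqP->]; rewrite /cs !scale0r addr0.
Qed.

Lemma cs_neq0 Z a b : a ^+ 2 + b ^+ 2 != 0 -> Z != 0 -> cs a b Z != 0.
Proof.
move=> ab /ip_gt0/lt0r_neq0 h; apply/eqP => h'.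
have : sq (cs a b Z) = 0 by rewrite h' (lin0 (ip_linr 0)).
by rewrite ip_cs => /eqP; rewrite mulf_eq0 (negbTE ab) (negbTE h).
Qed.

Lemma cpt_cs Z a b : a ^+ 2 + b ^+ 2 != 0 -> Z != 0 -> cpt (cs a b Z) = cpt Z.
Proof.
move=> ab Z0; have csZ := cs_neq0 ab Z0.
apply: CP_eq; rewrite !cptE//; apply/eqP; rewrite eqEdim !dim_vline !cvec_neq0// leqnn andbT -memvE.
apply/vlineP; exists (a +i* b)%C; apply/rowP => k; rewrite !mxE /xcoord /ycoord cs0E cs1E.
by apply/eqP; rewrite eq_complex /= !eqxx.
Qed.

Lemma cpt_inj Z Z' : Z != 0 -> Z' != 0 -> cpt Z = cpt Z' -> exists a b, a ^+ 2 + b ^+ 2 != 0 /\ Z' = cs a b Z.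
Proof.
move=> Z0 Z'0 h.
have [a [b [ab E]]] := hZ_cpt Z0; have [c [d [cd E']]] := hZ_cpt Z'0.
rewrite h E' in E.
exists ((a * c + b * d) / (c ^+ 2 + d ^+ 2)), ((b * c - a * d) / (c ^+ 2 + d ^+ 2)).
have E2 : Z' = cs (c / (c ^+ 2 + d ^+ 2)) (- d / (c ^+ 2 + d ^+ 2)) (cs c d Z').
  rewrite cs_cs -{1}(cs1 Z'); congr cs; by field.
split; last by rewrite E2 E cs_cs; congr cs; field.
rewrite (_ : _ + _ = (a ^+ 2 + b ^+ 2) / (c ^+ 2 + d ^+ 2)); last by field.
by rewrite mulf_neq0// invr_neq0.
Qed.

Lemma chart_cpt j Z : hN Z j != 0 -> chart_dom j (cpt Z) /\ chart j (cpt Z) = cj j Z.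
Proof.
move=> h; have Z0 := hN_neq0_Z h; have [a [b [ab E]]] := hZ_cpt Z0.
have h' : hN (hZ (cpt Z)) j != 0 by rewrite E hN_cs mulf_neq0.
by split; [apply/chart_domP|rewrite chartE// E cj_cs].
Qed.

Lemma chart_dom_cpt j Z : Z != 0 -> chart_dom j (cpt Z) -> hN Z j != 0.
Proof.
move=> Z0 /chart_domP; have [a [b [ab ->]]] := hZ_cpt Z0.
by rewrite hN_cs mulf_eq0 negb_or => /andP[].
Qed.

Lemma cpt_aff j L : chart_dom j L -> cpt (aff j (chart j L)) = L.
Proof.
move=> /chart_domP h; rewrite chartE// -[RHS]cpt_hZ -[in RHS](cs_aff_cj h) cpt_cs ?aff_neq0//.
Qed.

Lemma exists_hN Z : Z != 0 -> exists j, hN Z j != 0.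
Proof.
move=> Z0; apply/existsP; apply: contraNT Z0; rewrite negb_exists => /forallP h.
apply/eqP/mx2P => k; rewrite !mxE; have := h k; rewrite negbK hN_eq0 => /andP[/eqP-> /eqP->].
by [].
Qed.

End Charts.

Notation del0 := (del ord0).

(** * The standard ball in projective space *)

Section Ball.
Context {R : realType} (n : nat).
Local Notation V := 'M[R]_(n.+1, 2).
Local Notation E := 'M[R]_(n, 2).

Lemma enorm_ip m (z : 'M[R]_(m, 2)) : enorm z = Num.sqrt (sq z).
Proof. by congr Num.sqrt; apply: eq_bigr => k _; rewrite /xcoord /ycoord !expr2. Qed.

Lemma enorm_sqr m (z : 'M[R]_(m, 2)) : enorm z ^+ 2 = sq z.
Proof. by rewrite enorm_ip sqr_sqrtr// ip_ge0. Qed.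

Lemma enorm_ge0 m (z : 'M[R]_(m, 2)) : 0 <= enorm z.
Proof. exact: sqrtr_ge0. Qed.

Lemma enorm_lt m (z : 'M[R]_(m, 2)) c : 0 <= c -> (enorm z < c) = (sq z < c ^+ 2).
Proof. by move=> c0; rewrite -enorm_sqr ltr_pXn2r// ?nnegrE ?enorm_ge0. Qed.

Lemma enorm_le m (z : 'M[R]_(m, 2)) c : 0 <= c -> (enorm z <= c) = (sq z <= c ^+ 2).
Proof. by move=> c0; rewrite -enorm_sqr ler_pXn2r// ?nnegrE ?enorm_ge0. Qed.

Lemma enormZ m a (z : 'M[R]_(m, 2)) : enorm (a *: z) = `|a| * enorm z.
Proof.
rewrite !enorm_ip ipZl ipZr mulrA -expr2.
by rewrite sqrtrM ?sqr_ge0// sqrtr_sqr.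
Qed.

Lemma C1_ip m (U : normedModType R) (A : set U) (f g : U -> 'M[R]_(m, 2)) df dg : C1 A f df -> C1 A g dg ->
  C1 A (fun x => ip (f x) (g x)) (fun x v => ip (df x v) (g x) + ip (f x) (dg x v)).
Proof.
move=> hf hg.
apply: (C1_ext (C1_sum (index_enum _) xpredT (fun k => C1_add
  (C1_mul (C1_entry k ord0 hf) (C1_entry k ord0 hg)) (C1_mul (C1_entry k ord_max hf) (C1_entry k ord_max hg))))) => // x v.
by rewrite /ip -big_split; apply: eq_bigr => k _ /=; ring.
Qed.

Lemma C1_id (U : normedModType R) (A : set U) : C1 A (fun x : U => x) (fun _ v => v).
Proof. by apply: (@C1_lin _ _ _ A id) => //; exact: cont_id. Qed.

Lemma ip_cont m : continuous (fun z : 'M[R]_(m, 2) => sq z).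
Proof. by move=> z; exact: C1_cont (C1_ip (@C1_id _ setT) (@C1_id _ setT)) I. Qed.

Lemma open_shell m (a b : R) : open [set x : 'M[R]_(m, 2) | a < sq x < b].
Proof.
rewrite (_ : [set x | _] = (fun x => sq x) @^-1` [set` `]a, b[]); last by apply/seteqP; split=> x /=; rewrite in_itv.
by apply: open_comp => [x _|]; [exact: ip_cont|exact: interval_open].
Qed.

Lemma enorm_cont m : continuous (@enorm R m).
Proof.
move=> z; rewrite (_ : enorm = fun z => Num.sqrt (sq z)); last by apply/funext => y; exact: enorm_ip.
by apply: (@cont_comp _ _ _ (fun z => sq z) Num.sqrt); [exact: ip_cont|exact: sqrt_continuous].
Qed.

Lemma closure_eball m (r : R) : 0 < r -> closure (@eball R m r) = [set z | enorm z <= r].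
Proof.
move=> r0; apply/seteqP; split=> z.
  have cl : closed [set z : 'M[R]_(m, 2) | enorm z <= r].
    apply: (@preimage_closed _ _ (@enorm R m) [set y | y <= r]); first by move=> ? _; exact: enorm_cont.
    exact: closed_le.
  by move=> /(closure_subset (fun y (h : eball r y) => ltW h)); rewrite -(closure_id _).1.
rewrite /= => zr B zB.
(* Points of norm [r] are approached from inside by [t *: z] with [t] tending to 1 from below. *)
have ct : {for (1 : R), continuous (fun t : R => t *: z)}.
  by apply: (@continuousZ _ _ _ id (fun=> z)); [exact: cont_id|exact: cont_cst].
have h1 : \forall t \near (1 : R)^'-, B (t *: z).
  have nB : \forall t \near (1 : R), B (t *: z) by apply: (ct B); rewrite scale1r.
  by move: nB; apply: filterS => t Bt _.
have h2 : \forall t \near (1 : R)^'-, 0 < t < 1.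
  by near=> t; apply/andP; split; near: t; [apply: nbhs_left_gt; exact: ltr01|exact: nbhs_left_lt].
have [t [Bt /andP[t0 t1]]] := filter_ex (filterI h1 h2).
exists (t *: z); split=> //; rewrite /eball /= enormZ ger0_norm ?ltW//.
have [->|z0] := eqVneq (enorm z) 0; first by rewrite mulr0.
rewrite (lt_le_trans _ zr)// gtr_pMl// lt_neqAle eq_sym z0; exact: enorm_ge0.
Unshelve. all: by end_near. Qed.

Lemma shellE m (r d : R) : 0 < r -> 0 < d < 1 -> @shell R m r d = [set z | (r * (1 - d)) ^+ 2 <= sq z <= r ^+ 2].
Proof.
move=> r0 /andP[d0 d1]; rewrite /shell closure_eball//.
have rd : 0 <= r * (1 - d) by apply: mulr_ge0; rewrite ?subr_ge0; exact: ltW.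
apply/seteqP; split=> z /=; rewrite /eball/= enorm_le ?(ltW r0)// enorm_lt//.
  by move=> [-> /negP]; rewrite -leNgt => ->.
by move=> /andP[h1 h2]; split=> //; apply/negP; rewrite -leNgt.
Qed.

Definition sec (z : E) : V := \matrix_(i, b)
  if unlift ord0 i is Some k then z k b else if b == ord0 then Num.sqrt (1 - sq z) else 0.

Lemma sec_lift z k b : sec z (lift ord0 k) b = z k b.
Proof. by rewrite mxE liftK. Qed.
Lemma sec_00 z : sec z ord0 ord0 = Num.sqrt (1 - sq z).
Proof. by rewrite mxE unlift_none. Qed.
Lemma sec_01 z : sec z ord0 ord_max = 0.
Proof. by rewrite mxE unlift_none. Qed.

Lemma ball_embedE z : ball_embed z = cpt (sec z).
Proof.
have E : row_mx (Num.sqrt (1 - enorm z ^+ 2))%:C%C%:M (cvec z) = cvec (sec z) :> 'rV[R[i]]_(1 + n).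
  apply/rowP => i; case: (splitP i) => [j ij|k ik].
    have -> : i = lshift n j by exact: val_inj. have l0 : lshift n (ord0 : 'I_1) = (ord0 : 'I_n.+1) by exact: val_inj.
    rewrite row_mxEl ord1 l0 !mxE. by rewrite /xcoord /ycoord sec_00 sec_01 enorm_sqr mulr1n.
  have -> : i = rshift 1 k by exact: val_inj. have l1 : rshift 1 k = (lift ord0 k : 'I_n.+1) by exact: val_inj.
  rewrite row_mxEr l1 !mxE. by rewrite /xcoord /ycoord !sec_lift.
have n0 : sec z != 0.
  apply/eqP => h; have := homog_neq0 z; rewrite E h. suff -> : cvec (0 : V) = 0 by rewrite eqxx.
  by apply/rowP => k; rewrite !mxE /xcoord /ycoord !mxE.
by apply: CP_eq; rewrite cptE//= E.
Qed.

Definition ball1 : set E := [set z | sq z < 1].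

Lemma ball1_open : open ball1.
Proof. by apply: (@open_comp _ _ (fun z : E => sq z) [set y | y < 1]) => [z _|]; [exact: ip_cont|exact: open_lt]. Qed.

Lemma ip_sec z : ball1 z -> sq (sec z) = 1.
Proof.
move=> z1; rewrite (ip_lift ord0) sec_00 sec_01 -expr2 sqr_sqrtr; last by rewrite subr_ge0 ltW.
have -> : del ord0 (sec z) = z by apply/matrixP => k b; rewrite delE sec_lift.
by rewrite mulr0 addr0 subrK.
Qed.

Lemma sec_neq0 z : ball1 z -> sec z != 0.
Proof.
by move=> /ip_sec; apply: contra_eqN => /eqP ->; rewrite (lin0 (ip_linr 0)) eq_sym oner_neq0.
Qed.

Lemma sm_ip p q m (A : set 'M[R]_(p, q)) (F G : 'M[R]_(p, q) -> 'M[R]_(m, 2)) :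
  (forall i j, sm A (fun x => F x i j)) -> (forall i j, sm A (fun x => G x i j)) -> sm A (fun x => ip (F x) (G x)).
Proof. by move=> hF hG; apply: sm_sum => k; apply: sm_add; exact: sm_mul. Qed.

Lemma sm_sec i b : sm ball1 (fun z => sec z i b).
Proof.
case: (unliftP ord0 i) => [k ->|->].
  by apply: (@sm_eq _ _ _ _ (fun z => z k b)) => [z _|]; [rewrite sec_lift|exact: sm_coord].
case: (ord2P b) => ->.
  by apply: (@sm_eq _ _ _ _ (fun=> 0)) => [z _|]; [rewrite sec_01|exact: sm_cst].
apply: (@sm_eq _ _ _ _ (fun z => Num.sqrt (1 - sq z))) => [z _|]; first by rewrite sec_00.
apply: sm_sqrt => [z z1|]; first by rewrite subr_gt0.
apply: sm_sub; first exact: sm_cst.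
by apply: sm_ip => *; exact: sm_coord.
Qed.

Lemma sm_cj p q (A : set 'M[R]_(p, q)) (F : 'M[R]_(p, q) -> V) j k b :
  (forall x, A x -> hN (F x) j != 0) -> (forall i b, sm A (fun x => F x i b)) -> sm A (fun x => cj j (F x) k b).
Proof.
move=> F0 hF.
have hi : sm A (fun x => (hN (F x) j)^-1).
  apply: sm_inv => //; rewrite /hN.
  by apply: (@sm_eq _ _ _ _ (fun x => F x j ord0 * F x j ord0 + F x j ord_max * F x j ord_max)) => [x _|];
    [rewrite !expr2|apply: sm_add; exact: sm_mul].
case: (ord2P b) => ->.
  apply: (@sm_eq _ _ _ _ _ _ (fun x _ => esym (cj1E j (F x) k))). by apply: sm_mul => //; apply: sm_sub; exact: sm_mul.
apply: (@sm_eq _ _ _ _ _ _ (fun x _ => esym (cj0E j (F x) k))).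
by apply: sm_mul => //; apply: sm_add; exact: sm_mul.
Qed.

(** The section has a real zeroth entry, is tautological in the other entries and takes values in
    the unit sphere. Differentiating these three facts gives all that [Omega_sec] needs to turn
    [Omega] into [omega_st]. *)
Lemma C1_sec : exists2 dsec, C1 ball1 sec dsec &
  forall z u, ball1 z -> [/\ dsec z u ord0 ord_max = 0, del ord0 (dsec z u) = u & ip (dsec z u) (sec z) = 0].
Proof.
have h i b := cid2 (sm_C1 ball1_open (@sm_sec i b)).
pose dsec (z : E) (u : E) : V := \matrix_(i, b) s2val (h i b) z u.
have hd : C1 ball1 sec dsec.
  apply: C1_mx => i b; have h' := s2valP (h i b). by apply: (C1_ext h') => // x v; rewrite mxE.
exists dsec => // z u z1; split.
- have c0 : C1 ball1 (fun z => sec z ord0 ord_max) (fun _ _ => 0).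
    by apply: (C1_ext (C1_cst ball1 (0 : R))) => // x; rewrite sec_01.
  exact: (C1_unique u (C1_entry ord0 ord_max hd) c0 z1).
- apply/matrixP => k b; rewrite delE. have ck : C1 ball1 (fun z => sec z (lift ord0 k) b) (fun _ v => v k b).
    by apply: (C1_ext (@C1_coord _ _ _ ball1 k b)) => // x; rewrite sec_lift.
  exact: (C1_unique u (C1_entry (lift ord0 k) b hd) ck z1).
- have e1 := C1_unique u (C1_ip hd hd) (eq_C1 ball1_open (fun x Ax => esym (ip_sec Ax)) (fun _ _ _ => erefl) (C1_cst ball1 (1 : R))) z1.
  have : ip (dsec z u) (sec z) + ip (dsec z u) (sec z) = 0 by rewrite -[RHS]e1 [X in _ + X]ipC.
  by move=> /eqP; rewrite -mulr2n mulrn_eq0/= => /eqP.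
Qed.

Lemma Omega_sec z (u v : E) dsec : C1 ball1 sec dsec ->
  (forall z u, ball1 z -> [/\ dsec z u ord0 ord_max = 0, del ord0 (dsec z u) = u &
    ip (dsec z u) (sec z) = 0]) -> ball1 z ->
  Omega (sec z) (dsec z u) (dsec z v) = omega_st u v.
Proof.
move=> hd h z1; have [a1 a2 a3] := h z u z1; have [b1 b2 b3] := h z v z1.
rewrite /Omega a3 mul0r add0r (ipC (sec z) (dsec z v)) b3 mulr0 mul0r subr0 ip_sec// divr1.
rewrite (ip_lift ord0) del_J a2 b2 Jm0 a1 b1 oppr0 mul0r mulr0 !add0r.
by rewrite omega_ip.
Qed.

(* Inverse of the ball embedding: [Z |-> Z' conj(Z_0) / (|Z_0| |Z|)]. *)
Definition g0 (Z : V) : E := \matrix_(k, b)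
  ((if b == ord0 then Z (lift ord0 k) ord0 * Z ord0 ord0 + Z (lift ord0 k) ord_max * Z ord0 ord_max
  else Z (lift ord0 k) ord_max * Z ord0 ord0 - Z (lift ord0 k) ord0 * Z ord0 ord_max)
  / (Num.sqrt (hN Z ord0) * Num.sqrt (sq Z))).

Lemma g00E Z k : g0 Z k ord0 = (Z (lift ord0 k) ord0 * Z ord0 ord0 + Z (lift ord0 k) ord_max * Z ord0 ord_max)
  / (Num.sqrt (hN Z ord0) * Num.sqrt (sq Z)).
Proof. by rewrite mxE. Qed.
Lemma g01E Z k : g0 Z k ord_max = (Z (lift ord0 k) ord_max * Z ord0 ord0 - Z (lift ord0 k) ord0 * Z ord0 ord_max)
  / (Num.sqrt (hN Z ord0) * Num.sqrt (sq Z)).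
Proof. by rewrite mxE. Qed.

Lemma g0_cs Z a b : a ^+ 2 + b ^+ 2 != 0 -> g0 (cs a b Z) = g0 Z.
Proof.
move=> ab; have ab0 : 0 <= a ^+ 2 + b ^+ 2 by rewrite addr_ge0 ?sqr_ge0.
have E : Num.sqrt (hN (cs a b Z) ord0) * Num.sqrt (sq (cs a b Z)) =
   (a ^+ 2 + b ^+ 2) * (Num.sqrt (hN Z ord0) * Num.sqrt (sq Z)).
  by rewrite hN_cs ip_cs !sqrtrM// mulrACA -expr2 sqr_sqrtr.
apply: mx2P => k; rewrite !g00E !g01E E !invfM !mulrA !cs0E !cs1E.
set s := (Num.sqrt _)^-1; set t := (Num.sqrt _)^-1.
by split; field.
Qed.

Lemma g0_sec z : ball1 z -> g0 (sec z) = z.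
Proof.
move=> z1; have s0 : 0 < Num.sqrt (1 - sq z) by rewrite sqrtr_gt0 subr_gt0.
have E : Num.sqrt (hN (sec z) ord0) * Num.sqrt (sq (sec z)) = Num.sqrt (1 - sq z).
  by rewrite ip_sec// sqrtr1 mulr1 /hN sec_00 sec_01 expr0n addr0 sqrtr_sqr gtr0_norm.
apply: mx2P => k; rewrite !g00E !g01E E sec_00 sec_01 !sec_lift; have := lt0r_neq0 s0 => s0'.
by split; field.
Qed.

Lemma hN_sec z : ball1 z -> hN (sec z) ord0 != 0.
Proof.
move=> z1; rewrite /hN sec_00 sec_01 expr0n addr0 sqrf_eq0 gt_eqF//.
by rewrite sqrtr_gt0 subr_gt0.
Qed.

Lemma ball_embed_inj z z' : ball1 z -> ball1 z' -> ball_embed z = ball_embed z' -> z = z'.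
Proof.
rewrite !ball_embedE => z1 z'1 /(cpt_inj (sec_neq0 z1) (sec_neq0 z'1))[a [b [ab E]]].
by rewrite -(g0_sec z1) -(g0_sec z'1) E g0_cs.
Qed.

Lemma sm_g0 p q (A : set 'M[R]_(p, q)) (F : 'M[R]_(p, q) -> V) k b :
  (forall x, A x -> hN (F x) ord0 != 0) -> (forall i b, sm A (fun x => F x i b)) -> sm A (fun x => g0 (F x) k b).
Proof.
move=> F0 hF.
have hi : sm A (fun x => (Num.sqrt (hN (F x) ord0) * Num.sqrt (sq (F x)))^-1).
  have s1 x : A x -> 0 < hN (F x) ord0 by move=> /F0/hN_gt0.
  have s2 x : A x -> 0 < sq (F x) by move=> /F0/hN_neq0_Z/ip_gt0.
  apply: sm_inv => [x Ax|]; first by rewrite mulf_neq0// gt_eqF// sqrtr_gt0 ?s1 ?s2.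
  apply: sm_mul; apply: sm_sqrt => //; last exact: sm_ip.
  by apply: (@sm_eq _ _ _ _ (fun x => F x ord0 ord0 * F x ord0 ord0 + F x ord0 ord_max * F x ord0 ord_max)) => [x _|];
    [rewrite /hN !expr2|apply: sm_add; exact: sm_mul].
case: (ord2P b) => ->.
  apply: (@sm_eq _ _ _ _ _ _ (fun x _ => esym (g01E (F x) k))). by apply: sm_mul => //; apply: sm_sub; exact: sm_mul.
apply: (@sm_eq _ _ _ _ _ _ (fun x _ => esym (g00E (F x) k))).
by apply: sm_mul => //; apply: sm_add; exact: sm_mul.
Qed.

End Ball.

Arguments g0 {R n} Z.

(** * Shells inside the standard ball *)

Section BallEmbedding.
Context {R : realType} (n : nat).
Local Notation V := 'M[R]_(n.+1, 2).
Local Notation E := 'M[R]_(n, 2).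

Lemma hN_open j : open [set Z : V | hN Z j != 0].
Proof.
have c : continuous (fun Z : V => hN Z j) by move=> Z; exact: C1_cont (@C1_hN _ _ setT j) I.
have : open (~` [set (0 : R)]) by rewrite openC; exact: closed_eq.
by move=> /(open_comp (fun Z _ => c Z)); congr open; apply/seteqP; split=> Z /=; [move=> /eqP|move/eqP].
Qed.

Lemma hN_coord_open (F : E -> V) (A : set E) j : open A ->
  (forall i b x, A x -> {for x, continuous (fun x => F x i b)}) -> open [set x | A x /\ hN (F x) j != 0].
Proof.
move=> oA cF; rewrite openE => x [Ax hx]; rewrite /interior/=.
have cx : {for x, continuous F} by apply: cont_mx => i b; exact: cF.
have nA : \forall y \near x, A y by exact: open_nbhs_nbhs.
have nh : \forall y \near x, hN (F y) j != 0.
  by apply: (cx [set Z | hN Z j != 0]); apply: open_nbhs_nbhs; split => //; exact: hN_open.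
by near=> y; split; near: y.
Unshelve. all: by end_near. Qed.

Lemma ball_chart_dom j : @ball1 R n `&` (@ball_embed R n) @^-1` chart_dom j = [set z | ball1 z /\ hN (sec z) j != 0].
Proof.
apply/seteqP; split=> z /= [z1]; rewrite ball_embedE.
  by move=> /(chart_dom_cpt (sec_neq0 z1)).
by move=> /chart_cpt[].
Qed.

(** The lower bound for the capacity: the ball embedding itself, restricted to a neighbourhood of
    the shell that avoids the removed closed ball. *)
Lemma shell_embeds_ball (r d eps : R) : 0 < r < 1 -> 0 < d < 1 -> 0 < eps < 1 -> 1 - eps < r * (1 - d) ->
  @shell_embeds R n r d (V_eps eps).
Proof.
move=> /andP[r0 r1] d01 /andP[e0 e1] er; have d01' := d01; case/andP: d01 => d0 d1.
pose W : set E := [set z | (1 - eps) ^+ 2 < sq z /\ sq z < 1].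
have We : W `<=` @ball1 R n by move=> z [].
have e1' : 0 <= 1 - eps by rewrite subr_ge0 ltW.
have oW : open W.
  apply: openI; last exact: ball1_open.
  by apply: (@open_comp _ _ (fun z : E => sq z) [set y | (1 - eps) ^+ 2 < y]) => [z _|]; [exact: ip_cont|exact: open_gt].
have [dsec hds hdsP] := @C1_sec R n.
have WD j : W `&` (@ball_embed R n) @^-1` chart_dom j = [set z | W z /\ hN (sec z) j != 0].
  apply/seteqP; split=> z [Wz h]; split=> //.
    have : (@ball1 R n `&` (@ball_embed R n) @^-1` chart_dom j) z by split => //; exact: We.
    by rewrite ball_chart_dom => -[].
  have : [set z | ball1 z /\ hN (sec z) j != 0] z by split => //; exact: We. by rewrite -ball_chart_dom => -[].
have oWD j : open [set z | W z /\ hN (sec z) j != 0].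
  apply: hN_coord_open => // i b x Wx. by apply: (sm_cont (@ball1_open R n) (sm_sec i b)); exact: We.
have chE j z : W z -> hN (sec z) j != 0 -> chart j (ball_embed z) = cj j (sec z).
  by move=> Wz h; rewrite ball_embedE; have [_ ->] := chart_cpt h.
have smj j k b : sm [set z | W z /\ hN (sec z) j != 0] (fun z => chart j (ball_embed z) k b).
  apply: (@sm_eq _ _ _ _ (fun z => cj j (sec z) k b)) => [z [Wz h]|]; first by rewrite chE.
  apply: sm_cj => [z []//|i c]; apply: sm_subset (sm_sec i c) => z [Wz _]; exact: We.
have dch p j : W p -> hN (sec p) j != 0 -> is_diff p (chart j \o @ball_embed R n) (fun u => dcj j (sec p) (dsec p u)).
  move=> Wp h.
  have hc := C1_comp (@hN_open j) (C1_subset (A := [set z | W z /\ hN (sec z) j != 0]) (fun z h => We _ h.1) hds)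
     (@C1_cj R n j) (fun z h => h.2).
  have hc' := eq_C1 (oWD j) (fun z h => esym (chE j z h.1 h.2)) (fun _ _ _ => erefl) hc.
  by have [] := hc' p (conj Wp h).
have dom p j : W p -> chart_dom j (ball_embed p) -> hN (sec p) j != 0.
  move=> Wp h; have : (W `&` (@ball_embed R n) @^-1` chart_dom j) p by []. by rewrite WD => -[].
have symp : symplectic_on W (@ball_embed R n).
  move=> p j Wp /(dom p j Wp) h u v.
  have [_ ->] := dch p j Wp h; rewrite chE// FS_chart// (@Omega_sec _ _ _ _ _ dsec)//; exact: We.
exists W, (@ball_embed R n); split=> //.
- rewrite shellE// => z /= /andP[rz zr]; split.
    apply: lt_le_trans rz; rewrite ltr_pXn2r// nnegrE//; apply: mulr_ge0; rewrite ?subr_ge0; exact: ltW.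
  by rewrite (le_lt_trans zr)// -(expr1n _ 2) ltr_pXn2r// nnegrE// ltW.
- move=> _ [z [Wz1 Wz2] <-] [y]; rewrite closure_eball ?subr_gt0// => -[/=]; rewrite enorm_le// => ye.
  have y1 : ball1 y.
    rewrite /ball1 /= (le_lt_trans ye)// -(expr1n _ 2) ltr_pXn2r ?nnegrE//; lra.
  by move=> /(ball_embed_inj y1 Wz2) yz; move: Wz1; rewrite -yz ltNge ye.
- split.
  + move=> j; rewrite WD; split; first exact: oWD. by move=> k; apply: sm_Ck.
  + by move=> z y; rewrite !inE => Wz Wy /(ball_embed_inj (We _ Wz) (We _ Wy)).
  (* A map that preserves the nondegenerate form [omega_st] has injective differential. *)
  + move=> p j Wp hp u u' uu'. have nondeg (w : E) : (forall v, omega_st w v = 0) -> w = 0.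
      by move=> h; apply: ip_eq0; rewrite -ip_JJ -omega_ip h.
    apply/eqP; rewrite -subr_eq0; apply/eqP/nondeg => v.
    rewrite -(symp p j Wp hp) (_ : 'd _ p (u - u') = 0); last by rewrite linearB uu' subrr.
    rewrite omega_FSE ip0l (_ : Jm 0 = 0) ?ip0l; last first.
      by apply: mx2P => k; rewrite !mxE/= ?mxE oppr0.
    by rewrite !mul0r addr0 mul0r subr0.
  (* The open set is described through the inverse [g0], which depends only on the complex line of a
     vector. *)
  + move=> A oA AW. pose O : set (CP R n) := [set L | hN (hZ L) ord0 != 0 /\ A (g0 (hZ L))].
    have hOz z : W z -> O (ball_embed z) <-> A z.
      move=> /We z1; rewrite ball_embedE /O /=. have [a [b [ab ->]]] := hZ_cpt (sec_neq0 z1).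
      rewrite g0_cs// g0_sec// hN_cs; split=> [[]//|Az]; split=> //. by rewrite mulf_neq0// hN_sec.
    exists O; last first.
      apply/seteqP; split=> [_ [z Az <-]|_ [[z Wz <-] /(hOz z Wz) Az]]; last by exists z.
      by split; [exists z => //; exact: AW|apply/hOz => //; exact: AW].
    move=> j. rewrite (_ : _ @` _ = [set w | hN (aff j w) ord0 != 0 /\ A (g0 (aff j w))]).
      have smA i b : sm setT (fun w : E => aff j w i b).
        case: (unliftP j i) => [k ->|->].
          by apply: (@sm_eq _ _ _ _ (fun w => w k b)) => [w _|]; [rewrite aff_lift|exact: sm_coord].
        case: (ord2P b) => ->.
          by apply: (@sm_eq _ _ _ _ (fun=> 0)) => [w _|]; [rewrite aff_j1|exact: sm_cst].
        by apply: (@sm_eq _ _ _ _ (fun=> 1)) => [w _|]; [rewrite aff_j0|exact: sm_cst].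
      have oB : open [set w : E | hN (aff j w) ord0 != 0].
        have := @hN_coord_open (aff j) setT ord0 openT (fun i b x _ => sm_cont openT (smA i b) I).
        by congr open; apply/seteqP; split=> w /=; [move=> []|].
      rewrite openE => w [hw Aw]; rewrite /interior. have cg : {for w, continuous (fun w : E => g0 (aff j w))}.
        apply: cont_mx => k b; apply: (@sm_cont _ _ _ [set w : E | hN (aff j w) ord0 != 0]) => //.
        by apply: sm_g0 => // i c; exact: sm_subset (smA i c).
      have n1 : \forall y \near w, hN (aff j y) ord0 != 0 by exact: open_nbhs_nbhs.
      have n2 : \forall y \near w, A (g0 (aff j y)) by apply: cg; exact: open_nbhs_nbhs. exact: filterI n1 n2.
    apply/seteqP; split=> [_ [L [OL cL] <-]|w [hw Aw]].
      move: OL; rewrite /O /= -{1 2}(cpt_aff cL). have [a [b [ab ->]]] := hZ_cpt (aff_neq0 j (chart j L)).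
      by rewrite g0_cs// hN_cs => -[h Ag]; split=> //; move: h; rewrite mulf_eq0 negb_or => /andP[].
    have hj : hN (aff j w) j != 0 by rewrite hN_aff oner_neq0.
    exists (cpt (aff j w)); last by have [_ ->] := chart_cpt hj; rewrite cj_aff. split; last by have [] := chart_cpt hj.
    rewrite /O /=; have [a [b [ab ->]]] := hZ_cpt (aff_neq0 j w). by rewrite g0_cs// hN_cs mulf_neq0.
Qed.

End BallEmbedding.

(** * Inverse function theorem *)

Section InverseFunction.
Context {R : realType} (p q : nat).
Local Notation E := 'M[R]_(p, q).

Lemma linear_left_inverse (L M : E -> E) : linear L -> linear M -> (forall u, M (L u) = u) -> forall v, L (M v) = v.
Proof.
move=> lL lM ML.
pose L' : {linear E -> E} := HB.pack L (GRing.isLinear.Build _ _ _ _ L lL).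
pose M' : {linear E -> E} := HB.pack M (GRing.isLinear.Build _ _ _ _ M lM).
have h : lin_mx L' *m lin_mx M' = 1%:M.
  apply/row_matrixP => i; rewrite !rowE; set v := delta_mx _ _.
  have e1 := mul_vec_lin L' (vec_mx v); have e2 := mul_vec_lin M' (L (vec_mx v)).
  by rewrite mulmxA mulmx1 -{1}(vec_mxK v) [X in X *m _]e1 [LHS]e2 /= ML vec_mxK.
move=> v; apply: (can_inj mxvecK).
have := mulmx1C h => h'.
by rewrite -[L _]/(L' (M' v)) -mul_vec_lin -mul_vec_lin -mulmxA h' mulmx1.
Qed.

(** The estimate is uniform in both points near [x0], as the contraction argument requires. *)
Lemma strict_diff (A : set E) (F : E -> E) dF x0 (e : R) : open A -> C1 A F dF -> A x0 -> 0 < e ->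
  exists2 r : R, 0 < r & (forall x, `|x0 - x| < r -> A x) /\
   forall x x', `|x0 - x| < r -> `|x0 - x'| < r -> `|F x - F x' - dF x0 (x - x')| <= e * `|x - x'|.
Proof.
move=> oA hF Ax0 e0.
pose N := (p * q)%N; pose e' := e / N.+1%:R; have e'0 : 0 < e' by rewrite divr_gt0.
have : \forall y \near x0, A y /\ forall (i : 'I_p) (j : 'I_q) (k : 'I_p) (l : 'I_q),
    `|dF y (mxb k l) i j - dF x0 (mxb k l) i j| <= e'.
  near=> y; split; first by near: y; exact: open_nbhs_nbhs.
  near: y; apply: filter_forall => i; apply: filter_forall => j. apply: filter_forall => k; apply: filter_forall => l.
  have [_ /(_ (mxb k l)) c] := hF x0 Ax0.
  have := @cont_entry R E p q (fun y => dF y (mxb k l)) x0 i j c => /cvgrPdist_le /(_ e' e'0).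
  by apply: filterS => y; rewrite distrC.
move=> /nbhs_normP[r r0 hr]; exists r => //; split; first by move=> x /hr[].
move=> x x' xr xr'; apply: mx_norm_le => [|i j]; first by rewrite mulr_ge0// ltW.
have seg (t : R) : 0 <= t <= 1 -> `|x0 - (x' + t *: (x - x'))| < r.
  move=> /andP[t0 t1]. have -> : x0 - (x' + t *: (x - x')) = (1 - t) *: (x0 - x') + t *: (x0 - x).
    by rewrite !scalerBr !scalerBl scale1r; apply/matrixP => a b; rewrite !mxE; ring.
  rewrite (le_lt_trans (ler_normD _ _))// !normrZ !ger0_norm ?subr_ge0//.
  have [->|t0'] := eqVneq t 0; first by rewrite mul0r addr0 subr0 mul1r.
  have : t * `|x0 - x| < t * r by rewrite ltr_pM2l// lt_neqAle eq_sym t0'.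
  have : (1 - t) * `|x0 - x'| <= (1 - t) * r by rewrite ler_wpM2l ?subr_ge0// ltW. by move=> *; lra.
have [|t t01 EE] := @C1_MVT R _ A (fun x => F x i j) _ x' (x - x') (C1_entry i j hF).
  by move=> t /seg/hr[].
rewrite subrKC in EE.
rewrite !mxE EE; set z := x' + t *: (x - x').
have [Az hz] : A z /\ forall (i : 'I_p) (j : 'I_q) (k : 'I_p) (l : 'I_q),
    `|dF z (mxb k l) i j - dF x0 (mxb k l) i j| <= e' by exact/hr/seg.
set v := x - x'.
have lin y : A y -> dF y v i j = \sum_k \sum_l v k l * dF y (mxb k l) i j.
  move=> Ay; have l : linear (fun w => dF y w i j).
    by move=> a u w; rewrite (C1_linear hF Ay) !mxE.
  exact: (linear_coord_sum v l).
rewrite !lin// -sumrB.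
rewrite (le_trans (ler_norm_sum _ _ _))//.
rewrite (le_trans (y := \sum_(k < p) \sum_(l < q) e' * `|v|))//.
  apply: ler_sum => k _; rewrite -sumrB (le_trans (ler_norm_sum _ _ _))//.
  apply: ler_sum => l _; rewrite -mulrBr normrM mulrC. by apply: ler_pM => //; exact: coord_norm.
rewrite !sumr_const !card_ord -mulrnA -[_ *+ _]mulr_natl mulrA ler_wpM2r//.
rewrite /e' mulrCA ger_pMr// ler_pdivrMr// mul1r ler_nat mulnC; exact: leqnSn.
Unshelve. all: by end_near. Qed.

Variables (A : set E) (F : E -> E) (dF : E -> E -> E) (x0 : E) (M : E -> E).
Hypothesis (oA : open A) (hF : C1 A F dF) (Ax0 : A x0).
Hypothesis (lM : linear M) (ML : forall u, M (dF x0 u) = u).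

Lemma left_inverse_bound : exists2 c : R, 0 < c & forall v, `|M v| <= c * `|v|.
Proof.
pose M' : {linear E -> E} := HB.pack M (GRing.isLinear.Build _ _ _ _ M lM).
by have [|c c0 hc] := @linear_lipschitz _ _ _ M' _; [exact: linear_cont|exists c].
Qed.

(** The map [psi x = x - M (F x - y)] is a contraction near [x0] and preserves a closed ball when
    [y] is close to [F x0]; its fixed point solves [F x = y]. *)
Lemma inv_local (e : R) : 0 < e -> exists r s : R, [/\ 0 < r, 0 < s, forall x, `|x0 - x| < r -> A x,
  forall x, `|x0 - x| < r -> `|x - x0 - M (F x - F x0)| <= e * `|F x - F x0| &
  forall y, `|F x0 - y| < s -> exists2 x, `|x0 - x| < r & F x = y].
Proof.
move=> e0.
have [c c0 hc] := left_inverse_bound.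
(* The first bound makes [psi] contract by 1/2. The second absorbs the constant in the error
   [2 c^2 e' |F x - F x0|], where one factor [2 c] comes from the Lipschitz bound on the inverse. *)
pose e' := Num.min (2 * c)^-1 (e / (2 * c ^+ 2)).
have e'0 : 0 < e' by rewrite lt_min invr_gt0 divr_gt0 ?mulr_gt0 ?exprn_gt0.
have [r r0 [rA hr]] := strict_diff oA hF Ax0 e'0.
have MB u v : M (u - v) = M u - M v by have := lM (-1) v u; rewrite !scaleN1r [_ + u]addrC [_ + M u]addrC.
have half x x' : `|x0 - x| < r -> `|x0 - x'| < r -> `|x - x' - M (F x - F x')| <= c * e' * `|x - x'|.
  move=> xr xr'; rewrite -{1}(ML (x - x')) -MB (le_trans (hc _))// -mulrA ler_wpM2l ?(ltW c0)//. by rewrite distrC hr.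
have ce : c * e' <= 2^-1.
  have : e' <= (2 * c)^-1 by rewrite ge_min lexx. move=> /(ler_wpM2l (ltW c0)) /le_trans; apply.
  by rewrite le_eqVlt; apply/orP; left; apply/eqP; field; exact: lt0r_neq0.
have lip x : `|x0 - x| < r -> `|x - x0| <= 2 * c * `|F x - F x0|.
  move=> xr; have x00 : `|x0 - x0| < r by rewrite subrr normr0. have h1 := half x x0 xr x00.
  have h2 : `|x - x0| <= `|x - x0 - M (F x - F x0)| + `|M (F x - F x0)|.
    by rewrite (le_trans _ (ler_normD _ _))// subrK.
  have h3 := hc (F x - F x0). have h4 : c * e' * `|x - x0| <= 2^-1 * `|x - x0| by rewrite ler_wpM2r. by lra.
exists r, (r / (4 * c)); split=> //; first by rewrite divr_gt0// mulr_gt0.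
- move=> x xr; have x00 : `|x0 - x0| < r by rewrite subrr normr0. rewrite (le_trans (half x x0 xr x00))//.
  rewrite (le_trans (ler_wpM2l _ (lip x xr)))//; first by rewrite mulr_ge0// ltW. rewrite mulrA ler_wpM2r//.
  have : e' <= e / (2 * c ^+ 2) by rewrite ge_min lexx orbT.
  rewrite ler_pdivlMr ?mulr_gt0 ?exprn_gt0//; move=> h; apply: le_trans h.
  by rewrite le_eqVlt; apply/orP; left; apply/eqP; ring.
move=> y ys.
pose psi x := x - M (F x - y).
pose K := [set x : E | `|x0 - x| <= r / 2].
have Kr x : K x -> `|x0 - x| < r by move=> /= /le_lt_trans; apply; rewrite ltr_pdivrMr// ltr_pMr// ltr1n.
have cK : compact K.
  have -> : K = (fun x => x0 + x) @` [set x : E | `|x| <= r / 2].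
    apply/seteqP; split=> [x /= xr|_ [x /= xr <-]]; last by rewrite /K /= opprD addNKr normrN.
    by exists (x - x0); [rewrite distrC|rewrite addrC subrK].
  apply: continuous_compact (@compact_ball_mx R p q (r / 2)); apply: continuous_subspaceT => x.
  by apply: (@continuousD _ _ _ (fun=> x0) id); [exact: cont_cst|exact: cont_id].
have psiB x x' : psi x - psi x' = x - x' - M (F x - F x').
  rewrite /psi (_ : F x - F x' = (F x - y) - (F x' - y)) ?MB; last by rewrite opprB addrA subrK.
  by rewrite !opprD !opprK; apply/matrixP => i j; rewrite !mxE; ring.
have contr x x' : K x -> K x' -> `|psi x - psi x'| <= 2^-1 * `|x - x'|.
  move=> /Kr xr /Kr xr'; rewrite psiB (le_trans (half x x' xr xr'))//. by rewrite ler_wpM2r.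
have Kx0 : K x0 by rewrite /K /= subrr normr0 divr_ge0// ltW.
have psi0 : `|psi x0 - x0| < r / 4.
  rewrite /psi addrC addKr normrN (le_lt_trans (hc _))// -ltr_pdivlMl//.
  by rewrite (lt_le_trans ys)// le_eqVlt; apply/orP; left; apply/eqP; field; exact: lt0r_neq0.
have psiK x : K x -> K (psi x).
  move=> Kx; rewrite /K /= distrC -(subrKA (psi x0)) (le_trans (ler_normD _ _))//.
  have := contr x x0 Kx Kx0; move: Kx; rewrite /K /= distrC => Kx h; move/ltW: psi0 => h'; lra.
have cg : {within K, continuous (fun x => `|x - psi x|)}.
  apply: continuous_in_subspaceT => x; rewrite inE => Kx.
  have cF : {for x, continuous F} by apply: C1_cont hF _; exact/rA/Kr.
  apply: (@cont_comp E E R (fun x => x - psi x) (fun u : E => `|u|)); last exact: norm_continuous.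
  apply: (@continuousB _ _ _ id psi); first exact: cont_id.
  apply: (@continuousB _ _ _ id (fun x => M (F x - y))); first exact: cont_id.
  apply: (@cont_comp E E E (fun x => F x - y) M); last exact: linear_cont.
  by apply: (@continuousB _ _ _ F (fun=> y)); last exact: cont_cst.
(* The fixed point is found as a minimum point of the displacement [|x - psi x|] on the compact
   ball: one more application of [psi] would halve the displacement. *)
have [x Kx hx] := @compact_EVT_min _ R _ K (ex_intro _ x0 Kx0) cK cg.
rewrite inE in Kx.
exists x; first exact: Kr.
have fx : x = psi x.
  have h1 : `|x - psi x| <= `|psi x - psi (psi x)| by apply: hx; rewrite inE; exact: psiK.
  have h2 := contr x (psi x) Kx (psiK x Kx). have : `|x - psi x| <= 0 by move: (normr_ge0 (x - psi x)) => ?; lra.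
  by rewrite normr_le0 subr_eq0 => /eqP.
have M0 : M (F x - y) = 0.
  by move: fx; rewrite /psi -{1}[x]subr0 => /addrI/oppr_inj/esym.
have LM := linear_left_inverse (C1_linear hF Ax0) lM ML.
apply/eqP; rewrite -subr_eq0 -[F x - y]LM M0.
by have := C1_Z 0 0 hF Ax0; rewrite !scale0r => ->.
Qed.

Lemma inv_open : nbhs (F x0) (F @` A).
Proof.
have [r [s [r0 s0 rA _ h]]] := inv_local ltr01.
apply: filterS (nbhsx_ballx (F x0) s s0) => y; rewrite -ball_normE /= => /h[x xr <-].
by exists x => //; exact: rA.
Qed.

Lemma inv_diff (H : E -> E) : (forall x, A x -> H (F x) = x) -> is_diff (F x0) H M.
Proof.
move=> HF; apply/is_diffP; split=> //; first exact: linear_cont.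
move=> e e0; have [r [s [r0 s0 rA hb h]]] := inv_local e0.
near=> k.
have ks : `|F x0 - (k + F x0)| < s.
  rewrite opprD addrCA subrr addr0 normrN; near: k; exact: (@nbhs0_lt _ E _ s0).
have [x xr Fx] := h _ ks.
have -> : k = F x - F x0 by rewrite Fx addrK.
by rewrite subrK (HF x (rA x xr)) (HF x0 Ax0) hb.
Unshelve. all: by end_near. Qed.

End InverseFunction.

(** * Inverting a symplectic embedding on the cone over its image *)

Section IsC1.
Context {R : realType}.
Implicit Types U W : normedModType R.

Definition isC1 {U W} (A : set U) (f : U -> W) := exists df, C1 A f df.

(** Directional derivatives are a single global formula for the differential, so local
    representations glue. *)
Lemma C1_local U W (A : set U) (f : U -> W) : (forall x, A x -> exists2 B : set U, open B /\ B x & isC1 B f) ->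
  C1 A f (fun x v => 'D_v f x).
Proof.
move=> h x Ax; have [B [oB Bx] [df hf]] := h x Ax.
have E : C1 [set x] f df by move=> y ->; exact: hf.
apply: (@near_C1 _ _ _ [set x] f f df _ _ E x erefl) => _ ->.
near=> y; have By : B y by near: y; exact: open_nbhs_nbhs.
by split=> // v; have [_ ->] := C1_derive v hf By.
Unshelve. all: by end_near. Qed.

Lemma isC1_D U W (A : set U) (f : U -> W) : open A -> isC1 A f -> C1 A f (fun x v => 'D_v f x).
Proof. by move=> oA h; apply: C1_local => x Ax; exists A. Qed.

Lemma isC1_add U W (A : set U) (f g : U -> W) : isC1 A f -> isC1 A g -> isC1 A (fun x => f x + g x).
Proof. by move=> [df hf] [dg hg]; eexists; exact: C1_add hf hg. Qed.
Lemma isC1_sub U W (A : set U) (f g : U -> W) : isC1 A f -> isC1 A g -> isC1 A (fun x => f x - g x).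
Proof. by move=> [df hf] [dg hg]; eexists; exact: C1_sub hf hg. Qed.
Lemma isC1_opp U W (A : set U) (f : U -> W) : isC1 A f -> isC1 A (fun x => - f x).
Proof. by move=> [df hf]; eexists; exact: C1_opp hf. Qed.
Lemma isC1_mul U (A : set U) (f g : U -> R) : isC1 A f -> isC1 A g -> isC1 A (fun x => f x * g x).
Proof. by move=> [df hf] [dg hg]; eexists; exact: C1_mul hf hg. Qed.
Lemma isC1_inv U (A : set U) (f : U -> R) : (forall x, A x -> f x != 0) -> isC1 A f -> isC1 A (fun x => (f x)^-1).
Proof. by move=> f0 [df hf]; eexists; exact: C1_inv hf. Qed.
Lemma isC1_cst U W (A : set U) (c : W) : isC1 A (fun=> c).
Proof. by eexists; exact: C1_cst. Qed.
Lemma isC1_id U (A : set U) : isC1 A (fun x : U => x).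
Proof. by eexists; exact: C1_id. Qed.
Lemma isC1_entry U p q (A : set U) (f : U -> 'M[R]_(p, q)) i j : isC1 A f -> isC1 A (fun x => f x i j).
Proof. by move=> [df hf]; eexists; exact: C1_entry hf. Qed.

Lemma isC1_mx U p q (A : set U) (f : U -> 'M[R]_(p, q)) : (forall i j, isC1 A (fun x => f x i j)) -> isC1 A f.
Proof.
move=> h; pose D i j := projT1 (cid (h i j)).
exists (fun x v => \matrix_(i, j) D i j x v); apply: C1_mx => i j.
by apply: (C1_ext (projT2 (cid (h i j)))) => // x v; rewrite mxE.
Qed.

Lemma isC1_comp U p q W (A : set U) (B : set 'M[R]_(p, q)) (f : U -> 'M[R]_(p, q)) (g : 'M[R]_(p, q) -> W) :
  open B -> isC1 A f -> isC1 B g -> (forall x, A x -> B (f x)) -> isC1 A (fun x => g (f x)).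
Proof. by move=> oB [df hf] [dg hg] AB; eexists; exact: C1_comp oB hf hg AB. Qed.

Lemma isC1_ip U m (A : set U) (f g : U -> 'M[R]_(m, 2)) : isC1 A f -> isC1 A g -> isC1 A (fun x => ip (f x) (g x)).
Proof. by move=> [df hf] [dg hg]; eexists; exact: C1_ip hf hg. Qed.

Lemma isC1_subset U W (A B : set U) (f : U -> W) : A `<=` B -> isC1 B f -> isC1 A f.
Proof. by move=> AB [df hf]; exists df; exact: C1_subset hf. Qed.

Lemma isC1_eq U W (A : set U) (f g : U -> W) : open A -> (forall x, A x -> f x = g x) -> isC1 A f -> isC1 A g.
Proof. by move=> oA fg [df hf]; exists df; exact: (eq_C1 oA fg _ hf). Qed.

Lemma isC1_J U m (A : set U) (f : U -> 'M[R]_(m, 2)) : isC1 A f -> isC1 A (fun x => Jm (f x)).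
Proof.
move=> h; apply: isC1_mx => i j; case: (ord2P j) => ->.
  by under eq_fun do rewrite Jm1; exact: isC1_entry.
by under eq_fun do rewrite Jm0; apply/isC1_opp; exact: isC1_entry.
Qed.

Lemma isC1_Omega U m (A : set U) (Z Y Y' : U -> 'M[R]_(m, 2)) :
  (forall x, A x -> Z x != 0) -> isC1 A Z -> isC1 A Y -> isC1 A Y' -> isC1 A (fun x => Omega (Z x) (Y x) (Y' x)).
Proof.
move=> Z0 hZ hY hY'.
have hi : isC1 A (fun x => (sq (Z x))^-1).
  by apply: isC1_inv; [move=> x /Z0/ip_gt0/lt0r_neq0|exact: isC1_ip].
apply: isC1_sub; first by apply: isC1_mul => //; apply: isC1_ip => //; exact: isC1_J.
under eq_fun do rewrite expr2 invfM.
apply: isC1_mul; last exact: isC1_mul.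
by apply: isC1_add; apply: isC1_mul; apply: isC1_ip => //; exact: isC1_J.
Qed.

Lemma isC1_cont U W (A : set U) (f : U -> W) x : isC1 A f -> A x -> {for x, continuous f}.
Proof. by move=> [df hf]; exact: C1_cont hf. Qed.

End IsC1.

Section Cone.
Context {R : realType} (n : nat).
Local Notation V := 'M[R]_(n.+1, 2).
Local Notation E := 'M[R]_(n, 2).
Variables (W : set E) (f : E -> CP R n).
Hypotheses (oW : open W) (fe : embedding_on W f) (fs : symplectic_on W f).

Definition cone : set V := [set Z | Z != 0 /\ (f @` W) (cpt Z)].

(** The projection followed by the inverse of [f]; the value 0 is a default off the cone. *)
Definition coneG (Z : V) : E := xget 0 [set x | W x /\ f x = cpt Z].

Lemma coneGP Z : cone Z -> W (coneG Z) /\ f (coneG Z) = cpt Z.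
Proof. by move=> [_ [x Wx fx]]; rewrite /coneG; case: xgetP => [//|/(_ x)[]]. Qed.

Lemma coneG_eq Z x : W x -> f x = cpt Z -> coneG Z = x.
Proof.
move=> Wx fx; rewrite /coneG; case: xgetP => [y _ [Wy fy]|/(_ x)[]//].
have [_ inj _ _] := fe; apply: inj; rewrite ?inE//; by rewrite fy fx.
Qed.

Definition chd j := W `&` f @^-1` chart_dom j.
Definition chf j := chart j \o f.
Definition dchf j x v := 'D_v (chf j) x.

Lemma chd_open j : open (chd j).
Proof. by have [/(_ j)[]] := fe. Qed.

Lemma chf_C1 j : C1 (chd j) (chf j) (dchf j).
Proof. by have [h _ _ _] := fe; have [oj hk] := h j; exact: (Ck_C1 oj (hk 1%N)). Qed.

Lemma chf_C2 j v : isC1 (chd j) ((dchf j)^~ v).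
Proof.
have [h0 _ _ _] := fe; have [oj hk] := h0 j.
by eexists; exact: (Ck_C1 oj (Ck_deriv v (hk 2%N))).
Qed.

Lemma chf_symp j x u v : chd j x -> omega_FS (chf j x) (dchf j x u) (dchf j x v) = omega_st u v.
Proof.
move=> dx; have [Wx hx] := dx; have [[_ dE] _] := chf_C1 dx.
by have := fs Wx hx u v; rewrite -/(chf j) dE.
Qed.

Lemma chf_cpt j x : chd j x -> cpt (aff j (chf j x)) = f x.
Proof. by move=> [_ h]; rewrite /chf /= cpt_aff. Qed.

Lemma chfE j x : chf j x = chart j (f x). Proof. by []. Qed.

Lemma omega_FS_linr (w u : E) : linear (omega_FS w u).
Proof. by move=> a x y; rewrite !omega_FSE !ip_linr /GRing.scale/=; ring. Qed.

Opaque chf dchf omega_FS dcj ex ey.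

(** An explicit left inverse of the differential: symplecticity recovers the coordinates of [u] by
    pairing the image of [u] with the images of the basis vectors. The derivative of the inverse map
    is thus algebraic in the first derivatives of [f]. *)
Definition chM j x (w : E) : E := \matrix_(k, b) if b == ord0 then - omega_FS (chf j x) (dchf j x (ey k)) w
  else omega_FS (chf j x) (dchf j x (ex k)) w.

Lemma chM0E j x w k : chM j x w k ord0 = - omega_FS (chf j x) (dchf j x (ey k)) w.
Proof. by rewrite mxE. Qed.
Lemma chM1E j x w k : chM j x w k ord_max = omega_FS (chf j x) (dchf j x (ex k)) w.
Proof. by rewrite mxE. Qed.

Lemma chM_linear j x : linear (chM j x).
Proof.
move=> a u v.
have E (x1 y1 : E) k b : (a *: x1 + y1) k b = a * x1 k b + y1 k b by rewrite !mxE.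
apply: mx2P => k; rewrite !E !chM0E !chM1E; split; rewrite omega_FS_linr /GRing.scale/=; ring.
Qed.

Lemma chMK j x u : chd j x -> chM j x (dchf j x u) = u.
Proof.
move=> dx; apply: mx2P => k; split.
  rewrite chM0E; apply: (etrans (congr1 -%R (chf_symp (ey k) u dx))). by rewrite omega_ip Jm_ey ipC ipNr ip_ex opprK.
rewrite chM1E; apply: (etrans (chf_symp (ex k) u dx)).
by rewrite omega_ip Jm_ex ipC ip_ey.
Qed.

Lemma chf_nbhs j x : chd j x -> nbhs (chf j x) (chf j @` chd j).
Proof.
move=> dx; apply: (@inv_open _ _ _ (chd j) (chf j) _ x (chM j x) (@chd_open j) (@chf_C1 j)) => //.
  exact: chM_linear.
by move=> u; exact: chMK.
Qed.

Lemma cpt_aff_cj j (Z : V) : hN Z j != 0 -> cpt (aff j (cj j Z)) = cpt Z.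
Proof. by move=> h; rewrite -[in RHS](cs_aff_cj h) cpt_cs ?aff_neq0. Qed.

Lemma chf_coneG j Z : cone Z -> hN Z j != 0 -> chd j (coneG Z) /\ chf j (coneG Z) = cj j Z.
Proof.
move=> CZ h; have [WG fG] := coneGP CZ; have [c1 c2] := chart_cpt h.
by rewrite chfE fG c2; split=> //; split=> //=; rewrite fG.
Qed.

Lemma cone_nbhs j Z : cone Z -> hN Z j != 0 -> \forall Y \near Z, cone Y.
Proof.
move=> CZ h; have [dG eG] := chf_coneG CZ h.
have c : {for Z, continuous (cj j)} by exact: C1_cont (@C1_cj R n j) h.
have n1 : \forall Y \near Z, hN Y j != 0 by apply: open_nbhs_nbhs; split => //; exact: hN_open.
have n2 : \forall Y \near Z, (chf j @` chd j) (cj j Y).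
  by apply: c; rewrite -eG; exact: chf_nbhs.
near=> Y; have hY : hN Y j != 0 by near: Y.
have [x dx xY] : (chf j @` chd j) (cj j Y) by near: Y.
split; first exact: hN_neq0_Z hY.
by exists x; [case: dx|rewrite -(chf_cpt dx) xY cpt_aff_cj].
Unshelve. all: by end_near. Qed.

Lemma cone_open : open cone.
Proof.
rewrite openE => Z CZ; have [Z0 _] := CZ; have [j hj] := exists_hN Z0.
exact: cone_nbhs CZ hj.
Qed.

Definition conej j := cone `&` [set Z | hN Z j != 0].

Lemma conej_open j : open (conej j).
Proof. by apply: openI; [exact: cone_open|exact: hN_open]. Qed.

Definition coneY j (u : E) (Z : V) : V := cs (Z j ord0) (Z j ord_max) (ins j (dchf j (coneG Z) u)).

Lemma dcj_coneY j u Z : hN Z j != 0 -> dcj j Z (coneY j u Z) = dchf j (coneG Z) u.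
Proof.
move=> h; apply: mx2P => k; have [-> ->] := dcjE (coneY j u Z) k h.
rewrite /coneY !cs0E !cs1E !ins_lift !ins_j !mulr0 !addr0 !subr0.
by move: h; rewrite /hN => h; split; field.
Qed.

(** [chM] lifted to the cone. It is built from [Omega], [coneG] and first derivatives of the chart
    expression of [f], so it is C1 once [coneG] is; this is how second derivatives are reached in
    [coneG_C2]. *)
Definition conedG j (Z v : V) : E := \matrix_(k, b)
  if b == ord0 then - Omega Z (coneY j (ey k) Z) v else Omega Z (coneY j (ex k) Z) v.

Lemma conedG_chM j Z v : conej j Z -> conedG j Z v = chM j (coneG Z) (dcj j Z v).
Proof.
move=> [CZ h]; have [_ xZ] := chf_coneG CZ h.
have key w : omega_FS (chf j (coneG Z)) (dchf j (coneG Z) w) (dcj j Z v) = Omega Z (coneY j w Z) v.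
  by rewrite xZ -(dcj_coneY w h); exact: FS_chart.
have E0 k : conedG j Z v k ord0 = - Omega Z (coneY j (ey k) Z) v by rewrite mxE.
have E1 k : conedG j Z v k ord_max = Omega Z (coneY j (ex k) Z) v by rewrite mxE.
apply: mx2P => k; split; first by rewrite E0 chM0E key.
by rewrite E1 chM1E key.
Qed.

Lemma coneG_is_diff j Z : conej j Z -> is_diff Z coneG (conedG j Z).
Proof.
move=> [CZ h]; have [dx xZ] := chf_coneG CZ h.
pose H w := coneG (aff j w).
have HF x : chd j x -> H (chf j x) = x.
  by move=> dx'; apply: coneG_eq; [case: dx'|rewrite chf_cpt].
have dH := @inv_diff _ _ _ (chd j) (chf j) _ (coneG Z) (chM j (coneG Z)) (@chd_open j) (@chf_C1 j) dx
  (chM_linear j _) (fun u => chMK u dx) H HF.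
rewrite xZ in dH.
have [dc _] := @C1_cj R n j Z h.
have := @is_diff_comp _ _ _ _ (cj j) (dcj j Z) H (chM j (coneG Z)) Z dc dH => hd.
have hd2 : is_diff Z coneG (chM j (coneG Z) \o dcj j Z).
  apply: near_is_diff hd; near=> Y; rewrite /H /= /coneG.
  have hY : hN Y j != 0 by near: Y; apply: open_nbhs_nbhs; split => //; exact: hN_open. by rewrite cpt_aff_cj.
suff <- : chM j (coneG Z) \o dcj j Z = conedG j Z by [].
by apply/funext => v; rewrite conedG_chM.
Unshelve. all: by end_near. Qed.

Lemma coneG_cont Z : cone Z -> {for Z, continuous coneG}.
Proof.
move=> CZ; have [Z0 _] := CZ; have [j hj] := exists_hN Z0.
by have [d _] := @coneG_is_diff j Z (conj CZ hj); exact: differentiable_continuous.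
Qed.

Lemma isC1_cs (U : normedModType R) m (A : set U) (a b : U -> R) (g : U -> 'M[R]_(m, 2)) :
  isC1 A a -> isC1 A b -> isC1 A g -> isC1 A (fun x => cs (a x) (b x) (g x)).
Proof.
move=> ha hb hg; apply: isC1_mx => i c; case: (ord2P c) => ->.
  under eq_fun do rewrite cs1E. by apply: isC1_add; apply: isC1_mul => //; exact: isC1_entry.
under eq_fun do rewrite cs0E.
by apply: isC1_sub; apply: isC1_mul => //; exact: isC1_entry.
Qed.

Lemma isC1_ins (U : normedModType R) (A : set U) j (g : U -> E) : isC1 A g -> isC1 A (fun x => ins j (g x)).
Proof.
move=> hg; apply: isC1_mx => i c; case: (unliftP j i) => [k ->|->].
  by under eq_fun do rewrite ins_lift; exact: isC1_entry.
by under eq_fun do rewrite ins_j; exact: isC1_cst.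
Qed.

Lemma conej_neq0 j Z : conej j Z -> Z != 0. Proof. by move=> [[]]. Qed.

Lemma coneG_C1j j : C1 (conej j) coneG (conedG j).
Proof.
move=> Z CZ; split; first exact: coneG_is_diff.
have cY u : {for Z, continuous (coneY j u)}.
  have cD : {for Z, continuous (fun Z => dchf j (coneG Z) u)}.
    have [CZ' h] := CZ; have [dx _] := chf_coneG CZ' h.
    apply: (@cont_comp V E E coneG ((dchf j)^~ u)); first exact: coneG_cont. exact: isC1_cont (@chf_C2 j u) dx.
  apply: cont_mx => i b. have ci : {for Z, continuous (fun Z => ins j (dchf j (coneG Z) u))}.
    apply: cont_mx => i' b'; case: (unliftP j i') => [k ->|->].
      by apply: (@cont_ext _ _ (fun Z => dchf j (coneG Z) u k b')) => [|Y]; [exact: cont_entry|rewrite ins_lift].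
    by apply: (@cont_ext _ _ (fun=> 0)) => [|Y]; [exact: cont_cst|rewrite ins_j].
  have cc c d : {for Z, continuous (fun Z : V => Z j c * ins j (dchf j (coneG Z) u) i d)}.
    by apply: (@continuousM _ _ (fun Z : V => Z j c)); [exact: cont_coord|exact: cont_entry].
  case: (ord2P b) => ->.
    apply: (@cont_ext _ _ (fun Z : V => Z j ord0 * ins j (dchf j (coneG Z) u) i ord_max
       + Z j ord_max * ins j (dchf j (coneG Z) u) i ord0)) => [|Y]; last by rewrite cs1E.
    by apply: (@continuousD _ _ _ (fun Z : V => Z j ord0 * ins j (dchf j (coneG Z) u) i ord_max)).
  apply: (@cont_ext _ _ (fun Z : V => Z j ord0 * ins j (dchf j (coneG Z) u) i ord0
       - Z j ord_max * ins j (dchf j (coneG Z) u) i ord_max)) => [|Y]; last by rewrite cs0E.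
  by apply: (@continuousB _ _ _ (fun Z : V => Z j ord0 * ins j (dchf j (coneG Z) u) i ord0)).
move=> v.
have cO u : {for Z, continuous (fun Z => Omega Z (coneY j u Z) v)}.
  apply: (@cont_bil _ _ _ _ _ (fun Z u => Omega Z u v)) => //.
    by move=> Y; have [_] := Omega_lin Y; exact.
  move=> w; apply: (@isC1_cont _ _ _ (conej j)) => //.
  by apply: isC1_Omega; [exact: conej_neq0|exact: isC1_id|exact: isC1_cst|exact: isC1_cst].
apply: cont_mx => k b; case: (ord2P b) => ->.
  by apply: (@cont_ext _ _ (fun Z => Omega Z (coneY j (ex k) Z) v)) => // Y; rewrite mxE.
apply: (@cont_ext _ _ (fun Z => - Omega Z (coneY j (ey k) Z) v)) => [|Y]; last by rewrite mxE.
exact: (@continuousN _ _ _ (fun Z => Omega Z (coneY j (ey k) Z) v)).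
Qed.

Definition dG Z v := 'D_v coneG Z.

Lemma coneG_C1 : C1 cone coneG dG.
Proof.
apply: C1_local => Z CZ; have [Z0 _] := CZ; have [j hj] := exists_hN Z0.
by exists (conej j); [split; [exact: conej_open|split]|exists (conedG j); exact: coneG_C1j].
Qed.

Lemma coneG_D j Z v : conej j Z -> dG Z v = conedG j Z v.
Proof. by move=> CZ; rewrite /dG; have [_ ->] := C1_derive v (@coneG_C1j j) CZ. Qed.

Lemma coneG_C2 v : isC1 cone (dG^~ v).
Proof.
eexists; apply: C1_local => Z CZ; have [Z0 _] := CZ; have [j hj] := exists_hN Z0.
exists (conej j); first by split; [exact: conej_open|split].
apply: (@isC1_eq _ _ _ _ (fun Z => conedG j Z v)); [exact: conej_open|by move=> Y CY; rewrite (@coneG_D j)|].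
have GC : isC1 (conej j) coneG by exists (conedG j); exact: coneG_C1j.
have hY u : isC1 (conej j) (coneY j u).
  apply: isC1_cs; [exact/isC1_entry/isC1_id|exact/isC1_entry/isC1_id|].
  apply: isC1_ins; apply: (isC1_comp (@chd_open j) GC (@chf_C2 j u)) => Y [CY hY]. by have [] := chf_coneG CY hY.
have hO u : isC1 (conej j) (fun Z => Omega Z (coneY j u Z) v).
  by apply: isC1_Omega => //; [exact: conej_neq0|exact: isC1_id|exact: isC1_cst].
apply: isC1_mx => k b; case: (ord2P b) => ->.
  by apply: (@isC1_eq _ _ _ _ (fun Z => Omega Z (coneY j (ex k) Z) v)) => // [|Y _]; [exact: conej_open|rewrite mxE].
apply: (@isC1_eq _ _ _ _ (fun Z => - Omega Z (coneY j (ey k) Z) v)) => [|Y _|]; [exact: conej_open|by rewrite mxE|].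
exact: isC1_opp.
Qed.

Lemma coneG_symp Z u v : cone Z -> omega_st (dG Z u) (dG Z v) = Omega Z u v.
Proof.
move=> CZ; have [Z0 _] := CZ; have [j hj] := exists_hN Z0.
have [dx xZ] := chf_coneG CZ hj.
have key w : dchf j (coneG Z) (dG Z w) = dcj j Z w.
  rewrite (@coneG_D j) ?conedG_chM//.
  apply: (@linear_left_inverse _ _ _ (fun u => dchf j (coneG Z) u) (chM j (coneG Z))).
  - exact: (C1_linear (@chf_C1 j) dx).
  - exact: chM_linear.
  - by move=> w'; exact: chMK.
apply: (etrans (esym (@chf_symp j (coneG Z) (dG Z u) (dG Z v) dx))).
have e3 (a a' b b' c c' : E) : a = a' -> b = b' -> c = c' -> omega_FS a b c = omega_FS a' b' c' by move=> -> -> ->.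
exact: (etrans (e3 _ _ _ _ _ _ xZ (key u) (key v)) (@FS_chart R n j Z u v hj)).
Qed.

Lemma cone_cs a b Z : a ^+ 2 + b ^+ 2 != 0 -> cone Z -> cone (cs a b Z).
Proof. by move=> ab [Z0 WZ]; split; [exact: cs_neq0|rewrite cpt_cs]. Qed.

Lemma coneG_cs a b Z : a ^+ 2 + b ^+ 2 != 0 -> Z != 0 -> coneG (cs a b Z) = coneG Z.
Proof. by move=> ab Z0; rewrite /coneG cpt_cs. Qed.

Lemma cone_fibre Z Z' : cone Z -> cone Z' -> coneG Z = coneG Z' -> exists a b, a ^+ 2 + b ^+ 2 != 0 /\ Z' = cs a b Z.
Proof.
move=> CZ CZ' e; have [_ h] := coneGP CZ; have [_ h'] := coneGP CZ'.
by apply: cpt_inj; [case: CZ|case: CZ'|rewrite -h -h' e].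
Qed.

Definition lift_at j (y : E) : V := aff j (chf j y).

Lemma lift_at_cone j y : chd j y -> cone (lift_at j y) /\ coneG (lift_at j y) = y.
Proof.
move=> dy; have [Wy _] := dy; have h := chf_cpt dy.
split; last by apply: coneG_eq; rewrite ?h.
by split; [exact: aff_neq0|rewrite h; exists y].
Qed.

Lemma lift_at_C1 j : isC1 (chd j) (lift_at j).
Proof.
have h : isC1 (chd j) (chf j) by eexists; exact: (@chf_C1 j).
apply: isC1_mx => i b; case: (unliftP j i) => [k ->|->].
  by under eq_fun do rewrite aff_lift; exact: isC1_entry.
by under eq_fun do rewrite mxE unlift_none; exact: isC1_cst.
Qed.

Lemma chd_exists y : W y -> exists j, chd j y.
Proof.
move=> Wy; have [j hj] := exists_hN (hZ_neq0 (f y)).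
by exists j; split => //=; apply/chart_domP.
Qed.

End Cone.
(** * Cutoff functions *)

Section Profile.
Context {R : realType}.

Lemma isC1_comp1 (U W : normedModType R) (A : set U) (f : U -> R) (g : R -> W) :
  isC1 A f -> isC1 setT g -> isC1 A (fun x => g (f x)).
Proof. by move=> [df hf] [dg hg]; eexists; exact: (C1_comp1 openT hf hg). Qed.

Lemma isC1_scale (U : normedModType R) (A : set U) k (f : U -> R) : isC1 A f -> isC1 A (fun x => k * f x).
Proof. by move=> [df hf]; eexists; exact: C1_scale hf. Qed.

Lemma C1_exp (U : normedModType R) (A : set U) (f : U -> R) df k :
  C1 A f df -> C1 A (fun x => f x ^+ k.+1) (fun x v => df x v * (k.+1%:R * f x ^+ k)).
Proof.
move=> hf; elim: k => [|k IH].
  by apply: (C1_ext hf) => x // v; rewrite expr0 !mulr1.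
apply: (C1_ext (C1_mul hf IH)) => [x|x v]; first by rewrite [RHS]exprS.
by rewrite -(natr1 k.+1) !exprS; ring.
Qed.

Definition tpow k (x : R) : R := Num.max x 0 ^+ k.

Lemma tpow_ge0 k x : 0 <= tpow k x.
Proof. by rewrite exprn_ge0// le_max lexx orbT. Qed.

Lemma tpow_eq0 k x : x <= 0 -> tpow k.+1 x = 0.
Proof. by move=> h; rewrite /tpow max_r// expr0n. Qed.

Lemma tpow_gt0 k x : 0 < x -> 0 < tpow k x.
Proof. by move=> h; rewrite /tpow max_l ?ltW// exprn_gt0. Qed.

Lemma tpowM k s x : 0 <= s -> tpow k (s * x) = s ^+ k * tpow k x.
Proof. by move=> s0; rewrite /tpow -exprMn maxr_pMr// mulr0. Qed.

Lemma tpow_cont k : continuous (tpow k).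
Proof.
move=> x; rewrite /tpow; elim: k => [|k IH]; first exact: cont_cst.
under eq_fun do rewrite exprS; apply: (@continuousM R R (fun x => Num.max x 0)) => //.
by apply: continuous_max; [exact: cvg_id|exact: cont_cst].
Qed.

Lemma C1_tpow k : C1 setT (tpow k.+2) (fun x v => v * (k.+2%:R * tpow k.+1 x)).
Proof.
have hid A : C1 A (fun x : R => x) (fun _ v => v) by exact: C1_id.
move=> x _; split; last first.
  move=> v; apply: cont_mulc. by apply: cont_mulc; exact: tpow_cont.
have [x0|x0|->] := ltgtP x 0.
- apply: (@near_is_diff _ _ _ (fun=> 0)).
    near=> y; rewrite tpow_eq0// ltW//; near: y; exact: lt_nbhsl.
  rewrite tpow_eq0 ?ltW//. have -> : (fun v : R => v * (k.+2%:R * 0)) = (fun=> 0) by apply/funext => v; rewrite !mulr0.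
  by have [] := @C1_cst R R R setT 0 x I.
- apply: (@near_is_diff _ _ _ (fun y : R => y ^+ k.+2)).
    near=> y; rewrite /tpow max_l// ltW//; near: y; exact: lt_nbhsr.
  by have [+ _] := C1_exp k.+1 (hid setT) (I : setT x); rewrite /tpow max_l ?ltW.
rewrite tpow_eq0//; have -> : (fun v : R => v * (k.+2%:R * 0)) = (fun=> 0) by apply/funext => v; rewrite !mulr0.
apply/is_diffP; split => [a u v|y|e e0]; [by rewrite scaler0 addr0|exact: cont_cst|].
near=> h; rewrite addr0 (tpow_eq0 _ (lexx 0)) !subr0.
have h1 : `|h| < 1 by near: h; exact: (@nbhs0_lt _ R^o _ ltr01).
have he : `|h| < e by near: h; exact: (@nbhs0_lt _ R^o _ e0).
have hm : `|Num.max h 0| <= `|h| by case: (leP h 0) => // _; rewrite normr0.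
rewrite /tpow normrX !exprS mulrA; apply: (@le_trans _ _ (`|h| * `|h| * 1)).
  by apply: ler_pM; rewrite ?mulr_ge0 ?exprn_ge0 ?ler_pM ?exprn_ile1// (le_trans hm)// ltW.
by rewrite mulr1 ler_wpM2r// ltW.
Unshelve. all: by end_near. Qed.

Lemma isC1_tpow k : isC1 setT (tpow k.+2).
Proof. by eexists; exact: C1_tpow. Qed.

(** Truncated cubes make the cutoff C2, so that [cut1], its derivative, is C1 and can enter a
    differentiable form. The quotient depends only on ratios of distances, hence the exact scaling
    rule [cutM]. *)
Definition cut (u1 u2 u : R) : R := tpow 3 (u2 - u) / (tpow 3 (u2 - u) + tpow 3 (u - u1)).
Definition cut1 (u1 u2 u : R) : R :=
  - (3 * tpow 2 (u2 - u) * tpow 3 (u - u1) + tpow 3 (u2 - u) * (3 * tpow 2 (u - u1)))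
  / (tpow 3 (u2 - u) + tpow 3 (u - u1)) ^+ 2.

Lemma cutM s u1 u2 u : 0 < s -> cut (s * u1) (s * u2) (s * u) = cut u1 u2 u.
Proof.
move=> s0; rewrite /cut -!mulrBr !tpowM ?ltW// -mulrDr invfM mulrACA divff ?mul1r//.
by rewrite expf_neq0// gt_eqF.
Qed.

Variables (u1 u2 : R).
Hypothesis u12 : u1 < u2.

Lemma cut_den u : 0 < tpow 3 (u2 - u) + tpow 3 (u - u1).
Proof.
have [h|h] := ltP u u2; first by rewrite ltr_wpDr ?tpow_ge0// tpow_gt0 ?subr_gt0.
by rewrite ltr_wpDl ?tpow_ge0// tpow_gt0 ?subr_gt0// (lt_le_trans u12).
Qed.

Lemma cut_left u : u <= u1 -> cut u1 u2 u = 1.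
Proof.
move=> h; have := cut_den u; rewrite /cut (@tpow_eq0 2 (u - u1)) ?subr_le0// addr0 => d.
by rewrite divff// gt_eqF.
Qed.

Lemma cut_right u : u2 <= u -> cut u1 u2 u = 0.
Proof. by move=> h; rewrite /cut tpow_eq0 ?subr_le0// mul0r. Qed.

Lemma cut_ge0 u : 0 <= cut u1 u2 u.
Proof. by rewrite divr_ge0 ?tpow_ge0// ltW// cut_den. Qed.

Lemma cut_le1 u : cut u1 u2 u <= 1.
Proof. by rewrite ler_pdivrMr ?cut_den// mul1r lerDl tpow_ge0. Qed.

Lemma cut1_le0 u : cut1 u1 u2 u <= 0.
Proof.
have h k x : 0 <= 3 * tpow k x by rewrite mulr_ge0 ?tpow_ge0.
by rewrite /cut1 mulNr oppr_le0 divr_ge0 ?sqr_ge0// addr_ge0// mulr_ge0 ?tpow_ge0.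
Qed.

Lemma cut1_supp u : cut1 u1 u2 u != 0 -> u1 <= u <= u2.
Proof.
apply: contraR; rewrite negb_and -!ltNge /cut1 => /orP[h|h].
  by rewrite !(@tpow_eq0 _ (u - u1)) ?subr_le0 ?ltW// !mulr0 addr0 oppr0 mul0r.
by rewrite !(@tpow_eq0 _ (u2 - u)) ?subr_le0 ?ltW// mulr0 !mul0r addr0 oppr0 mul0r.
Qed.

Lemma cut1_lt0 u : u1 < u < u2 -> cut1 u1 u2 u < 0.
Proof.
move=> /andP[h1 h2]; rewrite /cut1 mulNr oppr_lt0 divr_gt0 ?exprn_gt0 ?cut_den//.
have h k x : 0 < x -> 0 < 3 * tpow k x by move=> x0; rewrite mulr_gt0// tpow_gt0.
by rewrite addr_gt0// mulr_gt0 ?h ?tpow_gt0 ?subr_gt0.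
Qed.

Lemma C1_cut : C1 setT (cut u1 u2) (fun x v => v * cut1 u1 u2 x).
Proof.
have hid : C1 setT (fun x : R => x) (fun _ v => v) by exact: C1_id.
have hA := C1_comp1 openT (C1_sub (C1_cst setT u2) hid) (C1_tpow 1) (fun _ _ => I).
have hB := C1_comp1 openT (C1_sub hid (C1_cst setT u1)) (C1_tpow 1) (fun _ _ => I).
have hD x : setT x -> tpow 3 (u2 - x) + tpow 3 (x - u1) != 0 by rewrite gt_eqF ?cut_den.
apply: (C1_ext (C1_mul hA (C1_inv hD (C1_add hA hB)))) => // x v.
rewrite /cut1 /GRing.scale/= !subr0 sub0r.
by field; rewrite hD.
Qed.

Lemma isC1_cut1 : isC1 setT (cut1 u1 u2).
Proof.
have hA k : isC1 setT (fun x => tpow k.+2 (u2 - x)).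
  by apply: isC1_comp1; [apply: isC1_sub; [exact: isC1_cst|exact: isC1_id]|exact: isC1_tpow].
have hB k : isC1 setT (fun x => tpow k.+2 (x - u1)).
  by apply: isC1_comp1; [apply: isC1_sub; [exact: isC1_id|exact: isC1_cst]|exact: isC1_tpow].
have hD : isC1 setT (fun x => tpow 3 (u2 - x) + tpow 3 (x - u1)) by exact: isC1_add.
apply: isC1_mul; last first.
  apply: isC1_inv; first by move=> x _; rewrite expf_neq0// gt_eqF// cut_den.
  by under eq_fun do rewrite expr2; exact: isC1_mul.
by apply/isC1_opp/isC1_add; apply: isC1_mul => //; exact: isC1_scale.
Qed.

Lemma cut_cont x : {for x, continuous (cut u1 u2)}.
Proof. exact: (C1_cont C1_cut I). Qed.

Lemma cut1_cont x : {for x, continuous (cut1 u1 u2)}.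
Proof. exact: (isC1_cont isC1_cut1 I). Qed.

Lemma cut_bound : exists2 c : R, 0 < c & forall u, `|cut1 u1 u2 u| <= c.
Proof.
have /compact_bounded[c [_ hc]] : compact (cut1 u1 u2 @` `[u1, u2]%classic).
  apply: continuous_compact; last exact: segment_compact. by apply: continuous_subspaceT; exact: cut1_cont.
exists (`|c| + 1) => [|u]; first by rewrite ltr_wpDl.
have [->|/cut1_supp h] := eqVneq (cut1 u1 u2 u) 0; first by rewrite normr0 addr_ge0.
apply: (hc (`|c| + 1)); first by rewrite (le_lt_trans (ler_norm c))// ltrDl.
by exists u => //=; rewrite in_itv.
Qed.

End Profile.

(** * Symplectic coordinates on an open cone *)

Section DerivativeRules.
Context {R : realType}.
Implicit Types U W : normedModType R.

Lemma D_eq0 U W (f : U -> W) x v : (\forall h \near (0 : R), f (h *: v + x) = f x) -> 'D_v f x = 0.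
Proof.
move=> h; rewrite /derive; apply: norm_lim_near_cst; apply: nbhs_dnbhs.
by apply: filterS h => t /= ->; rewrite subrr scaler0.
Qed.

Lemma D_of_C1 U W (A : set U) (f : U -> W) df x v : C1 A f df -> A x -> 'D_v f x = df x v.
Proof. by move=> h Ax; have [_ ->] := C1_derive v h Ax. Qed.

Lemma isC1_local U W (A : set U) (f : U -> W) :
  (forall x, A x -> exists2 B : set U, open B /\ B x & isC1 B f) -> isC1 A f.
Proof. by move=> h; eexists; exact: C1_local. Qed.

Lemma isC1_near_eq U W (A : set U) (f : U -> W) :
  (forall x, A x -> exists (B : set U) g, [/\ open B, B x, isC1 B g & forall y, B y -> g y = f y]) -> isC1 A f.
Proof.
move=> h; apply: isC1_local => x Ax; have [B [g [oB Bx hg gf]]] := h x Ax.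
by exists B => //; exact: isC1_eq gf hg.
Qed.

(** Extension by 0 off [C]. It remains C1 on [A] when the support of [F] is contained in a set that
    is closed relative to [A] ([ext0_isC1]). *)
Definition ext0 {U W} (C : set U) (F : U -> W) (x : U) : W := if `[< C x >] then F x else 0.

Lemma ext0_in U W (C : set U) (F : U -> W) x : C x -> ext0 C F x = F x.
Proof. by move=> h; rewrite /ext0 asboolT. Qed.

Lemma ext0_out U W (C : set U) (F : U -> W) x : ~ C x -> ext0 C F x = 0.
Proof. by move=> h; rewrite /ext0 asboolF. Qed.

Lemma ext0_D_in U W (C : set U) (F : U -> W) x v : open C -> C x -> 'D_v (ext0 C F) x = 'D_v F x.
Proof.
move=> oC Cx; apply: near_eq_derive; near=> y; apply: ext0_in.
by near: y; exact: open_nbhs_nbhs.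
Unshelve. all: by end_near. Qed.

Lemma ext0_near U W (C S : set U) (F : U -> W) (x : U) :
  (forall x, C x -> F x != 0 -> S x) -> (\forall y \near x, ~ (C y /\ S y)) -> \forall y \near x, ext0 C F y = 0.
Proof.
move=> FS; apply: filterS => y hy; have [Cy|/ext0_out->//] := pselect (C y).
by rewrite ext0_in//; apply: contrapT => /eqP Fy; apply: hy; split => //; exact: FS.
Qed.

Lemma ext0_isC1 U W (C S A : set U) (F : U -> W) : open C -> isC1 C F -> (forall x, C x -> F x != 0 -> S x) ->
  (forall x, A x -> ~ (C x /\ S x) -> \forall y \near x, ~ (C y /\ S y)) -> isC1 A (ext0 C F).
Proof.
move=> oC hF FS hS; apply: isC1_near_eq => x Ax; have [Cx|Cx] := pselect (C x).
  by exists C, F; split => // y Cy; rewrite ext0_in.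
have h : \forall y \near x, ext0 C F y = 0 by apply: (ext0_near FS); apply: hS => // -[].
exists (interior [set y | ext0 C F y = 0]), (fun=> 0); split => //.
- exact: open_interior.
- exact: isC1_cst.
- by move=> y /interior_subset.
Qed.

Lemma ext0_D_out U W (C S A : set U) (F : U -> W) x v : (forall x, C x -> F x != 0 -> S x) ->
  (forall x, A x -> ~ (C x /\ S x) -> \forall y \near x, ~ (C y /\ S y)) -> A x -> ~ C x -> 'D_v (ext0 C F) x = 0.
Proof.
move=> FS hS Ax Cx; rewrite (@near_eq_derive _ _ _ _ (fun=> 0)) ?derive_cst//.
by apply: (ext0_near FS); apply: hS => // -[].
Qed.

End DerivativeRules.

(** * Symplectic coordinates and the pulled-back Liouville form *)

Section SympCoord.
Context {R : realType} (n : nat).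
Local Notation V := 'M[R]_(n.+1, 2).
Local Notation E := 'M[R]_(n, 2).

Definition usq (G : V -> E) Z : R := sq (G Z).

(** The common features of the inverse of an embedded shell and of the inverse of the ball
    embedding. [sc_fibre] and [sc_lift] make [G] a submersion whose fibres are punctured complex
    lines; [sc_closed] lets functions supported in a closed subshell be extended by 0. *)
Record symp_coord (C : set V) (G : V -> E) (a b : R) : Prop := SympCoord { sc_open : open C;
  sc_neq0 : forall Z, C Z -> Z != 0;
  sc_cs : forall x y Z, x ^+ 2 + y ^+ 2 != 0 -> C Z -> C (cs x y Z) /\ G (cs x y Z) = G Z; sc_C1 : isC1 C G;
  sc_C2 : forall v, isC1 C (fun Z => 'D_v G Z);
  sc_symp : forall Z u v, C Z -> omega_st ('D_u G Z) ('D_v G Z) = Omega Z u v;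

  sc_range : forall Z, C Z -> a < usq G Z < b;
  sc_fibre : forall Z Z', C Z -> C Z' -> G Z = G Z' -> exists x y, x ^+ 2 + y ^+ 2 != 0 /\ Z' = cs x y Z;
  sc_lift : forall x, a < sq x < b -> exists (B : set E) (s : E -> V),
    [/\ open B, B x, isC1 B s & forall y, B y -> C (s y) /\ G (s y) = y];
  sc_closed : forall s t Z, a < s -> t < b -> Z != 0 -> ~ (C Z /\ s <= usq G Z <= t) ->
    \forall Y \near Z, ~ (C Y /\ s <= usq G Y <= t) }.

Variables (C : set V) (G : V -> E) (a b : R).
Hypothesis sc : symp_coord C G a b.

Let oC := sc_open sc.
Local Notation dG Z v := ('D_v G Z).

Lemma sc_dG : C1 C G (fun Z v => dG Z v).
Proof. exact: isC1_D (sc_C1 sc). Qed.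

Lemma sc_dG_lin Z : C Z -> linear (fun v => dG Z v).
Proof. by move=> CZ; exact: (C1_linear sc_dG CZ). Qed.

Lemma sc_dG_cs Z x y : C Z -> dG Z (cs x y Z) = 0.
Proof.
move=> CZ; apply: D_eq0.
have hc : {for (0 : R), continuous (fun h : R => (1 + h * x) ^+ 2 + (h * y) ^+ 2)}.
  have h1 z : {for (0 : R), continuous (fun h : R => h * z)}.
    by apply: (@continuousM _ _ (fun h : R => h)); [exact: cvg_id|exact: cont_cst].
  have h2 (f : R -> R) : {for 0, continuous f} -> {for 0, continuous (fun h => f h ^+ 2)}.
    by move=> hf; apply: (@cont_ext _ _ (fun h => f h * f h)) => [|h]; [exact: continuousM|rewrite expr2].
  apply: (@continuousD _ _ _ (fun h : R => (1 + h * x) ^+ 2)); apply: h2 => //.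
  by apply: (@continuousD _ _ _ (fun _ : R => 1 : R)) => //; exact: cont_cst.
near=> h; rewrite (_ : h *: _ + Z = cs (1 + h * x) (h * y) Z); last first.
  by apply: mx2P => k; rewrite cs0E cs1E !mxE/=; split; ring.
apply: (sc_cs sc _ CZ).2; near: h.
have : \forall h \near (0 : R), 0 < (1 + h * x) ^+ 2 + (h * y) ^+ 2.
  have h0 : 0 < (1 + 0 * x) ^+ 2 + (0 * y) ^+ 2 by rewrite !mul0r addr0 expr1n expr0n/= addr0.
  exact: (hc _ (lt_nbhsr h0)).
by apply: filterS => h /lt0r_neq0.
Unshelve. all: by end_near. Qed.

Lemma sc_surj Z u : C Z -> exists Y, dG Z Y = u.
Proof.
move=> CZ; have [B [s [oB Bx [ds hs] sK]]] := sc_lift sc (sc_range sc CZ).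
have [Cs Gs] := sK _ Bx; have [x [y [xy eZ]]] := sc_fibre sc Cs CZ Gs.
have hc : C1 setT (@cs R n.+1 x y) (fun _ v => cs x y v).
  by apply: C1_lin; [exact: cs_linear|apply: linear_cont; exact: cs_linear].
have h1 := C1_comp openT hs hc (fun _ _ => I).
have h2 := C1_comp oC h1 sc_dG (fun z Bz => (sc_cs sc xy (sK z Bz).1).1).
have h3 : C1 B (fun z : E => z) (fun _ v => v) by exact: C1_id.
exists (cs x y (ds (G Z) u)).
transitivity ('D_(cs x y (ds (G Z) u)) G (cs x y (s (G Z)))); first by rewrite -eZ.
apply: (@C1_unique _ _ _ B (fun z => G (cs x y (s z))) _ (fun _ v => v) (G Z) u h2 _ Bx); apply: (eq_C1 oB _ _ h3) => // z Bz.
by rewrite (sc_cs sc xy (sK z Bz).1).2 (sK z Bz).2.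
Qed.

Lemma sc_dGZ Z : C Z -> dG Z Z = 0.
Proof. by move=> CZ; rewrite -[X in 'D_X _ _](cs1 Z); exact: sc_dG_cs. Qed.

Lemma sc_dGJ Z : C Z -> dG Z (Jm Z) = 0.
Proof.
move=> CZ; rewrite (_ : Jm Z = cs 0 1 Z); first exact: sc_dG_cs.
by rewrite /cs scale0r add0r scale1r.
Qed.

Lemma sc_dG_sym Z u v : C Z -> 'D_u (fun Z => dG Z v) Z = 'D_v (fun Z => dG Z u) Z.
Proof.
move=> CZ; apply/matrixP => i j.
have h1 : C1 C (fun Z => G Z i j) (fun Z v => dG Z v i j) by exact: C1_entry sc_dG.
have h2 w : C1 C (fun Z => dG Z w i j) (fun Z u => ('D_u (fun Z => dG Z w) Z) i j).
  exact/C1_entry/(isC1_D oC (sc_C2 sc w)).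
exact: (C2_sym u v oC h1 h2 CZ).
Qed.

Lemma isC1_usq : isC1 C (usq G).
Proof. exact: isC1_ip (sc_C1 sc) (sc_C1 sc). Qed.

Lemma usq_D Z v : C Z -> 'D_v (usq G) Z = 2 * ip (G Z) (dG Z v).
Proof.
move=> CZ; rewrite (D_of_C1 v (C1_ip sc_dG sc_dG) CZ) [ip (dG Z v) _]ipC; ring.
Qed.

(* The pullback by [G] of the standard primitive of [omega_st]. *)
Definition lamG Z v : R := 1 / 2 * omega_st (G Z) (dG Z v).

Lemma lamG_lin Z : C Z -> linear (lamG Z).
Proof.
move=> CZ k u v; rewrite /lamG !omega_ip (sc_dG_lin CZ).
by rewrite ipDr ipZr mulrDr mulrCA.
Qed.

Lemma lamG_C1 v : isC1 C (lamG^~ v).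
Proof.
apply: isC1_scale; under eq_fun do rewrite omega_ip.
by apply: isC1_ip; [apply: isC1_J; exact: (sc_C1 sc)|exact: (sc_C2 sc)].
Qed.

Lemma lamG_D Z u v : C Z -> 'D_u (lamG^~ v) Z =
  1 / 2 * (omega_st (dG Z u) (dG Z v) + omega_st (G Z) ('D_u (fun Z => dG Z v) Z)).
Proof.
move=> CZ.
have hJ : C1 C (fun Z => Jm (G Z)) (fun Z v => Jm (dG Z v)).
  have hl : C1 setT (@Jm R n) (fun _ v => Jm v).
    by apply: C1_lin; [exact: Jm_linear|apply: linear_cont; exact: Jm_linear].
  exact: (C1_comp openT sc_dG hl (fun _ _ => I)).
have h := C1_scale (1 / 2) (C1_ip hJ (isC1_D oC (sc_C2 sc v))).
rewrite (@near_eq_derive _ _ _ _ (fun Z => 1 / 2 * ip (Jm (G Z)) (dG Z v))); last first.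
  by near=> Y; rewrite /lamG omega_ip.
by rewrite (D_of_C1 u h CZ) !omega_ip.
Unshelve. all: by end_near. Qed.

Lemma lamG_ext Z u v : C Z -> 'D_u (lamG^~ v) Z - 'D_v (lamG^~ u) Z = Omega Z u v.
Proof.
move=> CZ; apply: (etrans (congr2 (fun p q => p - q) (lamG_D u v CZ) (lamG_D v u CZ))).
rewrite (sc_dG_sym u v CZ) (sc_symp sc u v CZ) (sc_symp sc v u CZ) (Omega_anti Z v u).
have aux (x y : R) : 1 / 2 * (x + y) - 1 / 2 * (- x + y) = x by field.
exact: aux.
Qed.

Lemma lamG_Z Z : C Z -> lamG Z Z = 0.
Proof. by move=> CZ; rewrite /lamG sc_dGZ// omega_ip ip0r mulr0. Qed.

Lemma lamG_J Z : C Z -> lamG Z (Jm Z) = 0.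
Proof. by move=> CZ; rewrite /lamG sc_dGJ// omega_ip ip0r mulr0. Qed.

(** [Y] is a lift of the Liouville field [x / 2] of the coordinate space. *)
Lemma lamG_Omega Z : C Z -> exists2 Y, dG Z Y = 1 / 2 *: G Z & forall v, lamG Z v = Omega Z Y v.
Proof.
move=> CZ; have [Y hY] := sc_surj (1 / 2 *: G Z) CZ.
exists Y => // v; rewrite -(sc_symp sc)// hY /lamG !omega_ip.
by rewrite JmZ ipZl.
Qed.

Lemma sc_ext_isC1 (W : normedModType R) s t (F : V -> W) : a < s -> t < b -> isC1 C F ->
  (forall Z, C Z -> F Z != 0 -> s <= usq G Z <= t) -> isC1 [set Z | Z != 0] (ext0 C F).
Proof.
move=> hs ht hF FS; apply: (ext0_isC1 oC hF FS) => Z Z0; exact: (sc_closed sc).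
Qed.

Lemma sc_ext_D_out (W : normedModType R) s t (F : V -> W) Z v : a < s -> t < b ->
  (forall Z, C Z -> F Z != 0 -> s <= usq G Z <= t) -> Z != 0 -> ~ C Z -> 'D_v (ext0 C F) Z = 0.
Proof.
move=> hs ht FS Z0 CZ; apply: (@ext0_D_out _ _ _ _ _ [set Z | Z != 0] F Z v FS) => // Y Y0.
exact: (sc_closed sc).
Qed.

End SympCoord.

(** * Coordinates from an embedded shell *)

Section SympCoordCone.
Context {R : realType} (n : nat).
Local Notation V := 'M[R]_(n.+1, 2).
Local Notation E := 'M[R]_(n, 2).

Lemma cont_Jm (T : topologicalType) m (f : T -> 'M[R]_(m, 2)) x :
  {for x, continuous f} -> {for x, continuous (fun y => Jm (f y))}.
Proof. by move=> hf; apply: (@cont_comp T _ _ f (@Jm R m)) => //; apply: linear_cont; exact: Jm_linear. Qed.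

Lemma cont_ip (T : topologicalType) m (f g : T -> 'M[R]_(m, 2)) x :
  {for x, continuous f} -> {for x, continuous g} -> {for x, continuous (fun y => ip (f y) (g y))}.
Proof.
move=> hf hg; apply: cont_sum => k.
apply: (@continuousD _ _ _ (fun y => f y k ord0 * g y k ord0)).
  by apply: (@continuousM _ _ (fun y => f y k ord0)); exact: cont_entry.
by apply: (@continuousM _ _ (fun y => f y k ord_max)); exact: cont_entry.
Qed.

Lemma ip_coord_le m (x : 'M[R]_(m, 2)) i j : x i j ^+ 2 <= sq x.
Proof.
rewrite /ip (bigD1 i)//= -!expr2 -addrA; have h : 0 <= \sum_(k | k != i) (x k ord0 * x k ord0 + x k ord_max * x k ord_max).
  by apply: sumr_ge0 => k _; rewrite -!expr2 addr_ge0 ?sqr_ge0.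
by case: (ord2P j) => ->; [rewrite addrCA|]; rewrite lerDl addr_ge0 ?sqr_ge0.
Qed.

Lemma norm_le_ip m (x : 'M[R]_(m, 2)) c : 0 <= c -> sq x <= c ^+ 2 -> `|x| <= c.
Proof.
move=> c0 h; apply: mx_norm_le => // i j.
by rewrite -ler_sqr ?nnegrE// -normrX ger0_norm ?sqr_ge0// (le_trans (ip_coord_le x i j)).
Qed.

Lemma compact_shell m s t : compact [set x : 'M[R]_(m, 2) | s <= sq x <= t].
Proof.
pose c := Num.max t 1.
have c1 : 1 <= c by rewrite le_max lexx orbT.
apply: (subclosed_compact _ (@compact_ball_mx R m 2 c)).
  have -> : [set x : 'M[R]_(m, 2) | s <= sq x <= t] =
      (fun x : 'M[R]_(m, 2) => sq x) @^-1` [set u | s <= u] `&` (fun x : 'M[R]_(m, 2) => sq x) @^-1` [set u | u <= t].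
    by apply/seteqP; split => [x /= /andP[]|x /= [h1 h2]]; [split|apply/andP].
  by apply: closedI; apply: closed_comp => [x _|]; [exact: ip_cont|exact: closed_ge|exact: ip_cont|exact: closed_le].
move=> x /andP[_ h]; apply: norm_le_ip; first exact: le_trans c1.
rewrite (le_trans h)// expr2 (@le_trans _ _ c)//; first by rewrite le_max lexx.
by rewrite ler_peMl// (le_trans _ c1).
Qed.

(** The defect in the hermitian Cauchy-Schwarz inequality. For nonzero [Z] it vanishes exactly on
    the complex multiples of [Z], so equality of points in projective space becomes a continuous
    equation. *)
Definition defect (Z Y : V) : R := sq Z * sq Y - ip Z Y ^+ 2 - ip (Jm Z) Y ^+ 2.

Lemma cont_sq (T : topologicalType) (h : T -> R) x : {for x, continuous h} -> {for x, continuous (fun y => h y ^+ 2)}.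
Proof. by move=> c; apply: (@cont_ext _ _ (fun y => h y * h y)) => [|y]; [exact: continuousM|rewrite expr2]. Qed.

Lemma cont_defect (T : topologicalType) (f g : T -> V) x :
  {for x, continuous f} -> {for x, continuous g} -> {for x, continuous (fun y => defect (f y) (g y))}.
Proof.
move=> cf cg; have cJ := cont_Jm cf.
have h1 := @continuousM _ _ _ _ _ (cont_ip cf cf) (cont_ip cg cg).
have h2 := cont_sq (cont_ip cf cg); have h3 := cont_sq (cont_ip cJ cg).
exact: (@continuousB _ _ _ _ _ _ (@continuousB _ _ _ _ _ _ h1 h2) h3).
Qed.

Lemma defect_cs (Z : V) p q : defect Z (cs p q Z) = 0.
Proof.
rewrite /defect ip_cs /cs !ipDr !ipZr ip_JJ ip_J ip_Jself; ring.
Qed.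

Lemma defect_eq0 (Z Y : V) : Z != 0 -> defect Z Y = 0 -> exists p q, Y = cs p q Z.
Proof.
move=> Z0 d; have hZ := lt0r_neq0 (ip_gt0 Z0).
exists (ip Z Y / sq Z), (ip (Jm Z) Y / sq Z).
set p := ip Z Y / _; set q := ip (Jm Z) Y / _; apply/eqP; rewrite -subr_eq0; apply/eqP/ip_eq0.
rewrite (linB _ _ (ip_linr _)) ![ip (Y - _) _]ipC !(linB _ _ (ip_linr _)) ip_cs.
rewrite [ip (cs p q Z) Y]ipC [ip Y (cs _ _ _)](_ : _ = p * ip Z Y + q * ip (Jm Z) Y); last first.
  by rewrite /cs ipDr !ipZr ![ip Y _]ipC.
suff : (sq Z)^-1 * defect Z Y = 0 by rewrite /defect /p /q => <-; field.
by rewrite d mulr0.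
Qed.

Section Shell.
Variables (a b : R) (f : E -> CP R n).
Let W : set E := [set x | a < sq x < b].
Hypotheses (oW : open W) (fe : embedding_on W f) (fs : symplectic_on W f).

(** The image of a compact set is closed in projective space. Around each point of [K] a local lift
    stays non-proportional to vectors near [Z], because [defect] is continuous; compactness of [K]
    makes the neighbourhood of [Z] uniform. *)
Lemma cone_closed (K : set E) (Z : V) : compact K -> K `<=` W -> Z != 0 ->
  ~ (cone W f Z /\ K (coneG W f Z)) -> \forall Y \near Z, ~ (cone W f Y /\ K (coneG W f Y)).
Proof.
move=> cK KW Z0 hZ.
have cov : \forall Y \near Z, K `<=` (fun x => Y != 0 -> f x <> cpt Y).
  move: cK => /compact_near_coveringP cK; apply: (cK V (nbhs Z) (fun Y x => Y != 0 -> f x <> cpt Y)) => x Kx.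
  have [j dx] := @chd_exists R n W f x (KW _ Kx). have [cl gl] := @lift_at_cone R n W f fe j x dx.
  have [_ fl] := coneGP cl; rewrite gl in fl. have d0 : defect Z (lift_at f j x) != 0.
    apply/eqP => /(defect_eq0 Z0)[p [q e]]; apply: hZ. have pq : p ^+ 2 + q ^+ 2 != 0.
      apply: contraTneq isT => h0; have [l0 _] := cl; move: l0. suff -> : lift_at f j x = 0 by rewrite eqxx.
      by apply: ip_eq0; rewrite e ip_cs h0 mul0r.
    have fx : f x = cpt Z by rewrite fl e cpt_cs. split; first by split => //; exists x => //; exact: KW.
    by rewrite (@coneG_eq R n W f fe Z x)//; exact: KW.
  have nd : \forall x' \near x & Y \near Z, defect Y (lift_at f j x') != 0.
    have c1 : {for (x, Z), continuous (fun z : E * V => lift_at f j z.1)}.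
      apply: (@cont_comp (E * V)%type E V fst (lift_at f j)); first exact: cvg_fst.
      by apply: (isC1_cont (@lift_at_C1 R n W f fe j)).
    have c2 : {for (x, Z), continuous (fun z : E * V => z.2)} by exact: cvg_snd. have c := cont_defect c2 c1.
    exact: (cvgr_neq0 _ c d0).
  have nc : \forall x' \near x & Y \near Z, chd W f j x'.
    have h : \forall x' \near x, chd W f j x' by apply: open_nbhs_nbhs; split => //; exact: (@chd_open _ _ _ _ fe).
    by exists (chd W f j, setT) => [|[x' Y] []//]; split => //; exact: filterT.
  apply: filterS2 nd nc => -[x' Y] /= d' dx' Y0 e. have [cl' gl'] := @lift_at_cone R n W f fe j x' dx'.
  have [_ fl'] := coneGP cl'; rewrite gl' in fl'. have [l0 _] := cl'.
  have := cpt_inj Y0 l0 _; rewrite -e -fl' => /(_ erefl)[p [q [_ el]]]. by move: d'; rewrite el defect_cs eqxx.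
near=> Y => -[CY KY]; have [_ fY] := coneGP CY; have [Y0 _] := CY.
have : K `<=` (fun x => Y != 0 -> f x <> cpt Y) by near: Y.
by move=> /(_ _ KY Y0).
Unshelve. all: by end_near. Qed.

Lemma cone_symp_coord : symp_coord (cone W f) (coneG W f) a b.
Proof.
split.
- exact: cone_open.
- by move=> Z [].
- by move=> x y Z xy CZ; split; [exact: cone_cs|apply: coneG_cs => //; case: CZ].
- by eexists; exact: (coneG_C1 fe fs).
- by move=> v; exact: (@coneG_C2 R n W f fe fs v).
- by move=> Z u v; exact: (@coneG_symp R n W f fe fs Z u v).
- by move=> Z /coneGP[].
- by move=> Z Z'; exact: cone_fibre.
- move=> x Wx; have [j dx] := @chd_exists R n W f x Wx. exists (chd W f j), (lift_at f j); split => //.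
  + exact: (@chd_open _ _ _ _ fe).
  + exact: (@lift_at_C1 R n W f fe j).
  + by move=> y; exact: (@lift_at_cone R n W f fe j y).
- move=> s t Z hs ht Z0; apply: (@cone_closed [set x | s <= sq x <= t]) => //; first exact: compact_shell.
  by move=> x /andP[h1 h2]; apply/andP; split; [exact: lt_le_trans h1|exact: le_lt_trans ht].
Qed.

End Shell.
End SympCoordCone.

(** * Coordinates on the standard ball *)

Section SympCoordBall.
Context {R : realType} (n : nat).
Local Notation V := 'M[R]_(n.+1, 2).
Local Notation E := 'M[R]_(n, 2).
Local Notation C0 := [set Z : V | hN Z ord0 != 0].
Implicit Types Z : V.

Lemma ip_hN Z : sq Z = hN Z ord0 + sq (del0 Z).
Proof. by rewrite (ip_lift ord0) /hN -!expr2. Qed.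

Lemma usq_g0 Z : hN Z ord0 != 0 -> usq g0 Z = sq (del0 Z) / sq Z.
Proof.
move=> h; have h0 := hN_gt0 h; have z0 := ip_gt0 (hN_neq0_Z h).
rewrite /usq /ip mulr_suml; apply: eq_bigr => k _; rewrite g00E g01E !delE -/(sq Z).
have e1 := sqr_sqrtr (ltW h0); have e2 := sqr_sqrtr (ltW z0).
have s1 : Num.sqrt (hN Z ord0) != 0 by rewrite gt_eqF// sqrtr_gt0.
have s2 : Num.sqrt (sq Z) != 0 by rewrite gt_eqF// sqrtr_gt0.
rewrite -[in RHS]e2; move: e1 s1 s2; move: (Num.sqrt (hN Z ord0)) (Num.sqrt (sq Z)) => s r e1 s1 s2.
suff -> : (Z (lift ord0 k) ord0 * Z (lift ord0 k) ord0 + Z (lift ord0 k) ord_max * Z (lift ord0 k) ord_max) / r ^+ 2 =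
  (Z (lift ord0 k) ord0 * Z (lift ord0 k) ord0 + Z (lift ord0 k) ord_max * Z (lift ord0 k) ord_max) * hN Z ord0 / (s ^+ 2 * r ^+ 2).
  by rewrite /hN; field; rewrite s1 s2.
by rewrite -e1; field; rewrite s1 s2.
Qed.

Definition phx Z : R := Z ord0 ord0 * (Num.sqrt (hN Z ord0) * Num.sqrt (sq Z))^-1.
Definition phy Z : R := - (Z ord0 ord_max * (Num.sqrt (hN Z ord0) * Num.sqrt (sq Z))^-1).

Lemma ball1_g0 Z : hN Z ord0 != 0 -> ball1 (g0 Z).
Proof.
move=> h; rewrite /ball1/= -/(usq g0 Z) usq_g0//.
by rewrite ltr_pdivrMr ?mul1r ?ip_gt0 ?(hN_neq0_Z h)// [ltRHS]ip_hN ltrDr hN_gt0.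
Qed.

Lemma sec_g0 Z : hN Z ord0 != 0 -> sec (g0 Z) = cs (phx Z) (phy Z) Z.
Proof.
move=> h; have h0 := hN_gt0 h; have z0 := ip_gt0 (hN_neq0_Z h).
have s1 : Num.sqrt (hN Z ord0) != 0 by rewrite gt_eqF// sqrtr_gt0.
have s2 : Num.sqrt (sq Z) != 0 by rewrite gt_eqF// sqrtr_gt0.
apply: (@mx2liftP _ _ ord0) => [||k]; rewrite ?cs0E ?cs1E.
- rewrite sec_00 -/(usq g0 Z) usq_g0// (_ : 1 - _ = hN Z ord0 / sq Z); last first.
    have -> : sq (del0 Z) = sq Z - hN Z ord0 by rewrite [sq Z]ip_hN addrC addKr. by field; rewrite gt_eqF.
  rewrite sqrtrM ?ltW// sqrtrV ?ltW// /phx /phy.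
  have e1 : Num.sqrt (hN Z ord0) ^+ 2 = Z ord0 ord0 ^+ 2 + Z ord0 ord_max ^+ 2 := sqr_sqrtr (ltW h0).
  move: e1 s1 s2; move: (Num.sqrt (hN Z ord0)) (Num.sqrt (sq Z)) => s r e1 s1 s2.
  apply: (mulIf (mulf_neq0 s1 s2)); transitivity (s ^+ 2); first by field. by rewrite e1; field; rewrite s1 s2.
- by rewrite sec_01 /phx /phy; ring.
- by rewrite !sec_lift g00E g01E /phx /phy; split; ring.
Qed.

Lemma ph_neq0 Z : hN Z ord0 != 0 -> phx Z ^+ 2 + phy Z ^+ 2 != 0.
Proof.
move=> h; have e := ip_sec (ball1_g0 h); move: e; rewrite sec_g0// ip_cs => e.
by apply: contra_eq_neq e => ->; rewrite mul0r eq_sym oner_eq0.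
Qed.

Lemma g0_sm : exists2 dg : V -> V -> E, C1 C0 g0 dg & forall v, isC1 C0 (dg^~ v).
Proof.
have oC := @hN_open R n ord0.
have h k c : exists2 df, C1 C0 (fun Z => g0 Z k c) df & forall v, isC1 C0 (df^~ v).
  have hs : sm C0 (fun Z => g0 Z k c) by apply: sm_g0 => // i c'; exact: sm_coord.
  have [df h1 h2] := sm_C1 oC hs; exists df => // v. by have [d2 h3 _] := sm_C1 oC (h2 v); exists d2.
pose D k c := projT1 (cid2 (h k c)).
have hD k c : C1 C0 (fun Z => g0 Z k c) (D k c) /\ forall v, isC1 C0 ((D k c)^~ v).
  by rewrite /D; case: cid2.
exists (fun Z v => \matrix_(k, c) D k c Z v).
  by apply: C1_mx => k c; apply: (C1_ext (hD k c).1) => // Z v; rewrite mxE.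
move=> v; apply: isC1_mx => k c; apply: (@isC1_eq _ _ _ _ (fun Z => D k c Z v)) => //.
  by move=> Z _; rewrite mxE.
exact: (hD k c).2.
Qed.

Lemma csD m p q (u v : 'M[R]_(m, 2)) : cs p q (u + v) = cs p q u + cs p q v.
Proof. by rewrite /cs JmD !scalerDr addrACA. Qed.

Lemma C1_cs (U : normedModType R) m (A : set U) (p q : U -> R) (g : U -> 'M[R]_(m, 2)) dp dq dg :
  C1 A p dp -> C1 A q dq -> C1 A g dg ->
  C1 A (fun x => cs (p x) (q x) (g x)) (fun x v => cs (dp x v) (dq x v) (g x) + cs (p x) (q x) (dg x v)).
Proof.
move=> hp hq hg; apply: C1_mx => i c.
have h d := C1_entry i d hg.
case: (ord2P c) => ->.
  apply: (C1_ext (C1_add (C1_mul hp (h ord_max)) (C1_mul hq (h ord0)))) => [x|x v] /=.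
    by rewrite cs1E.
  by rewrite [RHS]addmxE !cs1E; ring.
apply: (C1_ext (C1_sub (C1_mul hp (h ord0)) (C1_mul hq (h ord_max)))) => [x|x v] /=.
  by rewrite cs0E.
by rewrite [RHS]addmxE !cs0E; ring.
Qed.

Lemma C1_ph : exists dp dq, C1 C0 phx dp /\ C1 C0 phy dq.
Proof.
have oC := @hN_open R n ord0.
have hd : sm C0 (fun Z => (Num.sqrt (hN Z ord0) * Num.sqrt (sq Z))^-1).
  have sN : sm C0 (fun Z => hN Z ord0) by apply: sm_add; apply: sm_mul; exact: sm_coord.
  have sI : sm C0 (fun Z => sq Z) by apply: sm_ip => i c; exact: sm_coord.
  apply: sm_inv; last by apply: sm_mul; apply: sm_sqrt => // Z h; [exact: hN_gt0|exact: (ip_gt0 (hN_neq0_Z h))].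
  by move=> Z h; rewrite mulf_neq0// gt_eqF// sqrtr_gt0; [exact: hN_gt0|exact: (ip_gt0 (hN_neq0_Z h))].
have [dp hp _] := sm_C1 oC (sm_mul (sm_coord _ ord0 ord0) hd).
have [dq hq _] := sm_C1 oC (sm_opp (sm_mul (sm_coord _ ord0 ord_max) hd)).
by exists dp, dq.
Qed.

Lemma g0_symp Z u v : C0 Z -> omega_st ('D_u g0 Z) ('D_v g0 Z) = Omega Z u v.
Proof.
move=> CZ; have [dg hg _] := g0_sm; have [ds hs dsP] := @C1_sec R n.
have [dp [dq [hp hq]]] := C1_ph; have oC := @hN_open R n ord0.
have bZ := ball1_g0 CZ.
have h1 := C1_comp (@ball1_open R n) hg hs (@ball1_g0).
have h2 := C1_cs hp hq (@C1_id R V C0).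
have h3 : C1 C0 (fun Y => sec (g0 Y)) (fun Y w => cs (dp Y w) (dq Y w) Y + cs (phx Y) (phy Y) w).
  by apply: (eq_C1 oC _ _ h2) => // Y CY; rewrite sec_g0.
have key w : ds (g0 Z) (dg Z w) = cs (dp Z w) (dq Z w) Z + cs (phx Z) (phy Z) w.
  exact: (C1_unique w h1 h3 CZ).
rewrite !(D_of_C1 _ hg CZ) -(@Omega_sec R n (g0 Z) (dg Z u) (dg Z v) ds hs dsP bZ).
have ph := ph_neq0 CZ; have Z0 := hN_neq0_Z CZ.
have key2 w : ds (g0 Z) (dg Z w) = cs (phx Z) (phy Z) (w +
    cs ((dp Z w * phx Z + dq Z w * phy Z) / (phx Z ^+ 2 + phy Z ^+ 2))
       ((dq Z w * phx Z - dp Z w * phy Z) / (phx Z ^+ 2 + phy Z ^+ 2)) Z).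
  by rewrite key addrC csD cs_cs; congr (_ + cs _ _ _); field.
rewrite !key2 sec_g0// Omega_cs// Omega_cs_dir// Omega_anti Omega_cs_dir// -Omega_anti//.
Qed.

Lemma usq_g0_lt Z : C0 Z -> -1 < usq g0 Z < 1.
Proof. by move=> /ball1_g0 h; rewrite h andbT (lt_le_trans _ (ip_ge0 _))// ltrN10. Qed.

(** The lower bound -1 is below every value of [usq g0], so that the origin of the ball is
    included. *)
Lemma ball_symp_coord : symp_coord C0 g0 (-1) 1.
Proof.
have oC := @hN_open R n ord0; have [dg hg h2] := g0_sm.
split.
- exact: oC.
- by move=> Z /hN_neq0_Z.
- move=> x y Z xy CZ; split; last exact: g0_cs. by rewrite /= hN_cs mulf_neq0.
- by exists dg.
- by move=> v; apply: (isC1_eq oC _ (h2 v)) => Z CZ; rewrite (D_of_C1 _ hg CZ).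
- exact: g0_symp.
- exact: usq_g0_lt.
- move=> Z Z' CZ CZ' e. have pZ := ph_neq0 CZ; have pZ' := ph_neq0 CZ'.
  apply: cpt_inj; [exact: hN_neq0_Z CZ|exact: hN_neq0_Z CZ'|].
  rewrite -(cpt_cs pZ (hN_neq0_Z CZ)) -sec_g0// e sec_g0// cpt_cs//; exact: hN_neq0_Z CZ'.
- move=> x /andP[_ hx]; exists (@ball1 R n), (@sec R n); split => //; first exact: ball1_open.
    by have [ds hs _] := @C1_sec R n; exists ds.
  by move=> y By; split; [exact: hN_sec|exact: g0_sec].
- move=> s t Z hs ht Z0 hZ. have cI : {for Z, continuous (fun Z => sq (del0 Z) - t * sq Z)}.
    have cd : {for Z, continuous (@del R n ord0)}.
      by apply: cont_mx => i c; apply: (@cont_ext _ _ (fun Z : V => Z (lift ord0 i) c)) => [|Y]; [exact: cont_coord|rewrite delE].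
    have c1 := cont_ip cd cd; have c2 := @ip_cont R n.+1 Z.
    have c3 := @continuousM _ _ (fun=> t) _ Z (@cont_cst _ _ t Z) c2. exact: (@continuousB _ _ _ _ _ _ c1 c3).
  have [CZ|CZ] := pselect (C0 Z).
    have cu : {for Z, continuous (usq g0)}.
      have cg : {for Z, continuous g0} by exact: C1_cont hg CZ. exact: (cont_ip cg cg).
    have : ~~ (s <= usq g0 Z <= t) by apply/negP => h; exact: hZ. rewrite negb_and -!ltNge => /orP[h|h].
      have hh : \forall Y \near Z, usq g0 Y < s by exact: (cu _ (lt_nbhsl h)).
      apply: filterS hh => Y /= hY [_ /andP[h' _]]. by move: (lt_le_trans hY h'); rewrite ltxx.
    have hh : \forall Y \near Z, t < usq g0 Y by exact: (cu _ (lt_nbhsr h)).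
    apply: filterS hh => Y /= hY [_ /andP[_ h']]. by move: (lt_le_trans hY h'); rewrite ltxx.
  (* Towards the hyperplane at infinity [usq g0] tends to 1, which exceeds [t]. Cleared of
     denominators, the inequality is continuous across the hyperplane. *)
  have h0 : hN Z ord0 = 0 by apply/eqP; apply: contrapT => /negP. have hp : 0 < sq (del0 Z) - t * sq Z.
    have := ip_gt0 Z0; rewrite ip_hN h0 add0r => hp. by rewrite subr_gt0 gtr_pMl.
  have hh : \forall Y \near Z, 0 < sq (del0 Y) - t * sq Y by exact: (cI _ (lt_nbhsr hp)).
  apply: filterS hh => Y /= hY [CY /andP[_]]. rewrite usq_g0// ler_pdivrMr ?ip_gt0 ?(hN_neq0_Z CY)// => h'.
  by move: hY; rewrite subr_gt0 ltNge h'.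
Qed.

End SympCoordBall.

(** * Functions with vanishing derivative *)

Section ZeroDerivative.
Context {R : realType}.

Lemma cs_eq0 m p q (u : 'M[R]_(m, 2)) : u != 0 -> cs p q u = 0 -> p = 0 /\ q = 0.
Proof.
move=> u0 h; have : sq (cs p q u) = 0 by rewrite h ip0r.
rewrite ip_cs => /eqP; rewrite mulf_eq0 (gt_eqF (ip_gt0 u0)) orbF paddr_eq0 ?sqr_ge0// !sqrf_eq0.
by move=> /andP[/eqP-> /eqP->].
Qed.

Lemma open_neq0 m : open [set z : 'M[R]_(m, 2) | z != 0].
Proof. by rewrite openE => z z0; exact: (cvgr_neq0 _ (@cvg_id _ (nbhs z)) z0). Qed.

(** A segment joins [z] to [y] unless its projection meets 0. Then [pi y] is a real multiple of
    [pi z], and the detour through [Jm z] avoids 0 since [pi z] and [Jm (pi z)] are independent over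
    the reals. *)
Lemma zero_deriv_cst k m (pi : 'M[R]_(k, 2) -> 'M[R]_(m, 2)) (f : 'M[R]_(k, 2) -> R) df :
  linear pi -> (forall z, pi (Jm z) = Jm (pi z)) -> C1 [set z | pi z != 0] f df ->
  (forall z v, pi z != 0 -> df z v = 0) -> forall z y, pi z != 0 -> pi y != 0 -> f z = f y.
Proof.
move=> lp pJ hf df0.
have piE z v (t : R) : pi (z + t *: v) = pi z + t *: pi v by rewrite addrC lp addrC.
have piB z v : pi (z - v) = pi z - pi v.
  by rewrite -scaleN1r piE scaleN1r.
have seg z y : (forall t : R, 0 <= t <= 1 -> pi z + t *: (pi y - pi z) != 0) -> f z = f y.
  move=> h; have h' t : 0 <= t <= 1 -> pi (z + t *: (y - z)) != 0 by move=> /h; rewrite piE piB.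
  rewrite -[y in RHS](subrKC z); apply/esym/(C1_segment_cst hf) => // t ht; exact/df0/h'.
move=> z y z0 y0.
have [h|] := pselect (forall t : R, 0 <= t <= 1 -> pi z + t *: (pi y - pi z) != 0); first exact: seg.
move=> /existsNP[t /not_implyP[t01 /negP]]; rewrite negbK => /eqP ht.
have t0 : t != 0 by apply: contra_eq_neq ht => ->; rewrite scale0r addr0.
have ye : pi y = (- (1 - t) / t) *: pi z.
  apply: (scalerI t0); rewrite scalerA mulrCA divff// mulr1 scaleNr scalerBl scale1r.
  by apply/eqP; rewrite -subr_eq0 opprK -[X in _ == X]ht scalerBr addrCA.
transitivity (f (Jm z)).
  apply: seg => s _; rewrite pJ; apply/negP => /eqP h.
  have : cs (1 - s) s (pi z) = 0 by rewrite -h /cs scalerBl scale1r scalerBr addrA addrAC.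
  by move=> /(cs_eq0 z0)[h1 h2]; move: h1; rewrite h2 subr0 => /eqP; rewrite oner_eq0.
apply: seg => s _; rewrite pJ; apply/negP => /eqP h.
have h2 : cs (s * (- (1 - t) / t)) (1 - s) (pi z) = 0.
  by rewrite -h ye /cs scalerBr scalerA scalerBl scale1r addrCA addrA.
have [_ /eqP] := cs_eq0 z0 h2; rewrite subr_eq0 => /eqP s1.
by move: h y0; rewrite -s1 scale1r subrKC => ->; rewrite eqxx.
Qed.

(** Radial segments stay in the shell and move every point to the sphere through [x]. On that sphere
    [f] is compared through [f (s z *: z)], which is defined for all nonzero vectors. *)
Lemma shell_zero_deriv_cst m (a b : R) (f : 'M[R]_(m, 2) -> R) df : 0 <= a ->
  C1 [set x | a < sq x < b] f df -> (forall x v, a < sq x < b -> df x v = 0) ->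
  forall x y, a < sq x < b -> a < sq y < b -> f x = f y.
Proof.
move=> a0 hf df0 x y hx hy.
have sc_ip s (z : 'M[R]_(m, 2)) : sq (s *: z) = s ^+ 2 * sq z.
  by rewrite ipZr ipZl mulrA.
have nz (z : 'M[R]_(m, 2)) : a < sq z < b -> z != 0.
  move=> /andP[h _]; apply: contraTneq h => ->; by rewrite ip0r -leNgt.
have nN (z : 'M[R]_(m, 2)) : z != 0 -> Num.sqrt (sq z) != 0.
  by move=> z0; rewrite gt_eqF// sqrtr_gt0 ip_gt0.
pose c := Num.sqrt (sq x).
have c2 : c ^+ 2 = sq x by rewrite sqr_sqrtr// ip_ge0.
pose s (z : 'M[R]_(m, 2)) := c * (Num.sqrt (sq z))^-1.
have sE z : z != 0 -> sq (s z *: z) = sq x.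
  move=> z0; have e := sqr_sqrtr (ip_ge0 z). by rewrite sc_ip /s exprMn c2 exprVn e mulfVK// gt_eqF// ip_gt0.
have oN := @open_neq0 m.
have [ds hs] : isC1 [set z : 'M[R]_(m, 2) | z != 0] (fun z => s z *: z).
  apply: isC1_mx => i j. have h : sm [set z : 'M[R]_(m, 2) | z != 0] (fun z => s z * z i j).
    apply: sm_mul; last exact: sm_coord. apply: sm_mul; first exact: sm_cst.
    apply: sm_inv; first by move=> z; exact: nN.
    by apply: sm_sqrt; [move=> z; exact: ip_gt0|apply: sm_ip => ? ?; exact: sm_coord].
  have [d hd _] := sm_C1 oN h; exists d; apply: (eq_C1 oN _ _ hd) => // z _. by rewrite mxE.
have hW z : z != 0 -> a < sq (s z *: z) < b by move=> z0; rewrite sE.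
have hk := C1_comp (@open_shell R m a b) hs hf hW.
have kk : f (s x *: x) = f (s y *: y).
  apply: (zero_deriv_cst (pi := idfun) _ _ hk) => //; [|exact: nz|exact: nz]. by move=> z v z0; apply: df0; exact: hW.
have rad z : a < sq z < b -> f z = f (s z *: z).
  move=> hz; have z0 := nz _ hz. have key (t : R) : 0 <= t <= 1 -> a < sq (z + t *: (s z *: z - z)) < b.
    move=> /andP[t0 t1]. rewrite -[X in t *: (_ - X)]scale1r -scalerBl scalerA -[X in X + _]scale1r -scalerDl sc_ip.
    have s0 : 0 < s z by rewrite mulr_gt0 ?invr_gt0 ?sqrtr_gt0 ?ip_gt0//; exact: nz hx.
    have s0' := ltW s0; have r0 : 0 <= 1 + t * (s z - 1) by nra.
    have hx' := hW z z0; rewrite sc_ip in hx'; case/andP: hx' => hx1 hx2; case/andP: hz => hz1 hz2.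
    have zz := ip_gt0 z0; have [h|h] := leP (s z) 1.
      have r1 : (s z) ^+ 2 <= (1 + t * (s z - 1)) ^+ 2 by rewrite ler_sqr ?nnegrE//; nra.
      have r2 : (1 + t * (s z - 1)) ^+ 2 <= 1 by rewrite expr_le1//; nra. by apply/andP; split; nra.
    have r1 : (1 + t * (s z - 1)) ^+ 2 <= (s z) ^+ 2 by rewrite ler_sqr ?nnegrE//; nra.
    have r2 : 1 <= (1 + t * (s z - 1)) ^+ 2 by rewrite expr_ge1//; nra. by apply/andP; split; nra.
  rewrite -[s z *: z](subrKC z); apply/esym/(C1_segment_cst hf) => // t ht; exact/df0/key.
have sx : s x *: x = x by rewrite /s -/c divff ?scale1r// nN// nz.
by rewrite -sx kk -rad.
Qed.

End ZeroDerivative.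

(** * Primitives of closed forms *)

Section FormCalculus.
Context {R : realType} (m : nat).
Local Notation V := 'M[R]_(m, 2).
Implicit Types (A : set V) (al : V -> V -> R) (da : V -> V -> V -> R).

Lemma form1_sum A al da x v : form1 A al da -> A x -> al x v = \sum_i \sum_j v i j * al x (mxb i j).
Proof. by move=> [hl _] Ax; rewrite (linear_coord_sum v (hl x Ax)). Qed.

Lemma form1_comp (U : normedModType R) (B : set U) A al da f g df dg :
  open B -> open A -> form1 A al da -> C1 B f df -> C1 B g dg -> (forall x, B x -> A (f x)) ->
  C1 B (fun x => al (f x) (g x)) (fun x v => da (g x) (f x) (df x v) + al (f x) (dg x v)).
Proof.
move=> oB oA hal hf hg BA; have [hl hC] := hal.
have h i j := C1_mul (C1_entry i j hg) (C1_comp oA hf (hC (mxb i j)) BA).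
have h2 := C1_sum (index_enum _) xpredT (fun i => C1_sum (index_enum _) xpredT (h i)).
apply: (eq_C1 oB _ _ h2) => [x Bx|x v Bx]; first by rewrite (form1_sum _ hal) //; exact: BA.
rewrite (form1_sum _ hal (BA _ Bx)) (linear_coord_sum (g x) (form1_lin (df x v) oA hal (BA _ Bx))) -big_split.
apply: eq_bigr => i _ /=; rewrite -big_split; apply: eq_bigr => j _ /=; rewrite addrC; congr (_ + _).
Qed.

Lemma form1_cont (T : topologicalType) A al da (f g : T -> V) (y : T) :
  open A -> form1 A al da -> A (f y) -> {for y, continuous f} -> {for y, continuous g} ->
  {for y, continuous (fun y => al (f y) (g y))}.
Proof.
move=> oA [hl hC] Af cf cg; apply: (@cont_bil_in _ _ _ _ _ (fun y => al (f y)) g) => //.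
  have h : \forall z \near y, A (f z) by apply: cf; exact: open_nbhs_nbhs. by apply: filterS h => z /hl.
by move=> v; apply: (@cont_comp _ _ _ f (al^~ v)) => //; exact: C1_cont (hC v) Af.
Qed.

Lemma form1_da_cont (T : topologicalType) A al da (f u w : T -> V) (y : T) :
  open A -> form1 A al da -> A (f y) -> {for y, continuous f} -> {for y, continuous u} -> {for y, continuous w} ->
  {for y, continuous (fun y => da (w y) (f y) (u y))}.
Proof.
move=> oA hal Af cf cu cw; have [hl hC] := hal.
have h : \forall z \near y, A (f z) by apply: cf; exact: open_nbhs_nbhs.
apply: (@cont_bil_in _ _ _ _ _ (fun y w => da w (f y) (u y)) w) => //.
  by apply: filterS h => z Az; exact: form1_lin oA hal Az.
move=> v; apply: (@cont_bil_in _ _ _ _ _ (fun y => da v (f y)) u) => //.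
  by apply: filterS h => z Az; exact: C1_linear (hC v) Az.
by move=> v'; apply: (@cont_comp _ _ _ f ((da v)^~ v')) => //; exact: (hC v _ Af).2.
Qed.

Variable e : V.
Hypothesis e0 : e != 0.
Let A0 : set V := [set z | z != 0].
Let oA0 : open A0 := @open_neq0 R m.

Definition star : set V := [set Z | forall t : R, 0 <= t <= 1 -> e + t *: (Z - e) != 0].

Lemma ray_cont (Z : V) (t : R) : {for (Z, t), continuous (fun z : V * R => e + z.2 *: (z.1 - e))}.
Proof.
apply: cont_mx => i j.
apply: (@cont_ext _ _ (fun z : V * R => e i j + z.2 * (z.1 i j - e i j))) => [|z]; last by rewrite !mxE.
have c1 : {for (Z, t), continuous (fun z : V * R => z.1 i j)}.
  by apply: cont_entry; exact: cvg_fst.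
have c2 : {for (Z, t), continuous (fun z : V * R => z.2)} by exact: cvg_snd.
have c3 := @continuousB _ _ _ _ _ _ c1 (@cont_cst _ _ (e i j) (Z, t)).
exact: (@continuousD _ _ _ _ _ _ (@cont_cst _ _ (e i j) (Z, t)) (@continuousM _ _ _ _ _ c2 c3)).
Qed.

Lemma star_open : open star.
Proof.
rewrite openE => Z hZ.
have /compact_near_coveringP cK : compact (net_dom (@I01 R)) by exact: I01_compact.
have hn : \forall Y \near Z, net_dom (@I01 R) `<=` (fun t => e + t *: (Y - e) != 0).
  apply: (cK V (nbhs Z) (fun Y t => e + t *: (Y - e) != 0)) => t It; have h := cvgr_neq0 _ (@ray_cont Z t) (hZ t It).
  case: h => -[P Q] /= [nP nQ] PQ; exists (Q, P) => // -[t' Y] /= [Qt PY]. exact: (PQ (Y, t') (conj PY Qt)).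
by apply: filterS hn => Y hY t ht; exact: hY.
Qed.

Lemma scal_cont (v : V) (t : R) : {for t, continuous (fun s : R => s *: v)}.
Proof.
apply: cont_mx => i j; apply: (@cont_ext R _ (fun s : R => s * v i j)) => [|s]; last by rewrite mxE.
by apply: (@continuousM _ _ (fun s : R => s)); [exact: cont_id|exact: cont_cst].
Qed.

Lemma ray_C1 (Z : V) : C1 (setT : set R) (fun t : R => e + t *: (Z - e)) (fun _ (s : R) => s *: (Z - e)).
Proof.
apply: C1_mx => i j.
have h := C1_add (C1_cst setT (e i j)) (C1_mul (@C1_id R R setT) (C1_cst setT (Z i j - e i j))).
apply: (C1_ext h) => [t|t s] /=; rewrite !mxE //; by rewrite mulr0 addr0 add0r.
Qed.

Lemma ray_C1Z (t : R) : C1 (setT : set V) (fun Z => e + t *: (Z - e)) (fun _ v => t *: v).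
Proof.
apply: C1_mx => i j.
have h := C1_add (C1_cst setT (e i j)) (C1_scale t (C1_sub (@C1_coord R m 2 setT i j) (C1_cst setT (e i j)))).
by apply: (C1_ext h) => [x|x v] /=; rewrite !mxE// subr0 add0r.
Qed.

(** Common to both Poincare primitives: the weight is 1 for closed 1-forms and [t] for closed
    2-forms. *)
Lemma ray_mean_C1 al da (c : R -> R) : form1 A0 al da -> continuous c ->
  C1 star (fun Z => mean I01 (fun t => c t * al (e + t *: (Z - e)) (Z - e)))
    (fun Z u => mean I01 (fun t => c t * (da (Z - e) (e + t *: (Z - e)) (t *: u) + al (e + t *: (Z - e)) u))).
Proof.
move=> hal cc.
have hB : C1 (setT : set V) (fun Z => Z - e) (fun _ v => v).
  by apply: (C1_ext (C1_sub (@C1_id R V setT) (C1_cst setT e))) => // x v; rewrite subr0.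
apply: (@mean_C1 _ _ _ (@I01_compact R) m 2 star (fun Z t => c t * al (e + t *: (Z - e)) (Z - e))
  (fun t Z u => c t * (da (Z - e) (e + t *: (Z - e)) (t *: u) + al (e + t *: (Z - e)) u))).
- exact: star_open.
- move=> t It; apply: C1_scale; apply: (form1_comp star_open oA0 hal) => [||Z hZ]; last exact: hZ.
    by apply: C1_subset (@ray_C1Z t).
  by apply: C1_subset hB.
- move=> Z t hZ It; apply: (@continuousM _ _ c); first exact: cc.
  apply: (@form1_cont R A0 al da (fun t : R => e + t *: (Z - e)) (fun=> Z - e) t oA0 hal (hZ t It)).
    exact: (C1_cont (ray_C1 Z)).
  exact: cont_cst.
move=> Z t v hZ It.
have cr := @ray_cont Z t.
have c1 : {for (Z, t), continuous (fun z : V * R => z.1 - e)}.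
  apply: (@continuousB _ _ _ (fun z : V * R => z.1)); [exact: cvg_fst|exact: cont_cst].
have c2 : {for (Z, t), continuous (fun z : V * R => z.2 *: v)}.
  apply: cont_mx => i j; apply: (@cont_ext _ _ (fun z : V * R => z.2 * v i j)) => [|z]; last by rewrite mxE.
  by apply: (@continuousM _ _ (fun z : V * R => z.2)); [exact: cvg_snd|exact: cont_cst].
have c3 : {for (Z, t), continuous (fun z : V * R => c z.2)}.
  by apply: (@cont_comp _ _ _ (fun z : V * R => z.2) c); [exact: cvg_snd|exact: cc].
have d1 := @form1_da_cont _ A0 al da (fun z : V * R => e + z.2 *: (z.1 - e)) _ _ (Z, t) oA0 hal (hZ t It) cr c2 c1.
have d2 := @form1_cont _ A0 al da (fun z : V * R => e + z.2 *: (z.1 - e)) _ (Z, t) oA0 hal (hZ t It) cr (@cont_cst _ _ v (Z, t)).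
exact: (@continuousM _ _ _ _ _ c3 (@continuousD _ _ _ _ _ _ d1 d2)).
Qed.

Definition prim1 al (Z : V) : R := mean I01 (fun t => 1 * al (e + t *: (Z - e)) (Z - e)).

Lemma prim1_C1 al da : form1 A0 al da -> (forall x u v, A0 x -> da u x v = da v x u) -> C1 star (prim1 al) al.
Proof.
move=> hal cl; have [hl hC] := hal.
apply: (eq_C1 star_open _ _ (ray_mean_C1 hal (@cont_cst _ _ (1 : R)))) => // Z v hZ.
(* Closedness turns the differentiated integrand into the derivative of [t al] along the ray. *)
have hf (t : R) : 0 <= t <= 1 -> is_derive t 1 (fun t => t * al (e + t *: (Z - e)) v)
    (1 * (da (Z - e) (e + t *: (Z - e)) (t *: v) + al (e + t *: (Z - e)) v)).
  move=> ht; have At := hZ t ht. pose B := [set t : R | A0 (e + t *: (Z - e))].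
  have oB : open B by apply: (open_comp _ oA0) => s _; exact: (C1_cont (ray_C1 Z)).
  have h := C1_mul (@C1_id R R B) (C1_comp oA0 (C1_subset (@subsetT _ B) (ray_C1 Z)) (hC v) (fun s Bs => Bs)).
  apply: (is_derive_eq (C1_derive (x := t) 1 h At)).
  by rewrite scale1r (C1_Z _ _ (hC _) At) (cl _ v (Z - e))// /GRing.scale/=; ring.
rewrite (I01_FTC hf); first by rewrite mul0r subr0 mul1r scale1r subrKC.
move=> t ht; have At := hZ t ht; apply: cont_mulc.
have cr := C1_cont (ray_C1 Z) (I : setT t).
have d1 := @form1_da_cont _ A0 al da (fun t : R => e + t *: (Z - e)) _ _ t oA0 hal At cr (@scal_cont v t) (@cont_cst _ _ (Z - e) t).
have d2 := @form1_cont _ A0 al da (fun t : R => e + t *: (Z - e)) _ t oA0 hal At cr (@cont_cst _ _ v t).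
exact: (@continuousD _ _ _ _ _ _ d1 d2).
Qed.

Section Two.
Variables (sg : V -> V -> V -> R) (ds : V -> V -> V -> V -> R).
Hypotheses (hsg : form2 A0 sg ds) (csg : closed2 A0 ds).

Definition prim2 (Z v : V) : R := mean I01 (fun t => t * sg (e + t *: (Z - e)) (Z - e) v).
Definition dprim2 (v Z u : V) : R := mean I01 (fun t =>
  t * (ds (Z - e) v (e + t *: (Z - e)) (t *: u) + sg (e + t *: (Z - e)) u v)).

Lemma form2_slice v : form1 A0 (fun x w => sg x w v) (fun w => ds w v).
Proof.
have [hb _ hC] := hsg; split; last by move=> w; exact: hC.
by move=> x /hb[_]; exact.
Qed.

Lemma prim2_form1 : form1 star prim2 dprim2.
Proof.
split=> [Z hZ a u v|v].
  have [hb _ _] := hsg. have bd w : bdd I01 (fun t => t * sg (e + t *: (Z - e)) (Z - e) w).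
    apply: I01_bdd. move=> t It; apply: (@continuousM _ _ (fun t : R => t)); first exact: cont_id.
    apply: (@form1_cont R A0 _ _ (fun t : R => e + t *: (Z - e)) (fun=> Z - e) t oA0 (form2_slice w) (hZ t It)).
      exact: (C1_cont (ray_C1 Z)).
    exact: cont_cst.
  transitivity (a * prim2 Z u + prim2 Z v); last by []. rewrite /prim2 -meanZ// -meanD//; last exact: bddZ.
  apply: mean_eq => t It; have [h1 _] := hb _ (hZ t It). by rewrite (linD _ _ (h1 _)) (linZ _ _ (h1 _)) mulrDr mulrCA.
exact: (ray_mean_C1 (form2_slice v) (@cont_id R)).
Qed.

(** The homotopy formula: with the radial vector as third argument, the cyclic identity makes the
    difference of the two integrands the derivative of [t^2 sg]. *)
Lemma prim2_ext Z u v : star Z -> ext1 dprim2 Z u v = sg Z u v.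
Proof.
move=> hZ; rewrite /ext1 /dprim2; have [hb ha hC] := hsg.
have cf (u' v' : V) (t : R) : 0 <= t <= 1 -> {for t, continuous (fun t : R =>
    t * (ds (Z - e) v' (e + t *: (Z - e)) (t *: u') + sg (e + t *: (Z - e)) u' v'))}.
  move=> ht; have At := hZ t ht; apply: (@continuousM _ _ (fun t : R => t)); first exact: cont_id.
  have cr := C1_cont (ray_C1 Z) (I : setT t).
  have d1 := @form1_da_cont _ A0 _ _ (fun t : R => e + t *: (Z - e)) _ _ t oA0 (form2_slice v') At cr (@scal_cont u' t) (@cont_cst _ _ (Z - e) t).
  have d2 := @form1_cont _ A0 _ _ (fun t : R => e + t *: (Z - e)) _ t oA0 (form2_slice v') At cr (@cont_cst _ _ u' t).
  exact: (@continuousD _ _ _ _ _ _ d1 d2).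
rewrite -meanB; [|by apply: I01_bdd => t It; exact: cf..].
have hf (t : R) : 0 <= t <= 1 -> is_derive t 1 (fun t => t * t * sg (e + t *: (Z - e)) u v)
    (t * (ds (Z - e) v (e + t *: (Z - e)) (t *: u) + sg (e + t *: (Z - e)) u v)
     - t * (ds (Z - e) u (e + t *: (Z - e)) (t *: v) + sg (e + t *: (Z - e)) v u)).
  move=> ht; have At := hZ t ht. pose B := [set t : R | A0 (e + t *: (Z - e))].
  have oB : open B by apply: (open_comp _ oA0) => s _; exact: (C1_cont (ray_C1 Z)).
  have h := C1_mul (C1_mul (@C1_id R R B) (@C1_id R R B))
    (C1_comp oA0 (C1_subset (@subsetT _ B) (ray_C1 Z)) (hC u v) (fun s Bs => Bs)).
  apply: (is_derive_eq (C1_derive (x := t) 1 h At)). rewrite scale1r !(C1_Z _ _ (hC _ _) At) (ha _ v u At).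
  have := csg u v (Z - e) At; rewrite (form2_anti v (Z - e) u oA0 hsg At) => hc.
  have -> : ds u v (e + t *: (Z - e)) (Z - e) = ds (Z - e) v (e + t *: (Z - e)) u - ds (Z - e) u (e + t *: (Z - e)) v.
    by apply/eqP; rewrite -subr_eq0 -hc; apply/eqP; ring.
  by rewrite /GRing.scale/=; ring.
rewrite (I01_FTC hf); first by rewrite !mul0r subr0 !mul1r scale1r subrKC.
by move=> t ht; exact: (@continuousB _ _ _ _ _ _ (cf u v t ht) (cf v u t ht)).
Qed.

End Two.
End FormCalculus.

(** * Averaging over the circle action *)

Section Rotation.
Context {R : realType} (m : nat).
Local Notation V := 'M[R]_(m, 2).

Definition rot (t : R) (Z : V) : V := cs (cos (2 * pi * t)) (sin (2 * pi * t)) Z.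

Lemma rot_norm (t : R) : cos (2 * pi * t) ^+ 2 + sin (2 * pi * t) ^+ 2 = 1.
Proof. exact: cos2Dsin2. Qed.

Lemma rot_linear t : linear (rot t). Proof. exact: cs_linear. Qed.

Lemma rot0 Z : rot 0 Z = Z.
Proof. by rewrite /rot mulr0 cos0 sin0 cs1. Qed.

Lemma rot1 Z : rot 1 Z = Z.
Proof. by rewrite /rot mulr1 mulr_natl cos2pi sin2pi cs1. Qed.

Lemma rotJ t Z : rot t (Jm Z) = Jm (rot t Z). Proof. exact: csJ. Qed.

Lemma C1_real (f f' : R -> R) : (forall x : R, is_derive x 1 f (f' x)) -> continuous f' ->
  C1 setT f (fun x v => v * f' x).
Proof.
move=> hf cf x _; split; last by move=> v; apply: cont_mulc; exact: cf.
have df : differentiable f x by apply/derivable1_diffP; have [] := hf x.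
split => //; apply/funext => v.
have -> : v = v *: 1 by rewrite /GRing.scale/= mulr1.
by rewrite linearZ /= -deriveE//; have [_ ->] := hf x; rewrite /GRing.scale/= mulr1.
Qed.

Lemma rot_C1 Z : C1 setT (fun t : R => rot t Z) (fun t s => s *: (2 * pi *: Jm (rot t Z))).
Proof.
have hl : C1 (setT : set R) (fun t : R => 2 * pi * t) (fun _ s => 2 * pi * s).
  by apply: C1_scale; exact: C1_id.
have hc : C1 setT (@cos R) (fun x v => v * - sin x).
  by apply: C1_real => x; apply: continuousN; exact: continuous_sin.
have hs : C1 setT (@sin R) (fun x v => v * cos x).
  by apply: C1_real => x; exact: continuous_cos.
have h1 := C1_comp1 openT hl hc (fun _ _ => I); have h2 := C1_comp1 openT hl hs (fun _ _ => I).
apply: (C1_ext (C1_cs h1 h2 (C1_cst setT Z))) => // t s.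
have E a (w : V) k b : (a *: w) k b = a * w k b by rewrite mxE.
have Z0 k b : (0 : V) k b = 0 by rewrite mxE.
apply: mx2P => k; rewrite [in X in X /\ _]addmxE [in X in _ /\ X]addmxE !E Jm0 Jm1 !cs0E !cs1E !Z0 /GRing.scale/=.
by split; ring.
Qed.

Lemma rot_cont (Z : V) (t : R) : {for (Z, t), continuous (fun z : V * R => rot z.2 z.1)}.
Proof.
have cc : {for (Z, t), continuous (fun z : V * R => cos (2 * pi * z.2))}.
  apply: (@cont_comp _ _ _ (fun z : V * R => 2 * pi * z.2) (@cos R)); last exact: continuous_cos.
  by apply: cont_mulc; exact: cvg_snd.
have cn : {for (Z, t), continuous (fun z : V * R => sin (2 * pi * z.2))}.
  apply: (@cont_comp _ _ _ (fun z : V * R => 2 * pi * z.2) (@sin R)); last exact: continuous_sin.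
  by apply: cont_mulc; exact: cvg_snd.
have ce i j : {for (Z, t), continuous (fun z : V * R => z.1 i j)} by apply: cont_entry; exact: cvg_fst.
apply: cont_mx => i j; case: (ord2P j) => ->.
  apply: (@cont_ext _ _ (fun z : V * R => cos (2 * pi * z.2) * z.1 i ord_max + sin (2 * pi * z.2) * z.1 i ord0)) => [|z].
    exact: (@continuousD _ _ _ _ _ _ (@continuousM _ _ _ _ _ cc (ce i ord_max)) (@continuousM _ _ _ _ _ cn (ce i ord0))).
  by rewrite /rot cs1E.
apply: (@cont_ext _ _ (fun z : V * R => cos (2 * pi * z.2) * z.1 i ord0 - sin (2 * pi * z.2) * z.1 i ord_max)) => [|z].
  exact: (@continuousB _ _ _ _ _ _ (@continuousM _ _ _ _ _ cc (ce i ord0)) (@continuousM _ _ _ _ _ cn (ce i ord_max))).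
by rewrite /rot cs0E.
Qed.

Lemma rot_cont1 Z t : {for t, continuous (fun t => rot t Z)}.
Proof. exact: (C1_cont (rot_C1 Z)). Qed.

Variables (P : set V) (tau : V -> V -> R) (dtau : V -> V -> V -> R).
Hypotheses (oP : open P) (hP : forall t Z, P Z -> P (rot t Z)) (ht : form1 P tau dtau).

(** Primitives along rays from a fixed point are not invariant under the circle; their average over
    rotations is, and has the same exterior derivative when that derivative is invariant. *)
Definition avgf (Z v : V) : R := mean I01 (fun t => tau (rot t Z) (rot t v)).
Definition davgf (v Z u : V) : R := mean I01 (fun t => dtau (rot t v) (rot t Z) (rot t u)).

Lemma avgf_bdd Z v : P Z -> bdd I01 (fun t => tau (rot t Z) (rot t v)).
Proof.
move=> PZ; apply: I01_bdd.
move=> t _; apply: (@form1_cont _ _ _ P tau dtau (rot^~ Z) (rot^~ v) t oP ht) => //; first exact: hP.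
all: exact: rot_cont1.
Qed.

Lemma davgf_cont Z u v (t : R) : P Z -> {for t, continuous (fun t => dtau (rot t v) (rot t Z) (rot t u))}.
Proof.
move=> PZ; apply: (@form1_da_cont _ _ _ P tau dtau (rot^~ Z) (rot^~ u) (rot^~ v) t oP ht) => //; first exact: hP.
all: exact: rot_cont1.
Qed.

Lemma avgf_form1 : form1 P avgf davgf.
Proof.
split=> [Z PZ a u v|v].
  transitivity (a * avgf Z u + avgf Z v); last by []. rewrite /avgf -meanZ; last exact: avgf_bdd.
  rewrite -meanD; [|exact/bddZ/avgf_bdd|exact: avgf_bdd]. apply: mean_eq => t _; rewrite rot_linear; have [hl _] := ht.
  by rewrite (hl _ (hP t PZ)).
apply: (@mean_C1 _ _ _ (@I01_compact R) m 2 P (fun Z t => tau (rot t Z) (rot t v))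
  (fun t Z u => dtau (rot t v) (rot t Z) (rot t u))) => //.
- move=> t _. have h1 : C1 P (rot t) (fun _ v => rot t v).
    by apply: C1_lin; [exact: rot_linear|apply: linear_cont; exact: rot_linear].
  have h2 := form1_comp oP oP ht h1 (C1_cst P (rot t v)) (fun Z PZ => hP t PZ).
  apply: (eq_C1 oP _ _ h2) => // Z u PZ; have [hl _] := ht. by rewrite (lin0 (hl _ (hP t PZ))) addr0.
- move=> Z t PZ _.
  exact: (@form1_cont _ _ _ P tau dtau (rot^~ Z) (rot^~ v) t oP ht (hP t PZ) (@rot_cont1 Z t) (@rot_cont1 v t)).
move=> Z t u PZ _.
have c1 w : {for (Z, t), continuous (fun z : V * R => rot z.2 w)}.
  apply: (@cont_comp _ _ _ (fun z : V * R => z.2) (rot^~ w)); [exact: cvg_snd|exact: rot_cont1].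
exact: (@form1_da_cont _ _ _ P tau dtau (fun z : V * R => rot z.2 z.1) _ _ (Z, t) oP ht (hP t PZ) (@rot_cont Z t) (c1 u) (c1 v)).
Qed.

Lemma avgf_ext Z u v : P Z -> ext1 davgf Z u v = mean I01 (fun t => ext1 dtau (rot t Z) (rot t u) (rot t v)).
Proof.
move=> PZ; rewrite /ext1 /davgf meanB //.
  by apply: I01_bdd => t _; exact: davgf_cont.
by apply: I01_bdd => t _; exact: davgf_cont.
Qed.

(* The Lie derivative of the average along the rotations vanishes. *)
Lemma avgf_J Z v : P Z -> davgf v Z (Jm Z) + avgf Z (Jm v) = 0.
Proof.
move=> PZ; have [hl hC] := ht.
have hf (t : R) : 0 <= t <= 1 -> is_derive t 1 (fun t => tau (rot t Z) (rot t v))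
    (2 * pi * (dtau (rot t v) (rot t Z) (rot t (Jm Z)) + tau (rot t Z) (rot t (Jm v)))).
  move=> _; have h := form1_comp openT oP ht (rot_C1 Z) (rot_C1 v) (fun t _ => hP t PZ).
  apply: (is_derive_eq (C1_derive (x := t) 1 h I)).
  rewrite !scale1r (C1_Z _ _ (hC _) (hP t PZ)) (linZ _ _ (hl _ (hP t PZ))) -!rotJ /GRing.scale/=; ring.
have cf (t : R) : {for t, continuous (fun t => dtau (rot t v) (rot t Z) (rot t (Jm Z)) + tau (rot t Z) (rot t (Jm v)))}.
  apply: (@continuousD _ _ _ _ _ _ (@davgf_cont Z (Jm Z) v t PZ)).
  by apply: (@form1_cont _ _ _ P tau dtau (rot^~ Z) (rot^~ (Jm v)) t oP ht (hP t PZ)); exact: rot_cont1.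
have b1 : bdd I01 (fun t => dtau (rot t v) (rot t Z) (rot t (Jm Z))).
  by apply: I01_bdd => t _; exact: davgf_cont.
have := I01_FTC hf; rewrite meanZ; last by apply: I01_bdd => t _; exact: cf.
rewrite meanD//; last exact: avgf_bdd.
rewrite !rot0 !rot1 subrr => /(_ _)/eqP; rewrite mulf_eq0 mulf_eq0 pnatr_eq0 /= gt_eqF ?pi_gt0//= => h; apply/eqP/h.
by move=> t _; apply: cont_mulc; exact: cf.
Qed.

End Rotation.

(** * Product functions and the size of slabs *)

Section GridProducts.
Context {R : realType}.
Variables (p q : nat) (M : R).
Hypothesis M0 : 0 < M.

Lemma prod_coord_cont (F : 'I_p * 'I_q -> R -> R) : (forall c, continuous (F c)) ->
  continuous (fun x : 'M[R]_(p, q) => \prod_c F c (x c.1 c.2)).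
Proof.
move=> cF x; elim: (index_enum _) => [|c r IH].
  by apply: (@cont_ext _ _ (fun _ : 'M[R]_(p, q) => 1 : R)) => [|y]; [exact: cont_cst|rewrite big_nil].
apply: (@cont_ext _ _ (fun x : 'M[R]_(p, q) => F c (x c.1 c.2) * \prod_(c <- r) F c (x c.1 c.2))) => [|y]; last by rewrite big_cons.
apply: continuousM => //.
by apply: (@cont_comp _ _ _ (fun x : 'M[R]_(p, q) => x c.1 c.2) (F c)); [exact: cont_coord|exact: cF].
Qed.

Definition gline (t : R) : R := - M + 2 * M * t.

Lemma gline_cont : continuous gline.
Proof.
move=> t; apply: (@continuousD _ _ _ (fun=> - M)); first exact: cont_cst.
by apply: cont_mulc; exact: cont_id.
Qed.

Lemma grid_avg_prod (k : nat) (F : 'I_p * 'I_q -> R -> R) :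
  avg (net_pts (grid p q M0) k) (fun x => \prod_c F c (x c.1 c.2)) =
  \prod_c avg (net_pts I01 k) (fun t => F c (gline t)).
Proof.
have e c : avg (net_pts I01 k) (fun t => F c (gline t)) = (\sum_(j < k.+1) F c (gline (j%:R / k.+1%:R))) / k.+1%:R.
  rewrite /avg /= /I01_pts size_map size_iota big_map; congr (_ / _).
  by rewrite -(big_mkord xpredT (fun j => F c (gline (j%:R / k.+1%:R)))).
under [RHS]eq_bigr => c _ do rewrite e.
rewrite grid_avgE prodf_div bigA_distr_bigA /=; congr (_ / _).
  apply: eq_bigr => g _; apply: eq_bigr => -[i j] _ /=. by rewrite /grid_pt mxE /gline mulrA.
by rewrite card_ffun card_ord prodr_const natrX.
Qed.

(** The grid is a product, so the averages factor at every finite stage and the limit is taken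
    factor by factor. *)
Lemma grid_mean_prod (F : 'I_p * 'I_q -> R -> R) : (forall c, continuous (F c)) ->
  mean (grid p q M0) (fun x => \prod_c F c (x c.1 c.2)) = \prod_c mean I01 (fun t => F c (gline t)).
Proof.
move=> cF.
have b1 c : bdd I01 (fun t => F c (gline t)).
  apply: I01_bdd. by move=> t _; apply: (@cont_comp _ _ _ gline (F c)); [exact: gline_cont|exact: cF].
have bp (r : seq ('I_p * 'I_q)) : bdd (grid p q M0) (fun x => \prod_(c <- r) F c (x c.1 c.2)).
  elim: r => [|c r IH].
    by apply: (bdd_eq _ (bdd_cst _ 1)) => x _; rewrite big_nil.
  apply: (@bdd_eq R _ _ (fun x : 'M[R]_(p, q) => F c (x c.1 c.2) * \prod_(c <- r) F c (x c.1 c.2))) => [x _|]; first by rewrite big_cons.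
  apply: bddM => //; apply: grid_bdd => x; apply: (@cont_comp _ _ _ (fun x : 'M[R]_(p, q) => x c.1 c.2) (F c)); [exact: cont_coord|exact: cF].
apply: mean_eqP; first exact: bp.
under eq_fun do rewrite grid_avg_prod.
elim: (index_enum _) => [|c r IH].
  rewrite big_nil (_ : (fun k => _) = (fun=> 1)); first exact: cvg_cst. by apply/funext => k; rewrite big_nil.
rewrite big_cons (_ : (fun k => _) = (fun k => avg (net_pts I01 k) (fun t => F c (gline t)) *
  \prod_(c <- r) avg (net_pts I01 k) (fun t => F c (gline t)))); last by apply/funext => k; rewrite big_cons.
by apply: cvgM IH; exact: mean_cvg.
Qed.

(** Minus the derivative of a cutoff: its mean is known exactly from the fundamental theorem. *)
Definition bump (c s x : R) : R := - cut1 (c - s) (c + s) x.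

Lemma bump_cont c s : 0 < s -> continuous (bump c s).
Proof.
move=> s0 x; apply: continuousN; apply: cut1_cont; lra.
Qed.

Lemma bump_ge0 c s x : 0 < s -> 0 <= bump c s x.
Proof. by move=> s0; rewrite oppr_ge0 cut1_le0//; lra. Qed.

Lemma bump_mean c s : 0 < s -> - M <= c - s -> c + s <= M -> mean I01 (fun t => bump c s (gline t)) = (2 * M)^-1.
Proof.
move=> s0 h1 h2; have cs' : c - s < c + s by lra.
have hl : C1 (setT : set R) gline (fun _ v => 2 * M * v).
  by apply: (C1_ext (C1_add (C1_cst setT (- M)) (C1_scale (2 * M) (@C1_id R R setT)))) => // x v; rewrite add0r.
have h := C1_scale (- (2 * M)^-1) (C1_comp1 openT hl (C1_cut cs') (fun _ _ => I)).
have hf (t : R) : 0 <= t <= 1 -> is_derive t 1 (fun t => - (2 * M)^-1 * cut (c - s) (c + s) (gline t)) (bump c s (gline t)).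
  move=> _; apply: (is_derive_eq (C1_derive (x := t) 1 h I)).
  by rewrite /bump /GRing.scale/= mul1r mulr1 mulrA mulNr mulVf ?mulN1r// mulf_neq0// gt_eqF.
rewrite (I01_FTC hf).
  have -> : gline 1 = M by rewrite /gline mulr1; ring. have -> : gline 0 = - M by rewrite /gline mulr0 addr0.
  by rewrite cut_right// cut_left// mulr0 mulr1 sub0r opprK.
move=> t _; apply: (@cont_comp _ _ _ gline (bump c s)); [exact: gline_cont|exact: bump_cont].
Qed.

(** A limit of positive averages may vanish. A product of bumps around [x0], suitably scaled, is a
    minorant of [f] whose mean is computed and positive. *)
Lemma grid_pos (f : 'M[R]_(p, q) -> R) x0 : continuous f -> (forall x, 0 <= f x) -> 0 < f x0 -> `|x0| < M ->
  0 < mean (grid p q M0) f.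
Proof.
move=> cf f0 fx0 hx0.
have : \forall x \near x0, f x0 / 2 < f x.
  by apply: (cf x0 _ (lt_nbhsr _)); rewrite ltr_pdivrMr// ltr_pMr// ltr1n.
move=> /nbhs_ballP[r /= r0 hr].
pose s := Num.min (r / 2) (M - `|x0|).
have s0 : 0 < s by rewrite lt_min divr_gt0//= subr_gt0.
have sM i j : - M <= x0 i j - s /\ x0 i j + s <= M.
  have h1 := coord_norm x0 i j; have h2 : s <= M - `|x0| by rewrite ge_min lexx orbT.
  by move: h1; rewrite ler_norml => /andP[h1 h3]; split; lra.
pose F (c : 'I_p * 'I_q) := bump (x0 c.1 c.2) s.
have cF c : continuous (F c) by exact: bump_cont.
have [B [B0 hB]] : exists B, 0 < B /\ forall x : 'M[R]_(p, q), \prod_c F c (x c.1 c.2) <= B.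
  have h c : exists2 b : R, 0 < b & forall x, F c x <= b.
    have cs : x0 c.1 c.2 - s < x0 c.1 c.2 + s by lra. have [b b0 hb] := cut_bound cs.
    by exists b => // x; apply: (le_trans (ler_norm _)); rewrite normrN.
  exists (\prod_c projT1 (cid2 (h c))); split=> [|x].
    by apply: prodr_gt0 => c _; case: cid2.
  by apply: ler_prod => c _; rewrite bump_ge0//=; case: cid2.
have key (x : 'M[R]_(p, q)) : f x0 / 2 / B * \prod_c F c (x c.1 c.2) <= f x.
  have [/eqP->|h] := boolP (\prod_c F c (x c.1 c.2) == 0); first by rewrite mulr0. have fx : f x0 / 2 <= f x.
    apply/ltW/hr; rewrite -ball_normE /=; apply: (@le_lt_trans _ _ (r / 2)); last first.
      by rewrite ltr_pdivrMr// ltr_pMr// ltr1n.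
    apply: mx_norm_le => [|i j]; first by rewrite ltW// divr_gt0. have : F (i, j) (x i j) != 0.
      by apply: contraNneq h => h; rewrite (bigD1 (i, j))//= h mul0r.
    rewrite /F /bump oppr_eq0 => /cut1_supp h'. have {h'} : x0 i j - s <= x i j <= x0 i j + s by apply: h'; lra.
    move=> /andP[h1 h2]; rewrite !mxE; have h3 : s <= r / 2 by rewrite ge_min lexx.
    by rewrite ler_norml; apply/andP; split; lra.
  rewrite -mulrA; apply: (le_trans _ fx); rewrite ger_pMr ?divr_gt0//. by rewrite mulrC ler_pdivrMr// mul1r.
have cprod := prod_coord_cont cF.
apply: lt_le_trans (mean_le _ (grid_bdd M0 cf) (fun x _ => key x)); last exact/bddZ/grid_bdd.
rewrite meanZ; last exact: grid_bdd.
apply: mulr_gt0; first by rewrite !divr_gt0.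
rewrite grid_mean_prod//; apply: prodr_gt0 => -[i j] _ /=.
by have [h1 h2] := sM i j; rewrite bump_mean// invr_gt0 mulr_gt0.
Qed.

End GridProducts.

Lemma cut1M {R : realType} (s u1 u2 u : R) : 0 < s -> u1 < u2 -> cut1 (s * u1) (s * u2) (s * u) = s^-1 * cut1 u1 u2 u.
Proof.
move=> s0 u12; rewrite /cut1 -!mulrBr !tpowM ?ltW//.
have h := lt0r_neq0 (cut_den u12 u); have s1 := lt0r_neq0 s0.
move: h; move: (tpow 3 _) (tpow 3 _) (tpow 2 _) (tpow 2 _) => x y z w h.
by rewrite -mulrDr; field; rewrite s1 h.
Qed.

(** The indicator is dominated by a product of bumps of width proportional to [s] in the [2 #|P|]
    small real coordinates; each contributes a factor of order [s]. *)
Lemma grid_slab {R : realType} (p : nat) (P : pred 'I_p) (M : R) (M0 : 0 < M) : exists2 c : R, 0 < c &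
  forall (s : R) (q : 'M[R]_(p, 2) -> bool), 0 < s -> 2 * s <= M ->
  (forall Z, q Z -> forall i j, P i -> `|Z i j| <= s) -> mean (grid p 2 M0) (fun Z => (q Z)%:R) <= (c * s) ^+ (2 * #|P|).
Proof.
have [d d0 hd] : exists2 d : R, 0 < d & forall x, `|x| <= 1 -> d <= bump 0 2 x.
  have cb : continuous (@bump R 0 2) by apply: bump_cont.
  have cw : {within `[(-1 : R), 1], continuous (@bump R 0 2)} by exact: continuous_subspaceT.
  have l11 : (-1 : R) <= 1 by lra. have [c hc hx] := EVT_min l11 cw.
  exists (bump 0 2 c); last by move=> y hy; apply: hx; rewrite in_itv /= -ler_norml.
  move: hc; rewrite in_itv /= => /andP[h1 h2]; rewrite oppr_gt0; apply: cut1_lt0; first by lra.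
  by apply/andP; split; lra.
exists (d^-1 * (2 * M)^-1); first by rewrite mulr_gt0 ?invr_gt0// mulr_gt0.
move=> s q s0 sM hq.
pose F (c : 'I_p * 'I_2) (x : R) : R := if P c.1 then s / d * bump 0 (2 * s) x else 1.
have bs x : bump 0 (2 * s) x = s^-1 * bump 0 2 (x / s).
  have e1 : 0 - 2 * s = s * (0 - 2) by ring. have e2 : 0 + 2 * s = s * (0 + 2) by ring.
  have e3 : x = s * (x / s) by field; rewrite gt_eqF. by rewrite /bump e1 e2 [in LHS]e3 cut1M ?mulrN//; lra.
have F0 c x : 0 <= F c x.
  by rewrite /F; case: ifP => // _; rewrite mulr_ge0 ?bump_ge0 ?mulr_gt0// ltW// divr_gt0.
have cF c : continuous (F c).
  rewrite /F; case: (P c.1); last exact: cont_cst. by move=> x; apply: cont_mulc; apply: bump_cont; rewrite mulr_gt0.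
have ind (Z : 'M[R]_(p, 2)) : (q Z)%:R <= \prod_c F c (Z c.1 c.2).
  have [h|h] := boolP (q Z); last by apply: prodr_ge0.
  rewrite (_ : true%:R = \prod_(c : 'I_p * 'I_2) 1); last by rewrite big1.
  apply: ler_prod => -[i j] _; rewrite ler01 /F /=; case: ifP => // Pi.
  have hk : `|Z i j / s| <= 1 by rewrite normrM normfV (gtr0_norm s0) ler_pdivrMr// mul1r hq.
  rewrite bs mulrA -[s / d * _]mulrAC divff ?gt_eqF// mul1r. by rewrite mulrC ler_pdivlMr// mul1r; exact: hd.
have cprod := prod_coord_cont cF.
have b1 : bdd (grid p 2 M0) (fun Z => (q Z)%:R : R).
  by exists 1 => Z _; rewrite normr_nat lern1 leq_b1.
have b2 : bdd (grid p 2 M0) (fun x => \prod_c F c (x c.1 c.2)) by exact: grid_bdd.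
apply: (le_trans (mean_le b1 b2 (fun Z _ => ind Z))).
rewrite grid_mean_prod// -(pair_bigA _ (fun i j => mean I01 (fun t => F (i, j) (gline M t)))) /=.
have e1 i j : mean I01 (fun t => F (i, j) (gline M t)) = if P i then d^-1 * (2 * M)^-1 * s else 1.
  rewrite /F /=; case: (P i); last by rewrite mean_cst. rewrite meanZ; last first.
    apply: I01_bdd.
    move=> t _; apply: (@cont_comp _ _ _ (gline M) (bump 0 (2 * s))); last by apply: bump_cont; rewrite mulr_gt0.
    exact: gline_cont.
  by rewrite bump_mean ?mulr_gt0//; [ring|lra|lra].
rewrite (eq_bigr (fun i => if P i then (d^-1 * (2 * M)^-1 * s) ^+ 2 else 1)).
  by rewrite -big_mkcond prodr_const exprM.
by move=> i _; case: (boolP (P i)) => Pi; rewrite (eq_bigr _ (fun j _ => e1 i j)) ?Pi ?(negbTE Pi) ?prodr_const ?card_ord ?expr1n.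
Qed.

(** * Weighted means over the cone *)

Section ConeMean.
Context {R : realType}.

(** A radial weight living on [1/8 <= |Z|^2 <= 1]. For functions constant on complex lines the mean
    weighted by it is a positive multiple of integration over projective space. *)
Definition rho (u : R) : R := (1 - cut (1 / 8) (1 / 4) u) * cut (1 / 2) 1 u.

Lemma rho_ge0 u : 0 <= rho u.
Proof. by rewrite mulr_ge0 ?subr_ge0 ?cut_le1 ?cut_ge0//; lra. Qed.

Lemma rho_le1 u : rho u <= 1.
Proof.
rewrite -[leRHS]mulr1 ler_pM ?subr_ge0 ?cut_le1 ?cut_ge0// ?lerBlDr ?lerDl ?cut_ge0//; lra.
Qed.

Lemma rho_supp u : rho u != 0 -> 1 / 8 <= u <= 1.
Proof.
apply: contraR; rewrite negb_and -!ltNge /rho => /orP[h|h].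
  by rewrite cut_left ?subrr ?mul0r ?ltW//; lra.
by rewrite [cut (1 / 2) 1 u]cut_right ?mulr0 ?ltW.
Qed.

Lemma rho_gt0 : 0 < rho (1 / 3).
Proof. by rewrite /rho cut_right ?subr0 ?mul1r ?cut_left//; lra. Qed.

Lemma isC1_rho : isC1 setT rho.
Proof.
apply: isC1_mul; [apply: isC1_sub; first exact: isC1_cst|].
all: by eexists; apply: C1_cut; lra.
Qed.

Variable m : nat.
Local Notation V := 'M[R]_(m, 2).
Definition annulus : set V := [set Z | 1 / 8 <= sq Z <= 1].

Lemma annulus_compact : compact annulus. Proof. exact: compact_shell. Qed.

Lemma annulus_closed : closed annulus.
Proof. by apply: compact_closed; [exact: norm_hausdorff|exact: annulus_compact]. Qed.

Lemma annulus_neq0 Z : annulus Z -> Z != 0.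
Proof.
by apply: contraPneq => ->; rewrite /annulus/= ip0r => /andP[h _]; move: h; rewrite leNgt divr_gt0.
Qed.

Lemma annulus_norm Z : annulus Z -> `|Z| <= 1.
Proof. by move=> /andP[_ h]; apply: norm_le_ip => //; rewrite expr1n. Qed.

(** The power [sq Z ^+ k] compensates the factors [|Z|^-2] produced by traces. The differential of
    the weight is a multiple of [ip Z], which contributes nothing when paired with the fields of
    basic forms. *)
Lemma radial_weight k : exists2 dr : R -> R,
  C1 (setT : set V) (fun Z => rho (sq Z) * sq Z ^+ k) (fun Z v => dr (sq Z) * ip Z v) &
  forall Z v, ~ annulus Z -> dr (sq Z) * ip Z v = 0.
Proof.
have [dr hdr] : isC1 setT (fun u : R => rho u * u ^+ k).
  apply: isC1_mul; first exact: isC1_rho. case: k => [|k]; first by under eq_fun do rewrite expr0; exact: isC1_cst.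
  by eexists; exact: (C1_exp k (@C1_id R R setT)).
have hC : C1 (setT : set V) (fun Z => rho (sq Z) * sq Z ^+ k) (fun Z v => (2 * dr (sq Z) 1) * ip Z v).
  apply: (C1_ext (C1_comp1 openT (C1_ip (@C1_id R V setT) (@C1_id R V setT)) hdr (fun _ _ => I))) => // Z v.
  by rewrite [ip v Z]ipC /GRing.scale/=; ring.
exists (fun u => 2 * dr u 1) => // Z v hZ.
rewrite -(D_of_C1 v hC (I : setT Z)); have oA : open (~` annulus) by apply: closed_openC; exact: annulus_closed.
rewrite (@near_eq_derive _ _ _ _ (fun=> 0)) ?derive_cst//.
have := open_nbhs_nbhs (conj oA hZ : open_nbhs Z (~` annulus)); apply: filterS => Y hY.
by have [->|/rho_supp//] := eqVneq (rho (sq Y)) 0; rewrite mul0r.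
Qed.

Fact two_gt0 : (0 : R) < 2. Proof. by []. Qed.
Definition box : net V := grid m 2 two_gt0.
Definition mu (q : V -> R) : R := mean box (fun Z => rho (sq Z) * q Z).

Lemma mu_bdd q : (exists B, forall Z, annulus Z -> `|q Z| <= B) -> bdd box (fun Z => rho (sq Z) * q Z).
Proof.
move=> [B hB]; exists `|B| => Z _; have [->|/rho_supp h] := eqVneq (rho (sq Z)) 0; first by rewrite mul0r normr0.
rewrite normrM ger0_norm ?rho_ge0// -[leRHS]mul1r ler_pM ?rho_ge0 ?rho_le1//.
exact: (le_trans (hB Z h) (ler_norm B)).
Qed.

Lemma mu_eq q q' : (forall Z, annulus Z -> q Z = q' Z) -> mu q = mu q'.
Proof.
move=> h; apply: mean_eq => Z _; have [->|/rho_supp hZ] := eqVneq (rho (sq Z)) 0; first by rewrite !mul0r.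
by rewrite h.
Qed.

Definition mbdd (q : V -> R) := exists B, forall Z, annulus Z -> `|q Z| <= B.

Lemma muD q q' : mbdd q -> mbdd q' -> mu (fun Z => q Z + q' Z) = mu q + mu q'.
Proof.
move=> h h'; rewrite /mu -meanD; [|exact: mu_bdd|exact: mu_bdd].
by apply: mean_eq => Z _; rewrite mulrDr.
Qed.

Lemma muZ c q : mbdd q -> mu (fun Z => c * q Z) = c * mu q.
Proof.
by move=> h; rewrite /mu -meanZ; [apply: mean_eq => Z _; rewrite mulrCA|exact: mu_bdd].
Qed.

Lemma mu_le q q' : mbdd q -> mbdd q' -> (forall Z, annulus Z -> q Z <= q' Z) -> mu q <= mu q'.
Proof.
move=> h h' qq; apply: mean_le; [exact: mu_bdd|exact: mu_bdd|move=> Z _].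
have [->|/rho_supp hZ] := eqVneq (rho (sq Z)) 0; first by rewrite !mul0r.
by rewrite ler_wpM2l ?rho_ge0 ?qq.
Qed.

Lemma mbddD q q' : mbdd q -> mbdd q' -> mbdd (fun Z => q Z + q' Z).
Proof. by move=> [B h] [B' h']; exists (B + B') => Z hZ; rewrite (le_trans (ler_normD _ _))// lerD ?h ?h'. Qed.
Lemma mbddM q q' : mbdd q -> mbdd q' -> mbdd (fun Z => q Z * q' Z).
Proof. by move=> [B h] [B' h']; exists (B * B') => Z hZ; rewrite normrM ler_pM ?h ?h'. Qed.
Lemma mbdd_cst c : mbdd (fun=> c). Proof. by exists `|c|. Qed.
Lemma mbddZ c q : mbdd q -> mbdd (fun Z => c * q Z).
Proof. by move=> h; apply: mbddM h; exact: mbdd_cst. Qed.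
Lemma mbdd_cont (q : V -> R) : (forall Z, Z != 0 -> {for Z, continuous q}) -> mbdd q.
Proof.
move=> h; have [B _ hB] := compact_bdd annulus_compact (fun Z hZ => h Z (annulus_neq0 hZ)).
by exists B.
Qed.

Lemma mu_pos (q : V -> R) Z0 : mbdd q -> (forall Z, annulus Z -> 0 <= q Z) -> (forall Z, Z != 0 -> {for Z, continuous q}) ->
  sq Z0 = 1 / 3 -> 0 < q Z0 -> 0 < mu q.
Proof.
move=> bq q0 cq Z03 qZ0; apply: (@grid_pos R m 2 2 two_gt0 _ Z0).
- move=> Z; have [Z1|Z1] := eqVneq Z 0; last first.
    apply: (@continuousM _ _ (fun Z => rho (sq Z))); last exact: cq.
    by apply: (@cont_comp _ _ _ (fun Z : V => sq Z) rho); [exact: ip_cont|exact: (isC1_cont isC1_rho)].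
  apply: (@near_cont _ _ _ (fun=> 0)); last exact: cont_cst. have : \forall Y \near Z, ~ annulus Y.
    by apply: open_nbhs_nbhs; split; [apply: closed_openC; exact: annulus_closed|rewrite Z1 => /annulus_neq0; rewrite eqxx].
  apply: filterS => Y hY. by have [->|/rho_supp//] := eqVneq (rho (sq Y)) 0; rewrite mul0r.
- move=> Z; have [->|/rho_supp h] := eqVneq (rho (sq Z)) 0; first by rewrite mul0r. by rewrite mulr_ge0 ?rho_ge0 ?q0.
- by rewrite Z03 mulr_gt0 ?rho_gt0.
- by apply: (@le_lt_trans _ _ 1); [apply: norm_le_ip => //; rewrite Z03; lra|rewrite ltr1n].
Qed.

End ConeMean.

(** * Stokes identities for the weighted mean *)

Section ConeStokes.
Context {R : realType} (n : nat).
Local Notation V := 'M[R]_(n.+1, 2).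
Local Notation E := 'M[R]_(n, 2).
Local Notation A0 := [set Z : V | Z != 0].
Lemma lin_sub (L K : V -> R) : linear L -> linear K -> linear (fun v => L v - K v).
Proof. by move=> hL hK k u v; rewrite hL hK /GRing.scale/=; ring. Qed.

Lemma lin_mulr (L : V -> R) c : linear L -> linear (fun v => L v * c).
Proof. by move=> hL k u v; rewrite hL /GRing.scale/=; ring. Qed.

Lemma lin_mull (L : V -> R) c : linear L -> linear (fun v => c * L v).
Proof. by move=> hL k u v; rewrite hL /GRing.scale/=; ring. Qed.

Lemma ext0_lin (P : set V) (F : V -> V -> R) Z : (P Z -> linear (fun v => F v Z)) -> linear (fun v => ext0 P (F v) Z).
Proof.
move=> h k u v; have [PZ|PZ] := pselect (P Z); last by rewrite !ext0_out// scaler0 addr0.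
by rewrite !ext0_in// h.
Qed.

Variables (C : set V) (G : V -> E) (a b : R).
Hypothesis sc : symp_coord C G a b.
Let oC := sc_open sc.

(** [f ka] extends by 0 to all nonzero vectors, where [stokes1] applies. The derivative of the
    weight contributes a multiple of [be Z (Jm Z)], which vanishes because [ka] kills the circle
    direction. *)
Lemma cone_stokes s t f df ka : a < s -> t < b -> C1 C f df ->
  (forall Z, C Z -> linear (ka Z)) -> (forall Z, C Z -> ka Z (Jm Z) = 0) -> (forall v, isC1 C (ka^~ v)) ->
  (forall Z, C Z -> f Z != 0 -> s <= usq G Z <= t) -> mu (fun Z => sq Z * ext0 C (fun Z => tr (wedge (df Z) (ka Z)) +
    f Z * tr (fun u v => 'D_u (ka^~ v) Z - 'D_v (ka^~ u) Z)) Z) = 0.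
Proof.
move=> hs ht hf lk kJ ck fS.
pose be (Z v : V) : R := ext0 C (fun Z => f Z * ka Z v) Z.
have supp v Z : C Z -> f Z * ka Z v != 0 -> s <= usq G Z <= t.
  by move=> CZ; rewrite mulf_eq0 negb_or => /andP[h _]; exact: fS.
have hb : form1 A0 be (fun v Z u => 'D_u (be^~ v) Z).
  split=> [Z _|v].
    apply: (ext0_lin (P := C) (F := fun v Z => f Z * ka Z v)) => CZ; exact: (lin_mull _ (lk Z CZ)).
  apply: isC1_D; first exact: open_neq0. apply: (sc_ext_isC1 sc hs ht _ (@supp v)). by apply: isC1_mul => //; exists df.
have [dr hw dr0] := @radial_weight R n.+1 1.
have key Z : Z != 0 -> tr (ext1 (fun v Z u => 'D_u (be^~ v) Z) Z) =
    ext0 C (fun Z => tr (wedge (df Z) (ka Z)) + f Z * tr (fun u v => 'D_u (ka^~ v) Z - 'D_v (ka^~ u) Z)) Z.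
  move=> Z0; have [CZ|CZ] := pselect (C Z); last first.
    rewrite ext0_out// /tr big1// => k _; rewrite /ext1.
    have h v u : 'D_u (be^~ v) Z = 0 by exact: (sc_ext_D_out sc u hs ht (@supp v) Z0 CZ). by rewrite !h subrr.
  rewrite ext0_in// /tr mulr_sumr -big_split; apply: eq_bigr => k _ /=.
  have aux (df1 k1 f1 d1 df2 k2 d2 p1 p2 : R) : p1 = df1 * k1 + f1 * d1 -> p2 = df2 * k2 + f1 * d2 ->
    p1 - p2 = df1 * k1 - df2 * k2 + f1 * (d1 - d2) by move=> -> ->; ring.
  have h u v : 'D_u (be^~ v) Z = df Z u * ka Z v + f Z * 'D_u (ka^~ v) Z.
    apply: (etrans (ext0_D_in (fun Z => f Z * ka Z v) u oC CZ)). exact: (D_of_C1 u (C1_mul hf (isC1_D oC (ck v))) CZ).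
  exact: (aux _ _ _ _ _ _ _ _ _ (h _ _) (h _ _)).
have lt12 : (1 : R) < 2 by rewrite ltr1n.
have := stokes1 (@two_gt0 R) (@open_neq0 R n.+1) (@annulus_closed R n.+1) (@annulus_neq0 R n.+1) lt12 (@annulus_norm R n.+1) hw _ _ hb.
have w0 (Z : V) : ~ annulus Z -> rho (sq Z) * sq Z ^+ 1 = 0.
  by move=> hZ; have [->|/rho_supp//] := eqVneq (rho (sq Z)) 0; rewrite mul0r.
move=> /(_ w0 (fun Z v hZ => dr0 Z v hZ)) h; rewrite /mu -[RHS]h; apply: mean_eq => Z _.
have [hZ|hZ] := pselect (annulus Z); last first.
  rewrite w0// mul0r /tr big1 ?addr0; last by move=> k _; rewrite /wedge !dr0// !mul0r subrr.
  by have [->|/rho_supp//] := eqVneq (rho (sq Z)) 0; rewrite mul0r.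
have Z0 := annulus_neq0 hZ; rewrite key// expr1 mulrA.
have -> : tr (wedge (fun v => dr (sq Z) * ip Z v) (be Z)) = 0; last by rewrite addr0.
have -> : tr (wedge (fun v => dr (sq Z) * ip Z v) (be Z)) = dr (sq Z) * - tr (wedge (be Z) (ip Z)).
  by rewrite /tr -sumrN mulr_sumr; apply: eq_bigr => k _; rewrite /wedge; ring.
have [hl _] := hb; rewrite (tr_wedge _ (hl Z Z0)) opprK.
have [CZ|CZ] := pselect (C Z); last by rewrite /be ext0_out// mulr0.
by rewrite /be ext0_in// kJ// !mulr0.
Qed.

(** Stokes for [f (|G|^2) lambda]. Evaluating [df] on the lifted Liouville field gives the term
    [f1 (u) u], and the trace of [Omega] gives the factor [n]. *)
Lemma radial_stokes s t (f f1 : R -> R) : a < s -> t < b -> C1 setT f (fun u v => v * f1 u) ->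
  (forall u, a < u < b -> f u != 0 -> s <= u <= t) ->
  mu (fun Z => ext0 C (fun Z => f1 (usq G Z) * usq G Z + n%:R * f (usq G Z)) Z) = 0.
Proof.
move=> hs ht hf fS.
pose df Z v := f1 (usq G Z) * (2 * ip (G Z) ('D_v G Z)).
have hdf : C1 C (fun Z => f (usq G Z)) df.
  have [du hu] := isC1_usq sc. apply: (eq_C1 oC _ _ (C1_comp1 openT hu hf (fun _ _ => I))) => // Z v CZ.
  by rewrite /df -(usq_D sc v CZ) (D_of_C1 v hu CZ) /GRing.scale/= mul1r mulrC.
have h := cone_stokes hs ht hdf (fun Z CZ => lamG_lin sc CZ) (fun Z CZ => lamG_J sc CZ) (fun v => lamG_C1 sc v)
  (fun Z CZ => fS _ (sc_range sc CZ)).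
rewrite -[RHS]h; apply: mu_eq => Z /annulus_neq0 Z0.
have [CZ|CZ] := pselect (C Z); last by rewrite !(ext0_out _ CZ) mulr0.
rewrite !(ext0_in _ CZ).
have z0 := lt0r_neq0 (ip_gt0 Z0).
have -> : (fun u v => 'D_u ((lamG G)^~ v) Z - 'D_v ((lamG G)^~ u) Z) = Omega Z.
  by apply/funext => u; apply/funext => v; exact: (lamG_ext sc u v CZ).
have [Y hY lY] := lamG_Omega sc CZ.
have -> : lamG G Z = Omega Z Y by apply/funext => v; exact: lY.
have d0 w : 'D_w G Z = 0 -> df Z w = 0 by rewrite /df => ->; rewrite ip0r !mulr0.
rewrite tr_Omega// (tr_wedge_Omega Y (C1_linear hdf CZ) (d0 _ (sc_dGZ sc CZ)) (d0 _ (sc_dGJ sc CZ))).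
rewrite /df hY ipZr -/(usq G Z) -(natr1 n).
by move: z0; move: (sq Z) (usq G Z) => x y x0; field.
Qed.

(* The push-forward of the mean under [G] is invariant under translations. *)
Lemma mu_partial s t (w : E -> R) dw c : a < s -> t < b -> C1 setT w dw -> (forall x, w x != 0 -> s <= sq x <= t) ->
  mu (fun Z => ext0 C (fun Z => dw (G Z) c) Z) = 0.
Proof.
move=> hs ht hw wS.
have hdf := C1_comp openT (sc_dG sc) hw (fun _ _ => I).
pose ka Z v := omega_st c ('D_v G Z).
have ck v : C1 C (ka^~ v) (fun Z u => ip (Jm c) ('D_u (fun Z => 'D_v G Z) Z)).
  apply: (C1_ext (C1_ip (@C1_cst R V E C (Jm c)) (isC1_D oC (sc_C2 sc v)))) => [Z|Z u].
    by rewrite /ka omega_ip.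
  by rewrite ip0l add0r.
have lk Z : C Z -> linear (ka Z).
  move=> CZ k u v; rewrite /ka (sc_dG_lin sc CZ) !omega_ip. by rewrite ipDr ipZr.
have kJ Z : C Z -> ka Z (Jm Z) = 0 by move=> CZ; rewrite /ka (sc_dGJ sc CZ) omega_ip ip0r.
have h := cone_stokes hs ht hdf lk kJ (fun v => ex_intro _ _ (ck v)) (fun Z _ => wS (G Z)).
rewrite -[RHS]h; apply: mu_eq => Z /annulus_neq0 Z0.
have [CZ|CZ] := pselect (C Z); last by rewrite !(ext0_out _ CZ) mulr0.
rewrite !(ext0_in _ CZ).
have z0 := lt0r_neq0 (ip_gt0 Z0).
have -> : (fun u v => 'D_u (ka^~ v) Z - 'D_v (ka^~ u) Z) = (fun _ _ => 0).
  apply/funext => u; apply/funext => v.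
  apply: (etrans (congr2 (fun x y => x - y) (D_of_C1 u (ck v) CZ) (D_of_C1 v (ck u) CZ))).
  by rewrite (sc_dG_sym sc u v CZ); exact: subrr.
have [Y hY] := sc_surj sc c CZ.
have -> : ka Z = Omega Z Y by apply/funext => v; rewrite /ka -hY (sc_symp sc).
have d0 w' : 'D_w' G Z = 0 -> dw (G Z) ('D_w' G Z) = 0 by move=> ->; exact: (lin0 (C1_linear hw (I : setT (G Z)))).
rewrite (tr_wedge_Omega Y (C1_linear hdf CZ) (d0 _ (sc_dGZ sc CZ)) (d0 _ (sc_dGJ sc CZ))) hY.
have -> : tr (fun _ _ : V => 0 : R) = 0 by rewrite /tr big1.
by rewrite mulr0 addr0 mulrC divfK.
Qed.

End ConeStokes.

(** * Stokes identities with a singularity along a line *)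

Section SlabStokes.
Context {R : realType} (n : nat).
Local Notation V := 'M[R]_(n.+1, 2).
Local Notation E := 'M[R]_(n, 2).
Hypothesis n2 : (2 <= n)%N.

(** The cone over projective space minus the centre of the standard ball. *)
Definition Vp : set V := [set Z | del0 Z != 0].

Lemma del_linear : linear (@del R n ord0).
Proof. by move=> k u v; apply/matrixP => i j; rewrite !mxE. Qed.

Lemma sumB_le m (F : 'M[R]_(m, 2) -> R) (K : R) : (forall k, `|F (ex k)| <= K) -> (forall k, `|F (ey k)| <= K) ->
  `|sumB F| <= (2 * m)%:R * K.
Proof.
move=> h1 h2; apply: (le_trans (ler_norm_sum _ _ _)); apply: (@le_trans _ _ (\sum_(k < m) (K + K))).
  by apply: ler_sum => k _; rewrite (le_trans (ler_normD _ _))// lerD.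
by rewrite sumr_const card_ord -mulr2n -mulrnA -[leLHS]mulr_natl.
Qed.

(** The slab has mass of order [s ^ (2 n)] with [2 n] at least 4. This beats the error [s ^ -3] and
    leaves a bound of order [s]. *)
Lemma slab_limit (q : V -> R) (B : R) : bdd (box n.+1) q ->
  (forall s : R, 0 < s <= 1 / 4 -> exists fs : V -> R, [/\ bdd (box n.+1) fs, mean (box n.+1) fs = 0 &
    forall Z, `|fs Z - q Z| <= B * s ^- 3 * (`|del0 Z| <= 2 * s)%R%:R]) ->
  mean (box n.+1) q = 0.
Proof.
move=> bq h; have [c c0 hc] := grid_slab (predC1 (@ord0 n)) (@two_gt0 R).
have Bp : 0 <= `|B| by [].
have key (s : R) : 0 < s <= 1 / 4 -> `|mean (box n.+1) q| <= `|B| * (2 * c) ^+ (2 * n) * s.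
  move=> hs; have [fs [bf mf hf]] := h s hs; case/andP: hs => s0 s1. pose ind (Z : V) : R := (`|del0 Z| <= 2 * s)%R%:R.
  have bi : bdd (box n.+1) ind by exists 1 => Z _; rewrite /ind normr_nat lern1 leq_b1.
  have b1 : bdd (box n.+1) (fun Z => `|B| * s ^- 3 * ind Z) by exact: bddZ.
  have s3 : 0 < s ^- 3 by rewrite invr_gt0 exprn_gt0. have d Z : `|fs Z - q Z| <= `|B| * s ^- 3 * ind Z.
    apply: (le_trans (hf Z)); rewrite -/(ind Z); apply: ler_wpM2r; first by rewrite /ind ler0n.
    by apply: ler_wpM2r; [exact: ltW|exact: ler_norm].
  have m1 : mean (box n.+1) (fun Z => `|B| * s ^- 3 * ind Z) <= `|B| * s ^- 3 * (c * (2 * s)) ^+ (2 * n).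
    rewrite meanZ// ler_wpM2l ?mulr_ge0 ?(ltW s3)//.
    have := hc (2 * s) (fun Z : V => `|del0 Z| <= 2 * s); rewrite cardC1 card_ord; apply; [by rewrite mulr_gt0|lra|].
    move=> Z hZ i j; case: (unliftP ord0 i) => [k -> _|-> /eqP//].
    by apply: le_trans hZ; rewrite -(delE ord0 Z k j); exact: coord_norm.
  have m2 : `|mean (box n.+1) q| <= mean (box n.+1) (fun Z => `|B| * s ^- 3 * ind Z).
    rewrite -[mean (box n.+1) q]subr0 -mf -meanB//. have bqf := bddB bq bf; have bqN := bddN bqf.
    rewrite ler_norml; apply/andP; split.
      rewrite lerNl -meanN//; apply: mean_le => // Z _. by rewrite opprB (le_trans (ler_norm _)).
    by apply: mean_le => // Z _; rewrite (le_trans (ler_norm _))// distrC.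
  apply: (le_trans m2 (le_trans m1 _)).
  have -> : `|B| * s ^- 3 * (c * (2 * s)) ^+ (2 * n) = `|B| * (2 * c) ^+ (2 * n) * (s ^- 3 * s ^+ (2 * n)).
    by rewrite mulrCA [2 * (c * s)]mulrA exprMn; ring.
  rewrite ler_wpM2l ?mulr_ge0 ?exprn_ge0//; first by rewrite mulr_ge0// ltW.
  have -> : (2 * n = 4 + 2 * (n - 2))%N by lia.
  rewrite exprD exprS mulrA mulrA [s ^- 3 * s]mulrC -[s * s ^- 3 * s ^+ 3]mulrA mulVf ?mulr1 ?expf_neq0 ?gt_eqF//.
  rewrite ger_pMr// exprn_ile1//; lra.
apply: (@le_small_eq0 _ _ (`|B| * (2 * c) ^+ (2 * n)) (1 / 4)) => [|s s0 s1]; first by rewrite divr_gt0.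
by apply: key; rewrite s0.
Qed.

(** Removes the line [del0 Z = 0]. The transition happens for [|Z'|^2] between [s^2] and [2 s^2], so
    the derivative is of order [1 / s] ([kz_bound]). *)
Definition kz (s : R) (Z : V) : R := 1 - cut (s ^+ 2) (2 * s ^+ 2) (sq (del0 Z)).
Definition dkz (s : R) (Z v : V) : R :=
  - (cut1 (s ^+ 2) (2 * s ^+ 2) (sq (del0 Z)) * (2 * ip (del0 Z) (del0 v))).

Lemma kz_C1 (s : R) : 0 < s -> C1 setT (kz s) (dkz s).
Proof.
move=> s0; have h12 : s ^+ 2 < 2 * s ^+ 2 by rewrite ltr_pMl ?exprn_gt0// ltr1n.
have hd : C1 (setT : set V) (@del R n ord0) (fun _ v => del0 v).
  by apply: C1_lin; [exact: del_linear|apply: linear_cont; exact: del_linear].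
have h := C1_comp1 openT (C1_ip hd hd) (C1_cut h12) (fun _ _ => I).
apply: (C1_ext (C1_sub (@C1_cst R V R setT 1) h)) => // Z v.
by rewrite /dkz [ip (del0 v) _]ipC /GRing.scale/=; ring.
Qed.

Lemma kz_low (s : R) Z : 0 < s -> sq (del0 Z) < s ^+ 2 -> kz s Z = 0 /\ forall v, dkz s Z v = 0.
Proof.
move=> s0 h; have h12 : s ^+ 2 < 2 * s ^+ 2 by rewrite ltr_pMl ?exprn_gt0// ltr1n.
split; first by rewrite /kz cut_left ?subrr// ltW.
move=> v; rewrite /dkz; have [->|/cut1_supp/andP[h1 _]] := eqVneq (cut1 (s ^+ 2) (2 * s ^+ 2) (sq (del0 Z))) 0.
  by rewrite mul0r oppr0.
by move: (lt_le_trans h h1); rewrite ltxx.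
Qed.

Lemma kz_high (s : R) Z : 0 < s -> 2 * s ^+ 2 < sq (del0 Z) -> kz s Z = 1 /\ forall v, dkz s Z v = 0.
Proof.
move=> s0 h; split; first by rewrite /kz cut_right ?subr0// ltW.
move=> v; rewrite /dkz; have [->|/cut1_supp/andP[_ h1]] := eqVneq (cut1 (s ^+ 2) (2 * s ^+ 2) (sq (del0 Z))) 0.
  by rewrite mul0r oppr0.
by move: (lt_le_trans h h1); rewrite ltxx.
Qed.

Lemma kz_bound : exists2 B : R, 0 < B & forall (s : R) (Z v : V), 0 < s ->
  sq (del0 Z) <= 2 * s ^+ 2 -> `|v| <= 1 -> `|dkz s Z v| <= B / s.
Proof.
have l12 : (1 : R) < 2 by rewrite ltr1n.
have [c c0 hc] := cut_bound l12.
exists (c * (2 * ((2 * n)%:R * 2)) + 1); first by rewrite ltr_wpDl// !mulr_ge0// ltW.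
move=> s Z v s0 hZ hv.
have cutE : cut1 (s ^+ 2) (2 * s ^+ 2) (sq (del0 Z)) = s ^- 2 * cut1 1 2 (sq (del0 Z) / s ^+ 2).
  have s2 : 0 < s ^+ 2 by rewrite exprn_gt0. have := cut1M (sq (del0 Z) / s ^+ 2) s2 l12.
  by rewrite mulr1 [s ^+ 2 * 2]mulrC [s ^+ 2 * (_ / _)]mulrC divfK ?gt_eqF.
rewrite /dkz normrN cutE normrM normrM ger0_norm ?invr_ge0 ?sqr_ge0//.
have h1 : `|ip (del0 Z) (del0 v)| <= (2 * n)%:R * (2 * s).
  have -> : ip (del0 Z) (del0 v) = sumB (fun a => ip (del0 Z) a * ip (del0 v) a).
    by rewrite sumB_riesz//; [rewrite ipC|exact: ip_linr].
  have hn : `|del0 Z| <= 2 * s.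
    apply: norm_le_ip; first by rewrite mulr_ge0// ltW.
    by apply: (le_trans hZ); rewrite exprMn ler_wpM2r ?sqr_ge0// expr2; lra.
  have hv' : `|del0 v| <= 1.
    by apply: mx_norm_le => // i j; rewrite delE (le_trans (coord_norm v _ _)).
  apply: sumB_le => k; rewrite ?ip_ex ?ip_ey normrM -[leRHS]mulr1 ler_pM//.
  - exact: le_trans (coord_norm _ _ _) hn.
  - exact: le_trans (coord_norm _ _ _) hv'.
  - exact: le_trans (coord_norm _ _ _) hn.
  - exact: le_trans (coord_norm _ _ _) hv'.
rewrite -mulrA; apply: (@le_trans _ _ (s ^- 2 * (c * (2 * ((2 * n)%:R * (2 * s)))))).
  rewrite ler_wpM2l ?invr_ge0 ?sqr_ge0// ler_pM// normrM ger0_norm// ler_wpM2l//.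
have -> : s ^- 2 * (c * (2 * ((2 * n)%:R * (2 * s)))) = c * (2 * ((2 * n)%:R * 2)) / s.
  by field; rewrite gt_eqF.
by rewrite ler_wpM2r ?invr_ge0 ?(ltW s0)// lerDl.
Qed.

(** Carries a Stokes identity for weights supported away from the removed line over to the radial
    weight. The error is a derivative of order [1 / s] against a field of order [s ^ -2];
    [T Z Z = 0] disposes of the derivative of the radial factor. *)
Lemma slab_stokes (k : nat) (Q : V -> R) (T : V -> V -> R) (B : R) :
  (forall (F : set V) (s : V -> R) (ds : V -> V -> R), closed F -> F `<=` Vp -> (forall Z, F Z -> `|Z| <= 1) -> C1 setT s ds ->
     (forall Z, ~ F Z -> s Z = 0) -> (forall Z v, ~ F Z -> ds Z v = 0) ->
     mean (box n.+1) (fun Z => s Z * Q Z + sumB (fun a => ds Z a * T Z a)) = 0) ->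
  (forall Z, Vp Z -> linear (T Z)) -> (forall Z, Vp Z -> T Z Z = 0) -> (forall Z, Vp Z -> annulus Z -> `|Q Z| <= B) ->
  (forall Z a, Vp Z -> annulus Z -> `|a| <= 1 -> `|T Z a| <= B / sq (del0 Z)) ->
  mu (fun Z => sq Z ^+ k * ext0 Vp Q Z) = 0.
Proof.
move=> HS lT TZ bQ bT.
have [dr hw dr0] := @radial_weight R n.+1 k.
pose w (Z : V) : R := rho (sq Z) * sq Z ^+ k.
have w0 Z : ~ annulus Z -> w Z = 0.
  by move=> hZ; rewrite /w; have [->|/rho_supp//] := eqVneq (rho (sq Z)) 0; rewrite mul0r.
have w1 Z : `|w Z| <= 1.
  have [hZ|/w0->] := pselect (annulus Z); last by rewrite normr0.
  have /andP[h1 h2] := hZ; have h0 : 0 <= sq Z by exact: ip_ge0.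
  have hk : 0 <= sq Z ^+ k <= 1 by rewrite exprn_ge0// exprn_ile1.
  case/andP: hk => k0 k1; have r0 := rho_ge0 (sq Z); have r1 := rho_le1 (sq Z).
  by rewrite ger0_norm; [exact: mulr_ile1|exact: mulr_ge0].
have [K K0 hK] := kz_bound.
pose B' := `|B| * (1 + (2 * n.+1)%:R * K).
have wQ Z : `|w Z * ext0 Vp Q Z| <= `|B|.
  have [hZ|/w0->] := pselect (annulus Z); last by rewrite mul0r normr0.
  rewrite normrM -[leRHS]mul1r ler_pM//; have [VZ|VZ] := pselect (Vp Z); last by rewrite ext0_out ?normr0.
  by rewrite ext0_in// (le_trans (bQ Z VZ hZ))// ler_norm.
rewrite /mu (@mean_eq _ _ _ _ (fun Z => w Z * ext0 Vp Q Z)); last by move=> Z _; rewrite /w mulrA.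
apply: (@slab_limit _ B'); first by exists `|B| => Z _.
move=> s /andP[s0 s4]; have s2 : 0 < s ^+ 2 by rewrite exprn_gt0.
pose F : set V := @annulus R n.+1 `&` [set Z | s ^+ 2 <= sq (del0 Z)].
have cF : closed F.
  apply: closedI; first exact: annulus_closed. have cd : continuous (fun Z : V => sq (del0 Z)).
    move=> Z; apply: cont_ip; apply: linear_cont; exact: del_linear.
  exact: (closed_comp (fun Z _ => cd Z) (@closed_ge R (s ^+ 2))).
have FV : F `<=` Vp.
  move=> Z [_ h]; apply: contraTneq h => ->; by rewrite ip0r -ltNge.
have hS := C1_mul hw (kz_C1 s0).
pose S Z := w Z * kz s Z.
pose dS (Z v : V) := dr (sq Z) * ip Z v * kz s Z + w Z * dkz s Z v.
have S0 Z : ~ F Z -> S Z = 0 /\ forall v, dS Z v = 0.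
  move=> /not_andP[h|/negP]; first by rewrite /S /dS w0// !mul0r; split => // v; rewrite dr0// !mul0r addr0.
  by rewrite -ltNge => /(kz_low s0)[h1 h2]; rewrite /S /dS h1 mulr0; split => // v; rewrite h2 !mulr0 addr0.
have m0 := HS F S dS cF FV (fun Z FZ => annulus_norm FZ.1) hS (fun Z h => (S0 Z h).1) (fun Z v h => (S0 Z h).2 v).
pose fs Z := S Z * Q Z + sumB (fun a => dS Z a * T Z a).
have s31 : 1 <= s ^- 3 by rewrite invr_ge1 ?unitfE ?expf_neq0 ?gt_eqF ?exprn_gt0// exprn_ile1//; lra.
have hB' : `|B| <= B' by rewrite /B' mulrDr mulr1 lerDl !mulr_ge0// ltW.
have diff Z : `|fs Z - w Z * ext0 Vp Q Z| <= B' * s ^- 3 * (`|del0 Z| <= 2 * s)%R%:R.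
  have nrm : sq (del0 Z) <= 2 * s ^+ 2 -> (`|del0 Z| <= 2 * s)%R.
    move=> h; apply: norm_le_ip; first by rewrite mulr_ge0// ltW.
    by apply: (le_trans h); rewrite exprMn ler_wpM2r ?sqr_ge0// expr2; lra.
  have rhs0 : 0 <= B' * s ^- 3 * (`|del0 Z| <= 2 * s)%R%:R.
    rewrite mulr_ge0 ?ler0n// mulr_ge0 ?(le_trans _ hB')//; exact: le_trans s31.
  have [FZ|FZ] := pselect (F Z); last first.
    have [h1 h2] := S0 Z FZ. have -> : fs Z = 0.
      by rewrite /fs h1 mul0r add0r /sumB big1// => j _; rewrite !h2 !mul0r addr0.
    rewrite sub0r normrN. have [hZ|/w0->] := pselect (annulus Z); last by rewrite mul0r normr0.
    have hlt : sq (del0 Z) < s ^+ 2.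
      by rewrite ltNge; apply/negP => h; apply: FZ.
    rewrite nrm ?mulr1; last by apply: (le_trans (ltW hlt)); rewrite ler_peMl ?ler1n// ltW.
    by apply: (le_trans (wQ Z)); rewrite -[leLHS]mulr1 ler_pM.
  have VZ := FV _ FZ; have [hZ hge] := FZ; rewrite ext0_in//.
  have -> : fs Z - w Z * Q Z = (kz s Z - 1) * (w Z * Q Z) + w Z * sumB (fun a => dkz s Z a * T Z a).
    rewrite /fs /S /dS. have -> : sumB (fun a => (dr (sq Z) * ip Z a * kz s Z + w Z * dkz s Z a) * T Z a) =
        dr (sq Z) * kz s Z * sumB (fun a => ip Z a * T Z a) + w Z * sumB (fun a => dkz s Z a * T Z a).
      by rewrite -!sumBZ -sumBD; apply: eq_sumB => a; ring.
    by rewrite sumB_riesz; [rewrite TZ//; ring|exact: lT].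
  have [h|h] := ltP (2 * s ^+ 2) (sq (del0 Z)).
    have [-> hd] := kz_high s0 h.
    by rewrite subrr mul0r add0r (@eq_sumB _ _ _ (fun a => 0)) ?/sumB ?big1 ?mulr0 ?normr0// => [j _|a]; rewrite ?addr0// hd mul0r.
  rewrite nrm// mulr1 (le_trans (ler_normD _ _))//. have k1 : `|kz s Z - 1| <= 1.
    by rewrite /kz [1 - _]addrC addrK normrN ger0_norm ?cut_ge0 ?cut_le1// ltr_pMl// ltr1n.
  have t1 : `|(kz s Z - 1) * (w Z * Q Z)| <= `|B| * s ^- 3.
    rewrite normrM; apply: (@le_trans _ _ (1 * `|B|)); last by rewrite mul1r -[leLHS]mulr1 ler_wpM2l.
    by rewrite ler_pM//; have := wQ Z; rewrite ext0_in.
  have t2 : `|w Z * sumB (fun a => dkz s Z a * T Z a)| <= (2 * n.+1)%:R * (K / s * (`|B| / s ^+ 2)).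
    rewrite normrM; apply: (@le_trans _ _ (1 * `|sumB (fun a => dkz s Z a * T Z a)|)); first by rewrite ler_wpM2r.
    have en a : `|a| <= 1 -> `|dkz s Z a * T Z a| <= K / s * (`|B| / s ^+ 2).
      move=> ha; rewrite normrM ler_pM// ?hK// (le_trans (bT Z a VZ hZ ha))//.
      have dp : 0 < sq (del0 Z) by exact: lt_le_trans hge. apply: (@le_trans _ _ (`|B| / sq (del0 Z))).
        by rewrite ler_wpM2r ?ler_norm// invr_ge0 ltW.
      by rewrite ler_wpM2l// lef_pV2 ?posrE.
    by rewrite mul1r; apply: sumB_le => j; apply: en; exact: mxb_norm.
  apply: (le_trans (lerD t1 t2)); rewrite /B' le_eqVlt; apply/orP; left; apply/eqP. by field; rewrite gt_eqF.
exists fs; split=> //; exists (`|B| + B' * s ^- 3) => Z _.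
rewrite -[fs Z](subrK (w Z * ext0 Vp Q Z)) addrC (le_trans (ler_normD _ _))// lerD// (le_trans (diff Z))//.
by rewrite ler_piMr ?lern1 ?leq_b1// mulr_ge0 ?(le_trans _ hB') ?(le_trans _ s31).
Qed.

End SlabStokes.

Arguments Vp {R n}.
Arguments del_linear {R n}.
(** * Bounds on forms *)

Section FormBounds.
Context {R : realType}.

Lemma lin_abs m (L : 'M[R]_(m, 2) -> R) v : linear L -> `|L v| <= `|v| * \sum_i \sum_j `|L (mxb i j)|.
Proof.
move=> hL; rewrite {1}(linear_coord_sum v hL) (le_trans (ler_norm_sum _ _ _))// mulr_sumr.
apply: ler_sum => i _; rewrite (le_trans (ler_norm_sum _ _ _))// mulr_sumr.
by apply: ler_sum => j _; rewrite normrM ler_wpM2r// coord_norm.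
Qed.

Lemma bilin_abs m (g : 'M[R]_(m, 2) -> 'M[R]_(m, 2) -> R) u v : bilin g ->
  `|g u v| <= `|u| * `|v| * \sum_i \sum_j \sum_k \sum_l `|g (mxb k l) (mxb i j)|.
Proof.
move=> [h1 h2]; apply: (le_trans (lin_abs v (h1 u))); rewrite [`|u| * _]mulrC -mulrA ler_wpM2l// mulr_sumr.
by apply: ler_sum => i _; rewrite mulr_sumr; apply: ler_sum => j _; exact: (lin_abs u (h2 _)).
Qed.

Lemma mbdd_sum m (I : Type) (r : seq I) (F : I -> 'M[R]_(m, 2) -> R) :
  (forall i, mbdd (F i)) -> mbdd (fun Z => \sum_(i <- r) F i Z).
Proof.
move=> h; elim: r => [|i r [B hB]]; first by exists 0 => Z _; rewrite big_nil normr0.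
have [B' hB'] := h i; exists (B' + B) => Z aZ.
by rewrite big_cons (le_trans (ler_normD _ _))// lerD ?hB ?hB'.
Qed.

Lemma mbdd_norm m (F : 'M[R]_(m, 2) -> R) : mbdd F -> mbdd (fun Z => `|F Z|).
Proof. by move=> [B hB]; exists B => Z aZ; rewrite normr_id hB. Qed.

Lemma mbdd_lin m (L : 'M[R]_(m, 2) -> 'M[R]_(m, 2) -> R) : (forall v, mbdd (L^~ v)) ->
  exists2 B : R, 0 <= B & forall Z v, annulus Z -> linear (L Z) -> `|L Z v| <= B * `|v|.
Proof.
move=> h; have [B hB] : mbdd (fun Z => \sum_i \sum_j `|L Z (mxb i j)|).
  by do 2 (apply: mbdd_sum => ?); exact: mbdd_norm.
exists `|B| => // Z v aZ lZ; rewrite mulrC; apply: (le_trans (lin_abs v lZ)); rewrite ler_wpM2l//.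
by rewrite (le_trans (ler_norm _))// (le_trans (hB Z aZ))// ler_norm.
Qed.

Lemma mbdd_bilin m (g : 'M[R]_(m, 2) -> 'M[R]_(m, 2) -> 'M[R]_(m, 2) -> R) : (forall u v, mbdd (fun Z => g Z u v)) ->
  exists2 B : R, 0 <= B & forall Z u v, annulus Z -> bilin (g Z) -> `|g Z u v| <= B * (`|u| * `|v|).
Proof.
move=> h; have [B hB] : mbdd (fun Z => \sum_i \sum_j \sum_k \sum_l `|g Z (mxb k l) (mxb i j)|).
  by do 4 (apply: mbdd_sum => ?); exact: mbdd_norm.
exists `|B| => // Z u v aZ lZ; rewrite mulrC; apply: (le_trans (bilin_abs u v lZ)).
rewrite ler_wpM2l ?mulr_ge0//.
by rewrite (le_trans (ler_norm _))// (le_trans (hB Z aZ))// ler_norm.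
Qed.

Lemma cs_norm m p q (v : 'M[R]_(m, 2)) : p ^+ 2 + q ^+ 2 = 1 -> `|cs p q v| <= 2 * `|v|.
Proof.
move=> pq; have p1 : `|p| <= 1 by rewrite -ler_sqr ?nnegrE// expr1n real_normK ?num_real// -pq lerDl sqr_ge0.
have q1 : `|q| <= 1 by rewrite -ler_sqr ?nnegrE// expr1n real_normK ?num_real// -pq lerDr sqr_ge0.
have c i j k l : `|p * v i j| + `|q * v k l| <= 2 * `|v|.
  by rewrite !normrM [2 * _]mulrDl mul1r lerD// -[leRHS]mul1r ler_pM// coord_norm.
apply: mx_norm_le => [|i j]; first by rewrite mulr_ge0.
by case: (ord2P j) => ->; [rewrite cs1E (le_trans (ler_normD _ _))|rewrite cs0E (le_trans (ler_normB _ _))].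
Qed.

Lemma ip_del0 n (Z : 'M[R]_(n.+1, 2)) : sq Z = Z ord0 ord0 ^+ 2 + Z ord0 ord_max ^+ 2 + sq (del0 Z).
Proof. by rewrite /ip big_ord_recl !expr2; congr (_ + _); apply: eq_bigr => i _; rewrite !mxE. Qed.

Lemma ip_del_le n (Z : 'M[R]_(n.+1, 2)) : sq (del0 Z) <= sq Z.
Proof. by rewrite [leRHS]ip_del0 lerDr addr_ge0 ?sqr_ge0. Qed.

(** For [t <= 1/4] the real part of the zeroth coordinate on the ray is at least 1/2; for larger [t]
    the other coordinates are at least a quarter of those of [Z]. It limits the growth of ray
    primitives to [|Z'|^-2]. *)
Lemma ray_del_le n (Z : 'M[R]_(n.+1, 2)) (t : R) (e := @ej R n ord0) : 0 <= t <= 1 -> sq Z <= 1 ->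
  sq (del0 Z) <= 16 * sq (e + t *: (Z - e)).
Proof.
move=> /andP[t0 t1] Z1.
have dE : del0 (e + t *: (Z - e)) = t *: del0 Z.
  by apply/matrixP => i j; rewrite !mxE [lift _ _ == _]eq_sym (negbTE (neq_lift _ _)) /=; ring.
have e0 : (e + t *: (Z - e)) ord0 ord0 = 1 - t + t * Z ord0 ord0 by rewrite !mxE /=; ring.
rewrite (ip_del0 (e + _)) dE e0 ipZr ipZl.
have := ip_ge0 (del0 Z); have := sqr_ge0 ((e + t *: (Z - e)) ord0 ord_max).
move: Z1; rewrite (ip_del0 Z); have := sqr_ge0 (Z ord0 ord_max).
move: (ip _ _) (_ ^+ 2) (_ ^+ 2) (Z ord0 ord0) => D y w z w0 h y0 D0.
have z1 : -1 <= z by nra.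
have [h4|h4] := lerP t (1 / 4).
  have h2 : 1 / 2 <= 1 - t + t * z by nra. have := sqr_ge0 z; nra.
have ht : 1 / 16 <= t * t by nra.
have := sqr_ge0 (1 - t + t * z); nra.
Qed.

Section DOmega.
Variable m : nat.
Local Notation V := 'M[R]_(m, 2).

Definition dOmega (u v Z w : V) : R :=
  - (2 * ip Z w * ip (Jm u) v * (sq Z)^-1 ^+ 2)
  - (ip u w * ip (Jm Z) v + ip u Z * ip (Jm w) v + ip (Jm u) w * ip Z v + ip (Jm u) Z * ip w v) * (sq Z)^-1 ^+ 2
  + 4 * ip Z w * (ip u Z * ip (Jm Z) v + ip (Jm u) Z * ip Z v) * (sq Z)^-1 ^+ 3.

Lemma Omega_C1 u v : C1 [set Z | Z != 0] (fun Z => Omega Z u v) (dOmega u v).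
Proof.
pose A0 := [set Z : V | Z != 0].
have hJ : C1 A0 (@Jm R m) (fun _ u => Jm u).
  by apply: C1_lin; [exact: Jm_linear|apply: linear_cont; exact: Jm_linear].
have hc (x : V) := @C1_cst R V V A0 x; have hi := @C1_id R V A0.
have h2 := C1_inv (fun Z Z0 => lt0r_neq0 (ip_gt0 Z0)) (C1_ip hi hi).
have h3 := C1_add (C1_mul (C1_ip (hc u) hi) (C1_ip hJ (hc v))) (C1_mul (C1_ip (hc (Jm u)) hi) (C1_ip hi (hc v))).
apply: (C1_ext (C1_sub (C1_scale (ip (Jm u) v) h2) (C1_mul h3 (C1_mul h2 h2)))) => [Z|Z w].
  by rewrite /Omega -exprVn expr2.
rewrite /dOmega -!exprVn !ip0r !ip0l [ip w Z]ipC.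
by move: (sq Z)^-1 => x; ring.
Qed.

Lemma dOmega_cyc (u v w Z : V) : dOmega u v Z w + dOmega v w Z u + dOmega w u Z v = 0.
Proof.
rewrite /dOmega [ip (Jm v) u]ip_Jl [ip (Jm w) v]ip_Jl [ip (Jm u) w]ip_Jl.
rewrite [ip v (Jm u)]ipC [ip w (Jm v)]ipC [ip u (Jm w)]ipC.
rewrite [ip (Jm u) Z]ip_Jl [ip (Jm v) Z]ip_Jl [ip (Jm w) Z]ip_Jl.
rewrite [ip u (Jm Z)]ipC [ip v (Jm Z)]ipC [ip w (Jm Z)]ipC [ip u Z]ipC [ip v Z]ipC [ip w Z]ipC.
rewrite [ip v u]ipC [ip w v]ipC [ip u w]ipC.
by move: (sq Z)^-1 => x; ring.
Qed.

End DOmega.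

End FormBounds.

(** * The potential of a cutoff *)

Section Potential.
Context {R : realType} (n : nat).
Local Notation V := 'M[R]_(n.+1, 2).
Local Notation E := 'M[R]_(n, 2).
Variables (C : set V) (G : V -> E) (a b : R).
Hypothesis sc : symp_coord C G a b.
Let oC := sc_open sc.
Local Notation dG Z v := ('D_v G Z).
Local Notation A0 := [set Z : V | Z != 0].
Local Notation Vp := (@Vp R n).

Lemma cs_0 m p q : cs p q (0 : 'M[R]_(m, 2)) = 0.
Proof.
have z k c : (0 : 'M[R]_(m, 2)) k c = 0 by rewrite mxE.
by apply: mx2P => k; rewrite cs0E cs1E !z !mulr0 subrr addr0.
Qed.

Lemma cs_lin_C1 p q (A : set V) : C1 A (@cs R n.+1 p q) (fun _ v => cs p q v).
Proof. by apply: C1_lin; [exact: cs_linear|apply: linear_cont; exact: cs_linear]. Qed.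

Lemma sc_dG_inv Z p q v : p ^+ 2 + q ^+ 2 != 0 -> C Z -> dG (cs p q Z) (cs p q v) = dG Z v.
Proof.
move=> pq CZ.
have h1 := C1_comp oC (@cs_lin_C1 p q C) (sc_dG sc) (fun Y CY => (sc_cs sc pq CY).1).
have h2 : C1 C G (fun Y v => dG (cs p q Y) (cs p q v)).
  by apply: (eq_C1 oC _ _ h1) => // Y CY; exact: (sc_cs sc pq CY).2.
exact: (C1_unique v h2 (sc_dG sc) CZ).
Qed.

Lemma lamG_inv Z p q v : p ^+ 2 + q ^+ 2 != 0 -> C Z -> lamG G (cs p q Z) (cs p q v) = lamG G Z v.
Proof. by move=> pq CZ; rewrite /lamG (sc_dG_inv v pq CZ) (sc_cs sc pq CZ).2. Qed.

Lemma usq_cs Z p q : p ^+ 2 + q ^+ 2 != 0 -> C Z -> usq G (cs p q Z) = usq G Z.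
Proof. by move=> pq CZ; rewrite /usq (sc_cs sc pq CZ).2. Qed.

(** The orbit is parametrized by nonzero 1 by 2 matrices, and [zero_deriv_cst] applies on this
    punctured complex line. *)
Lemma zero_deriv_orbit (P : set V) (f : V -> R) df Z : open P ->
  (forall p q, p ^+ 2 + q ^+ 2 != 0 -> P (cs p q Z)) -> C1 P f df -> (forall p q Y, P Y -> df Y (cs p q Y) = 0) ->
  forall p q, p ^+ 2 + q ^+ 2 != 0 -> f (cs p q Z) = f Z.
Proof.
move=> oP hP hf df0 p q pq.
pose w2 (x y : R) : 'M[R]_(1, 2) := \matrix_(i, j) if j == ord0 then x else y.
have w2n (w : 'M[R]_(1, 2)) : w != 0 -> w ord0 ord0 ^+ 2 + w ord0 ord_max ^+ 2 != 0.
  move=> w0; have := ip_gt0 w0; rewrite /ip big_ord1 -!expr2 => /lt0r_neq0 //.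
have h1 : C1 [set w : 'M[R]_(1, 2) | w != 0] (fun w => cs (w ord0 ord0) (w ord0 ord_max) Z)
    (fun w v => cs (v ord0 ord0) (v ord0 ord_max) Z).
  apply: (C1_ext (C1_cs (@C1_coord R 1 2 _ ord0 ord0) (@C1_coord R 1 2 _ ord0 ord_max) (C1_cst _ Z))) => // w v.
  by rewrite cs_0 addr0.
have h2 := C1_comp oP h1 hf (fun w w0 => hP _ _ (w2n w w0)).
have h3 := @zero_deriv_cst R 1 1 idfun _ _ _ _ h2.
have wn (x y : R) : x ^+ 2 + y ^+ 2 != 0 -> w2 x y != 0.
  apply: contraNneq => h; have := congr1 (fun w : 'M[R]_(1, 2) => w ord0 ord0 ^+ 2 + w ord0 ord_max ^+ 2) h.
  by rewrite !mxE/= expr0n/= addr0 => ->.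
have := h3 _ _ _ (w2 p q) (w2 1 0); rewrite !mxE/= cs1; apply.
- by [].
- by [].
- move=> w v w0; have := w2n w w0; set x := w _ _; set y := w _ _ => xy. set x' := v _ _; set y' := v _ _.
  have -> : cs x' y' Z = cs ((x' * x + y' * y) / (x ^+ 2 + y ^+ 2)) ((y' * x - x' * y) / (x ^+ 2 + y ^+ 2)) (cs x y Z).
    by rewrite cs_cs; congr cs; field.
  by apply: df0; exact: hP.
- exact: wn.
- by apply: wn; rewrite expr1n expr0n/= addr0 oner_eq0.
Qed.

(** [f] is constant on fibres by [zero_deriv_orbit], so it descends through local lifts to the shell
    of the coordinate space, which is connected. *)
Lemma sc_zero_deriv_cst (f : V -> R) df : 0 <= a -> C1 C f df -> (forall Z v, C Z -> df Z v = 0) ->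
  forall Z Y, C Z -> C Y -> f Z = f Y.
Proof.
move=> a0 hf df0.
have inv Z p q : p ^+ 2 + q ^+ 2 != 0 -> C Z -> f (cs p q Z) = f Z.
  move=> pq CZ; apply: (zero_deriv_orbit oC _ hf) => // [x y xy|x y Y CY]; first exact: (sc_cs sc xy CZ).1. exact: df0.
pose L x := xget 0 [set Z | C Z /\ G Z = x].
have LP x : a < sq x < b -> C (L x) /\ G (L x) = x.
  move=> hx; have [B [s [_ Bx _ /(_ _ Bx)[h1 h2]]]] := sc_lift sc hx. by rewrite /L; case: xgetP => [//|/(_ (s x))[]].
have fL Z Y : C Z -> C Y -> G Z = G Y -> f Z = f Y.
  by move=> CZ CY /(sc_fibre sc CZ CY)[p [q [pq ->]]]; rewrite inv.
have hk : C1 [set x | a < sq x < b] (fun x => f (L x)) (fun _ _ => 0).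
  move=> x hx; have [B [s [oB Bx [ds hs] sP]]] := sc_lift sc hx. have h1 := C1_comp oC hs hf (fun y By => (sP y By).1).
  have oW : open [set x : E | a < sq x < b].
    have -> : [set x : E | a < sq x < b] = (fun x : E => sq x) @^-1` [set u | a < u] `&` (fun x : E => sq x) @^-1` [set u | u < b].
      by apply/seteqP; split => [z /= /andP[]|z /= [? ?]]; [split|apply/andP].
    by apply: openI; apply: open_comp => [z _|]; [exact: ip_cont|exact: open_gt|exact: ip_cont|exact: open_lt].
  have h2 : C1 (B `&` [set x | a < sq x < b]) (fun x => f (L x)) (fun _ _ => 0).
    apply: (@eq_C1 _ _ _ _ (fun y => f (s y)) _ (fun x v => df (s x) (ds x v))).
    - exact: openI.
    - by move=> y [By Wy]; apply: fL; [exact: (sP y By).1|exact: (LP y Wy).1|rewrite (sP y By).2 (LP y Wy).2].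
    - by move=> y v [By _]; apply: df0; exact: (sP y By).1.
    - by apply: C1_subset h1 => y [].
  exact: h2.
move=> Z Y CZ CY.
have h := @shell_zero_deriv_cst R n a b _ _ a0 hk (fun _ _ _ => erefl) (G Z) (G Y) (sc_range sc CZ) (sc_range sc CY).
have [c1 c2] := LP _ (sc_range sc CZ); have [d1 d2] := LP _ (sc_range sc CY).
by rewrite (fL Z (L (G Z)))// h (fL Y (L (G Y))).
Qed.

Variables (u1 u2 : R).
Hypotheses (au1 : a < u1) (u12 : u1 < u2) (u2b : u2 < b).

Definition hcut (Z : V) : R := cut u1 u2 (usq G Z).
Definition dcut (Z v : V) : R := cut1 u1 u2 (usq G Z) * (2 * ip (G Z) (dG Z v)).
(** The differential of the cutoff, extended by 0: a closed 1-form on all nonzero vectors. The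
    cutoff itself does not extend by 0, since it equals 1 towards the inner boundary. *)
Definition eta (Z v : V) : R := ext0 C (dcut^~ v) Z.
Definition deta (v Z u : V) : R := 'D_u (eta^~ v) Z.

Lemma dcut_supp Z v : C Z -> dcut Z v != 0 -> u1 <= usq G Z <= u2.
Proof. by move=> _; rewrite mulf_eq0 negb_or => /andP[/cut1_supp]. Qed.

Lemma hcut_C1 : C1 C hcut dcut.
Proof.
have [du hu] := isC1_usq sc.
apply: (eq_C1 oC _ _ (C1_comp1 openT hu (C1_cut u12) (fun _ _ => I))) => // Z v CZ.
rewrite /dcut -(usq_D sc v CZ) (D_of_C1 v hu CZ) /GRing.scale/= mul1r mulrC //.
Qed.

Lemma dcut_C1 v : isC1 C (dcut^~ v).
Proof.
apply: isC1_mul; first by apply: isC1_comp1; [exact: isC1_usq sc|exact: isC1_cut1].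
by apply: isC1_scale; apply: isC1_ip; [exact: (sc_C1 sc)|exact: (sc_C2 sc)].
Qed.

Lemma eta_out Z v : ~ C Z -> eta Z v = 0. Proof. exact: ext0_out. Qed.
Lemma eta_in Z v : C Z -> eta Z v = dcut Z v. Proof. exact: ext0_in. Qed.

Lemma dcut_lin Z : C Z -> linear (dcut Z).
Proof. by move=> CZ; exact: (C1_linear hcut_C1). Qed.

Lemma eta_lin Z : linear (eta Z).
Proof.
have [CZ|CZ] := pselect (C Z); move=> k u v; first by rewrite !eta_in// dcut_lin.
by rewrite !eta_out// scaler0 addr0.
Qed.

Lemma eta_form1 : form1 A0 eta deta.
Proof.
split=> [Z _|v]; first exact: eta_lin.
apply: isC1_D; first exact: open_neq0.
by apply: (sc_ext_isC1 sc au1 u2b (dcut_C1 v)) => Z; exact: dcut_supp.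
Qed.

Lemma deta_out Z u v : Z != 0 -> ~ C Z -> deta v Z u = 0.
Proof. by move=> Z0 CZ; apply: (sc_ext_D_out sc _ au1 u2b _ Z0 CZ) => Y; exact: dcut_supp. Qed.

Lemma dcut_sym Z u v : C Z -> 'D_u (dcut^~ v) Z = 'D_v (dcut^~ u) Z.
Proof. by move=> CZ; exact: (C2_sym u v oC hcut_C1 (fun w => isC1_D oC (dcut_C1 w)) CZ). Qed.

Lemma deta_sym Z u v : Z != 0 -> deta u Z v = deta v Z u.
Proof.
move=> Z0; have [CZ|CZ] := pselect (C Z); last by rewrite !deta_out.
apply: (etrans (ext0_D_in (dcut^~ u) v oC CZ)); apply: (etrans (dcut_sym v u CZ)).
by apply/esym/ext0_D_in.
Qed.

Lemma eta_cs Z p q : eta Z (cs p q Z) = 0.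
Proof.
have [CZ|CZ] := pselect (C Z); last by rewrite eta_out.
by rewrite eta_in// /dcut (sc_dG_cs sc)// ip0r !mulr0.
Qed.

Lemma sc_cs_iff Z p q : p ^+ 2 + q ^+ 2 != 0 -> C (cs p q Z) -> C Z.
Proof.
move=> pq CZ; pose d := p ^+ 2 + q ^+ 2.
have pq' : (p / d) ^+ 2 + (- q / d) ^+ 2 != 0.
  have -> : (p / d) ^+ 2 + (- q / d) ^+ 2 = d^-1 by rewrite /d; field. by rewrite invr_eq0.
have [+ _] := sc_cs sc pq' CZ; rewrite cs_cs.
rewrite (_ : _ - _ = 1); last by rewrite /d; field.
by rewrite (_ : _ + _ = 0) ?cs1 // /d; field.
Qed.

Lemma eta_inv Z p q v : p ^+ 2 + q ^+ 2 != 0 -> eta (cs p q Z) (cs p q v) = eta Z v.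
Proof.
move=> pq; have [CZ|CZ] := pselect (C Z).
  rewrite (eta_in _ CZ) (eta_in _ (sc_cs sc pq CZ).1) /dcut (usq_cs pq CZ).
  by congr (_ * (2 * ip _ _)); [exact: (sc_cs sc pq CZ).2|exact: sc_dG_inv].
by rewrite !eta_out// => /(sc_cs_iff pq).
Qed.

Local Notation e := (@ej R n ord0).
Lemma ej_neq0 : e != 0.
Proof. by apply/eqP => h; have := @ej_j0 R n ord0; rewrite h mxE => /esym/eqP; rewrite oner_eq0. Qed.

Lemma del_ej : del0 e = 0.
Proof. by apply/matrixP => k c; rewrite delE ej_lift mxE. Qed.

Lemma Vp_open : open Vp.
Proof. by apply: (open_comp _ (@open_neq0 R n)) => Z _; apply: linear_cont; exact: del_linear. Qed.

Lemma Vp_neq0 Z : Vp Z -> Z != 0.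
Proof.
apply: contraNneq => ->; apply/eqP/matrixP => k c; by rewrite delE !mxE.
Qed.

Lemma del_cs (Z : V) p q : del0 (cs p q Z) = cs p q (del0 Z).
Proof. by apply: mx2P => k; rewrite !delE !cs0E !cs1E !delE. Qed.

Lemma Vp_cs Z p q : p ^+ 2 + q ^+ 2 != 0 -> Vp Z -> Vp (cs p q Z).
Proof.
move=> pq hZ; rewrite /Vp/= del_cs; apply/eqP => h; have [h1 h2] := cs_eq0 hZ h.
by move: pq; rewrite h1 h2 expr0n/= addr0 eqxx.
Qed.

Lemma Vp_star : Vp `<=` star e.
Proof.
move=> Z hZ t _; have [->|t0] := eqVneq t 0; first by rewrite scale0r addr0 ej_neq0.
apply: contraNneq hZ => h; have : del0 (e + t *: (Z - e)) = 0.
  by rewrite h; apply/matrixP => k c; rewrite delE !mxE.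
rewrite addrC del_linear del_ej addr0 => /eqP; rewrite scaler_eq0 (negPf t0) /=.
by rewrite -[X in X - _]scale1r addrC -scaleN1r del_linear del_ej scaler0 add0r scale1r.
Qed.

Hypotheses (a0 : 0 <= a) (CVp : C `<=` Vp).
Variables (Zs : V) (CZs : C Zs).

(** [eta] is integrated along segments from [e], which lies over the centre of the ball. The
    constant makes [Phi] agree with the cutoff at [Zs], hence on [C]; it is also the value of [Phi]
    on the removed ball ([Phi_core]). *)
Definition Psi : V -> R := prim1 e eta.
Definition Psi0 : R := hcut Zs - Psi Zs.
Definition Phi (Z : V) : R := Psi Z + Psi0.

Lemma Phi_C1_star : C1 (star e) Phi eta.
Proof.
have h := prim1_C1 eta_form1 (fun x u v x0 => deta_sym u v x0).
by apply: (C1_ext (C1_add (h e) (C1_cst _ Psi0))) => // x v; rewrite addr0.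
Qed.

Lemma Phi_C1 : C1 Vp Phi eta.
Proof. exact: C1_subset Vp_star Phi_C1_star. Qed.

Lemma Phi_in Z : C Z -> Phi Z = hcut Z.
Proof.
move=> CZ; have h := C1_sub (C1_subset CVp Phi_C1) hcut_C1.
have h' : Phi Z - hcut Z = Phi Zs - hcut Zs.
  by apply: (sc_zero_deriv_cst a0 h _ CZ CZs) => Y v CY; rewrite eta_in// subrr.
have h0 : Phi Zs - hcut Zs = 0 by rewrite /Phi /Psi0 [X in X - _]addrC subrK subrr.
by apply/eqP; rewrite -subr_eq0 h' h0.
Qed.

Lemma Phi_cs Z p q : p ^+ 2 + q ^+ 2 != 0 -> Vp Z -> Phi (cs p q Z) = Phi Z.
Proof.
move=> pq hZ; apply: (zero_deriv_orbit Vp_open _ Phi_C1) => // [x y xy|x y Y _]; first exact: Vp_cs.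
exact: eta_cs.
Qed.

Lemma hcut2_supp Z : C Z -> hcut Z * (1 - hcut Z) != 0 -> u1 <= usq G Z <= u2.
Proof.
move=> _; apply: contraR; rewrite negb_and -!ltNge => /orP[h|h]; rewrite /hcut.
  by rewrite cut_left ?ltW// subrr mulr0.
by rewrite cut_right ?ltW// mul0r.
Qed.

(** Both sides have the same derivative on the connected set [Vp] and agree at [Zs]. Off the image
    [Phi] is therefore a root of [x (1 - x)]. *)
Lemma Phi2 Z : Vp Z -> Phi Z * (1 - Phi Z) = ext0 C (fun Z => hcut Z * (1 - hcut Z)) Z.
Proof.
move=> VZ; pose F := fun Z => hcut Z * (1 - hcut Z).
have hF : isC1 C F.
  by apply: isC1_mul; [|apply: isC1_sub; first exact: isC1_cst]; exists dcut; exact: hcut_C1.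
have F1 := sc_ext_isC1 sc au1 u2b hF hcut2_supp.
have F2 := C1_subset (@Vp_neq0) (isC1_D (@open_neq0 R n.+1) F1).
have h := C1_sub (C1_mul Phi_C1 (C1_sub (@C1_cst R V R Vp 1) Phi_C1)) F2.
have VZs := CVp CZs.
have h0 : Phi Z * (1 - Phi Z) - ext0 C F Z = Phi Zs * (1 - Phi Zs) - ext0 C F Zs.
  apply: (zero_deriv_cst del_linear _ h) => // [Y|Y v VY]; first exact: del_J.
  have [CY|CY] := pselect (C Y); last first.
    rewrite (sc_ext_D_out sc _ au1 u2b hcut2_supp (Vp_neq0 VY) CY) !eta_out// sub0r oppr0.
    by rewrite mul0r mulr0 !addr0.
  rewrite (ext0_D_in _ _ oC CY) (D_of_C1 v (C1_mul hcut_C1 (C1_sub (@C1_cst R V R C 1) hcut_C1)) CY).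
  by rewrite (Phi_in CY) eta_in// subrr.
by move: h0; rewrite (Phi_in CZs) (ext0_in _ CZs) subrr => /eqP; rewrite subr_eq0 => /eqP.
Qed.

Lemma Phi_out Z : Vp Z -> ~ C Z -> Phi Z = 0 \/ Phi Z = 1.
Proof.
move=> VZ CZ; have := Phi2 VZ; rewrite ext0_out// => /eqP; rewrite mulf_eq0 subr_eq0 => /orP[/eqP|/eqP]; by [left|right].
Qed.

Lemma Phi_ge0 Z : Vp Z -> 0 <= Phi Z <= 1.
Proof.
move=> VZ; have [CZ|CZ] := pselect (C Z); first by rewrite Phi_in// cut_ge0// cut_le1.
by have [->|->] := Phi_out VZ CZ; rewrite ?lexx ler01.
Qed.

Variable kap : R.
Hypotheses (kap0 : 0 <= kap) (Ckap : forall Z, C Z -> kap * sq Z < sq (del0 Z)) (kap1 : kap < 1).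

(** Multiplication by the conjugate of the zeroth coordinate makes that coordinate positive. The
    segment from [e] then stays over the ball, which [C] avoids, so the integral of [eta] along it
    is 0. *)
Lemma Phi_core Z : Vp Z -> sq (del0 Z) <= kap * sq Z -> Phi Z = Psi0.
Proof.
move=> VZ hZ.
have hN0 : 0 < hN Z ord0.
  have k' : 0 < (1 - kap) * sq Z by rewrite mulr_gt0 ?subr_gt0 ?ip_gt0 ?Vp_neq0. have e1 := ip_hN Z; move: e1 hZ k'.
  by move: (sq Z) (hN Z ord0) (sq (del0 Z)) => x y z; nra.
pose p := Z ord0 ord0; pose q := - Z ord0 ord_max.
have pq : p ^+ 2 + q ^+ 2 != 0 by rewrite sqrrN gt_eqF.
rewrite -(Phi_cs pq VZ) /Phi /Psi /prim1.
set Y := cs p q Z.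
have Y0 : Y ord0 ord0 = hN Z ord0 by rewrite cs0E /hN /p /q; ring.
have Y1 : Y ord0 ord_max = 0 by rewrite cs1E /p /q; ring.
have hY : sq (del0 Y) <= kap * sq Y.
  have e1 : sq (del0 Y) = (p ^+ 2 + q ^+ 2) * sq (del0 Z).
    by rewrite -ip_cs -del_cs.
  by rewrite e1 /Y ip_cs mulrCA ler_wpM2l// addr_ge0 ?sqr_ge0.
rewrite (@mean_eq _ _ _ _ (fun=> 0)) ?mean_cst ?add0r// => t It; have /andP[t0 t1] : 0 <= t <= 1 := It.
rewrite eta_out ?mulr0// => /Ckap.
rewrite ip_hN.
have -> : del0 (e + t *: (Y - e)) = t *: del0 Y.
  rewrite addrC del_linear del_ej addr0; congr (_ *: _).
  by rewrite -[X in X - _]scale1r addrC -scaleN1r del_linear del_ej scaler0 add0r scale1r.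
rewrite ipZr ipZl mulrA -expr2.
have -> : hN (e + t *: (Y - e)) ord0 = (1 + t * (hN Z ord0 - 1)) ^+ 2.
  have EE (U : V) c : (e + t *: (U - e)) ord0 c = e ord0 c + t * (U ord0 c - e ord0 c) by rewrite !mxE.
  by rewrite {1}/hN !EE ej_j0 ej_j1 Y0 Y1; ring.
have hNY : hN Y ord0 = hN Z ord0 ^+ 2 by rewrite {1}/hN Y0 Y1 expr0n/= addr0.
move: hY; rewrite [sq Y]ip_hN hNY.
move: (sq (del0 Y)) (hN Z ord0) hN0 => r h h0 hr hlt.
have [k0|k0] := eqVneq kap 0; first by move: hr hlt; rewrite k0 !mul0r => hr; nra.
have kp : 0 < kap by rewrite lt_def k0.
have : (1 + t * (h - 1)) ^+ 2 < t ^+ 2 * h ^+ 2.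
  have hr2 : t ^+ 2 * r <= t ^+ 2 * (kap * (h ^+ 2 + r)) by rewrite ler_wpM2l ?sqr_ge0. by rewrite -(ltr_pM2l kp); nra.
rewrite -exprMn ltr_sqr ?nnegrE; nra.
Qed.

(** The connection form of the Hopf fibration: a primitive of [Omega] on the cone, with value 1/2 on
    the circle direction. *)
Definition Afm (Z v : V) : R := 1 / 2 * (ip (Jm Z) v * (sq Z)^-1).

Lemma Afm_lin Z : linear (Afm Z).
Proof. by move=> k u v; rewrite /Afm ip_linr /GRing.scale/=; ring. Qed.

Lemma Afm_C1 v : C1 A0 (Afm^~ v) (fun Z u => 1 / 2 * (ip (Jm u) v * (sq Z)^-1
  + ip (Jm Z) v * (- (sq Z) ^- 2 * (ip u Z + ip Z u)))).
Proof.
have hJ : C1 A0 (@Jm R n.+1) (fun _ u => Jm u).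
  by apply: C1_lin; [exact: Jm_linear|apply: linear_cont; exact: Jm_linear].
have h1 := C1_ip hJ (@C1_cst R V V A0 v).
have h2 := C1_inv (fun Z Z0 => lt0r_neq0 (ip_gt0 Z0)) (C1_ip (@C1_id R V A0) (@C1_id R V A0)).
apply: (C1_ext (C1_scale (1 / 2) (C1_mul h1 h2))) => // Z u.
by rewrite ip0r addr0.
Qed.

Lemma Afm_form1 : form1 A0 Afm (fun v Z u => 'D_u (Afm^~ v) Z).
Proof.
split=> [Z _|v]; first exact: Afm_lin.
by apply: isC1_D; [exact: open_neq0|eexists; exact: Afm_C1].
Qed.

Lemma Afm_ext Z u v : Z != 0 -> 'D_u (Afm^~ v) Z - 'D_v (Afm^~ u) Z = Omega Z u v.
Proof.
move=> Z0; apply: (etrans (congr2 (fun x y => x - y) (D_of_C1 u (Afm_C1 v) Z0) (D_of_C1 v (Afm_C1 u) Z0))).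
rewrite /Omega [ip (Jm v) u]ip_Jl [ip v (Jm u)]ipC [ip (Jm u) Z]ip_Jl [ip u (Jm Z)]ipC [ip u Z]ipC [ip v Z]ipC.
by have := lt0r_neq0 (ip_gt0 Z0); move: (sq Z) => x x0; field.
Qed.

Lemma Afm_J Z : Z != 0 -> Afm Z (Jm Z) = 1 / 2.
Proof. by move=> Z0; rewrite /Afm ip_JJ divff ?mulr1// gt_eqF// ip_gt0. Qed.

Lemma Afm_inv Z p q v : p ^+ 2 + q ^+ 2 != 0 -> Z != 0 -> Afm (cs p q Z) (cs p q v) = Afm Z v.
Proof.
move=> pq Z0; rewrite /Afm ip_J_cs ip_cs; have := lt0r_neq0 (ip_gt0 Z0).
by move: (sq Z) pq => x; move: (p ^+ 2 + q ^+ 2) => y y0 x0; field; rewrite y0 x0.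
Qed.

(** A difference of two primitives of [Omega], hence closed on [C]. *)
Definition zeta (Z v : V) : R := Afm Z v - lamG G Z v.

Lemma zeta_lin Z : C Z -> linear (zeta Z).
Proof. by move=> CZ; exact: (lin_sub (@Afm_lin Z) (lamG_lin sc CZ)). Qed.

Lemma zeta_C1 v : isC1 C (zeta^~ v).
Proof.
apply: isC1_sub; last exact: lamG_C1 sc v.
by apply: (isC1_subset (sc_neq0 sc)); eexists; exact: Afm_C1.
Qed.

Lemma zeta_sym Z u v : C Z -> 'D_u (zeta^~ v) Z = 'D_v (zeta^~ u) Z.
Proof.
have aux (x1 x2 x3 x4 : R) : x1 - x2 = x3 - x4 -> x2 - x4 = x1 - x3 by move=> ?; lra.
move=> CZ; have Z0 := sc_neq0 sc CZ.
have key w : C1 C (zeta^~ w) (fun Z u => 'D_u (Afm^~ w) Z - 'D_u ((lamG G)^~ w) Z).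
  by apply: C1_sub; [exact: (C1_subset (sc_neq0 sc) (Afm_form1.2 w))|exact: isC1_D oC (lamG_C1 sc w)].
apply: (etrans (D_of_C1 u (key v) CZ)); apply: esym; apply: (etrans (D_of_C1 v (key u) CZ)).
have e1 := Afm_ext u v Z0; have e2 := lamG_ext sc u v CZ; rewrite -e2 in e1.
exact: (aux _ _ _ _ e1).
Qed.

Lemma zeta_J Z : C Z -> zeta Z (Jm Z) = 1 / 2.
Proof. by move=> CZ; rewrite /zeta (lamG_J sc CZ) subr0 Afm_J//; exact: (sc_neq0 sc CZ). Qed.

Lemma zeta_inv Z p q v : p ^+ 2 + q ^+ 2 != 0 -> C Z -> zeta (cs p q Z) (cs p q v) = zeta Z v.
Proof. by move=> pq CZ; rewrite /zeta lamG_inv// Afm_inv//; exact: (sc_neq0 sc CZ). Qed.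

Definition sgC (Z u v : V) : R := dcut Z u * zeta Z v - dcut Z v * zeta Z u.
(** The closed form [d chi /\ (Afm - lambda)] extended by 0. Since [(Phi - c) Omega + d chi /\
    lambda = d ((Phi - c) Afm) - sigma], it is the only part for which a primitive has to be
    constructed. *)
Definition sigma (Z u v : V) : R := ext0 C (fun Z => sgC Z u v) Z.
Definition dsigma (u v Z w : V) : R := 'D_w (fun Z => sigma Z u v) Z.

Lemma sgC_supp u v Z : C Z -> sgC Z u v != 0 -> u1 <= usq G Z <= u2.
Proof.
move=> CZ; apply: contraR => h.
have h' w : dcut Z w = 0 by apply/eqP; move: h; apply: contraR; exact: dcut_supp.
have aux (x y z w : R) : x = 0 -> y = 0 -> x * z - y * w = 0 by move=> -> ->; rewrite !mul0r subrr.
by apply/eqP; exact: (aux _ _ _ _ (h' u) (h' v)).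
Qed.

Lemma sgC_C1 u v : isC1 C (fun Z => sgC Z u v).
Proof. by apply: isC1_sub; apply: isC1_mul; (exact: dcut_C1 || exact: zeta_C1). Qed.

Lemma sigma_in Z u v : C Z -> sigma Z u v = sgC Z u v. Proof. exact: ext0_in. Qed.
Lemma sigma_out Z u v : ~ C Z -> sigma Z u v = 0. Proof. exact: ext0_out. Qed.

Lemma sigma_anti Z u v : sigma Z u v = - sigma Z v u.
Proof.
have [CZ|CZ] := pselect (C Z); last by rewrite !sigma_out// oppr0.
by rewrite !sigma_in// /sgC opprB.
Qed.

Lemma sigma_lin Z u : linear (sigma Z u).
Proof.
apply: (ext0_lin (P := C) (F := fun v Z => sgC Z u v)) => CZ.
exact: (lin_sub (lin_mull _ (zeta_lin CZ)) (lin_mulr _ (dcut_lin CZ))).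
Qed.

Lemma sigma_lin_l Z v : linear ((sigma Z)^~ v).
Proof.
apply: (ext0_lin (P := C) (F := fun u Z => sgC Z u v)) => CZ.
exact: (lin_sub (lin_mulr _ (dcut_lin CZ)) (lin_mull _ (zeta_lin CZ))).
Qed.

Lemma sigma_form2 : form2 A0 sigma dsigma.
Proof.
split=> [Z _|Z u v _|u v]; [|exact: sigma_anti|].
  by split=> [u|v]; [exact: sigma_lin|exact: sigma_lin_l].
apply: isC1_D; first exact: open_neq0.
exact: (sc_ext_isC1 sc au1 u2b (sgC_C1 u v) (@sgC_supp u v)).
Qed.

Lemma dsigma_in Z u v w : C Z -> dsigma u v Z w = 'D_w (dcut^~ u) Z * zeta Z v + dcut Z u * 'D_w (zeta^~ v) Z
  - ('D_w (dcut^~ v) Z * zeta Z u + dcut Z v * 'D_w (zeta^~ u) Z).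
Proof.
move=> CZ; apply: (etrans (ext0_D_in (fun Z => sgC Z u v) w oC CZ)).
have h w' := isC1_D oC (dcut_C1 w'); have h' w' := isC1_D oC (zeta_C1 w').
exact: (D_of_C1 w (C1_sub (C1_mul (h u) (h' v)) (C1_mul (h v) (h' u))) CZ).
Qed.

Lemma sigma_closed : closed2 A0 dsigma.
Proof.
move=> Z u v w Z0; have [CZ|CZ] := pselect (C Z); last first.
  have h x y z : dsigma x y Z z = 0 by exact: (sc_ext_D_out sc z au1 u2b (@sgC_supp x y) Z0 CZ). by rewrite !h !addr0.
have e x y z := dsigma_in x y z CZ.
apply: (etrans (congr2 +%R (congr2 +%R (e u v w) (e v w u)) (e w u v))).
have aux (du dv dw zu zv zw a1 a2 a3 a4 a5 a6 b1 b2 b3 b4 b5 b6 : R) :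
    a1 = a2 -> a3 = a4 -> a5 = a6 -> b1 = b2 -> b3 = b4 -> b5 = b6 ->
    a5 * zv + du * b4 - (a4 * zu + dv * b5) + (a1 * zw + dv * b6 - (a6 * zv + dw * b1))
    + (a3 * zu + dw * b2 - (a2 * zw + du * b3)) = 0.
  by move=> -> -> -> -> -> ->; ring.
exact: (aux _ _ _ _ _ _ _ _ _ _ _ _ _ _ _ _ _ _ (dcut_sym u v CZ) (dcut_sym v w CZ) (dcut_sym w u CZ)
  (zeta_sym u v CZ) (zeta_sym v w CZ) (zeta_sym w u CZ)).
Qed.

Lemma sigma_J Z v : sigma Z (Jm Z) v = - (1 / 2 * eta Z v).
Proof.
have [CZ|CZ] := pselect (C Z); last by rewrite sigma_out// eta_out// mulr0 oppr0.
have eJ : dcut Z (Jm Z) = 0.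
  by rewrite -(eta_in _ CZ) (_ : Jm Z = cs 0 1 Z) ?eta_cs// /cs scale0r add0r scale1r.
by rewrite sigma_in// /sgC eJ mul0r sub0r zeta_J// eta_in// mulrC.
Qed.

Lemma dcut_inv Z p q v : p ^+ 2 + q ^+ 2 != 0 -> C Z -> dcut (cs p q Z) (cs p q v) = dcut Z v.
Proof.
move=> pq CZ; have CZ' := (sc_cs sc pq CZ).1.
exact: (etrans (esym (eta_in _ CZ')) (etrans (eta_inv Z v pq) (eta_in _ CZ))).
Qed.

Lemma sigma_inv Z p q u v : p ^+ 2 + q ^+ 2 != 0 -> sigma (cs p q Z) (cs p q u) (cs p q v) = sigma Z u v.
Proof.
move=> pq; have [CZ|CZ] := pselect (C Z); last by rewrite !sigma_out// => /(sc_cs_iff pq).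
have CZ' := (sc_cs sc pq CZ).1; rewrite (sigma_in _ _ CZ) (sigma_in _ _ CZ') /sgC.
by rewrite (dcut_inv u pq CZ) (dcut_inv v pq CZ) (zeta_inv u pq CZ) (zeta_inv v pq CZ).
Qed.

Definition tau : V -> V -> R := prim2 e sigma.
Definition dtau : V -> V -> V -> R := dprim2 e sigma dsigma.
Definition taub : V -> V -> R := avgf tau.
Definition dtaub : V -> V -> V -> R := davgf dtau.

Lemma tau_form1 : form1 Vp tau dtau.
Proof.
have [h1 h2] := prim2_form1 e sigma_form2; split=> [Z /Vp_star|v]; first exact: h1.
exact: (C1_subset Vp_star (h2 v)).
Qed.

Lemma Vp_rot t Z : Vp Z -> Vp (rot t Z).
Proof. by apply: Vp_cs; rewrite rot_norm oner_eq0. Qed.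

Lemma taub_form1 : form1 Vp taub dtaub.
Proof. exact: avgf_form1 Vp_open Vp_rot tau_form1. Qed.

Lemma taub_ext Z u v : Vp Z -> ext1 dtaub Z u v = sigma Z u v.
Proof.
move=> VZ; rewrite /dtaub (avgf_ext Vp_open Vp_rot tau_form1 u v VZ).
apply: (etrans _ (mean_cst I01 (sigma Z u v))); apply: mean_eq => t _.
rewrite (prim2_ext sigma_form2 sigma_closed _ _ (Vp_star (Vp_rot t VZ))).
by apply: sigma_inv; rewrite rot_norm oner_eq0.
Qed.

(** The value for which the circle component of [alpha] vanishes; it measures the class of
    [Phi Omega + d chi /\ lambda] in units of [Omega]. *)
Definition cc : R := Phi Zs - 2 * taub Zs (Jm Zs).

(** With [i_J] the contraction with the circle direction, invariance of [taub] gives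
    [d (i_J taub) = - i_J sigma = eta / 2]. Hence [taub Z (Jm Z) - Phi Z / 2] is constant. *)
Lemma taub_J Z : Vp Z -> taub Z (Jm Z) = 1 / 2 * (Phi Z - cc).
Proof.
have aux (x d t h' : R) : d + t = 0 -> x - d = h' -> x + t - h' = 0 by move=> e3 <-; lra.
have aux2 (t p ts ps : R) : t - 1 / 2 * p = ts - 1 / 2 * ps -> t = 1 / 2 * (p - (ps - 2 * ts)) by move=> h; lra.
move=> VZ.
have hJ : C1 Vp (@Jm R n.+1) (fun _ u => Jm u).
  by apply: C1_lin; [exact: Jm_linear|apply: linear_cont; exact: Jm_linear].
have h1 := form1_comp Vp_open Vp_open taub_form1 (@C1_id R V Vp) hJ (fun Z VZ => VZ).
have h := C1_sub h1 (C1_scale (1 / 2) Phi_C1).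
have h0 : taub Z (Jm Z) - 1 / 2 * Phi Z = taub Zs (Jm Zs) - 1 / 2 * Phi Zs.
  apply: (zero_deriv_cst del_linear _ h) => // [Y|Y v VY|]; [exact: del_J| |exact: CVp].
  have e1 := avgf_J Vp_open Vp_rot tau_form1 v VY; have e2 := taub_ext v (Jm Y) VY.
  rewrite sigma_anti sigma_J opprK /ext1 in e2. exact: (aux _ _ _ _ e1 e2).
exact: (aux2 _ _ _ _ h0).
Qed.

Definition alpha (Z v : V) : R := (Phi Z - cc) * Afm Z v - taub Z v.
Definition dalpha (v Z u : V) : R := eta Z u * Afm Z v + (Phi Z - cc) * 'D_u (Afm^~ v) Z - dtaub v Z u.
Definition lamx (Z v : V) : R := ext0 C ((lamG G)^~ v) Z.

Lemma lamx_in Z v : C Z -> lamx Z v = lamG G Z v. Proof. exact: ext0_in. Qed.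
Lemma lamx_out Z v : ~ C Z -> lamx Z v = 0. Proof. exact: ext0_out. Qed.

Lemma lamx_lin Z : linear (lamx Z).
Proof.
by apply: (ext0_lin (P := C) (F := fun v Z => lamG G Z v)) => CZ; exact: (lamG_lin sc CZ).
Qed.

Lemma alpha_form1 : form1 Vp alpha dalpha.
Proof.
have [h1 h2] := taub_form1; split=> [Z VZ k u v|v].
  exact: (lin_sub (lin_mull _ (@Afm_lin Z)) (h1 _ VZ)).
have hA := C1_subset (@Vp_neq0) (Afm_form1.2 v).
apply: (C1_ext (C1_sub (C1_mul (C1_sub Phi_C1 (@C1_cst R V R Vp cc)) hA) (h2 v))) => // Z u.
by rewrite subr0.
Qed.

Lemma alpha_ext Z u v : Vp Z -> ext1 dalpha Z u v = (Phi Z - cc) * Omega Z u v + wedge (eta Z) (lamx Z) u v.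
Proof.
have aux0 (s du dv Au Av lu lv eu ev xu xv : R) : s = du * (Av - lv) - dv * (Au - lu) ->
    eu = du -> ev = dv -> xu = lu -> xv = lv -> s = eu * Av - ev * Au - (eu * xv - ev * xu).
  by move=> -> -> -> -> ->; ring.
move=> VZ; have e1 := taub_ext u v VZ; have e2 := Afm_ext u v (Vp_neq0 VZ).
have e3 : sigma Z u v = eta Z u * Afm Z v - eta Z v * Afm Z u - wedge (eta Z) (lamx Z) u v.
  have [CZ|CZ] := pselect (C Z); last first.
    by rewrite sigma_out// /wedge !eta_out// !mul0r !subr0.
  exact: (aux0 _ _ _ _ _ _ _ _ _ _ _ (sigma_in u v CZ) (eta_in u CZ) (eta_in v CZ) (lamx_in u CZ) (lamx_in v CZ)).
have aux (x1 x2 x3 x4 p q r s f o g w : R) : x3 - x4 = g -> x1 - x2 = o -> g = p * q - r * s - w ->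
    p * q + f * x1 - x3 - (r * s + f * x2 - x4) = f * o + w.
  move=> h1 <- h2; have -> : w = p * q - r * s - g by rewrite h2; ring. by rewrite -h1; ring.
exact: (aux _ _ _ _ _ _ _ _ _ _ _ _ e1 e2 e3).
Qed.

Lemma alpha_J Z : Vp Z -> alpha Z (Jm Z) = 0.
Proof. by move=> VZ; rewrite /alpha taub_J// Afm_J ?Vp_neq0// mulrC subrr. Qed.

Lemma eta_Z Z : eta Z Z = 0. Proof. by rewrite -[X in eta _ X](cs1 Z) eta_cs. Qed.
Lemma eta_J Z : eta Z (Jm Z) = 0.
Proof. by rewrite (_ : Jm Z = cs 0 1 Z) ?eta_cs// /cs scale0r add0r scale1r. Qed.
Lemma lamx_Z Z : lamx Z Z = 0.
Proof. by have [CZ|CZ] := pselect (C Z); [exact: (etrans (lamx_in _ CZ) (lamG_Z sc CZ))|exact: lamx_out]. Qed.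
Lemma lamx_J Z : lamx Z (Jm Z) = 0.
Proof. by have [CZ|CZ] := pselect (C Z); [exact: (etrans (lamx_in _ CZ) (lamG_J sc CZ))|exact: lamx_out]. Qed.

Definition ell (Z : V) : R := ext0 C (fun Z => cut1 u1 u2 (usq G Z) * usq G Z) Z.

Lemma ell_in Z : C Z -> ell Z = cut1 u1 u2 (usq G Z) * usq G Z. Proof. exact: ext0_in. Qed.
Lemma ell_out Z : ~ C Z -> ell Z = 0. Proof. exact: ext0_out. Qed.

(** [lamx] is [Omega] contracted with a lift of the Liouville field, so the trace is the value of
    [eta] on that lift divided by [|Z|^2]. *)
Lemma tr_eta_lam Z : tr (wedge (eta Z) (lamx Z)) = ell Z / sq Z.
Proof.
have [CZ|CZ] := pselect (C Z); last first.
  rewrite ell_out// mul0r /tr big1// => k _. by rewrite /wedge (eta_out _ CZ) (eta_out _ CZ) !mul0r subrr.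
have [Y hY lY] := lamG_Omega sc CZ.
have -> : lamx Z = Omega Z Y.
  by apply/funext => v; exact: (etrans (lamx_in v CZ) (lY v)).
apply: (etrans (tr_wedge_Omega Y (@eta_lin Z) (@eta_Z Z) (@eta_J Z))).
congr (_ / _); apply: (etrans (eta_in Y CZ)); rewrite ell_in//.
by rewrite /dcut hY ipZr -/(usq G Z); field.
Qed.

Lemma sigma_bilin Z : bilin (sigma Z).
Proof. by split=> [u|v]; [exact: sigma_lin|exact: sigma_lin_l]. Qed.

Lemma sigma_mbdd u v : mbdd (fun Z => sigma Z u v).
Proof.
have [_ _ h] := sigma_form2; apply: mbdd_cont => Z Z0; exact: (C1_cont (h u v) Z0).
Qed.

(* By homogeneity it suffices to bound [sigma] on a compact set. *)
Lemma sigma_bound : exists2 B : R, 0 <= B & forall Z u v, Z != 0 -> `|sigma Z u v| <= B * (`|u| * `|v|) / sq Z.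
Proof.
have aux (B x y r i : R) : i = r ^+ 2 -> r != 0 -> B * (r^-1 * x * (r^-1 * y)) = B * (x * y) / i.
  by move=> -> r0; field.
have [B B0 hB] := mbdd_bilin sigma_mbdd; exists B => // Z u v Z0.
pose r := Num.sqrt (sq Z); have ip0 := ip_gt0 Z0.
have r0 : 0 < r by rewrite sqrtr_gt0.
have r2 : sq Z = r ^+ 2 by rewrite sqr_sqrtr// ltW.
have pq : r^-1 ^+ 2 + 0 ^+ 2 != 0 :> R by rewrite expr0n addr0 expf_neq0// invr_neq0// gt_eqF.
have csE (w : V) : cs r^-1 0 w = r^-1 *: w by rewrite /cs scale0r addr0.
rewrite -(sigma_inv Z u v pq).
have aY : annulus (cs r^-1 0 Z).
  rewrite /annulus /= ip_cs expr0n addr0 r2 -exprMn mulVf ?gt_eqF// expr1n lexx andbT; lra.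
apply: (le_trans (hB _ _ _ aY (sigma_bilin _))).
have nE (w : V) : `|cs r^-1 0 w| = r^-1 * `|w| by rewrite csE normrZ gtr0_norm// invr_gt0.
by rewrite !nE (aux _ _ _ _ _ r2)// gt_eqF.
Qed.

(** [sigma] is of order [|Y|^-2] at a point [Y] of the ray, and [ray_del_le] replaces this by
    [16 / |Z'|^2]. With [|Z - e| <= 2] the constant becomes 32. *)
Lemma tau_bound : exists2 B : R, 0 <= B & forall Z v, Vp Z -> sq Z <= 1 -> `|tau Z v| <= B * `|v| / sq (del0 Z).
Proof.
have aux (t s B z v D x : R) : 0 <= t <= 1 -> `|s| <= B * (z * v) / x -> 0 <= B -> 0 <= z <= 2 -> 0 <= v ->
    0 < D -> D <= 16 * x -> `|t * s| <= 32 * B * v / D.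
  move=> /andP[t0 t1] hs B0 /andP[z0 z2] v0 D0 Dx; have x0 : 0 < x by lra.
  rewrite normrM ger0_norm//; apply: (@le_trans _ _ `|s|); first by rewrite ler_piMl.
  apply: (le_trans hs); rewrite ler_pdivrMr// mulrAC ler_pdivlMr//. have -> : B * (z * v) * D = B * v * (z * D) by ring.
  have -> : 32 * B * v * x = B * v * (32 * x) by ring. by rewrite ler_wpM2l ?mulr_ge0//; nra.
have [B B0 hB] := sigma_bound; exists (32 * B); first by rewrite mulr_ge0.
move=> Z v VZ Z1; apply: mean_norm => t; rewrite I01_domP => ht.
have D0 : 0 < sq (del0 Z) by exact: ip_gt0.
have zb : 0 <= `|Z - e| <= 2.
  rewrite normr_ge0 (le_trans (ler_normB _ _))//. have h1 : `|Z| <= 1 by apply: norm_le_ip; rewrite ?expr1n.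
  have h2 : `|e| <= 1.
    by apply: norm_le_ip => //; rewrite expr1n ip_ex mxE !eqxx.
  lra.
exact: (aux _ _ _ _ _ _ _ ht (hB _ (Z - e) v (Vp_star VZ ht)) B0 zb (normr_ge0 v) D0 (ray_del_le ht Z1)).
Qed.

Lemma taub_bound : exists2 B : R, 0 <= B & forall Z v, Vp Z -> sq Z <= 1 -> `|taub Z v| <= B * `|v| / sq (del0 Z).
Proof.
have [B B0 hB] := tau_bound; exists (2 * B); first by rewrite mulr_ge0.
move=> Z v VZ Z1; apply: mean_norm => t _.
have D0 : 0 < sq (del0 Z) by exact: ip_gt0.
have ipr m (W : 'M[R]_(m, 2)) : sq (rot t W) = sq W by rewrite ip_cs rot_norm mul1r.
apply: (le_trans (hB _ _ (Vp_rot t VZ) _)); first by rewrite ipr.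
have aux (r x D : R) : 0 < D -> r <= 2 * x -> B * r / D <= 2 * B * x / D.
  by move=> d0 h; rewrite [2 * B]mulrC -mulrA -mulrA -mulrA !ler_wpM2l// mulrA ler_wpM2r ?invr_ge0 ?(ltW d0).
rewrite del_cs -/(rot t _) ipr; apply: aux D0 _.
by apply: cs_norm; exact: rot_norm.
Qed.

Lemma alpha_bound : exists2 B : R, 0 <= B & forall Z v, Vp Z -> annulus Z -> `|alpha Z v| <= B * `|v| / sq (del0 Z).
Proof.
have aux (p c A t B K v D : R) : 0 <= p <= 1 -> `|A| <= K * v -> `|t| <= B * v / D -> 0 <= K -> 0 <= v -> 0 < D -> D <= 1 ->
    `|(p - c) * A - t| <= ((1 + `|c|) * K + B) * v / D.
  move=> /andP[p0 p1] hA ht K0 v0 D0 D1.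
  have -> : ((1 + `|c|) * K + B) * v / D = (1 + `|c|) * (K * v) / D + B * v / D by ring.
  apply: (le_trans (ler_normB _ _) (lerD _ ht)); rewrite normrM.
  have h : `|p - c| <= 1 + `|c| by rewrite (le_trans (ler_normB _ _))// lerD2r ger0_norm.
  apply: (@le_trans _ _ ((1 + `|c|) * (K * v))); first by rewrite ler_pM. rewrite ler_peMr ?mulr_ge0 ?addr_ge0//.
  by rewrite invr_ge1 ?unitfE ?gt_eqF ?posrE.
have [B B0 hB] := taub_bound.
have [K K0 hK] : exists2 K : R, 0 <= K & forall Z v, annulus Z -> linear (Afm Z) -> `|Afm Z v| <= K * `|v|.
  apply: mbdd_lin => v; apply: mbdd_cont => Z Z0; exact: (C1_cont (Afm_C1 v) Z0).
exists ((1 + `|cc|) * K + B); first by rewrite addr_ge0 ?mulr_ge0 ?addr_ge0.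
move=> Z v VZ aZ; have /andP[_ Z1] := aZ.
exact: (aux _ _ _ _ _ _ _ _ (Phi_ge0 VZ) (hK Z v aZ (@Afm_lin Z)) (hB Z v VZ Z1) K0 (normr_ge0 v) (ip_gt0 VZ) (le_trans (ip_del_le Z) Z1)).
Qed.

(** [lamx], extended by 0 without a cutoff, need not be continuous. The right side shows that its
    wedge with [eta] is nevertheless C1. *)
Lemma wedge_eta_lam Z u v : wedge (eta Z) (lamx Z) u v = eta Z u * Afm Z v - eta Z v * Afm Z u - sigma Z u v.
Proof.
have aux (a1 a2 l1 l2 A1 A2 : R) : a1 * l2 - a2 * l1 = a1 * A2 - a2 * A1 - (a1 * (A2 - l2) - a2 * (A1 - l1)) by ring.
have [CZ|CZ] := pselect (C Z); last first.
  by rewrite /wedge (eta_out u CZ) (eta_out v CZ) (sigma_out u v CZ) !mul0r !subr0.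
by rewrite /wedge (lamx_in u CZ) (lamx_in v CZ) (eta_in u CZ) (eta_in v CZ) (sigma_in u v CZ); exact: aux.
Qed.

(** An expression for [d alpha] ([ext1_dalpha]). Unlike [alpha] it stays bounded near the removed
    line ([sg_bound]). *)
Definition sg (Z u v : V) : R := (Phi Z - cc) * Omega Z u v + wedge (eta Z) (lamx Z) u v.
Definition dsg (u v Z w : V) : R := (eta Z w * Omega Z u v + (Phi Z - cc) * dOmega u v Z w)
  + ((deta u Z w * Afm Z v + eta Z u * 'D_w (Afm^~ v) Z)
     - (deta v Z w * Afm Z u + eta Z v * 'D_w (Afm^~ u) Z) - dsigma u v Z w).

Lemma sg_bilin Z : bilin (sg Z).
Proof.
have [h1 h2] := Omega_lin Z; have [h3 h4] := wedge_lin (@eta_lin Z) (@lamx_lin Z).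
have aux (L K : V -> R) (c : R) : linear L -> linear K -> linear (fun v => c * L v + K v).
  move=> hL hK k u v; rewrite hL hK /GRing.scale/=; move: (L u) (L v) (K u) (K v) => x y z w; ring.
by split=> u; [exact: aux (h1 u) (h3 u)|exact: aux (h2 u) (h4 u)].
Qed.

Lemma Phi_cc_C1 : C1 Vp (fun Z => Phi Z - cc) eta.
Proof.
have aux (x : R) : x - 0 = x by ring.
by apply: (C1_ext (C1_sub Phi_C1 (@C1_cst R V R Vp cc))) => // Z v; exact: aux.
Qed.

Lemma wl_C1 u v : C1 A0 (fun Z => eta Z u * Afm Z v - eta Z v * Afm Z u - sigma Z u v)
  (fun Z w => (deta u Z w * Afm Z v + eta Z u * 'D_w (Afm^~ v) Z)
     - (deta v Z w * Afm Z u + eta Z v * 'D_w (Afm^~ u) Z) - dsigma u v Z w).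
Proof.
have [_ he] := eta_form1; have [_ hA] := Afm_form1; have [_ _ hs] := sigma_form2.
exact: (C1_sub (C1_sub (C1_mul (he u) (hA v)) (C1_mul (he v) (hA u))) (hs u v)).
Qed.

Lemma sg_form2 : form2 Vp sg dsg.
Proof.
have aux (p o w o' w' : R) : o = - o' -> w = - w' -> p * o + w = - (p * o' + w') by move=> -> ->; ring.
split=> [Z _|Z u v VZ|u v]; first exact: sg_bilin.
  exact: (aux _ _ _ _ _ (Omega_anti Z u v) (wedge_anti _ _ u v)).
have VA : Vp `<=` A0 by move=> Z; exact: Vp_neq0.
have h := C1_add (C1_mul Phi_cc_C1 (C1_subset VA (Omega_C1 u v))) (C1_subset VA (wl_C1 u v)).
by apply: (C1_ext h) => // Z; rewrite /sg wedge_eta_lam.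
Qed.

Lemma sg_closed : closed2 Vp dsg.
Proof.
have aux (p Ouv Ovw Owu d1 d2 d3 eu ev ew euv evu euw ewu evw ewv Au Av Aw Auv Avu Auw Awu Avw Awv s1 s2 s3 : R) :
    Ouv = Avu - Auv -> Ovw = Awv - Avw -> Owu = Auw - Awu -> d1 + d2 + d3 = 0 -> s1 + s2 + s3 = 0 ->
    euv = evu -> euw = ewu -> evw = ewv -> ew * Ouv + p * d1 + (euw * Av + eu * Avw - (evw * Au + ev * Auw) - s1)
    + (eu * Ovw + p * d2 + (evu * Aw + ev * Awu - (ewu * Av + ew * Avu) - s2))
    + (ev * Owu + p * d3 + (ewv * Au + ew * Auv - (euv * Aw + eu * Awv) - s3)) = 0.
  move=> -> -> -> hd hs -> -> ->; have -> : d3 = - d1 - d2 by lra. have -> : s3 = - s1 - s2 by lra. ring.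
move=> Z u v w VZ; have Z0 := Vp_neq0 VZ; have [[e1 e2] e3] := (deta_sym u v Z0, deta_sym u w Z0, deta_sym v w Z0).
exact: (aux _ _ _ _ _ _ _ _ _ _ _ _ _ _ _ _ _ _ _ _ _ _ _ _ _ _ _ _ (esym (Afm_ext u v Z0)) (esym (Afm_ext v w Z0))
  (esym (Afm_ext w u Z0)) (dOmega_cyc u v w Z) (sigma_closed u v w Z0) e1 e2 e3).
Qed.

Lemma sg_bound : exists2 B : R, 0 <= B & forall Z u v, Vp Z -> annulus Z -> `|sg Z u v| <= B * (`|u| * `|v|).
Proof.
have aux (p c o w B1 B2 x : R) : 0 <= p <= 1 -> `|o| <= B1 * x -> `|w| <= B2 * x ->
    `|(p - c) * o + w| <= ((1 + `|c|) * B1 + B2) * x.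
  move=> /andP[p0 p1] h1 h2; rewrite [leRHS]mulrDl; apply: (le_trans (ler_normD _ _) (lerD _ h2)).
  rewrite normrM -mulrA ler_pM//. by rewrite (le_trans (ler_normB _ _))// lerD2r ger0_norm.
have [B1 B10 h1] : exists2 B : R, 0 <= B & forall Z u v, annulus Z -> bilin (@Omega R n.+1 Z) -> `|Omega Z u v| <= B * (`|u| * `|v|).
  apply: mbdd_bilin => u v; apply: mbdd_cont => Z Z0; exact: (C1_cont (Omega_C1 u v) Z0).
have [B2 B20 h2] : exists2 B : R, 0 <= B & forall Z u v, annulus Z -> bilin (wedge (eta Z) (lamx Z)) ->
    `|wedge (eta Z) (lamx Z) u v| <= B * (`|u| * `|v|).
  apply: mbdd_bilin => u v; apply: mbdd_cont => Z Z0; apply: (cont_ext (C1_cont (wl_C1 u v) Z0)) => Y.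
  by rewrite wedge_eta_lam.
exists ((1 + `|cc|) * B1 + B2); first by rewrite addr_ge0 ?mulr_ge0 ?addr_ge0.
move=> Z u v VZ aZ.
exact: (aux _ _ _ _ _ _ _ (Phi_ge0 VZ) (h1 Z u v aZ (Omega_lin Z)) (h2 Z u v aZ (wedge_lin (@eta_lin Z) (@lamx_lin Z)))).
Qed.

Hypothesis n2 : (2 <= n)%N.

Lemma ell_C1 : isC1 A0 ell.
Proof.
apply: (sc_ext_isC1 sc au1 u2b) => [|Z CZ h].
  by apply: isC1_mul; [apply: isC1_comp1; [exact: (isC1_usq sc)|exact: isC1_cut1]|exact: (isC1_usq sc)].
by apply: cut1_supp; apply: contraNneq h => ->; rewrite mul0r.
Qed.

Lemma ell_mbdd : mbdd ell.
Proof. by apply: mbdd_cont => Z Z0; exact: (isC1_cont ell_C1 Z0). Qed.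

Lemma ell_le0 Z : ell Z <= 0.
Proof.
have [CZ|CZ] := pselect (C Z); last by rewrite ell_out.
by rewrite ell_in// mulr_le0_ge0 ?cut1_le0// ip_ge0.
Qed.

Lemma mbdd_ext0 (f : V -> R) B : (forall Z, Vp Z -> annulus Z -> `|f Z| <= B) -> mbdd (ext0 Vp f).
Proof.
move=> h; exists `|B| => Z aZ; have [VZ|VZ] := pselect (Vp Z); last by rewrite (ext0_out _ VZ) normr0.
by rewrite (ext0_in _ VZ) (le_trans (h Z VZ aZ))// ler_norm.
Qed.

Lemma Phi_mbdd : mbdd (ext0 Vp Phi).
Proof. by apply: (@mbdd_ext0 _ 1) => Z VZ _; have /andP[p0 p1] := Phi_ge0 VZ; rewrite ger0_norm. Qed.

Lemma one_mbdd : mbdd (ext0 Vp (fun=> 1 : R)).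
Proof. by apply: (@mbdd_ext0 _ 1) => Z _ _; rewrite normr1. Qed.

Lemma tr_sg Z : Z != 0 -> tr (sg Z) = (n%:R * (Phi Z - cc) + ell Z) / sq Z.
Proof.
have aux (p x l : R) : p * ((n.+1%:R - 1) / x) + l / x = (n%:R * p + l) / x.
  by rewrite -natr1 addrK mulrA -mulrDl [p * _]mulrC.
move=> Z0; rewrite -(aux _ _ _).
apply: (etrans _ (congr2 (fun x y => (Phi Z - cc) * x + y) (tr_Omega Z0) (tr_eta_lam Z))).
by rewrite /tr mulr_sumr -big_split.
Qed.

Lemma ext1_dalpha Z : Vp Z -> ext1 dalpha Z = sg Z.
Proof. by move=> VZ; apply/funext => u; apply/funext => v; exact: alpha_ext. Qed.

Lemma tr_sg_bound : exists B : R, forall Z, Vp Z -> annulus Z -> `|tr (sg Z)| <= B.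
Proof.
have [B B0 hB] := sg_bound; exists (\sum_(k < n.+1) B) => Z VZ aZ.
apply: (le_trans (ler_norm_sum _ _ _)); apply: ler_sum => k _; apply: (le_trans (hB _ _ _ VZ aZ)).
by rewrite -[leRHS]mulr1 ler_wpM2l// -[leRHS]mulr1 ler_pM ?mxb_norm.
Qed.

Lemma Jm_norm m (v : 'M[R]_(m, 2)) : `|Jm v| <= `|v|.
Proof.
apply: mx_norm_le => // i j; case: (ord2P j) => ->; by rewrite ?Jm0 ?Jm1 ?normrN coord_norm.
Qed.

Lemma mean_trace_off m (L K : 'M[R]_(m, 2) -> R) (s t t' : R) : s = 0 -> (forall v, L v = 0) ->
  s * t + sumB (fun a => L a * K (Jm a)) = s * t' + tr (wedge L K).
Proof.
move=> -> h; rewrite !mul0r /tr /sumB !big1// => k _; rewrite /wedge !h !mul0r ?subrr ?addr0//.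
Qed.

Lemma mean_trace : mu (fun Z => sq Z ^+ 1 * ext0 Vp (fun Z => tr (sg Z)) Z) = 0.
Proof.
have [B hB] := tr_sg_bound; have [K K0 hK] := alpha_bound.
have [lal _] := alpha_form1; have lt1 : (1 : R) < 2 by rewrite ltr1n.
have D0 (Z : V) : 0 <= (sq (del0 Z))^-1 by rewrite invr_ge0 ip_ge0.
apply: (@slab_stokes R n n2 1 _ (fun Z a => alpha Z (Jm a)) (`|B| + K)) => [F s ds cF FV F1 hs s0 ds0|Z VZ|Z VZ|Z VZ aZ|Z v VZ aZ v1].
- apply: (etrans _ (stokes1 two_gt0 Vp_open cF FV lt1 F1 hs s0 ds0 alpha_form1)).
  apply: mean_eq => Z _; have [FZ|FZ] := pselect (F Z); last first.
    by apply: mean_trace_off => [|v]; [exact: s0|exact: ds0].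
  rewrite ext1_dalpha; last exact: FV.
  congr (_ + _); apply: sumB_wedge; [exact: (C1_linear hs)|exact: (lal Z (FV _ FZ))].
- move=> k u v; rewrite JmD JmZ; exact: (lal Z VZ).
- exact: alpha_J.
- by apply: (le_trans (hB Z VZ aZ)); rewrite (le_trans (ler_norm _))// lerDl.
- apply: (le_trans (hK Z (Jm v) VZ aZ)); rewrite ler_wpM2r ?D0//.
  apply: (@le_trans _ _ (K * 1)); first by rewrite ler_wpM2l// (le_trans (Jm_norm v)). by rewrite mulr1 lerDr.
Qed.

Lemma mean_linear : mu (ext0 Vp (fun Z => n%:R * (Phi Z - cc) + ell Z)) = 0.
Proof.
have aux (x y : R) : x != 0 -> y = x ^+ 1 * (y / x) by move=> x0; rewrite expr1 mulrC divfK.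
rewrite -mean_trace; apply: mu_eq => Z aZ; have Z0 := annulus_neq0 aZ.
have [VZ|VZ] := pselect (Vp Z); last by rewrite !(ext0_out _ VZ) mulr0.
rewrite !(ext0_in _ VZ) tr_sg//; exact: (aux _ _ (lt0r_neq0 (ip_gt0 Z0))).
Qed.

Lemma trfield_lin Z : Vp Z -> linear (trfield alpha sg Z).
Proof.
move=> VZ; have [lal _] := alpha_form1; have [h1 h2] := sg_bilin Z.
have l1 : linear (fun a => alpha Z (Jm a)) by move=> k u v; rewrite JmD JmZ; exact: (lal Z VZ).
have l2 (c : V) : linear (fun a => sg Z (Jm a) c) by move=> k u v; rewrite JmD JmZ; exact: h2.
have aux (x y t s1 s2 k : R) : 2 * (k * x + y) * t - 2 * (k * s1 + s2) = k * (2 * x * t - 2 * s1) + (2 * y * t - 2 * s2) by ring.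
move=> k u v; rewrite /trfield; apply: (etrans _ (aux _ _ _ _ _ _)); congr (2 * _ * _ - 2 * _); first exact: l1.
rewrite -sumBZ -sumBD; apply: eq_sumB => c; apply: (etrans (congr1 (fun x => _ * x) (l2 (Jm c) k u v))).
by move: (alpha _ _) (sg _ _ _) (sg _ _ _) => x y z; rewrite /GRing.scale/=; ring.
Qed.

Lemma sg_J Z v : Vp Z -> sg Z (Jm Z) v = 0.
Proof.
move=> VZ; rewrite /sg; apply: (etrans (congr2 (fun x y => _ * x + y) (Omega_JZ v (Vp_neq0 VZ)) (_ : _ = 0))).
  by apply: (etrans (congr2 (fun x y => x * _ - _ * y) (@eta_J Z) (@lamx_J Z))); rewrite mul0r mulr0 subrr.
by rewrite mulr0 addr0.
Qed.

Lemma trfield_Z Z : Vp Z -> trfield alpha sg Z Z = 0.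
Proof.
have aux (x y s s' : R) : s = 0 -> s' = 0 -> x * s + y * s' = 0 by move=> -> ->; rewrite !mulr0 addr0.
move=> VZ; rewrite /trfield (alpha_J VZ) mulr0 mul0r sub0r /sumB big1 ?mulr0 ?oppr0// => k _.
exact: (aux _ _ _ _ (sg_J _ VZ) (sg_J _ VZ)).
Qed.

Lemma quad_sg Z : Vp Z -> 2 * tr (sg Z) * tr (sg Z) - CC (sg Z) (sg Z) =
  2 * (n%:R - 1) / sq Z * ((n%:R * (Phi Z - cc) ^+ 2 + 2 * (Phi Z - cc) * ell Z) / sq Z).
Proof.
have aux (p x l t c : R) : 2 * t ^+ 2 - c = 2 * (n.+1%:R - 2) / x * (p ^+ 2 * (n.+1%:R - 1) / x + 2 * p * (l / x)) ->
    2 * t * t - c = 2 * (n%:R - 1) / x * ((n%:R * p ^+ 2 + 2 * p * l) / x).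
  have -> : 2 * t * t = 2 * t ^+ 2 by ring. move=> ->; have -> : n.+1%:R = n%:R + 1 :> R by rewrite natr1.
  have -> : n%:R + 1 - 2 = n%:R - 1 :> R by ring. by congr (_ * _); ring.
move=> VZ; apply: aux; rewrite -(tr_eta_lam Z).
exact: (quadratic_trace (Phi Z - cc) (Vp_neq0 VZ) (@eta_lin Z) (@lamx_lin Z) (@eta_Z Z) (@eta_J Z) (@lamx_Z Z) (@lamx_J Z)).
Qed.

Lemma mean_quad : mu (fun Z => sq Z ^+ 2 * ext0 Vp (fun Z => 2 * tr (sg Z) * tr (sg Z) - CC (sg Z) (sg Z)) Z) = 0.
Proof.
have off (s t t' : R) (L T : V -> R) : s = 0 -> s * t + sumB (fun a => L a * T a) = s * t' + sumB (fun a => L a * T a).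
  by move=> ->; rewrite !mul0r.
have [B1 hB1] := tr_sg_bound; have [B2 B20 hB2] := sg_bound; have [K K0 hK] := alpha_bound.
have [lal _] := alpha_form1; have lt1 : (1 : R) < 2 by rewrite ltr1n.
have D0 (Z : V) : 0 <= (sq (del0 Z))^-1 by rewrite invr_ge0 ip_ge0.
have nJ (v : V) : `|v| <= 1 -> `|Jm v| <= 1 by exact: le_trans (Jm_norm v).
have s1 (Z u v : V) : Vp Z -> annulus Z -> `|u| <= 1 -> `|v| <= 1 -> `|sg Z u v| <= B2.
  move=> VZ aZ hu hv; apply: (le_trans (hB2 Z u v VZ aZ)). by rewrite -[leRHS]mulr1 ler_wpM2l// -[leRHS]mulr1 ler_pM.
have a1 (Z v : V) : Vp Z -> annulus Z -> `|v| <= 1 -> `|alpha Z v| <= K / sq (del0 Z).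
  move=> VZ aZ hv; apply: (le_trans (hK Z v VZ aZ)); rewrite ler_wpM2r ?D0//. by rewrite -[leRHS]mulr1 ler_wpM2l.
pose N : R := (2 * n.+1)%:R.
pose T1 := N * (N * (B2 * B2)).
pose T2 := 2 * K * `|B1| + 2 * (N * (K * B2)).
have N0 : 0 <= N by rewrite ler0n.
have T10 : 0 <= T1 by rewrite !mulr_ge0.
have T20 : 0 <= T2 by rewrite addr_ge0 ?mulr_ge0.
have q1 (x y c : R) : `|x| <= y -> `|c| <= T1 -> `|2 * x * x - c| <= 2 * y * y + T1.
  move=> hx hc; apply: (le_trans (ler_normB _ _) (lerD _ hc)).
  by rewrite !normrM (ger0_norm (ler0n _ 2)) -!mulrA ler_wpM2l// ler_pM.
have q2 (x t c d : R) : 0 <= d -> `|x| <= K * d -> `|t| <= B1 -> `|c| <= N * (K * d * B2) -> `|2 * x * t - 2 * c| <= T2 * d.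
  move=> d0 hx ht hc; have -> : T2 * d = 2 * (K * d) * `|B1| + 2 * (N * (K * d * B2)) by rewrite /T2; ring.
  apply: (le_trans (ler_normB _ _)); rewrite !normrM (ger0_norm (ler0n _ 2)); apply: lerD; last by rewrite ler_wpM2l.
  by rewrite -!mulrA ler_wpM2l// mulrA ler_pM// (le_trans ht)// ler_norm.
have le1 (x y : R) : 0 <= y -> x <= x + y by move=> ?; rewrite lerDl.
have le2 (x y d : R) : 0 <= x -> 0 <= d -> y * d <= (x + y) * d by move=> ? d0; rewrite ler_wpM2r// lerDr.
pose Bd := 2 * `|B1| * `|B1| + T1.
have Bd0 : 0 <= Bd by rewrite addr_ge0 ?mulr_ge0.
apply: (@slab_stokes R n n2 2 _ (trfield alpha sg) (Bd + T2)) => [F s ds cF FV F1 hs s0 ds0|Z VZ|Z VZ|Z VZ aZ|Z v VZ aZ v1].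
- apply: (etrans _ (stokes2 two_gt0 Vp_open cF FV lt1 F1 hs s0 ds0 alpha_form1 sg_form2 sg_closed)).
  apply: mean_eq => Z _; have [FZ|FZ] := pselect (F Z); last by apply: off; exact: s0.
  by rewrite (ext1_dalpha (FV _ FZ)).
- exact: trfield_lin.
- exact: trfield_Z.
- apply: (@le_trans _ _ Bd _ _ _ (le1 _ _ T20)); apply: q1; first exact: (le_trans (hB1 Z VZ aZ) (ler_norm _)).
  apply: sumB_le => k; apply: sumB_le => l; rewrite normrM; apply: ler_pM => //; apply: s1 => //; try exact: mxb_norm; apply: nJ; exact: mxb_norm.
- apply: (@le_trans _ _ (T2 / sq (del0 Z)) _ _ _ (le2 _ _ _ Bd0 (D0 Z))).
  apply: q2; [exact: D0|exact: (a1 _ _ VZ aZ (nJ _ v1))|exact: hB1|].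
  by apply: sumB_le => k; rewrite normrM; apply: ler_pM => //; do ?[exact: (a1 _ _ VZ aZ (mxb_norm _ _))|apply: s1 => //; apply: nJ => //; exact: mxb_norm].
Qed.

Lemma quad_mbdd : mbdd (ext0 Vp (fun Z => n%:R * (Phi Z - cc) ^+ 2 + 2 * (Phi Z - cc) * ell Z)).
Proof.
have [B hB] := ell_mbdd; apply: (@mbdd_ext0 _ (n%:R * (1 + `|cc|) ^+ 2 + 2 * (1 + `|cc|) * `|B|)) => Z VZ aZ.
have aux2 (p c l : R) : 0 <= p <= 1 -> `|l| <= B ->
    `|n%:R * (p - c) ^+ 2 + 2 * (p - c) * l| <= n%:R * (1 + `|c|) ^+ 2 + 2 * (1 + `|c|) * `|B|.
  move=> /andP[p0 p1] hl; have h : `|p - c| <= 1 + `|c| by rewrite (le_trans (ler_normB _ _))// lerD2r ger0_norm.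
  apply: (le_trans (ler_normD _ _)); apply: lerD.
    by rewrite normrM normrX ger0_norm// ler_wpM2l// lerXn2r ?nnegrE// (le_trans _ h).
  by rewrite !normrM (ger0_norm (ler0n _ 2)) -!mulrA ler_wpM2l// ler_pM// (le_trans hl)// ler_norm.
exact: (aux2 _ _ _ (Phi_ge0 VZ) (hB Z aZ)).
Qed.

(** Comes from the integral of [d alpha /\ d alpha]; the common factor [n - 1] of the quadratic
    trace is divided out. *)
Lemma mean_square : mu (ext0 Vp (fun Z => n%:R * (Phi Z - cc) ^+ 2 + 2 * (Phi Z - cc) * ell Z)) = 0.
Proof.
have aux (x y k : R) : x != 0 -> k != 0 -> x ^+ 2 * (2 * k / x * (y / x)) = 2 * k * y by move=> x0 k0; field.
have n1 : n%:R - 1 != 0 :> R by rewrite subr_eq0 gt_eqF// ltr1n.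
pose q := ext0 Vp (fun Z => n%:R * (Phi Z - cc) ^+ 2 + 2 * (Phi Z - cc) * ell Z).
have bq : mbdd q := quad_mbdd.
have h : mu (fun Z => 2 * (n%:R - 1) * q Z) = 0.
  rewrite -mean_quad; apply: mu_eq => Z aZ; have Z0 := annulus_neq0 aZ; rewrite /q.
  have [VZ|VZ] := pselect (Vp Z); last by rewrite !(ext0_out _ VZ) !mulr0.
  rewrite !(ext0_in _ VZ) (quad_sg VZ); apply: esym; exact: (aux _ _ _ (lt0r_neq0 (ip_gt0 Z0)) n1).
move: h; rewrite muZ// => /eqP; rewrite !mulf_eq0 pnatr_eq0 (negbTE n1) /= => /eqP //.
Qed.

(** This is [radial_stokes] for the function [chi (1 - chi)], expressed through [Phi] by [Phi2]. *)
Lemma mean_cut : mu (ext0 Vp (fun Z => (1 - 2 * Phi Z) * ell Z + n%:R * (Phi Z * (1 - Phi Z)))) = 0.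
Proof.
have aux (x y z k : R) : (1 - 2 * y) * (x * z) + k * (y * (1 - y)) = x * (1 - 2 * y) * z + k * (y * (1 - y)) by ring.
pose f u := cut u1 u2 u * (1 - cut u1 u2 u).
pose f1 u := cut1 u1 u2 u * (1 - 2 * cut u1 u2 u).
have hf : C1 setT f (fun u v => v * f1 u).
  have h := C1_cut u12; apply: (C1_ext (C1_mul h (C1_sub (@C1_cst R R R setT 1) h))) => // u v. by rewrite /f1; ring.
have fs u : a < u < b -> f u != 0 -> u1 <= u <= u2.
  move=> _ h; have [h1|h1] := lerP u1 u; last first.
    by move: h; rewrite /f cut_left ?(ltW h1)// subrr mulr0 eqxx.
  have [//|h2] := lerP u u2; by move: h; rewrite /f cut_right ?(ltW h2)// mul0r eqxx.
rewrite -(radial_stokes sc au1 u2b hf fs); apply: mu_eq => Z aZ.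
have [VZ|VZ] := pselect (Vp Z); last first.
  by rewrite !ext0_out// => /CVp.
rewrite (ext0_in _ VZ) (Phi2 VZ); have [CZ|CZ] := pselect (C Z); last first.
  by rewrite (ell_out CZ) !(ext0_out _ CZ) !mulr0 addr0.
rewrite (ell_in CZ) !(ext0_in _ CZ) (Phi_in CZ) /f /f1 /hcut.
exact: aux.
Qed.

(** A vector at which both the weight [rho] and the derivative of the cutoff are nonzero; it makes
    the signs of the means strict. *)
Lemma mid_point : exists Z, [/\ sq Z = 1 / 3, C Z & u1 < usq G Z < u2].
Proof.
pose m := (u1 + u2) / 2; have hm : u1 < m < u2 by have h := u12; rewrite /m; apply/andP; split; lra.
have n0 : (0 < n)%N by lia.
have m0 : 0 < m by case/andP: hm => h _; apply: le_lt_trans a0 (lt_trans au1 h).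
pose x : E := Num.sqrt m *: mxb (Ordinal n0) ord0.
have hx : sq x = m.
  by rewrite /x ipZr ipZl -[mxb _ _]/(ex (Ordinal n0)) ip_ex mxE !eqxx mulr1 -expr2 sqr_sqrtr// ltW.
have hab : a < sq x < b by rewrite hx; case/andP: hm => h1 h2; rewrite (lt_trans au1 h1) (lt_trans h2 u2b).
have [B [s [oB Bx _ hs]]] := sc_lift sc hab; have [CY GY] := hs x Bx; pose Y := s x.
have Y0 := ip_gt0 (sc_neq0 sc CY).
pose r := Num.sqrt (1 / 3 / sq Y).
have r2 : r ^+ 2 = 1 / 3 / sq Y by rewrite sqr_sqrtr// divr_ge0// ltW.
have pq : r ^+ 2 + 0 ^+ 2 != 0 by rewrite expr0n addr0 r2 gt_eqF// divr_gt0.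
exists (cs r 0 Y); split; last by rewrite usq_cs// /usq GY hx.
  by rewrite ip_cs expr0n addr0 r2 divfK// gt_eqF.
exact: (sc_cs sc pq CY).1.
Qed.

Lemma mu_ext0_lin (x y z : R) : mu (ext0 Vp (fun Z => x * Phi Z + y * ell Z + z)) =
  x * mu (ext0 Vp Phi) + y * mu ell + z * mu (ext0 Vp (fun=> 1 : R)).
Proof.
have bP := Phi_mbdd; have bl := ell_mbdd; have b1 := one_mbdd.
have b2 := mbddZ x bP; have b3 := mbddZ y bl; have b4 := mbddZ z b1.
rewrite -(muZ x bP) -(muZ y bl) -(muZ z b1) -(muD b2 b3) -(muD (mbddD b2 b3) b4).
apply: mu_eq => Z _; have [VZ|VZ] := pselect (Vp Z); first by rewrite !(ext0_in _ VZ) mulr1.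
by rewrite !(ext0_out _ VZ) (@ell_out Z) ?mulr0 ?addr0// => /CVp.
Qed.

Lemma muNell_gt0 : mu ell < 0.
Proof.
have [Z0 [h1 CZ0 hu]] := mid_point; have bl := ell_mbdd.
rewrite -oppr_gt0 -mulN1r -(muZ _ bl).
apply: (@mu_pos _ _ _ Z0 (mbddZ _ bl)) => // [Z _|Z zn|].
- by rewrite mulN1r oppr_ge0 ell_le0.
- have hc := isC1_cont (isC1_scale (-1) ell_C1) zn; exact: hc.
rewrite mulN1r oppr_gt0 (ell_in CZ0) nmulr_rlt0 ?cut1_lt0//.
by case/andP: hu => hu _; apply: le_lt_trans a0 (lt_trans au1 hu).
Qed.

Lemma one_gt0 : 0 < mu (ext0 Vp (fun=> 1 : R)).
Proof.
have [Z0 [h1 CZ0 hu]] := mid_point.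
pose q (Z : V) := sq (del0 Z) / sq Z.
have qc (Z : V) : Z != 0 -> {for Z, continuous q}.
  move=> zn; apply: continuousM; first by apply: cont_ip; apply: linear_cont; exact: del_linear.
  by apply: continuousV; [rewrite gt_eqF// ip_gt0|apply: cont_ip; exact: cont_id].
have bq : mbdd q by exact: mbdd_cont.
apply: (@lt_le_trans _ _ (mu q)).
  apply: (mu_pos bq _ qc h1) => [Z _|]; first by rewrite divr_ge0// ip_ge0.
  by rewrite divr_gt0// ip_gt0//; [exact: (CVp CZ0)|exact: (sc_neq0 sc)].
apply: mu_le => // [|Z aZ]; first exact: one_mbdd.
have Z0' := ip_gt0 (annulus_neq0 aZ).
have [VZ|VZ] := pselect (Vp Z); first by rewrite (ext0_in _ VZ) /q ler_pdivrMr// mul1r ip_del_le.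
rewrite (ext0_out _ VZ) /q; move/negP: VZ; rewrite negbK => /eqP ->.
by rewrite ip0r mul0r.
Qed.

Lemma cc_eq0 : cc = 0.
Proof.
have P0 := Phi_mbdd; pose k : R := n%:R; have k0 : 0 < k by rewrite ltr0n; lia.
pose P := mu (ext0 Vp Phi); pose L := mu ell; pose I := mu (ext0 Vp (fun=> 1 : R)).
have I0 : 0 < I := one_gt0; have L0 : L < 0 := muNell_gt0.
have e1 : k * P + L - k * cc * I = 0.
  have aux (p l : R) : k * (p - cc) + l = k * p + 1 * l + - (k * cc) by ring.
  rewrite -[RHS]mean_linear; apply: (etrans _ (etrans (esym (mu_ext0_lin k 1 (- (k * cc)))) _)); first by rewrite mul1r mulNr.
  by apply: mu_eq => Z _; have [VZ|VZ] := pselect (Vp Z); rewrite ?(ext0_in _ VZ) ?(ext0_out _ VZ)//; exact/esym/aux.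
have e2 : k * (1 - 2 * cc) * P + (1 - 2 * cc) * L + k * cc ^+ 2 * I = 0.
  have aux (p l : R) : (k * (p - cc) ^+ 2 + 2 * (p - cc) * l) + ((1 - 2 * p) * l + k * (p * (1 - p))) =
      k * (1 - 2 * cc) * p + (1 - 2 * cc) * l + k * cc ^+ 2 by ring.
  have [B hB] := ell_mbdd. have b2 : mbdd (ext0 Vp (fun Z => (1 - 2 * Phi Z) * ell Z + k * (Phi Z * (1 - Phi Z)))).
    apply: (@mbdd_ext0 _ (3 * B + k * 1)) => Z VZ aZ.
    have aux2 (p l : R) : 0 <= p <= 1 -> `|l| <= B -> `|(1 - 2 * p) * l + k * (p * (1 - p))| <= 3 * B + k * 1.
      move=> /andP[p0 p1] hl; apply: (le_trans (ler_normD _ _)); apply: lerD; rewrite normrM.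
        by rewrite ler_pM// ler_norml; apply/andP; split; lra.
      by rewrite ger0_norm ?(ltW k0)// ler_wpM2l ?(ltW k0)// ger0_norm; nra.
    exact: (aux2 _ _ (Phi_ge0 VZ) (hB Z aZ)).
  have h := muD quad_mbdd b2; rewrite mean_square mean_cut addr0 in h.
  rewrite -[RHS]h; apply: (etrans (esym (mu_ext0_lin _ _ _))).
  apply: mu_eq => Z _; have [VZ|VZ] := pselect (Vp Z); last by rewrite !(ext0_out _ VZ) addr0.
  by rewrite !(ext0_in _ VZ); exact/esym/aux.
(* In [e2], the sum of [mean_square] and [mean_cut], the squares of [Phi] have cancelled.
   Subtracting [1 - 2 cc] times [mean_linear] leaves [cc (1 - cc)] times the total mass. *)
have e3 : k * (cc * (1 - cc)) * I = 0.
  have -> : k * (cc * (1 - cc)) * I = (k * (1 - 2 * cc) * P + (1 - 2 * cc) * L + k * cc ^+ 2 * I) -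
      (1 - 2 * cc) * (k * P + L - k * cc * I) by ring.
  by rewrite e1 e2 mulr0 subr0.
move/eqP: e3; rewrite !mulf_eq0 (gt_eqF k0) (gt_eqF I0) /= orbF => /orP[/eqP//|]; rewrite subr_eq0 => /eqP c1.
(* For [cc = 1] the first identity reads [n (P - I) + L = 0], against [P <= I] and [L < 0]. *)
have PI : P <= I.
  apply: mu_le => [||Z _]; [exact: P0|exact: one_mbdd|].
  have [VZ|VZ] := pselect (Vp Z); last by rewrite !(ext0_out _ VZ). by rewrite !(ext0_in _ VZ); case/andP: (Phi_ge0 VZ).
move: e1; rewrite -c1 => e1; have : 0 <= k * (I - P) by rewrite mulr_ge0 ?(ltW k0)// subr_ge0.
lra.
Qed.

Lemma mean_Phi : n%:R * mu (ext0 Vp Phi) = - mu ell.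
Proof.
have aux (p l : R) : n%:R * (p - 0) + l = n%:R * p + 1 * l + 0 by ring.
have h : mu (ext0 Vp (fun Z => n%:R * Phi Z + 1 * ell Z + 0)) = 0.
  rewrite -[RHS]mean_linear cc_eq0; apply: mu_eq => Z _.
  by have [VZ|VZ] := pselect (Vp Z); rewrite ?(ext0_in _ VZ) ?(ext0_out _ VZ)//; exact/esym/(aux (Phi Z) (ell Z)).
rewrite mu_ext0_lin mul1r mul0r addr0 in h; apply/eqP; rewrite -addr_eq0; exact/eqP.
Qed.

End Potential.
(** * Integrals of compactly supported functions on the coordinate space *)

Section FlatIntegral.
Context {R : realType} (n : nat) (M : R) (M0 : 0 < M).
Local Notation E := 'M[R]_(n, 2).
Local Notation I := (mean (grid n 2 M0)).

Lemma grid_derive (f df : R -> E -> R) (s v : R) :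
  (forall z, {for z, continuous (fun z => f z.1 z.2)}) -> (forall z, {for z, continuous (fun z => df z.1 z.2)}) ->
  (forall s y, is_derive s v (f^~ y) (df s y)) -> is_derive s v (fun s => I (f s)) (I (df s)).
Proof.
move=> fc dfc h; apply: (mean_derive (@grid_compact R n 2 M M0) (A := setT) (df := df)) => //; first exact: openT.
  by move=> *; exact: cont_slice.
by move=> *; exact: cont_slice.
Qed.

Lemma C1_support_deriv (s : E -> R) ds M' : C1 setT s ds -> (forall x, M' < `|x| -> s x = 0) ->
  forall x v, M' < `|x| -> ds x v = 0.
Proof.
move=> hs s0 x v hx; have oA : open [set x : E | M' < `|x|].
  have -> : [set x : E | M' < `|x|] = (fun x : E => `|x|) @^-1` [set u | M' < u] by [].
  by apply: open_comp => [y _|]; [exact: norm_continuous|exact: open_gt].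
have h := eq_C1 oA (fun x Ax => esym (s0 x Ax)) (fun x v _ => erefl _) (@C1_cst R E R [set x : E | M' < `|x|] 0).
have hs' := C1_subset (fun x _ => Logic.I : setT x) hs.
exact: (C1_unique v (hs' _) h hx).
Qed.

(** Affine fields cover the three uses: the Euler identity ([L] the identity), translations
    ([L = 0]) and the linear fields behind [symp_invariance]. *)
Lemma flat_div (s : E -> R) ds M' (L : E -> E) (c : E) : linear L -> C1 setT s ds -> M' < M ->
  (forall x, M' < `|x| -> s x = 0) -> I (fun x => s x * sumB (fun a => ip (L a) a) + ds x (L x + c)) = 0.
Proof.
move=> lL hs hM s0; have ds0 := C1_support_deriv hs s0.
pose F : set E := [set x | `|x| <= M'].
have cF : closed F.
  have -> : F = (fun x : E => `|x|) @^-1` [set u | u <= M'] by [].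
  exact: (closed_comp (fun x _ => @norm_continuous _ _ x) (@closed_le R M')).
have nF x : ~ F x -> M' < `|x| by move=> /negP; rewrite -ltNge.
have hL : C1 setT (fun x => L x + c) (fun _ v => L v).
  by apply: (C1_ext (C1_add (C1_lin lL (linear_cont lL)) (@C1_cst R E E setT c))) => // x v; rewrite addr0.
have hX a : C1 setT (fun x => ip (L x + c) a) (fun _ v => ip (L v) a).
  by apply: (C1_ext (C1_ip hL (@C1_cst R E E setT a))) => // x v; rewrite ip0r addr0.
have := div_theorem M0 openT cF (@subsetT _ F) hM (fun x Fx => Fx) hs (fun x h => s0 x (nF x h)) (fun x v h => ds0 x v (nF x h)) hX.
move=> h; rewrite -[RHS]h; apply: mean_eq => x _; congr (_ + _).
rewrite -(sumB_riesz (L x + c) (C1_linear hs Logic.I)).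
by apply: eq_sumB => a; rewrite mulrC.
Qed.

Variables (u1 u2 : R) (u12 : u1 < u2).

Definition sym_form (B : E -> E -> R) := bilin B /\ forall x y, B x y = B y x.

Lemma form_cont (B : E -> E -> R) : sym_form B -> continuous (fun x => B x x).
Proof.
move=> [[l1 l2] sB] x; apply: (@cont_bil R E n 2 R B (fun x => x)) => [y|v|]; [exact: l1|exact: (linear_cont (l2 v))|exact: cont_id].
Qed.

Lemma cutB_C1 (B : E -> E -> R) : sym_form B ->
  C1 setT (fun x => cut u1 u2 (B x x)) (fun x v => 2 * B x v * cut1 u1 u2 (B x x)).
Proof.
move=> [[l1 l2] sB].
have hB : form1 setT B (fun v x u => B u v).
  by split=> [x _|v]; [exact: l1|apply: C1_lin; [exact: l2|exact: (linear_cont (l2 v))]].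
have h := form1_comp openT openT hB (@C1_id R E setT) (@C1_id R E setT) (fun _ _ => Logic.I).
apply: (C1_ext (C1_comp1 openT h (C1_cut u12) (fun _ _ => Logic.I))) => // x v.
by rewrite [B v x]sB /GRing.scale/=; ring.
Qed.

Lemma cutB_cont (B : E -> E -> R) : sym_form B -> continuous (fun x => cut u1 u2 (B x x)).
Proof. by move=> hB x; exact: (C1_cont (cutB_C1 hB) Logic.I). Qed.

Lemma cutB_euler (B : E -> E -> R) M' : sym_form B -> M' < M -> (forall x, B x x <= u2 -> `|x| <= M') ->
  I (fun x => n%:R * cut u1 u2 (B x x) + cut1 u1 u2 (B x x) * B x x) = 0.
Proof.
move=> hB hM hs.
have s0 x : M' < `|x| -> cut u1 u2 (B x x) = 0.
  by move=> hx; apply: cut_right; rewrite leNgt; apply/negP => /ltW/hs; rewrite leNgt hx.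
have := flat_div 0 (fun k u v => erefl : k *: u + v = k *: u + v) (cutB_C1 hB) hM s0.
have e : sumB (fun a : E => sq a) = 2 * n%:R.
  rewrite /sumB (eq_bigr (fun=> 2)) => [|k _]; last by rewrite ip_ex ip_ey !mxE !eqxx.
  by rewrite sumr_const card_ord -[LHS]mulr_natr.
rewrite e => h.
have b : bdd (grid n 2 M0) (fun x => n%:R * cut u1 u2 (B x x) + cut1 u1 u2 (B x x) * B x x).
  apply: bdd_cont (@grid_compact R n 2 M M0) _ => x _; have hc : {for x, continuous (fun x => B x x)} := form_cont hB (x := x).
  apply: continuousD; apply: continuousM; [exact: cont_cst|exact: (cutB_cont hB)| |exact: hc].
  by apply: (@cont_comp _ _ _ (fun x => B x x)); [exact: hc|exact: cut1_cont].
have : 2 * I (fun x => n%:R * cut u1 u2 (B x x) + cut1 u1 u2 (B x x) * B x x) = 0.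
  rewrite -meanZ// -[RHS]h; apply: mean_eq => x _; rewrite addr0; ring.
by move=> /eqP; rewrite mulf_eq0 pnatr_eq0 /= => /eqP.
Qed.

Lemma C1_pow (U : normedModType R) (A : set U) (f : U -> R) df m :
  C1 A f df -> C1 A (fun x => f x ^+ m) (fun x v => df x v * (m%:R * f x ^+ m.-1)).
Proof.
case: m => [|m] hf; last exact: C1_exp.
by apply: (C1_ext (@C1_cst R U R A 1)) => x //=; rewrite ?expr0// => v; rewrite mul0r mulr0.
Qed.

(** The derivative in [t] of the left side is the Euler identity for the form [t B]. For [t >= 1]
    the support only shrinks and stays in the cube. The exponent is [n] because [t] multiplies a
    quadratic form in [2 n] variables. *)
Lemma cutB_scale (B : E -> E -> R) M' (t : R) : (0 < n)%N -> sym_form B -> (forall x, 0 <= B x x) -> M' < M ->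
  (forall x, B x x <= u2 -> `|x| <= M') -> 1 <= t ->
  t ^+ n * I (fun x => cut u1 u2 (t * B x x)) = I (fun x => cut u1 u2 (B x x)).
Proof.
move=> n0 hB B0 hM hs t1.
have hc x : {for x, continuous (fun x => B x x)} := form_cont hB (x := x).
pose f (s : R) (x : E) : R := s ^+ n * cut u1 u2 (s * B x x).
pose df (s v : R) (x : E) : R := v * (n%:R * s ^+ n.-1) * cut u1 u2 (s * B x x) + s ^+ n * (v * B x x * cut1 u1 u2 (s * B x x)).
have cs (g : R -> R) (z : R * E) : continuous g -> {for z, continuous (fun z : R * E => g (z.1 * B z.2 z.2))}.
  move=> cg; apply: (@cont_comp _ _ _ (fun z : R * E => z.1 * B z.2 z.2) g z); last exact: cg.
  apply: continuousM; first exact: cvg_fst. by apply: (cont_comp _ (hc z.2)); exact: cvg_snd.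
have pc (z : R * E) m : {for z, continuous (fun z : R * E => z.1 ^+ m)}.
  by apply: (@cont_comp _ _ _ (fun z : R * E => z.1) (fun s => s ^+ m) z); [exact: cvg_fst|exact: exprn_continuous].
have cc x := @cut_cont R u1 u2 u12 x; have cc1 x := @cut1_cont R u1 u2 u12 x.
have cB (z : R * E) : {for z, continuous (fun z : R * E => B z.2 z.2)} by apply: (cont_comp _ (hc z.2)); exact: cvg_snd.
have fc (z : R * E) : {for z, continuous (fun z => f z.1 z.2)}.
  by apply: continuousM; [exact: pc|exact: (cs _ _ cc)].
have dfc v (z : R * E) : {for z, continuous (fun z => df z.1 v z.2)}.
  apply: continuousD; apply: continuousM.
  - by apply: continuousM; [exact: cont_cst|apply: continuousM; [exact: cont_cst|exact: pc]].
  - exact: (cs _ _ cc).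
  - exact: pc.
  - by apply: continuousM; [apply: continuousM; [exact: cont_cst|exact: cB]|exact: (cs _ _ cc1)].
have hD (s v : R) : is_derive s v (fun s => I (f s)) (I (df s v)).
  apply: (@grid_derive f (fun s => df s v)) => // s' y; have hid := @C1_id R R setT. have h1 := C1_pow n hid.
  have h2 := C1_comp1 openT (C1_mul hid (@C1_cst R R R setT (B y y))) (C1_cut u12) (fun _ _ => Logic.I).
  have := C1_derive v (C1_mul h1 h2) (Logic.I : setT s'). by congr is_derive; rewrite /df /GRing.scale/=; ring.
have zero (s v : R) : 1 <= s -> I (df s v) = 0.
  move=> s1; have s0 : 0 < s by rewrite (lt_le_trans _ s1). have hB' : sym_form (fun x y => s * B x y).
    have [[l1 l2] sB] := hB; split; last by move=> x y; rewrite sB.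
    by split=> x k u v'; [rewrite (l1 x)|rewrite (l2 x)]; rewrite /GRing.scale/=; ring.
  have hs' x : s * B x x <= u2 -> `|x| <= M'.
    by move=> h; apply: hs; apply: le_trans h; rewrite ler_peMl.
  have e := cutB_euler hB' hM hs'.
  have b : bdd (grid n 2 M0) (fun x => n%:R * cut u1 u2 (s * B x x) + cut1 u1 u2 (s * B x x) * (s * B x x)).
    apply: bdd_cont (@grid_compact R n 2 M M0) _ => x _; have sl (g : R -> R) : continuous g -> {for x, continuous (fun x => g (s * B x x))}.
      by move=> cg; exact: (@cont_slice R E R (fun s x => g (s * B x x)) s x (cs g (s, x) cg)).
    apply: continuousD; apply: continuousM; [exact: cont_cst|exact: sl|exact: sl|].
    by apply: continuousM; [exact: cont_cst|exact: hc].
  rewrite -[RHS](mulr0 (v * s ^+ n.-1)) -e -meanZ//; apply: mean_eq => x _. rewrite /df -(prednK n0) /= exprS; ring.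
have [s /andP[s0 _]] := MVT_line (f := fun s => I (f s)) (x := 1 : R) (v := t - 1) (fun s _ => hD (1 + s *: (t - 1)) (t - 1)).
rewrite zero; last by rewrite lerDl mulr_ge0// subr_ge0.
move=> /eqP; rewrite subr_eq0 addrC subrK => /eqP e.
rewrite -meanZ; last by apply: bdd_cont (@grid_compact R n 2 M M0) _ => x _; exact: (@cont_slice R E R (fun s x => cut u1 u2 (s * B x x)) t x (cs _ (t, x) cc)).
rewrite [LHS]e; apply: mean_eq => x _; by rewrite /f expr1n !mul1r.
Qed.

Lemma flat_shift (v : E -> R) dv M' (p : E) : C1 setT v dv -> M' < M ->
  (forall t : R, 0 <= t <= 1 -> forall x, M' < `|x| -> v (x - t *: p) = 0) -> I (fun x => v (x - p)) = I v.
Proof.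
move=> hv hM hs.
pose f (t : R) x := v (x - t *: p).
have cz (z : R * E) : {for z, continuous (fun z : R * E => z.2 - z.1 *: p)}.
  apply: continuousB; first exact: cvg_snd.
  by apply: (@cont_comp _ _ _ (fun z : R * E => z.1) (fun s : R => s *: p) z); [exact: cvg_fst|exact: scal_cont].
have cv : continuous v by move=> x; exact: (C1_cont hv Logic.I).
have cdv (c : E) : continuous (dv^~ c) by move=> x; exact: (hv x Logic.I).2.
have hD (s w : R) : is_derive s w (fun s => I (f s)) (I (fun x => dv (x - s *: p) (- (w *: p)))).
  apply: (@grid_derive f (fun s x => dv (x - s *: p) (- (w *: p)))) => [z|z|s' y].
  - exact: (cont_comp (cz z) (cv _)).
  - exact: (cont_comp (cz z) (cdv _ _)).
  have h1 : C1 (setT : set R) (fun s : R => y - s *: p) (fun _ w => - (w *: p)).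
    have h0 : C1 (setT : set R) (fun s : R => s *: p) (fun _ (w : R) => w *: p).
      by apply: C1_lin; [move=> k a b; rewrite scalerDl scalerA|move=> t; exact: scal_cont].
    by apply: (C1_ext (C1_sub (@C1_cst R R E setT y) h0)) => // a b; rewrite sub0r.
  exact: (C1_derive w (C1_comp openT h1 hv (fun _ _ => Logic.I)) (Logic.I : setT s')).
have zero (s : R) : 0 <= s <= 1 -> I (fun x => dv (x - s *: p) (- (1 *: p))) = 0.
  move=> s01; have h1 : C1 (setT : set E) (fun x : E => x - s *: p) (fun _ v => v).
    by apply: (C1_ext (C1_sub (@C1_id R E setT) (@C1_cst R E E setT (s *: p)))) => // a b; rewrite subr0.
  have l0 : linear (fun x : E => 0 : E) by move=> k a b; rewrite scaler0 addr0.
  have h := flat_div (- (1 *: p)) l0 (C1_comp openT h1 hv (fun _ _ => Logic.I)) hM (hs s s01).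
  rewrite -[RHS]h; apply: mean_eq => x _; rewrite /sumB big1 ?mulr0 ?add0r// => k _. by rewrite !ip0l addr0.
have [s hs1 hs2] := MVT_line (f := fun s => I (f s)) (x := 0 : R) (v := 1 : R) (fun t _ => hD (0 + t *: 1) 1).
move: hs2; rewrite zero; last by rewrite add0r [s *: 1]mulr1.
move=> /eqP; rewrite subr_eq0 => /eqP e.
transitivity (I (f 1)); first by apply: mean_eq => x _; rewrite /f scale1r.
by rewrite add0r in e; rewrite e; apply: mean_eq => x _; rewrite /f scale0r subr0.
Qed.

End FlatIntegral.

(** * Invariance of integrals under linear symplectic maps *)

Section LinearSymplectic.
Context {R : realType} (n : nat) (M : R) (M0 : 0 < M).
Local Notation E := 'M[R]_(n, 2).
Local Notation I := (mean (grid n 2 M0)).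

Lemma linear_inj_inv p q (L : 'M[R]_(p, q) -> 'M[R]_(p, q)) : linear L -> (forall x, L x = 0 -> x = 0) ->
  exists2 K : 'M[R]_(p, q) -> 'M[R]_(p, q), linear K & forall x, L (K x) = x.
Proof.
move=> lL Li.
pose L' : {linear 'M[R]_(p, q) -> 'M[R]_(p, q)} := HB.pack L (GRing.isLinear.Build _ _ _ _ L lL).
have hu : lin_mx L' \in unitmx.
  rewrite -row_free_unit -kermx_eq0; apply/eqP/row_matrixP => i; rewrite row0.
  set v := row i _; have : v *m lin_mx L' = 0 by rewrite /v -row_mul mulmx_ker row0.
  rewrite -{1}(vec_mxK v) mul_vec_lin => /(congr1 vec_mx); rewrite mxvecK linear0 => /Li h.
  by rewrite -(vec_mxK v) h linear0.
exists (fun x => vec_mx (mxvec x *m invmx (lin_mx L'))).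
  by move=> k u v; rewrite !linearP /= mulmxDl -scalemxAl linearP.
move=> x; apply: (can_inj mxvecK).
by rewrite -[L _]/(L' _) -mul_vec_lin vec_mxK mulmxKV.
Qed.

Lemma ip_inj m (x y : 'M[R]_(m, 2)) : (forall z, ip z x = ip z y) -> x = y.
Proof.
move=> h; apply/eqP; rewrite -subr_eq0; apply/eqP/ip_eq0.
by rewrite (linB _ _ (ip_linr _)) h subrr.
Qed.

Definition riesz m (L : 'M[R]_(m, 2) -> R) : 'M[R]_(m, 2) := \sum_k (L (ex k) *: ex k + L (ey k) *: ey k).

Lemma ip_riesz m (L : 'M[R]_(m, 2) -> R) x : linear L -> ip x (riesz L) = L x.
Proof.
move=> hL; rewrite [RHS](lin_basis _ hL).
have aux (r : seq 'I_m) : ip x (\sum_(k <- r) (L (ex k) *: ex k + L (ey k) *: ey k)) =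
    \sum_(k <- r) (x k ord0 * L (ex k) + x k ord_max * L (ey k)).
  elim: r => [|k r IH]; first by rewrite !big_nil ip0r. rewrite !big_cons -IH !ipDr !ipZr ip_ex ip_ey; congr (_ + _).
  by rewrite [_ * x k ord0]mulrC [_ * x k ord_max]mulrC.
exact: aux.
Qed.

Lemma vlin0 (U W : lmodType R) (L : U -> W) : linear L -> L 0 = 0.
Proof. by move=> hL; have := hL (-1) 0 0; rewrite scaler0 addr0 scaleN1r addNr. Qed.

Lemma vlinZ (U W : lmodType R) (L : U -> W) a u : linear L -> L (a *: u) = a *: L u.
Proof. by move=> hL; have := hL a u 0; rewrite (vlin0 hL) !addr0. Qed.

Lemma vlinD (U W : lmodType R) (L : U -> W) u v : linear L -> L (u + v) = L u + L v.
Proof. by move=> hL; have := hL 1 u v; rewrite !scale1r. Qed.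

Lemma vlinN (U W : lmodType R) (L : U -> W) u : linear L -> L (- u) = - L u.
Proof. by move=> hL; rewrite -scaleN1r vlinZ// scaleN1r. Qed.

Section Path.
Variables (A : E -> E) (lA : linear A) (sA : forall u v, omega_st (A u) (A v) = omega_st u v).

Lemma sA_ip u v : ip (Jm (A u)) (A v) = ip (Jm u) v.
Proof. by rewrite -!omega_ip. Qed.

Lemma symp_inj x : A x = 0 -> x = 0.
Proof.
move=> h; apply: ip_eq0; have := sA_ip x (Jm x).
by rewrite h (_ : Jm 0 = 0) ?ip_JJ ?ip0l// -(scale0r x) JmZ !scale0r.
Qed.

Let P y : E := riesz (fun x => ip (A x) (A y)).

Lemma ip_A_lin y : linear (fun x => ip (A x) (A y)).
Proof. by move=> k u v; rewrite lA ip_linl. Qed.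

Lemma P_ip x y : ip x (P y) = ip (A x) (A y).
Proof. by rewrite ip_riesz//; exact: ip_A_lin. Qed.

Lemma P_lin : linear P.
Proof. by move=> k u v; apply: ip_inj => z; rewrite ip_linr !P_ip lA ip_linr. Qed.

(** [P] is the adjoint of [A] composed with [A], hence symmetric and symplectic, and [Jm] conjugates
    it to its inverse. This symmetry does the work of a determinant. *)
Lemma PJP y : P (Jm (P y)) = Jm y.
Proof.
have [K lK AK] := linear_inj_inv lA symp_inj.
have h : A (Jm (P y)) = Jm (A y).
  apply: ip_inj => z; have -> : z = Jm (A (- K (Jm z))).
    by rewrite (vlinN _ lA) AK JmN JmJ opprK.
  by rewrite sA_ip ip_JJ P_ip ip_JJ.
apply: ip_inj => z; rewrite P_ip h.
by rewrite -[ip (A z) _]opprK -ip_Jl sA_ip ip_Jl opprK.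
Qed.

(* The path of forms from the standard one to its pullback. *)
Definition Bpath (t : R) (x y : E) : R := (1 - t) * ip x y + t * ip (A x) (A y).

Lemma Bpath_form t : sym_form (Bpath t).
Proof.
split=> [|x y]; last by rewrite /Bpath ipC [ip (A x) _]ipC.
by split=> x k u v; rewrite /Bpath lA ?ip_linr ?ip_linl /GRing.scale/=; ring.
Qed.

(** [K] is chosen so that the Lie derivative of [Bpath t] along it is twice the derivative of the
    path of forms in [t]. *)
Lemma path_field t : 0 <= t <= 1 -> exists2 K : E -> E, linear K & forall y, (1 - t) *: K y + t *: P (K y) = P y - y.
Proof.
move=> /andP[t0 t1].
have lQ : linear (fun y => (1 - t) *: y + t *: P y).
  by move=> k u v; rewrite P_lin !scalerDr !scalerA [(1 - t) * k]mulrC [t * k]mulrC -!scalerA addrACA -scalerDr.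
have [y|S lS QS] := linear_inj_inv lQ _.
  move=> h; apply: ip_eq0; have h1 : (1 - t) * sq y + t * sq (A y) = 0.
    have := lin0 (ip_linr y); rewrite -h ipDr !ipZr P_ip //.
  have i1 := ip_ge0 y; have i2 := ip_ge0 (A y). have [t1'|t1'] := eqVneq t 1.
    move: h1; rewrite t1' subrr mul0r add0r mul1r => /ip_eq0/symp_inj->; exact: lin0 (ip_linr _).
  have t2 : 0 < 1 - t by rewrite subr_gt0 lt_neqAle t1' t1. have : (1 - t) * sq y <= 0 by rewrite -h1 lerDl mulr_ge0.
  by rewrite pmulr_rle0// => h2; apply/eqP; rewrite eq_le h2 i1.
exists (fun y => S (P y - y)).
  move=> k u v; rewrite P_lin -lS; congr S. by rewrite scalerBr opprD addrACA.
by move=> y; rewrite QS.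
Qed.

Lemma path_field_flip t (K : E -> E) : linear K -> (forall y, (1 - t) *: K y + t *: P (K y) = P y - y) ->
  forall y, t *: Jm (K (Jm y)) + (1 - t) *: P (Jm (K (Jm y))) = P y - y.
Proof.
move=> lK hK y; set w := K (Jm y).
have PZ (k : R) u : P (k *: u) = k *: P u by exact: vlinZ P_lin.
have PD u v : P (u + v) = P u + P v by exact: vlinD P_lin.
have -> : t *: Jm w + (1 - t) *: P (Jm w) = P (Jm ((1 - t) *: w + t *: P w)).
  by rewrite JmD !JmZ PD !PZ PJP addrC.
by rewrite hK JmB PD (vlinN _ P_lin) PJP !JmJ (vlinN _ P_lin) opprK addrC.
Qed.

Variables (u1 u2 M' : R) (u12 : u1 < u2) (hM : M' < M).
Hypothesis hs : forall t x, 0 <= t <= 1 -> Bpath t x x <= u2 -> `|x| <= M'.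

Let F (t : R) := I (fun x => cut u1 u2 (Bpath t x x)).
Let dF (t : R) := I (fun x => (sq (A x) - sq x) * cut1 u1 u2 (Bpath t x x)).
Let h (K : E -> E) := sumB (fun a => ip (K a) a).

Lemma path_ode t (K : E -> E) : 0 <= t <= 1 -> linear K ->
  (forall y, (1 - t) *: K y + t *: P (K y) = P y - y) -> 2 * dF t = - h K * F t.
Proof.
move=> ht lK hK.
have s0 x : M' < `|x| -> cut u1 u2 (Bpath t x x) = 0.
  by move=> hx; apply: cut_right; rewrite leNgt; apply/negP => /ltW/(hs ht); rewrite leNgt hx.
have hB := Bpath_form t; have := flat_div M0 0 lK (cutB_C1 u12 hB) hM s0.
have cB x : {for x, continuous (fun x => Bpath t x x)} := form_cont hB (x := x).
have c1 : continuous (fun x => cut u1 u2 (Bpath t x x)) by exact: cutB_cont.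
have c2 : continuous (fun x => cut1 u1 u2 (Bpath t x x)) by move=> x; apply: (@cont_comp _ _ _ (fun x => Bpath t x x)); [exact: cB|exact: cut1_cont].
have c3 : continuous (fun x => sq (A x) - sq x).
  move=> x; have h1 : {for x, continuous (fun x => sq (A x))} by apply: cont_ip; exact: linear_cont.
  have h2 : {for x, continuous (fun x : E => sq x)} by apply: cont_ip; exact: cont_id. exact: (continuousB h1 h2).
rewrite (@mean_eq _ _ _ _ (fun x => h K * cut u1 u2 (Bpath t x x) + 2 * ((sq (A x) - sq x) * cut1 u1 u2 (Bpath t x x)))); last first.
  move=> x _; rewrite addr0 mulrC; congr (_ + _); rewrite -mulrA; congr (2 * (_ * _)).
  by rewrite /Bpath -P_ip -!ipZr -ipDr hK (linB _ _ (ip_linr _)) P_ip.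
rewrite meanD; [|apply: bddZ; exact: grid_bdd|apply: bddZ; apply: bddM; exact: grid_bdd].
rewrite !meanZ; [|apply: bddM; exact: grid_bdd|exact: grid_bdd] => e.
by apply/eqP; rewrite -subr_eq0 mulNr opprK addrC; apply/eqP.
Qed.

(** Conjugating [K] by [Jm] gives a field for the parameter [1 - t] with the opposite divergence. By
    [path_ode], the ratios of [dF] to [F] at [t] and at [1 - t] are therefore opposite. *)
Lemma path_odd t : 0 <= t <= 1 -> dF (1 - t) * F t = - (dF t * F (1 - t)).
Proof.
move=> ht; have ht' : 0 <= 1 - t <= 1 by case/andP: ht => t0 t1; apply/andP; split; lra.
have [K lK hK] := path_field ht; have lK' : linear (fun y => Jm (K (Jm y))).
  by move=> k u v; rewrite JmD JmZ lK JmD JmZ.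
have e1 := path_ode ht lK hK.
have hK' y : (1 - (1 - t)) *: Jm (K (Jm y)) + (1 - t) *: P (Jm (K (Jm y))) = P y - y.
  by rewrite subKr; exact: (path_field_flip lK hK).
have e2 := path_ode ht' lK' hK'.
have e3 : h (fun y => Jm (K (Jm y))) = - h K.
  rewrite /h -(@sumB_J R n (fun a b => ip (K a) b)); last first.
    by split=> x k u v; [exact: ip_linr|rewrite lK ip_linl].
  by rewrite -sumBN; apply: eq_sumB => a; rewrite ip_Jl.
have : 2 * (dF (1 - t) * F t) = 2 * - (dF t * F (1 - t)).
  by rewrite mulrA e2 e3 mulrN mulrA e1; ring.
by apply: mulfI; rewrite pnatr_eq0.
Qed.

Hypothesis u10 : 0 < u1.

Lemma F_gt0 t : 0 < F t.
Proof.
apply: (@grid_pos R n 2 M M0 _ 0) => [|x||].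
- exact: (cutB_cont u12 (Bpath_form t)).
- exact: cut_ge0.
- by have [[l1 _] _] := Bpath_form t; rewrite (lin0 (l1 0)) cut_left ?(ltW u10)// ltr01.
- by rewrite normr0.
Qed.

Lemma F_deriv (t v : R) : is_derive t v F (v * dF t).
Proof.
have cA : continuous (fun x => sq (A x)) by move=> x; apply: cont_ip; exact: linear_cont.
have ci : continuous (fun x : E => sq x) by move=> x; apply: cont_ip; exact: cont_id.
have cz (z : R * E) : {for z, continuous (fun z : R * E => Bpath z.1 z.2 z.2)}.
  have c1 : {for z, continuous (fun z : R * E => z.1)} by exact: cvg_fst.
  have c2 : {for z, continuous (fun z : R * E => z.2)} by exact: cvg_snd.
  apply: continuousD; apply: continuousM; [apply: continuousB; [exact: cont_cst|exact: c1]|exact: (cont_comp c2 (ci _))|exact: c1|exact: (cont_comp c2 (cA _))].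
pose f (t : R) x := cut u1 u2 (Bpath t x x).
pose df (t : R) x := v * ((sq (A x) - sq x) * cut1 u1 u2 (Bpath t x x)).
have fc (z : R * E) : {for z, continuous (fun z => f z.1 z.2)} by apply: (@cont_comp _ _ _ (fun z : R * E => Bpath z.1 z.2 z.2)); [exact: cz|exact: cut_cont].
have dfc (z : R * E) : {for z, continuous (fun z => df z.1 z.2)}.
  have c2 : {for z, continuous (fun z : R * E => z.2)} by exact: cvg_snd.
  apply: continuousM; [exact: cont_cst|apply: continuousM; last by apply: (@cont_comp _ _ _ (fun z : R * E => Bpath z.1 z.2 z.2)); [exact: cz|exact: cut1_cont]].
  by apply: continuousB; [exact: (cont_comp c2 (cA _))|exact: (cont_comp c2 (ci _))].
have -> : v * dF t = I (df t).
  rewrite -meanZ//; apply: bdd_cont (@grid_compact R n 2 M M0) _ => x _; apply: continuousM; first by apply: continuousB; [exact: cA|exact: ci].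
  have hc : {for x, continuous (fun x => Bpath t x x)} := form_cont (Bpath_form t) (x := x).
  by apply: (@cont_comp _ _ _ (fun x => Bpath t x x)); [exact: hc|exact: cut1_cont].
apply: (@grid_derive _ _ M M0 f df) => // s y; have hid := @C1_id R R setT.
have h1 := C1_add (C1_mul (C1_sub (@C1_cst R R R setT 1) hid) (@C1_cst R R R setT (sq y))) (C1_mul hid (@C1_cst R R R setT (sq (A y)))).
have := C1_derive v (C1_comp1 openT h1 (C1_cut u12) (fun _ _ => Logic.I)) (Logic.I : setT s).
by congr is_derive; rewrite /df /Bpath /GRing.scale/=; ring.
Qed.

(** [path_odd] says that [F t / F (1 - t)] has derivative 0. Equating its values at 0 and 1 gives
    [F 1 ^+ 2 = F 0 ^+ 2], and both are positive. *)
Lemma symp_invariance : I (fun x => cut u1 u2 (sq (A x))) = I (fun x => cut u1 u2 (sq x)).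
Proof.
have F1 : F 1 = I (fun x => cut u1 u2 (sq (A x))).
  by apply: mean_eq => x _; rewrite /Bpath subrr mul0r add0r mul1r.
have F0 : F 0 = I (fun x => cut u1 u2 (sq x)).
  by apply: mean_eq => x _; rewrite /Bpath subr0 mul0r addr0 mul1r.
rewrite -F0 -F1; pose g (t : R) : R := F t / F (1 - t).
have hD (t : R) : 0 <= t <= 1 -> is_derive (0 + t *: 1 : R) 1 g 0.
  rewrite add0r [t *: 1]mulr1 => ht. have h1 : is_derive t 1 F (dF t) by have := F_deriv t 1; rewrite mul1r.
  have h2 : is_derive t 1 (fun s => F (1 - s)) (- dF (1 - t)).
    have a1 : is_derive t 1 (fun s : R => 1 - s) (-1).
      by have := C1_derive (1 : R) (C1_sub (@C1_cst R R R setT 1) (@C1_id R R setT)) (Logic.I : setT t); rewrite sub0r.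
    have a2 := F_deriv (1 - t) 1; rewrite mul1r in a2.
    by have := @is_derive1_comp R F (fun s => 1 - s) t _ _ a2 a1; rewrite mulrN1.
  have n0 : F (1 - t) != 0 by rewrite gt_eqF// F_gt0. have h3 := @is_deriveV R (fun s => F (1 - s)) t _ 1 n0 h2.
  have := is_deriveM h1 h3. congr is_derive; rewrite /GRing.scale/=.
  have e := path_odd ht; move: n0; move: (F (1 - t)) (F t) (dF t) (dF (1 - t)) e => x y z w e x0.
  have -> : y * (- x ^- 2 * - w) + x^-1 * z = (w * y + z * x) / x ^+ 2 by field. by rewrite e addNr mul0r.
have [t _] := MVT_line hD; rewrite add0r /g subr0 subrr => /eqP; rewrite subr_eq0 => /eqP e.
have x0 := lt0r_neq0 (F_gt0 0); have x1 := lt0r_neq0 (F_gt0 1).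
have e2 : F 1 ^+ 2 = F 0 ^+ 2.
  have : F 1 / F 0 * (F 0 * F 1) = F 0 / F 1 * (F 0 * F 1) by rewrite e.
  by rewrite mulrA divfK// [F 0 * F 1]mulrC mulrA divfK// -!expr2.
by apply/eqP; rewrite -(eqrXn2 (ltn0Sn 1) (ltW (F_gt0 1)) (ltW (F_gt0 0))); apply/eqP.
Qed.

End Path.
End LinearSymplectic.

(** * Push-forward of the mean under symplectic coordinates *)

Section PushForward.
Context {R : realType} (n : nat) (M : R) (M0 : 0 < M).
Local Notation V := 'M[R]_(n.+1, 2).
Local Notation E := 'M[R]_(n, 2).
Local Notation I := (mean (grid n 2 M0)).

(** The cross term is bounded by [e |y|^2 + |z|^2 / e]. *)
Lemma ip_near m (y z : 'M[R]_(m, 2)) (e : R) : 0 < e ->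
  (1 - e) * sq y - sq z / e <= sq (y + z) <= (1 + e) * sq y + (1 + e^-1) * sq z.
Proof.
move=> e0; have h (k : R) : 0 <= k ^+ 2 * sq y + 2 * k * ip y z + sq z.
  have := ip_ge0 (k *: y + z); rewrite ipDr !ipDl !ipZr !ipZl.
  by rewrite [ip z y]ipC; set l := (X in 0 <= X -> _); have -> : l = k ^+ 2 * sq y + 2 * k * ip y z + sq z by rewrite /l; ring.
have h1 := h e; have h2 := h (- e); rewrite ipDr !ipDl [ip z y]ipC.
move: h1 h2 (ip_ge0 z); move: (sq y) (ip y z) (sq z) => Y X Z h1 h2 Z0.
have e1 : e * e^-1 = 1 by rewrite divff// gt_eqF.
have i0 : 0 < e^-1 by rewrite invr_gt0.
have k1 : 0 <= e * Y + 2 * X + Z / e.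
  have -> : e * Y + 2 * X + Z / e = (e ^+ 2 * Y + 2 * e * X + Z) / e by field; rewrite gt_eqF.
  by rewrite mulr_ge0// ltW.
have k2 : 0 <= e * Y - 2 * X + Z / e.
  have -> : e * Y - 2 * X + Z / e = ((- e) ^+ 2 * Y + 2 * (- e) * X + Z) / e by field; rewrite gt_eqF.
  by rewrite mulr_ge0// ltW.
by apply/andP; split; [rewrite mulrBl mul1r|rewrite !mulrDl !mul1r [e^-1 * Z]mulrC]; lra.
Qed.

Lemma near_shell (a1 a2 b2 b1 : R) : 0 <= a2 -> a1 < a2 -> a2 < b2 -> b2 < b1 ->
  exists2 d : R, 0 < d & forall m (x y : 'M[R]_(m, 2)), a2 <= sq y <= b2 -> sq (x - y) <= d -> a1 <= sq x <= b1.
Proof.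
move=> a20 a12 ab b21; pose m := Num.min (a2 - a1) (b1 - b2).
have m0 : 0 < m by rewrite lt_min !subr_gt0 a12.
have [m1 m2] : m <= a2 - a1 /\ m <= b1 - b2 by rewrite !ge_min !lexx orbT.
pose e := m / (2 * (1 + b2)); have b0 : 0 < 1 + b2 by lra.
have e0 : 0 < e by rewrite divr_gt0// mulr_gt0.
have eb : e * (1 + b2) = m / 2 by rewrite /e; field; rewrite gt_eqF.
have i0 : 0 < e^-1 by rewrite invr_gt0.
pose d := m / (2 * (1 + e^-1)); have k0 : 0 < 1 + e^-1 by lra.
have d0 : 0 < d by rewrite divr_gt0// mulr_gt0.
have dk : (1 + e^-1) * d = m / 2 by rewrite /d; move: (1 + e^-1) k0 => k kk; field; rewrite gt_eqF.
exists d => // p x y /andP[y1 y2] hz; have yx : y + (x - y) = x by rewrite addrC subrK.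
have := ip_near y (x - y) e0; rewrite yx.
have z0 := ip_ge0 (x - y); move: hz z0; move: (ip (x - y) _) => z hz z0 /andP[h1 h2].
have k1 : (1 + e^-1) * z <= m / 2 by rewrite -dk ler_wpM2l// ltW.
have k2 : e * sq y <= m / 2.
  by rewrite -eb ler_wpM2l ?(ltW e0)//; lra.
have k3 : z / e <= m / 2.
  by apply: le_trans k1; rewrite mulrC ler_wpM2r// ?z0//; lra.
rewrite mulrBl mul1r in h1; rewrite mulrDl mul1r in h2.
by apply/andP; split; lra.
Qed.

Variables (C : set V) (G : V -> E) (a b : R).
Hypothesis sc : symp_coord C G a b.
Let oC := sc_open sc.
Variables (a0 a1 a2 b2 b1 b0 : R).
Hypotheses (ha0 : a < a0) (ha1 : a0 < a1) (ha2 : a1 < a2) (a20 : 0 <= a2) (hab : a2 < b2)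
  (hb2 : b2 < b1) (hb1 : b1 < b0) (hb0 : b0 < b).

(** Confines the kernel to a closed subshell, so that its extension by 0 is continuous, and equals 1
    wherever [v (G Z - y)] is nonzero for [y] in the inner shell. *)
Definition plateau (u : R) : R := (1 - cut a0 a1 u) * cut b1 b0 u.

Lemma plateau_supp u : plateau u != 0 -> a0 <= u <= b0.
Proof.
move=> h; apply/andP; split; rewrite leNgt; apply/negP => hu; move/eqP: h; apply.
  by rewrite /plateau cut_left ?subrr ?mul0r// ltW.
by rewrite /plateau [cut b1 b0 u]cut_right ?mulr0// ltW.
Qed.

Lemma plateau1 u : a1 <= u <= b1 -> plateau u = 1.
Proof. by move=> /andP[h1 h2]; rewrite /plateau cut_right// cut_left// subr0 mulr1. Qed.

Lemma plateau_cont : continuous plateau.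
Proof.
move=> u; have h2 : {for u, continuous (fun u => cut b1 b0 u)} by exact: cut_cont.
have h1 : {for u, continuous (fun u => 1 - cut a0 a1 u)}.
  by apply: continuousB; [exact: cont_cst|exact: cut_cont].
exact: (continuousM h1 h2).
Qed.

Definition kern (q : E -> E -> R) (y : E) (Z : V) : R := rho (sq Z) * ext0 C (fun Z => plateau (usq G Z) * q (G Z) y) Z.

Lemma rho_near0 (Z : V) : sq Z < 1 / 8 -> \forall Y \near Z, rho (sq Y) = 0.
Proof.
move=> h; have hc : {for Z, continuous (fun Y : V => sq Y)} by apply: cont_ip; exact: cont_id.
have hn : \forall Y \near Z, sq Y < 1 / 8 by exact: (hc _ (lt_nbhsl h)).
apply: filterS hn => Y hY; apply/eqP; apply: contraTT hY => /rho_supp/andP[h1 _]; by rewrite -leNgt.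
Qed.

Lemma kern_cont (q : E -> E -> R) : (forall z : E * E, {for z, continuous (fun z => q z.1 z.2)}) ->
  forall z : E * V, {for z, continuous (fun z => kern q z.1 z.2)}.
Proof.
move=> hq [y Z]; have c2 : {for (y, Z), continuous (fun z : E * V => z.2)} by exact: cvg_snd.
have zero : (\forall z \near (y, Z), kern q z.1 z.2 = 0) -> {for (y, Z), continuous (fun z : E * V => kern q z.1 z.2)}.
  move=> h; have h' : \forall z \near (y, Z), (fun=> 0 : R) z = kern q z.1 z.2 by apply: filterS h => z ->.
  exact: (near_cont h' (@cont_cst _ _ (0 : R) (y, Z))).
have [h|h] := ltP (sq Z) (1 / 8).
  have hn : \forall z \near (y, Z), rho (sq z.2) = 0 by exact: (c2 _ (rho_near0 h)).
  by apply: zero; apply: filterS hn => z hz; rewrite /kern hz mul0r.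
have Z0 : Z != 0 by apply: contraTneq h => ->; rewrite ip0r -ltNge.
have [CZ|CZ] := pselect (C Z); last first.
  have hZ : ~ (C Z /\ a0 <= usq G Z <= b0) by case.
  have hn : \forall z \near (y, Z), ~ (C z.2 /\ a0 <= usq G z.2 <= b0) by exact: (c2 _ (sc_closed sc ha0 hb0 Z0 hZ)).
  apply: zero; apply: filterS hn => -[y' Y] /= nY; rewrite /kern.
  have [CY|CY] := pselect (C Y); last by rewrite ext0_out ?mulr0.
  rewrite ext0_in//; have [->|/plateau_supp hu] := eqVneq (plateau (usq G Y)) 0; first by rewrite mul0r mulr0.
  by case: nY.
have hC : \forall z \near (y, Z), C z.2 by exact: (c2 _ (open_nbhs_nbhs (conj oC CZ))).
have hn : \forall z \near (y, Z), rho (sq z.2) * (plateau (usq G z.2) * q (G z.2) z.1) = kern q z.1 z.2.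
  by apply: filterS hC => z Cz; rewrite /kern ext0_in.
apply: (near_cont hn).
have cG : {for (y, Z), continuous (fun z : E * V => G z.2)} by exact: (cont_comp c2 (isC1_cont (sc_C1 sc) CZ)).
have cu : {for (y, Z), continuous (fun z : E * V => usq G z.2)} by apply: cont_ip.
have c1 : {for (y, Z), continuous (fun z : E * V => z.1)} by exact: cvg_fst.
have hr : {for (y, Z), continuous (fun z : E * V => rho (sq z.2))}.
  have hi : {for (y, Z), continuous (fun z : E * V => sq z.2)} by apply: cont_ip.
  exact: (cont_comp hi (isC1_cont isC1_rho Logic.I)).
apply: continuousM; first exact: hr.
apply: continuousM; first exact: (cont_comp cu (@plateau_cont _)).
exact: (@cont_comp _ _ _ (fun z : E * V => (G z.2, z.1)) (fun z : E * E => q z.1 z.2) (y, Z) (cont_pair cG c1) (hq _)).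
Qed.

Lemma kern_slice (q : E -> E -> R) y Z : (forall z : E * E, {for z, continuous (fun z => q z.1 z.2)}) ->
  {for Z, continuous (kern q y)}.
Proof. by move=> hq; apply: (@cont_slice _ _ _ (kern q)); exact: kern_cont. Qed.

Variables (v : E -> R) (dv : E -> E -> R) (d : R).
Hypotheses (hv : C1 setT v dv) (ve : forall x, v (- x) = v x) (v0 : forall x, 0 <= v x)
  (vd : forall x, v x != 0 -> sq x <= d).
Hypothesis hd : forall m (x y : 'M[R]_(m, 2)), a2 <= sq y <= b2 -> sq (x - y) <= d -> a1 <= sq x <= b1.

(** The push-forward of the weighted mean, mollified by [v]. Translation invariance ([mu_partial])
    makes it constant on the inner shell. *)
Definition phi (y : E) : R := mean (box n.+1) (kern (fun x y => v (x - y)) y).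

Lemma sub_cont2 (f : E -> R) : continuous f -> forall z : E * E, {for z, continuous (fun z : E * E => f (z.1 - z.2))}.
Proof.
move=> cf z; apply: (@cont_comp _ _ _ (fun z : E * E => z.1 - z.2) f z); last exact: cf.
by apply: continuousB; [exact: cvg_fst|exact: cvg_snd].
Qed.

Lemma box_compact m : compact (net_dom (box m) : set 'M[R]_(m, 2)). Proof. exact: grid_compact. Qed.

Lemma phi_C1 : C1 setT phi (fun y w => mean (box n.+1) (kern (fun x y => dv (x - y) (- w)) y)).
Proof.
have cv : continuous v by move=> x; exact: (C1_cont hv Logic.I).
have cdv (c : E) : continuous (dv^~ c) by move=> x; exact: (hv Logic.I).2.
apply: (@mean_C1 R V (box n.+1) (@box_compact n.+1) n 2 setT (kern (fun x y => v (x - y)))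
  (fun Z y w => kern (fun x y => dv (x - y) (- w)) y Z)) => [|Z _|y Z _ _|y Z w _ _]; first exact: openT.
- have [CZ|CZ] := pselect (C Z); last first.
    by apply: (C1_ext (@C1_cst R E R setT 0)) => y *; rewrite /kern ext0_out ?mulr0.
  have h1 : C1 (setT : set E) (fun y : E => G Z - y) (fun _ w => - w).
    by apply: (C1_ext (C1_sub (@C1_cst R E E setT (G Z)) (@C1_id R E setT))) => // y w; rewrite sub0r.
  apply: (C1_ext (C1_scale (rho (sq Z) * plateau (usq G Z)) (C1_comp openT h1 hv (fun _ _ => Logic.I)))) => y *;
    by rewrite /kern ext0_in// mulrA.
- by apply: kern_slice; exact: sub_cont2.
- have h : forall z : E * E, {for z, continuous (fun z : E * E => dv (z.1 - z.2) (- w))} by exact: (@sub_cont2 (dv^~ (- w)) (cdv _)).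
  exact: (@kern_cont (fun x y : E => dv (x - y) (- w)) h (y, Z)).
Qed.

Lemma phi_deriv0 y w : a2 < sq y < b2 -> mean (box n.+1) (kern (fun x y => dv (x - y) (- w)) y) = 0.
Proof.
move=> /andP[y1 y2]; have hy : a2 <= sq y <= b2 by rewrite !ltW.
have h1 : C1 (setT : set E) (fun x : E => x - y) (fun _ w => w).
  by apply: (C1_ext (C1_sub (@C1_id R E setT) (@C1_cst R E E setT y))) => // x u; rewrite subr0.
have hw := C1_comp openT h1 hv (fun _ _ => Logic.I).
have hs x : v (x - y) != 0 -> a1 <= sq x <= b1 by move=> /vd; exact: hd.
rewrite -(mu_partial sc (- w) (lt_trans ha0 ha1) (lt_trans hb1 hb0) hw hs); apply: mean_eq => Z _; rewrite /kern.
congr (_ * _); have [CZ|CZ] := pselect (C Z); last by rewrite !ext0_out.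
rewrite !ext0_in//; have [h|h] := pselect (a1 <= usq G Z <= b1); first by rewrite plateau1// mul1r.
have -> : dv (G Z - y) (- w) = 0; last by rewrite mulr0.
pose A : set E := [set x | sq x < a1] `|` [set x | b1 < sq x].
have ci : continuous (fun x : E => sq x) by move=> x; apply: cont_ip; exact: cont_id.
have oA : open A.
  by apply: openU; [exact: (open_comp (fun x _ => ci x) (@open_lt R a1))|exact: (open_comp (fun x _ => ci x) (@open_gt R b1))].
have AZ : A (G Z).
  by move/negP: h; rewrite negb_and -!ltNge => /orP[h|h]; [left|right].
have s0 x : A x -> v (x - y) = 0.
  move=> Ax; apply/eqP; apply: contraT => /hs/andP[k1 k2]; case: Ax => /=; by rewrite ltNge ?k1 ?k2.
have e := eq_C1 oA (fun x Ax => esym (s0 x Ax)) (fun x u _ => erefl _) (@C1_cst R E R A 0).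
exact: (C1_unique (- w) (C1_subset (@subsetT _ A) hw) e AZ).
Qed.

Lemma phi_cst y p : a2 < sq y < b2 -> a2 < sq p < b2 -> phi y = phi p.
Proof.
apply: (shell_zero_deriv_cst a20 (C1_subset (@subsetT _ _) phi_C1)) => x w; exact: phi_deriv0.
Qed.

Lemma phi_mu p : a2 < sq p < b2 -> phi p = mu (ext0 C (fun Z => v (G Z - p))).
Proof.
move=> /andP[y1 y2]; have hy : a2 <= sq p <= b2 by rewrite !ltW.
apply: mean_eq => Z _; rewrite /kern; congr (_ * _).
have [CZ|CZ] := pselect (C Z); last by rewrite !ext0_out.
rewrite !ext0_in//; have [->|/vd h] := eqVneq (v (G Z - p)) 0; first by rewrite mulr0.
by rewrite plateau1 ?mul1r//; exact: (hd hy h).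
Qed.

Variables (M' : R) (w : E -> R) (e : R).
Hypotheses (d0 : 0 <= d) (M'0 : 0 <= M') (bM : b <= M' ^+ 2) (dM : d <= ((M - M') / 2) ^+ 2) (MM : M' < M).
Hypotheses (cw : continuous w) (ws : forall x, w x != 0 -> a2 < sq x < b2)
  (we : forall x y, sq (x - y) <= d -> `|w x - w y| <= e).

Lemma v_shift x : sq x < b -> I (fun y => v (x - y)) = I v.
Proof.
move=> hx; have hM' := MM; have hM : (M + M') / 2 < M by lra.
transitivity (I (fun y => v (y - x))); first by apply: mean_eq => y _; rewrite -ve opprB.
have nx : `|x| <= M' by apply: norm_le_ip => //; exact: ltW (lt_le_trans hx bM).
apply: (flat_shift M0 hv hM) => t /andP[t0 t1] y hy; apply/eqP; apply: contraT => /vd h.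
have h2 : `|y - t *: x| <= (M - M') / 2 by apply: norm_le_ip; [lra|exact: le_trans dM].
have h3 : `|t *: x| <= M' by rewrite normrZ ger0_norm// (le_trans _ nx)// ler_piMl.
have := ler_normD (y - t *: x) (t *: x); rewrite subrK; lra.
Qed.

(** Averaging [w y * v (G Z - y)] over [y] gives nearly [w (G Z)] times the mean of [v]; exchanging
    the two means gives [phi p] times the mean of [w]. *)
Lemma push_estimate p : a2 < sq p < b2 -> `|mu (ext0 C (fun Z => w (G Z))) * I v - phi p * I w| <= e * I v.
Proof.
move=> hp; have cv : continuous v by move=> x; exact: (C1_cont hv Logic.I).
have ck z : {for z, continuous (fun z : E * V => kern (fun x y => v (x - y)) z.1 z.2)} by apply: kern_cont; exact: sub_cont2.
have e1 : phi p * I w = mean (box n.+1) (fun Z => I (fun y => w y * kern (fun x y => v (x - y)) y Z)).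
  rewrite -(@mean_exchange R E V (grid n 2 M0) (box n.+1) (@grid_compact R n 2 M M0) (@box_compact n.+1)
    (fun y Z => w y * kern (fun x y => v (x - y)) y Z)); last first. move=> y Z _ _; apply: continuousM; last exact: ck.
    by apply: (@cont_comp _ _ _ (fun z : E * V => z.1) w (y, Z)); [exact: cvg_fst|exact: cw].
  rewrite -meanZ; last exact: grid_bdd. apply: mean_eq => y _; rewrite meanZ; last first.
    by apply: bdd_cont (@box_compact n.+1) _ => Z _; apply: kern_slice; exact: sub_cont2.
  have [->|/ws hy] := eqVneq (w y) 0; first by rewrite mul0r mulr0. by rewrite mulrC -/(phi y) (phi_cst hy hp).
have Iv0 : 0 <= I v by apply: mean_ge0 => //; exact: grid_bdd.
have wb : exists2 B : R, 0 < B & forall x, `|w x| <= B.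
  have hcw : forall x : E, [set x | `|x| <= M'] x -> {for x, continuous w} by move=> x _; exact: cw.
  have [B B0 hB] := compact_bdd (@compact_ball_mx R n 2 M') hcw.
  exists B => // x; have [->|/ws/andP[_ h]] := eqVneq (w x) 0; first by rewrite normr0 ltW.
  apply: hB; apply: norm_le_ip => //; apply: ltW; apply: (lt_le_trans h); apply: le_trans bM; exact: ltW (lt_trans hb2 (lt_trans hb1 hb0)).
have [B B0 hB] := wb.
have pw (Z : V) : `|ext0 C (fun Z => w (G Z)) Z * I v - I (fun y => w y * ext0 C (fun Z => plateau (usq G Z) * v (G Z - y)) Z)| <= e * I v.
  have e0 : 0 <= e by apply: le_trans (we (x := 0) (y := 0) _) => //; rewrite subrr ip0r.
  have [CZ|CZ] := pselect (C Z); last first.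
    rewrite ext0_out// mul0r sub0r normrN (@mean_eq _ _ _ _ (fun=> 0)) ?mean_cst ?normr0 ?mulr_ge0//.
    by move=> y _; rewrite ext0_out ?mulr0.
  have /andP[_ ub] := sc_range sc CZ; rewrite ext0_in//. have c1 : continuous (fun y : E => v (G Z - y)).
    move=> y; apply: (@cont_comp _ _ _ (fun y : E => G Z - y) v y); last exact: cv.
    by apply: continuousB; [exact: cont_cst|exact: cont_id].
  rewrite -(v_shift ub) -meanZ; last exact: grid_bdd.
  rewrite (@mean_eq _ _ _ (fun y => w y * _) (fun y : E => w y * v (G Z - y))); last first.
    move=> y _; rewrite ext0_in//; have [->|/ws /andP[y1 y2]] := eqVneq (w y) 0; first by rewrite !mul0r.
    have [->|/vd h] := eqVneq (v (G Z - y)) 0; first by rewrite mulr0.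
    by rewrite plateau1 ?mul1r//; apply: (@hd n _ y) => //; rewrite !ltW.
  have b1' : bdd (grid n 2 M0) (fun y : E => w (G Z) * v (G Z - y)) by apply: bddZ; exact: grid_bdd.
  have b2' : bdd (grid n 2 M0) (fun y : E => w y * v (G Z - y)) by apply: bddM; exact: grid_bdd.
  rewrite -meanB//; apply: (@le_trans _ _ (I (fun y : E => e * v (G Z - y)))); last first.
    by rewrite meanZ//; exact: grid_bdd.
  have bs := bddB b1' b2'; have be : bdd (grid n 2 M0) (fun y : E => e * v (G Z - y)) by apply: bddZ; exact: grid_bdd.
  have pt y : `|w (G Z) * v (G Z - y) - w y * v (G Z - y)| <= e * v (G Z - y).
    rewrite -mulrBl normrM [`|v _|]ger0_norm//; have [->|/vd h] := eqVneq (v (G Z - y)) 0; first by rewrite !mulr0.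
    by rewrite ler_wpM2r// we.
  rewrite ler_norml -meanN; last exact: be. apply/andP; split.
    by apply: (mean_le (bddN be) bs) => y _; have := pt y; rewrite ler_norml => /andP[].
  by apply: (mean_le bs be) => y _; have := pt y; rewrite ler_norml => /andP[].
have bN : bdd (box n.+1) (fun Z => rho (sq Z) * ext0 C (fun Z => w (G Z)) Z).
  exists B => Z _; rewrite normrM ger0_norm ?rho_ge0// -[leRHS]mul1r ler_pM ?rho_ge0 ?rho_le1//.
  have [CZ|CZ] := pselect (C Z); [by rewrite ext0_in|by rewrite ext0_out ?normr0 ?ltW].
have e2 : mu (ext0 C (fun Z => w (G Z))) * I v = mean (box n.+1) (fun Z => I v * (rho (sq Z) * ext0 C (fun Z => w (G Z)) Z)).
  by rewrite mulrC meanZ.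
have bN' : bdd (box n.+1) (fun Z => I v * (rho (sq Z) * ext0 C (fun Z => w (G Z)) Z)) by exact: bddZ.
have dZ Z : `|I v * (rho (sq Z) * ext0 C (fun Z => w (G Z)) Z) - I (fun y => w y * kern (fun x y => v (x - y)) y Z)| <= e * I v.
  have -> : I v * (rho (sq Z) * ext0 C (fun Z => w (G Z)) Z) - I (fun y => w y * kern (fun x y => v (x - y)) y Z) =
    rho (sq Z) * (ext0 C (fun Z => w (G Z)) Z * I v - I (fun y => w y * ext0 C (fun Z => plateau (usq G Z) * v (G Z - y)) Z)).
    rewrite mulrBr mulrC mulrA; congr (_ - _); rewrite -meanZ; first by apply: mean_eq => y _; rewrite /kern mulrCA.
    apply: bddM; first exact: grid_bdd.
    have [CZ|CZ] := pselect (C Z); last by exists 0 => y _; rewrite ext0_out// normr0.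
    have [k hk] : bdd (grid n 2 M0) (fun y : E => v (G Z - y)).
      apply: grid_bdd => y; apply: (@cont_comp _ _ _ (fun y : E => G Z - y) v y); last exact: cv.
      by apply: continuousB; [exact: cont_cst|exact: cont_id].
    by exists (`|plateau (usq G Z)| * k) => y hy; rewrite ext0_in// normrM ler_wpM2l// hk.
  by rewrite normrM ger0_norm ?rho_ge0// -[leRHS]mul1r ler_pM ?rho_ge0 ?rho_le1.
have bK : bdd (box n.+1) (fun Z => I (fun y => w y * kern (fun x y => v (x - y)) y Z)).
  have [c hc] := bN'; exists (c + e * I v) => Z hZ; have hd' := dZ Z.
  rewrite -[I (fun y => w y * _)](subKr (I v * (rho (sq Z) * ext0 C (fun Z => w (G Z)) Z))).
  by rewrite (le_trans (ler_normB _ _))// lerD// hc.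
rewrite e1 e2 -(meanB bN' bK); apply: mean_norm => Z _; exact: dZ.
Qed.

End PushForward.

(** * Comparison of symplectic coordinates *)

Section Transition.
Context {R : realType} (n : nat).
Local Notation V := 'M[R]_(n.+1, 2).
Local Notation E := 'M[R]_(n, 2).

Lemma ip_norm_le m (x : 'M[R]_(m, 2)) : sq x <= (2 * m)%:R * `|x| ^+ 2.
Proof.
have c i j : x i j * x i j <= `|x| ^+ 2.
  by rewrite -expr2 -real_normK ?num_real// lerXn2r ?nnegrE// coord_norm.
apply: (@le_trans _ _ (\sum_(k < m) (`|x| ^+ 2 + `|x| ^+ 2))); first by apply: ler_sum => k _; rewrite lerD.
by rewrite sumr_const card_ord -mulr2n -mulrnA -[leLHS]mulr_natl.
Qed.

Lemma norm2_le_ip m (x : 'M[R]_(m, 2)) : `|x| ^+ 2 <= sq x.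
Proof.
have h : `|x| <= Num.sqrt (sq x) by apply: norm_le_ip; rewrite ?sqrtr_ge0// sqr_sqrtr ?ip_ge0.
by rewrite -[leRHS]sqr_sqrtr ?ip_ge0// lerXn2r ?nnegrE ?sqrtr_ge0.
Qed.

Lemma near_ip m (p : 'M[R]_(m, 2)) (P : 'M[R]_(m, 2) -> Prop) : (\forall x \near p, P x) ->
  exists2 r : R, 0 < r & forall x, sq (x - p) <= r -> P x.
Proof.
move=> /nbhs_ballP[e /= e0 h]; exists ((e / 2) ^+ 2); first by rewrite exprn_gt0// divr_gt0.
move=> x hx; apply: h; rewrite -ball_normE /ball_ /= distrC (@le_lt_trans _ _ (e / 2))//.
  by apply: norm_le_ip => //; rewrite ltW// divr_gt0.
by rewrite ltr_pdivrMr// ltr_pMr// ltr1n.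
Qed.

Lemma linear_ip_bound m (L : 'M[R]_(m, 2) -> 'M[R]_(m, 2)) : linear L ->
  exists2 c : R, 0 < c & forall x, sq (L x) <= c * sq x.
Proof.
move=> lL; pose S : R := \sum_i \sum_j \sum_k \sum_l `|L (mxb k l) i j|.
have Lij i j x : `|L x i j| <= `|x| * \sum_k \sum_l `|L (mxb k l) i j|.
  by apply: (@lin_abs R m (fun x => L x i j)) => k u v; rewrite lL !mxE.
have S0 : 0 <= S by do 4 (apply: sumr_ge0 => ? _).
have LS x : `|L x| <= S * `|x|.
  apply: mx_norm_le => [|i j]; first by rewrite mulr_ge0. apply: (le_trans (Lij i j x)); rewrite mulrC ler_wpM2r//.
  rewrite /S [leRHS](bigD1 i)//= [X in X + _](bigD1 j)//= -addrA lerDl addr_ge0//; first by do 3 (apply: sumr_ge0 => ? _).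
  by do 4 (apply: sumr_ge0 => ? _).
exists ((2 * m)%:R * S ^+ 2 + 1); first by rewrite ltr_wpDl// mulr_ge0// sqr_ge0.
move=> x; apply: (le_trans (ip_norm_le _)).
have h : `|L x| ^+ 2 <= S ^+ 2 * `|x| ^+ 2 by rewrite -exprMn lerXn2r ?nnegrE ?mulr_ge0.
apply: (@le_trans _ _ ((2 * m)%:R * (S ^+ 2 * `|x| ^+ 2))); first by rewrite ler_wpM2l.
rewrite mulrA mulrDl mul1r -[leLHS]addr0 lerD ?ip_ge0// ler_wpM2l ?mulr_ge0 ?sqr_ge0//.
exact: norm2_le_ip.
Qed.

Lemma symp_coercive (A : E -> E) : linear A -> (forall u v, omega_st (A u) (A v) = omega_st u v) ->
  exists2 l : R, 0 < l & forall x, l * sq x <= sq (A x).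
Proof.
move=> lA sA; have [K lK AK] := linear_inj_inv lA (symp_inj sA).
have KA := linear_left_inverse lK lA AK.
have [c c0 hc] := linear_ip_bound lK; exists c^-1; first by rewrite invr_gt0.
by move=> x; rewrite mulrC ler_pdivrMr// mulrC -{1 2}(KA x).
Qed.

(** [H] is [G'] applied to a local lift of [G]. Both coordinates are constant on punctured complex
    lines, so the choice of lift within its fibre is immaterial. *)
Lemma transition (C C' : set V) (G G' : V -> E) (a b a' b' : R) (Z0 : V) :
  symp_coord C G a b -> symp_coord C' G' a' b' -> C Z0 -> C' Z0 ->
  exists (B : set E) (H : E -> E) (dH : E -> E -> E), [/\ open B, B (G Z0), C1 B H dH /\ H (G Z0) = G' Z0,
    forall Z, C Z -> B (G Z) -> C' Z /\ G' Z = H (G Z) &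
    forall u v, omega_st (dH (G Z0) u) (dH (G Z0) v) = omega_st u v].
Proof.
move=> sc sc' CZ CZ'; have [B [s [oB Bx [ds hs] sK]]] := sc_lift sc (sc_range sc CZ).
have sc_s : {for G Z0, continuous s} by exact: C1_cont hs Bx.
have rel Z : C Z -> B (G Z) -> exists x y, x ^+ 2 + y ^+ 2 != 0 /\ Z = cs x y (s (G Z)).
  move=> Cz Bz; have [Cs Gs] := sK _ Bz; exact: (sc_fibre sc Cs Cz Gs).
have C's : C' (s (G Z0)).
  have [Cs Gs] := sK _ Bx; have [x [y [xy e]]] := sc_fibre sc CZ Cs (esym Gs).
  by rewrite e; exact: (sc_cs sc' xy CZ').1.
pose B' := B `&` s @^-1` C'.
have oB' : open B'.
  rewrite openE => x [Bx' C'x]; have cx : {for x, continuous s} by exact: C1_cont hs Bx'.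
  apply: filterI; first exact: open_nbhs_nbhs. exact: (cx _ (open_nbhs_nbhs (conj (sc_open sc') C'x))).
have rel' Z : C Z -> B' (G Z) -> C' Z /\ G' Z = G' (s (G Z)).
  move=> Cz [Bz C'z]; have [x [y [xy e]]] := rel Z Cz Bz. by have [h1 h2] := sc_cs sc' xy C'z; rewrite {1 2}e.
have hs' : C1 B' s ds by exact: (C1_subset (fun x (h : B' x) => h.1) hs).
have hG := C1_comp (sc_open sc') hs' (sc_dG sc') (fun x (Bx : B' x) => Bx.2).
exists B', (fun x => G' (s x)), (fun x v => 'D_(ds x v) G' (s x)); split => //.
  by split=> //; have [] := rel' Z0 CZ (conj Bx C's).
move=> u v; have [Cs Gs] := sK _ Bx.
have h2 := C1_comp (sc_open sc) hs (sc_dG sc) (fun x Bx => (sK x Bx).1).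
have hid w : 'D_(ds (G Z0) w) G (s (G Z0)) = w.
  apply: (@C1_unique _ _ _ B (fun x => G (s x)) _ (fun _ v => v) (G Z0) w h2 _ Bx).
  by apply: (eq_C1 oB _ _ (@C1_id R E B)) => // x /sK[].
by rewrite (sc_symp sc')// -(sc_symp sc)// !hid.
Qed.

Lemma cut_lipschitz (u1 u2 : R) : u1 < u2 ->
  exists2 c : R, 0 < c & forall x y, `|cut u1 u2 x - cut u1 u2 y| <= c * `|x - y|.
Proof.
move=> u12; have [c c0 hc] := cut_bound u12; exists c => // x y.
have [t _ h] := C1_MVT (C1_cut u12) (x := y) (v := x - y) (fun t _ => Logic.I : setT (y + t *: (x - y))).
have yx : y + (x - y) = x by rewrite addrC subrK.
by rewrite yx in h; rewrite h normrM mulrC ler_wpM2r.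
Qed.

End Transition.

(** * Independence of the proportionality constant from the coordinates *)

Section Compare.
Context {R : realType} (n : nat) (M M' : R) (M0 : 0 < M) (M'0 : 0 <= M') (MM : M' < M) (n0 : (0 < n)%N).
Local Notation V := 'M[R]_(n.+1, 2).
Local Notation E := 'M[R]_(n, 2).
Local Notation I := (mean (grid n 2 M0)).

Lemma three_between (x y : R) : x < y -> exists a b c : R, [/\ x < a, a < b, b < c & c < y].
Proof. by move=> xy; exists ((3 * x + y) / 4), ((x + y) / 2), ((x + 3 * y) / 4); split; lra. Qed.

(** Chooses the intermediate radii for [push_estimate] and replaces [phi p] by the mean of
    [v (G Z - p)]: the constant of proportionality is read off from bumps concentrated at one
    point. *)
Lemma push_limit (C : set V) (G : V -> E) (a b s t : R) (w : E -> R) (p : E) (e : R) :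
  symp_coord C G a b -> 0 < s -> a < s -> t < b -> (forall x, w x != 0 -> s <= sq x <= t) -> continuous w ->
  Num.max a 0 < sq p < b -> b <= M' ^+ 2 -> 0 < e ->
  exists2 d : R, 0 < d & forall (v : E -> R) dv, C1 setT v dv -> (forall x, v (- x) = v x) -> (forall x, 0 <= v x) ->
    (forall x, v x != 0 -> sq x <= d) ->
    `|mu (ext0 C (fun Z => w (G Z))) * I v - mu (ext0 C (fun Z => v (G Z - p))) * I w| <= e * I v.
Proof.
move=> sc s0 sa tb ws cw /andP[p1 p2] bM e0.
pose L := Num.max a 0; have aL : a <= L /\ 0 <= L by rewrite !le_max !lexx orbT.
case: aL => aL L0.
pose lo := Num.min s (sq p); have [los lop] : lo <= s /\ lo <= sq p by rewrite !ge_min !lexx orbT.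
have Llo : L < lo by rewrite lt_min p1 andbT gt_max sa s0.
pose hi := Num.max t (sq p); have [hit hip] : t <= hi /\ sq p <= hi by rewrite !le_max !lexx orbT.
have hib : hi < b by rewrite gt_max tb p2.
have [a0 [a1 [a2 [k0 k0' k1' k2']]]] := three_between Llo.
have [b2 [b1 [b0 [l2 l1 l0 l0']]]] := three_between hib.
have k2 : L < a2 by lra.
have ha0 : a < a0 by exact: le_lt_trans k0.
have a20 : 0 <= a2 by apply: ltW; exact: le_lt_trans k2.
have a2b2 : a2 < b2 by lra.
have [d1 d10 hd1] := near_shell a20 k1' a2b2 l1.
have far (x : E) : 1 + t < `|x| -> w x = 0.
  move=> hx; apply/eqP; apply: contraLR hx => /ws/andP[h1 h2]; rewrite -leNgt.
  by apply: norm_le_ip; move: (sq x) h1 h2 => z h1 h2; nra.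
have [d2 d20 hd2] := near_ip (compact_uniform_cont e0 cw far).
have [d3 d3E] : exists d3, d3 = ((M - M') / 2) ^+ 2 by eexists.
have d30 : 0 < d3 by rewrite d3E exprn_gt0// divr_gt0// subr_gt0.
exists (Num.min d1 (Num.min d2 d3)); first by rewrite !lt_min d10 d20.
move=> v dv hv ve v0 vd.
set d := Num.min _ _ in vd.
have dd1 : d <= d1 by rewrite ge_min lexx.
have dd2 : d <= d2 by rewrite /d !ge_min lexx !orbT.
have dd3 : d <= d3 by rewrite /d !ge_min lexx !orbT.
have dpos : 0 <= d by rewrite ltW// !lt_min d10 d20.
clearbody d.
have hd m (x y : 'M[R]_(m, 2)) : a2 <= sq y <= b2 -> sq (x - y) <= d -> a1 <= sq x <= b1.
  by move=> hy hx; exact: (hd1 m x y hy (le_trans hx dd1)).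
have hp : a2 < sq p < b2 by apply/andP; split; [exact: lt_le_trans lop|exact: le_lt_trans l2].
have ws' x : w x != 0 -> a2 < sq x < b2.
  by move=> /ws/andP[h1 h2]; apply/andP; split; [exact: lt_le_trans (le_trans los h1)|exact: le_lt_trans (le_trans h2 hit) l2].
have we x y : sq (x - y) <= d -> `|w x - w y| <= e.
  move=> h; have := hd2 (x - y); rewrite subr0 => /(_ (le_trans h dd2) y). by rewrite [y + _]addrC subrK => /ltW.
have := push_estimate M0 sc ha0 k0' a20 l1 l0 l0' hv ve v0 vd hd dpos M'0 bM (_ : d <= ((M - M') / 2) ^+ 2) MM cw ws' we hp; rewrite -d3E => /(_ dd3).
by rewrite (phi_mu C G a0 l0 vd hd hp).
Qed.

Lemma ip_form : sym_form (@ip R n).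
Proof. by split=> [|x y]; [split=> x; [exact: ip_linr|exact: ip_linl]|exact: ipC]. Qed.

Lemma cut_scale4 (s : R) : 0 < s -> (forall x : E, sq x <= 4 * s -> `|x| <= M') ->
  4 ^+ n * I (fun x => cut (s / 2) s (sq x)) = I (fun x => cut (4 * (s / 2)) (4 * s) (sq x)).
Proof.
move=> s0 hs; have u12 : 4 * (s / 2) < 4 * s by lra.
have t1 : (1 : R) <= 4 by rewrite ler1n.
rewrite -(cutB_scale M0 u12 n0 ip_form (@ip_ge0 R n) MM hs t1); congr (_ * _).
by apply: mean_eq => x _; rewrite cutM.
Qed.

Lemma mu_dist m (f g h : 'M[R]_(m, 2) -> R) : mbdd f -> mbdd g -> mbdd h ->
  (forall Z, annulus Z -> `|f Z - g Z| <= h Z) -> `|mu f - mu g| <= mu h.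
Proof.
move=> bf bg bh H; rewrite ler_norml; apply/andP; split.
  rewrite lerBrDr addrC lerBlDr -muD//; apply: mu_le => // [|Z aZ]; first exact: mbddD.
  by have := H Z aZ; rewrite ler_norml => /andP[]; lra.
rewrite lerBlDr -muD//; apply: mu_le => // [|Z aZ]; first exact: mbddD.
by have := H Z aZ; rewrite ler_norml => /andP[]; lra.
Qed.

Lemma ext0_cut_mbdd m (P : set 'M[R]_(m, 2)) f (v1 v2 : R) : v1 < v2 -> mbdd (ext0 P (fun Z => cut v1 v2 (f Z))).
Proof.
move=> v12; exists 1 => Z _; have [PZ|PZ] := pselect (P Z); last by rewrite ext0_out// normr0 ler01.
by rewrite ext0_in// ger0_norm ?cut_ge0 ?cut_le1.
Qed.

(** [A] is the differential at [G2 Z0] of the transition map. The squared norms inside the two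
    cutoffs differ by a small relative error, which matters only for values at most [2 s]; there the
    cutoff of fourfold scale on the right is 1. *)
Lemma blowup (C1 C2 : set V) (G1 G2 : V -> E) (a1 b1 a2 b2 : R) (Z0 : V) :
  symp_coord C1 G1 a1 b1 -> symp_coord C2 G2 a2 b2 -> C1 Z0 -> C2 Z0 ->
  exists2 A : E -> E, linear A /\ (forall u v, omega_st (A u) (A v) = omega_st u v) &
  forall e : R, 0 < e -> exists2 s0 : R, 0 < s0 & forall s : R, 0 < s -> s <= s0 -> forall Z : V,
    `|ext0 C1 (fun Z => cut (s / 2) s (sq (G1 Z - G1 Z0))) Z -
      ext0 C2 (fun Z => cut (s / 2) s (sq (A (G2 Z - G2 Z0)))) Z| <=
    e * ext0 C2 (fun Z => cut (4 * (s / 2)) (4 * s) (sq (A (G2 Z - G2 Z0)))) Z.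
Proof.
move=> sc1 sc2 CZ1 CZ2.
set p1 := G1 Z0; set p2 := G2 Z0.
have [B1 [K [dK [oB1 Bp1 [hK Kp] r1 _]]]] := transition sc1 sc2 CZ1 CZ2.
have [B2 [H [dH [oB2 Bp2 [hH Hp] r2 sA]]]] := transition sc2 sc1 CZ2 CZ1.
pose A : E -> E := dH p2; have lA : linear A by exact: (C1_linear hH Bp2).
have sA' u v : omega_st (A u) (A v) = omega_st u v by exact: sA.
have Hp' : H p2 = p1 by exact: Hp.
have Kp' : K p1 = p2 by exact: Kp.
exists A => //; have [l l0 hl] := symp_coercive lA sA'.
have u12' : (1 / 2 : R) < 1 by lra.
have [Lc Lc0 hLc] := cut_lipschitz u12'.
(* A relative error [3 k] at values up to [2 s] changes the rescaled cutoff by at most [6 Lc k]. The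
   bound 1/4 keeps [1 - 2 k] at least 1/2, so that values beyond [2 s] stay beyond [s]. *)
move=> e e0; pose k := Num.min (1 / 4) (e / (6 * Lc)).
have k0 : 0 < k by rewrite lt_min !divr_gt0// mulr_gt0.
have k4 : k <= 1 / 4 by rewrite ge_min lexx.
have kL : 6 * Lc * k <= e.
  by rewrite mulrC -ler_pdivlMr ?mulr_gt0//; rewrite ge_min lexx orbT.
clearbody k.
have nn0 : 0 < (2 * n)%:R :> R by rewrite ltr0n muln_gt0.
(* A remainder of sup norm at most [sqrt q |x|] has squared Euclidean norm at most [k^2 |A x|^2]:
   [2 n] compares the norms and [l] is the coercivity constant of [A]. *)
pose q := k ^+ 2 * l / (2 * n)%:R; have q0 : 0 < q by rewrite divr_gt0// mulr_gt0// exprn_gt0.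
have sq0 : 0 < Num.sqrt q by rewrite sqrtr_gt0.
have hdiff : forall e, 0 < e -> \forall h \near (0 : E), `|H (h + p2) - H p2 - A h| <= e * `|h|.
  by have [/is_diffP[_ _ h] _] := hH p2 Bp2.
have [ra ra0 hra] : exists2 ra : R, 0 < ra & forall x, sq (x - p2) <= ra ->
    B2 x /\ `|H x - H p2 - A (x - p2)| <= Num.sqrt q * `|x - p2|.
  apply: near_ip; apply: filterI; first exact: open_nbhs_nbhs.
  have c : {for p2, continuous (fun x : E => x - p2)} by apply: continuousB; [exact: cont_id|exact: cont_cst].
  have h := hdiff _ sq0; rewrite -(subrr p2) in h.
  have hn : \forall x \near p2, `|H (x - p2 + p2) - H p2 - A (x - p2)| <= Num.sqrt q * `|x - p2| by exact: (c _ h).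
  by apply: filterS hn => x; rewrite subrK.
have est x : sq (x - p2) <= ra ->
    (1 - 2 * k) * sq (A (x - p2)) <= sq (H x - p1) <= sq (A (x - p2)) + 3 * k * sq (A (x - p2)).
  move=> /hra[_ hx]; set r := H x - H p2 - A (x - p2) in hx.
  have eX : H x - p1 = A (x - p2) + r by rewrite /r Hp' [RHS]addrC subrK. have hr : sq r <= k ^+ 2 * sq (A (x - p2)).
    apply: (le_trans (ip_norm_le _)); apply: (@le_trans _ _ ((2 * n)%:R * (q * `|x - p2| ^+ 2))).
      by rewrite ler_wpM2l// -{1}(sqr_sqrtr (ltW q0)) -exprMn lerXn2r ?nnegrE// mulr_ge0//; exact: ltW.
    apply: (@le_trans _ _ ((2 * n)%:R * (q * sq (x - p2)))).
      by rewrite ler_wpM2l// ler_wpM2l ?(ltW q0)// norm2_le_ip.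
    have -> : (2 * n)%:R * (q * sq (x - p2)) = k ^+ 2 * (l * sq (x - p2)).
      by rewrite /q; move: (ip _ _) (2 * n)%:R nn0 => i N hN; field; rewrite gt_eqF.
    by rewrite ler_wpM2l ?sqr_ge0.
  have aux (Y X i : R) : 0 <= Y -> 0 <= i -> i <= k ^+ 2 * Y -> (1 - k) * Y - i / k <= X <= (1 + k) * Y + (1 + k^-1) * i ->
      (1 - 2 * k) * Y <= X <= Y + 3 * k * Y.
    move=> Y0 i0 hi /andP[h1 h2]. have h3 : i / k <= k * Y by rewrite ler_pdivrMr// mulrAC -expr2.
    have h4 : (1 + k^-1) * i <= k ^+ 2 * Y + k * Y.
      by rewrite mulrDl mul1r [k^-1 * _]mulrC lerD.
    have h5 : k ^+ 2 * Y <= k * Y by rewrite ler_wpM2r// expr2 ler_piMl ?(ltW k0)//; lra. by apply/andP; split; lra.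
  apply: (aux _ _ _ (ip_ge0 _) (ip_ge0 r) hr); rewrite eX; exact: (ip_near (A (x - p2)) r k0).
have [rb rb0 hrb] : exists2 rb : R, 0 < rb & forall y, sq (y - p1) <= rb -> B1 y /\ sq (K y - p2) < ra.
  apply: near_ip; apply: filterI; first exact: open_nbhs_nbhs.
  have cK : {for p1, continuous K} by exact: (C1_cont hK Bp1). have c : {for p1, continuous (fun y => sq (K y - p2))}.
    by apply: cont_ip; apply: continuousB => //; exact: cont_cst.
  have h0 : sq (K p1 - p2) < ra by rewrite Kp' subrr ip0r. exact: (c _ (lt_nbhsl h0)).
exists (Num.min rb (l * ra)); first by rewrite lt_min rb0 mulr_gt0.
move=> s s0 hs Z; have [hs1 hs2] : s <= rb /\ s <= l * ra.
  by split; apply: (le_trans hs); rewrite ge_min lexx ?orbT.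
have lt4 : 4 * (s / 2) < 4 * s by lra.
have rhs0 : 0 <= e * ext0 C2 (fun Z => cut (4 * (s / 2)) (4 * s) (sq (A (G2 Z - p2)))) Z.
  rewrite mulr_ge0 ?(ltW e0)//; have [CZ|CZ] := pselect (C2 Z); [rewrite ext0_in//|by rewrite ext0_out]. exact: cut_ge0.
have aux (X Y : R) : 0 <= Y -> (1 - 2 * k) * Y <= X <= Y + 3 * k * Y -> 0 <= e * cut (4 * (s / 2)) (4 * s) Y ->
    `|cut (s / 2) s X - cut (s / 2) s Y| <= e * cut (4 * (s / 2)) (4 * s) Y.
  move=> Y0 /andP[h1 h2] h0. have XY : `|X - Y| <= 3 * k * Y by rewrite ler_norml; apply/andP; split; nra.
  have [Yb|Yb] := lerP Y (2 * s); last first.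
    have Xs : s <= X by nra. by rewrite !(@cut_right _ (s / 2) s) ?subrr ?normr0//; lra.
  have -> : cut (4 * (s / 2)) (4 * s) Y = 1 by apply: cut_left => //; lra. rewrite mulr1.
  have cE x : cut (s / 2) s x = cut (1 / 2) 1 (x / s).
    rewrite -(cutM (1 / 2) 1 (x / s) s0) mulr1 [s * (x / s)]mulrC divfK ?gt_eqF//. by congr (cut _ _ _); rewrite mul1r.
  rewrite !cE; apply: (le_trans (hLc _ _)); rewrite -mulrBl normrM [`|s^-1|]gtr0_norm ?invr_gt0// mulrA ler_pdivrMr//.
  apply: (@le_trans _ _ (Lc * (3 * k * Y))); first by rewrite ler_wpM2l ?(ltW Lc0).
  apply: (@le_trans _ _ (6 * Lc * k * s)); last by rewrite ler_wpM2r// ltW.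
  have -> : Lc * (3 * k * Y) = 3 * (Lc * k) * Y by ring. have -> : 6 * Lc * k * s = 3 * (Lc * k) * (2 * s) by ring.
  by rewrite ler_wpM2l// mulr_ge0// mulr_ge0// ltW.
have [[C2Z hZ]|h] := pselect (C2 Z /\ sq (G2 Z - p2) <= ra).
  have [B2Z _] := hra _ hZ; have [C1Z GZ] := r2 Z C2Z B2Z.
  move: rhs0; rewrite !ext0_in// GZ; exact: (aux _ _ (ip_ge0 _) (est _ hZ)).
have z2 : ext0 C2 (fun Z => cut (s / 2) s (sq (A (G2 Z - p2)))) Z = 0.
  have [C2Z|C2Z] := pselect (C2 Z); last by rewrite ext0_out.
  rewrite ext0_in//; apply: cut_right; rewrite leNgt; apply/negP => hY; apply: h; split=> //.
  by rewrite -(ler_pM2l l0); apply: (le_trans (hl _)); exact: ltW (lt_le_trans hY hs2).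
have z1 : ext0 C1 (fun Z => cut (s / 2) s (sq (G1 Z - p1))) Z = 0.
  have [C1Z|C1Z] := pselect (C1 Z); last by rewrite ext0_out.
  rewrite ext0_in//; apply: cut_right; rewrite leNgt; apply/negP => hX; apply: h.
  have [B1Z hK'] := hrb _ (ltW (lt_le_trans hX hs1)). by have [C2Z GZ] := r1 Z C1Z B1Z; split=> //; rewrite GZ ltW.
by rewrite z1 z2 subrr normr0.
Qed.

(* A symplectic change of coordinates preserves the constant of proportionality: compare both sides on shrinking bumps. *)
Lemma push_compare (C1 C2 : set V) (G1 G2 : V -> E) (a1 b1 a2 b2 s1 t1 s2 t2 : R) (w1 w2 : E -> R) (Z0 : V) :
  symp_coord C1 G1 a1 b1 -> symp_coord C2 G2 a2 b2 -> C1 Z0 -> C2 Z0 ->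
  0 < s1 -> a1 < s1 -> t1 < b1 -> (forall x, w1 x != 0 -> s1 <= sq x <= t1) -> continuous w1 ->
  0 < s2 -> a2 < s2 -> t2 < b2 -> (forall x, w2 x != 0 -> s2 <= sq x <= t2) -> continuous w2 ->
  0 < usq G1 Z0 -> 0 < usq G2 Z0 -> b1 <= M' ^+ 2 -> b2 <= M' ^+ 2 -> I w2 != 0 ->
  mu (ext0 C1 (fun Z => w1 (G1 Z))) * I w2 = mu (ext0 C2 (fun Z => w2 (G2 Z))) * I w1.
Proof.
move=> sc1 sc2 CZ1 CZ2 s10 as1 tb1 ws1 hw1 s20 as2 tb2 ws2 hw2 u10 u20 bM1 bM2 Iw2.
have [A [lA sA] key] := blowup sc1 sc2 CZ1 CZ2.
set p1 := G1 Z0 in key; set p2 := G2 Z0 in key.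
have hp1 : Num.max a1 0 < sq p1 < b1.
  by have /andP[h1 h2] := sc_range sc1 CZ1; rewrite gt_max h1 u10 h2.
have hp2 : Num.max a2 0 < sq p2 < b2.
  by have /andP[h1 h2] := sc_range sc2 CZ2; rewrite gt_max h1 u20 h2.
have [l l0 hl] := symp_coercive lA sA.
have M'p : 0 < M'.
  rewrite lt_neqAle eq_sym M'0 andbT; apply: contraTneq bM1 => ->; rewrite expr0n /= -ltNge.
  by case/andP: hp1 => _; apply: le_lt_trans; exact: ip_ge0.
(* [E1] and [E2] replace the bumps by multiples of flat means. The blow-up error in [E4] is measured
   by [f3], which [E3] bounds at the fourfold scale. *)
have fin (N1 N2 I1 I2 f1 f2 f3 J e k : R) : 0 < J -> 0 < e -> e <= 1 -> 0 <= k -> 0 <= f3 ->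
    `|N1 * J - f1 * I1| <= e * J -> `|N2 * J - f2 * I2| <= e * J -> `|N2 * (k * J) - f3 * I2| <= e * (k * J) -> `|f1 - f2| <= e * f3 ->
    `|N1 * I2 - N2 * I1| <= e * (`|I2| + (`|N2| + 1) * k * `|I1| + `|I1|).
  move=> J0 e0 e1 k0 f30 E1 E2 E3 E4; rewrite -(ler_pM2r J0). have h3 : f3 * `|I2| <= (`|N2| + 1) * (k * J).
    have := ler_normB (N2 * (k * J)) (N2 * (k * J) - f3 * I2); rewrite subKr normrM (ger0_norm f30) => h.
    apply: (le_trans h); rewrite normrM (ger0_norm (mulr_ge0 k0 (ltW J0))) mulrDl lerD//.
    by apply: (le_trans E3); rewrite ler_wpM2r// mulr_ge0// ltW.
  have eq : (N1 * I2 - N2 * I1) * J = (N1 * J - f1 * I1) * I2 + (f1 - f2) * I2 * I1 - (N2 * J - f2 * I2) * I1 by ring.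
  rewrite -[X in _ * X <= _](gtr0_norm J0) -normrM eq; apply: (le_trans (ler_normB _ _)).
  have -> : e * (`|I2| + (`|N2| + 1) * k * `|I1| + `|I1|) * J =
     e * J * `|I2| + e * ((`|N2| + 1) * (k * J)) * `|I1| + e * J * `|I1| by ring.
  apply: lerD; last by rewrite normrM ler_wpM2r.
  apply: (le_trans (ler_normD _ _)); apply: lerD; first by rewrite normrM ler_wpM2r.
  rewrite !normrM ler_wpM2r//; apply: (@le_trans _ _ (e * f3 * `|I2|)); first by rewrite ler_wpM2r.
  by rewrite -mulrA ler_wpM2l// ltW.
set N1 := mu _; set N2 := mu (ext0 C2 _).
pose Q := `|I w2| + (`|N2| + 1) * 4 ^+ n * `|I w1| + `|I w1|.
have main (e : R) : 0 < e -> e <= 1 -> `|N1 * I w2 - N2 * I w1| <= e * Q.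
  move=> e0 e1; have [d1 d10 hd1] := push_limit sc1 s10 as1 tb1 ws1 hw1 hp1 bM1 e0.
  have [d2 d20 hd2] := push_limit sc2 s20 as2 tb2 ws2 hw2 hp2 bM2 e0. have [d3 d30 hd3] := key e e0.
  pose l' := Num.min 1 l; have l'0 : 0 < l' by rewrite lt_min ltr01.
  pose m := Num.min (Num.min d1 d3) (Num.min (l * d2) (l' * M' ^+ 2)).
  have m0 : 0 < m by rewrite !lt_min d10 d30 !mulr_gt0// exprn_gt0.
  pose s := m / 4; have s0 : 0 < s by rewrite divr_gt0. have s4 : 4 * s = m by rewrite /s mulrC divfK.
  have [m1 m2] : m <= d1 /\ m <= d3 by split; rewrite /m !ge_min lexx ?orbT.
  have [m3 m4] : m <= l * d2 /\ m <= l' * M' ^+ 2 by split; rewrite /m !ge_min lexx ?orbT. clearbody m.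
  have lt1 : s / 2 < s by lra. have lt4 : 4 * (s / 2) < 4 * s by lra.
  have hs t x : 0 <= t <= 1 -> Bpath A t x x <= 4 * s -> `|x| <= M'.
    move=> /andP[t0 t1']; rewrite /Bpath s4 => h; apply: norm_le_ip => //.
    rewrite -(ler_pM2l l'0); apply: le_trans m4; apply: le_trans h.
    have i0 := ip_ge0 x; have h1 : l' * sq x <= sq x by rewrite ler_piMl// ge_min lexx.
    have h2 : l' * sq x <= sq (A x) by apply: le_trans (hl x); rewrite ler_wpM2r// ge_min lexx orbT.
    have -> : l' * sq x = (1 - t) * (l' * sq x) + t * (l' * sq x) by ring. by rewrite lerD// ler_wpM2l// subr_ge0.
  have hs' t x : 0 <= t <= 1 -> Bpath A t x x <= s -> `|x| <= M'.
    by move=> ht h; apply: (hs t) => //; apply: (le_trans h); lra.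
  have hs1 (x : E) : sq x <= 4 * s -> `|x| <= M'.
    by move=> h; apply: (hs 0); rewrite ?lexx ?ler01// /Bpath subr0 mul1r mul0r addr0.
  have s20' : 0 < s / 2 by rewrite divr_gt0. have i1 := symp_invariance M0 lA sA lt1 MM hs' s20'.
  have i2 := symp_invariance M0 lA sA lt4 MM hs (mulr_gt0 (ltr0n _ 4) s20'). pose v x := cut (s / 2) s (@ip R n x x).
  have Iv : 0 < I v.
    apply: (@grid_pos R n 2 M M0 _ 0) => [|x||]; [exact: (cutB_cont lt1 ip_form)|exact: cut_ge0| |by rewrite normr0].
    by rewrite /v ip0r cut_left ?ltr01// ltW.
  have fA : sym_form (fun x y => ip (A x) (A y)).
    split=> [|x y]; last exact: ipC. by split=> x k u v'; rewrite lA ?ip_linr ?ip_linl.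
  have sup (u1 u2 x : R) : u1 < u2 -> cut u1 u2 x != 0 -> x < u2.
    by move=> u12; rewrite ltNge; apply: contraNN => h; rewrite cut_right.
  have AN x : A (- x) = - A x by exact: vlinN. have ipN x : sq (- x) = sq x :> R.
    by rewrite ipNr ipNl opprK.
  have E1 : `|N1 * I v - mu (ext0 C1 (fun Z => v (G1 Z - p1))) * I w1| <= e * I v.
    apply: (hd1 v _ (cutB_C1 lt1 ip_form)) => x; [by rewrite /v ipN|exact: cut_ge0|].
    move=> /(sup _ _ _ lt1) h; apply: le_trans (ltW h) _; apply: le_trans m1; lra.
  have supA u x : u <= m -> sq (A x) < u -> sq x <= d2.
    by move=> hu h; rewrite -(ler_pM2l l0); apply: le_trans (hl x) (le_trans (ltW h) (le_trans hu m3)).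
  have E2 : `|N2 * I v - mu (ext0 C2 (fun Z => cut (s / 2) s (sq (A (G2 Z - p2))))) * I w2| <= e * I v.
    have := hd2 _ _ (cutB_C1 lt1 fA); rewrite i1; apply=> x; [by rewrite AN ipN|exact: cut_ge0|].
    by move=> /(sup _ _ _ lt1); apply: supA; lra.
  have E3 : `|N2 * (4 ^+ n * I v) - mu (ext0 C2 (fun Z => cut (4 * (s / 2)) (4 * s) (sq (A (G2 Z - p2))))) * I w2| <= e * (4 ^+ n * I v).
    rewrite (cut_scale4 s0 hs1) -i2. apply: (hd2 _ _ (cutB_C1 lt4 fA)) => x; [by rewrite AN ipN|exact: cut_ge0|].
    by move=> /(sup _ _ _ lt4); apply: supA; lra.
  have E4 : `|mu (ext0 C1 (fun Z => v (G1 Z - p1))) - mu (ext0 C2 (fun Z => cut (s / 2) s (sq (A (G2 Z - p2)))))| <=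
      e * mu (ext0 C2 (fun Z => cut (4 * (s / 2)) (4 * s) (sq (A (G2 Z - p2))))).
    rewrite -muZ; last exact: ext0_cut_mbdd.
    apply: mu_dist; [exact: ext0_cut_mbdd|exact: ext0_cut_mbdd|apply: mbddZ; exact: ext0_cut_mbdd|] => Z _.
    by apply: hd3 => //; apply: le_trans m2; lra.
  apply: (fin _ _ _ _ _ _ _ _ _ _ Iv e0 e1 _ _ E1 E2 E3 E4); first exact: exprn_ge0.
  apply: mean_ge0; first exact: (mu_bdd (ext0_cut_mbdd _ _ lt4)).
  move=> Z _; rewrite mulr_ge0 ?rho_ge0//; have [C2Z|C2Z] := pselect (C2 Z); last by rewrite ext0_out.
  by rewrite ext0_in// cut_ge0.
apply/eqP; rewrite -subr_eq0; apply/eqP; apply: (@le_small_eq0 _ _ Q 1) => // e e0 e1.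
by rewrite [leRHS]mulrC; exact: main.
Qed.

End Compare.

(** * Volume comparison *)

Section CoreBound.
Context {R : realType} (n : nat) (n2 : (2 <= n)%N).
Local Notation V := 'M[R]_(n.+1, 2).
Local Notation E := 'M[R]_(n, 2).
Local Notation Vp := (@Vp R n).
Local Notation C0 := [set Z : V | hN Z ord0 != 0].
Let n0 : (0 < n)%N. Proof. exact: ltnW. Qed.

(** Up to the factor [- n] it has the same mean as the cutoff, but it is supported in a shell and
    can thus be pulled back by coordinates defined on a shell only. *)
Definition wcut (u1 u2 : R) (x : E) : R := cut1 u1 u2 (sq x) * sq x.

Lemma wcut_cont u1 u2 : u1 < u2 -> continuous (wcut u1 u2).
Proof.
move=> u12 x; have hi : {for x, continuous (fun x : E => sq x)} by apply: cont_ip; exact: cont_id.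
have hc : {for x, continuous (fun x : E => cut1 u1 u2 (sq x))}.
  by apply: (@cont_comp _ _ _ (fun x : E => sq x)); [exact: hi|exact: cut1_cont].
exact: (continuousM hc hi).
Qed.

Lemma wcut_supp u1 u2 x : wcut u1 u2 x != 0 -> u1 <= sq x <= u2.
Proof. by rewrite mulf_eq0 negb_or => /andP[/cut1_supp]. Qed.

Section Weight.
Variables (M M' : R) (M0 : 0 < M) (MM : M' < M) (M'0 : 0 <= M').
Local Notation I := (mean (grid n 2 M0)).

Definition vol (u1 u2 : R) : R := I (fun x : E => cut u1 u2 (sq x)).
Lemma vol_gt0 u1 u2 : 0 < u1 -> u1 < u2 -> 0 < vol u1 u2.
Proof.
move=> u10 u12; apply: (@grid_pos R n 2 M M0 _ 0) => [|x||]; [exact: (cutB_cont u12 (@ip_form R n))|exact: cut_ge0| |by rewrite normr0].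
by rewrite ip0r cut_left ?ltr01// ltW.
Qed.

Lemma vol_supp u2 (x : E) : u2 <= M' ^+ 2 -> sq x <= u2 -> `|x| <= M'.
Proof. by move=> h1 h2; apply: norm_le_ip => //; exact: le_trans h1. Qed.

Lemma wcut_mean u1 u2 : u1 < u2 -> u2 <= M' ^+ 2 -> I (wcut u1 u2) = - (n%:R * vol u1 u2).
Proof.
move=> u12 hu; have b1 := grid_bdd M0 (cutB_cont u12 (@ip_form R n)); have b2 := grid_bdd M0 (wcut_cont u12).
have := cutB_euler M0 u12 (@ip_form R n) MM (fun x => @vol_supp u2 x hu).
rewrite meanD//; last exact: bddZ.
by rewrite meanZ// addrC => /eqP; rewrite addr_eq0 => /eqP.
Qed.

Lemma vol_scale (t s : R) : 0 < t < 1 -> 1 <= M' ^+ 2 -> 0 < s -> s <= M' ^+ 2 -> vol (t * s) s = s ^+ n * vol t 1.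
Proof.
move=> /andP[t0 t1] M1 s0 sM.
have key (u k : R) : 1 <= k -> 0 < u -> u <= M' ^+ 2 -> k ^+ n * vol (t * (u / k)) (u / k) = vol (t * u) u.
  move=> k1 u0 uM; have k0 : 0 < k by exact: lt_le_trans k1. have tu : t * u < u by rewrite gtr_pMl.
  apply: (etrans _ (cutB_scale M0 tu n0 (@ip_form R n) (@ip_ge0 R n) MM (fun x => @vol_supp u x uM) k1)).
  congr (_ * _); apply: mean_eq => x _; rewrite -(cutM _ _ _ k0). by congr (cut _ _ _); field; rewrite gt_eqF.
have [s1|s1] := lerP s 1.
  have h : 1 <= s^-1 by rewrite invr_ge1 ?unitfE ?gt_eqF ?posrE.
  have := key 1 s^-1 h ltr01 M1; rewrite invrK !mul1r mulr1 => <-.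
  by rewrite mulrA -exprMn divff ?gt_eqF// expr1n mul1r.
by rewrite -(key s s (ltW s1) s0 sM) divff ?gt_eqF// mulr1.
Qed.

End Weight.

Definition ballm (v1 v2 : R) : R := mu (ext0 C0 (fun Z => cut v1 v2 (usq g0 Z))).

Lemma ballm_wcut v1 v2 : 0 < v1 -> v1 < v2 -> v2 < 1 ->
  mu (ext0 C0 (fun Z => wcut v1 v2 (@g0 R n Z))) = - (n%:R * ballm v1 v2).
Proof.
move=> v10 v12 v21; have l0 : (-1 / 2 : R) < -1 / 4 by lra.
(* The first factor is 1 for [u >= 0], where all values of [usq g0] lie; it gives [f] compact
   support in the coordinate range from -1 to 1. *)
pose f u := (1 - cut (-1 / 2) (-1 / 4) u) * cut v1 v2 u.
pose f1 u := - cut1 (-1 / 2) (-1 / 4) u * cut v1 v2 u + (1 - cut (-1 / 2) (-1 / 4) u) * cut1 v1 v2 u.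
have hf : C1 setT f (fun u v => v * f1 u).
  apply: (C1_ext (C1_mul (C1_sub (@C1_cst R R R setT 1) (C1_cut l0)) (C1_cut v12))) => // u v. by rewrite /f1; ring.
have fs u : -1 < u < 1 -> f u != 0 -> -1 / 2 <= u <= v2.
  move=> _ h; apply/andP; split; rewrite leNgt; apply/negP => hu; move/eqP: h; apply; rewrite /f.
    by rewrite cut_left ?subrr ?mul0r// ltW.
  by rewrite [cut v1 v2 u]cut_right ?mulr0// ltW.
have s1 : -1 < (-1 / 2 : R) by lra.
have := radial_stokes (ball_symp_coord n) s1 v21 hf fs.
have bw : mbdd (ext0 C0 (fun Z => wcut v1 v2 (@g0 R n Z))).
  have [c c0 hc] := cut_bound v12; exists c => Z _; have [CZ|CZ] := pselect (C0 Z); last by rewrite ext0_out// normr0 ltW.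
  have /andP[_ h] := usq_g0_lt CZ; rewrite ext0_in// /wcut normrM -[leRHS]mulr1 ler_pM// ger0_norm ?ip_ge0//; exact: ltW.
rewrite (@mu_eq _ _ _ (fun Z => ext0 C0 (fun Z => wcut v1 v2 (g0 Z)) Z + n%:R * ext0 C0 (fun Z => cut v1 v2 (usq g0 Z)) Z)).
  rewrite muD//; last by apply: mbddZ; exact: ext0_cut_mbdd. rewrite muZ; last exact: ext0_cut_mbdd.
  by move=> /eqP; rewrite addr_eq0 => /eqP.
move=> Z _; have [CZ|CZ] := pselect (C0 Z); last by rewrite !(ext0_out _ CZ) mulr0 addr0.
have u0 : 0 <= usq g0 Z by exact: ip_ge0.
have c1 : cut1 (-1 / 2) (-1 / 4) (usq g0 Z) = 0.
  by apply/eqP; apply: contraT => /cut1_supp/andP[_]; lra.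
have c2 : cut (-1 / 2) (-1 / 4) (usq g0 Z) = 0 by apply: cut_right; lra.
by rewrite !(ext0_in _ CZ) /f /f1 c1 c2 oppr0 mul0r add0r addr0 !mul1r.
Qed.

Lemma ballm_le v1 v2 w1 w2 : v1 < v2 -> v2 <= w1 -> w1 < w2 -> ballm v1 v2 <= ballm w1 w2.
Proof.
move=> v12 vw w12; apply: mu_le => [||Z _]; [exact: ext0_cut_mbdd|exact: ext0_cut_mbdd|].
have [CZ|CZ] := pselect (C0 Z); last by rewrite !(ext0_out _ CZ).
rewrite !(ext0_in _ CZ); have [h|h] := lerP (usq g0 Z) w1; first by rewrite [leRHS]cut_left ?cut_le1.
by rewrite cut_right ?cut_ge0//; apply: ltW; exact: le_lt_trans h.
Qed.

Lemma ballm_gt0 : 0 < ballm (1 / 4) (1 / 2).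
Proof.
have l : (1 / 4 : R) < 1 / 2 by lra.
have sm : -1 < (-1 / 2 : R) by lra.
have s1 : (1 / 2 : R) < 1 by lra.
have hC : isC1 [set Z : V | Z != 0] (ext0 C0 (fun Z => cut (1 / 4) (1 / 2) (usq g0 Z))).
  apply: (sc_ext_isC1 (ball_symp_coord n) sm s1) => [|Z CZ h].
    by apply: isC1_comp1; [exact: (isC1_usq (ball_symp_coord n))|eexists; exact: C1_cut].
  apply/andP; split; first by apply: (@le_trans _ _ 0); [lra|exact: ip_ge0].
  by rewrite leNgt; apply: contraNN h => h; rewrite cut_right// ltW.
pose r := Num.sqrt (1 / 3 : R); have r2 : r ^+ 2 = 1 / 3 by rewrite sqr_sqrtr.
pose Z1 : V := r *: ex ord0.
have d0 : del0 Z1 = 0 by apply/matrixP => i j; rewrite !mxE [lift _ _ == _]eq_sym (negbTE (neq_lift _ _)) /= mulr0.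
have i1 : sq Z1 = 1 / 3.
  by rewrite /Z1 ipZr ipZl ip_ex mxE !eqxx mulr1 -expr2.
have h1 : C0 Z1.
  by have := ip_hN Z1; rewrite d0 ip0r addr0 i1 /= => <-; rewrite mulf_neq0// invr_neq0.
apply: (@mu_pos _ _ _ Z1) => [|Z _|Z z0||]; [exact: ext0_cut_mbdd| |exact: (isC1_cont hC z0)|exact: i1|].
  by have [CZ|CZ] := pselect (C0 Z); [rewrite ext0_in// cut_ge0|rewrite ext0_out].
by rewrite (ext0_in _ h1) usq_g0// d0 ip0r mul0r cut_left// divr_ge0.
Qed.

(** What the ball misses satisfies [|Z_0|^2 <= 1 - v1], a slab in one complex coordinate, of mass of
    order [1 - v1]. *)
Lemma one_le_ballm : exists2 c : R, 0 < c & forall v1 v2, 0 < v1 -> v1 < v2 -> v2 < 1 ->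
  mu (fun _ : V => 1 : R) <= ballm v1 v2 + c * (1 - v1).
Proof.
have [c c0 hc] := grid_slab (pred1 (@ord0 n)) (@two_gt0 R).
exists (c ^+ 2); first by rewrite exprn_gt0.
move=> v1 v2 v10 v12 v21; pose e := 1 - v1; have e0 : 0 < e by rewrite /e; lra.
have s0 : 0 < Num.sqrt e by rewrite sqrtr_gt0.
have s1 : Num.sqrt e <= 1 by rewrite -sqrtr1 ler_wsqrtr// /e; lra.
have := hc (Num.sqrt e) (fun Z : V => hN Z ord0 <= e) s0; rewrite card1 muln1 exprMn sqr_sqrtr ?(ltW e0)// => hs.
have {}hs : mean (box n.+1) (fun Z : V => (hN Z ord0 <= e)%R%:R) <= c ^+ 2 * e.
  apply: hs => [|Z hZ i j /eqP ->]; first lra.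
  rewrite -ler_sqr ?nnegrE// sqr_sqrtr ?(ltW e0)// real_normK ?num_real//; apply: le_trans hZ.
  by case: (ord2P j) => ->; rewrite (lerDl, lerDr) sqr_ge0.
pose q (Z : V) : R := (hN Z ord0 <= e)%R%:R.
have bq : mbdd q by exists 1 => Z _; rewrite normr_nat lern1 leq_b1.
apply: (@le_trans _ _ (ballm v1 v2 + mu q)); last first.
  rewrite lerD2l; apply: le_trans hs; apply: mean_le => [||Z _]; [exact: mu_bdd|by exists 1 => Z _; rewrite normr_nat lern1 leq_b1|].
  by rewrite ler_piMl ?rho_le1// ler0n.
rewrite /ballm -muD//; last exact: ext0_cut_mbdd.
apply: mu_le => [||Z aZ]; [exact: mbdd_cst|apply: mbddD => //; exact: ext0_cut_mbdd|].
have /andP[_ z1] := aZ; have z0 := ip_gt0 (annulus_neq0 aZ).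
rewrite /q; have [h|h] := lerP (hN Z ord0) e.
  by rewrite lerDr; have [CZ|CZ] := pselect (C0 Z); [rewrite ext0_in// cut_ge0|rewrite ext0_out].
have CZ : C0 Z by rewrite /= gt_eqF// (lt_trans e0).
rewrite addr0 (ext0_in _ CZ) cut_left// usq_g0// ler_pdivrMr//.
have := ip_hN Z; move: h; rewrite /e; nra.
Qed.

Variables (C : set V) (G : V -> E) (a b d : R) (Zs : V).
Hypothesis sc : symp_coord C G a b.
Hypotheses (a0 : 0 <= a) (d01 : 0 < d < 1) (CZs : C Zs) (C0Zs : C0 Zs).
Let kap : R := (1 - d) ^+ 2.
Hypothesis Ckap : forall Z, C Z -> kap * sq Z < sq (del0 Z).

Let kap0 : 0 < kap. Proof. by case/andP: d01 => h1 h2; rewrite exprn_gt0// subr_gt0. Qed.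
Let kap1 : kap < 1. Proof. by case/andP: d01 => h1 h2; rewrite expr_lt1// ?subr_ge0 ?(ltW h2)// ltrBlDr ltrDl. Qed.

Let CVp : C `<=` Vp.
Proof.
move=> Z CZ; apply: contraTneq (Ckap CZ) => ->; rewrite ip0r -leNgt.
by rewrite mulr_ge0 ?ip_ge0// ltW.
Qed.

(** The two cutoffs differ by a function supported in a closed subshell, which extends by 0. This
    extension and the difference of the potentials have the same derivative and the same value at
    [Zs]. *)
Lemma Phi_indep u1 u2 v1 v2 Z : a < u1 -> u1 < u2 -> u2 < b -> a < v1 -> v1 < v2 -> v2 < b -> Vp Z -> ~ C Z ->
  Phi C G u1 u2 Zs Z = Phi C G v1 v2 Zs Z.
Proof.
move=> au1 u12 u2b av1 v12 v2b VZ CZ.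
pose F Z := hcut G u1 u2 Z - hcut G v1 v2 Z.
have as1 : a < Num.min u1 v1 by rewrite lt_min au1.
have tb : Num.max u2 v2 < b by rewrite gt_max u2b.
have F1 := C1_sub (hcut_C1 sc u12) (hcut_C1 sc v12).
have FS Y : C Y -> F Y != 0 -> Num.min u1 v1 <= usq G Y <= Num.max u2 v2.
  move=> _ h; apply/andP; split; rewrite leNgt; apply: contraNN h.
    by rewrite lt_min => /andP[h1 h2]; rewrite /F /hcut !cut_left ?subrr// ltW.
  by rewrite gt_max => /andP[h1 h2]; rewrite /F /hcut !cut_right ?subrr// ltW.
have hE := sc_ext_isC1 sc as1 tb (ex_intro _ _ F1) FS.
have VA : Vp `<=` [set Z | Z != 0] by move=> Y; exact: Vp_neq0.
have oA : open [set Z : V | Z != 0] by exact: open_neq0.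
have h1 := C1_sub (Phi_C1 sc au1 u12 u2b Zs) (Phi_C1 sc av1 v12 v2b Zs).
have h2 := C1_sub h1 (C1_subset VA (isC1_D oA hE)).
have e : Phi C G u1 u2 Zs Z - Phi C G v1 v2 Zs Z - ext0 C F Z = Phi C G u1 u2 Zs Zs - Phi C G v1 v2 Zs Zs - ext0 C F Zs.
  apply: (zero_deriv_cst del_linear _ h2) => // [Y|Y v VY|]; [exact: del_J| |exact: CVp]. have [CY|CY] := pselect (C Y).
    have e1 : 'D_v (ext0 C F) Y = dcut G u1 u2 Y v - dcut G v1 v2 Y v.
      exact: (etrans (ext0_D_in _ _ (sc_open sc) CY) (D_of_C1 v F1 CY)).
    by rewrite e1 (eta_in _ _ _ _ CY) (eta_in _ _ _ _ CY) subrr.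
  by rewrite (sc_ext_D_out sc v as1 tb FS (Vp_neq0 VY) CY) (eta_out _ _ _ _ CY) (eta_out _ _ _ _ CY) !subr0.
move: e; rewrite (ext0_out _ CZ) (ext0_in _ CZs) (Phi_in sc au1 u12 u2b a0 CVp CZs CZs) (Phi_in sc av1 v12 v2b a0 CVp CZs CZs).
by rewrite /F subrr subr0 => /eqP; rewrite subr_eq0 => /eqP.
Qed.

(** [mean_Phi] and [ballm_wcut] express both masses through [wcut], [push_compare] reduces these to
    flat means, and [vol_scale] evaluates the latter as powers of [s] and [v]. *)
Lemma Phi_ballm (t s v : R) : 0 < t < 1 -> a < t * s -> s < b -> 0 < v < 1 ->
  mu (ext0 Vp (Phi C G (t * s) s Zs)) * v ^+ n = ballm (t * v) v * s ^+ n.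
Proof.
move=> /[dup] ht /andP[t0 t1] ats sb /andP[v0 v1].
have ts0 : 0 < t * s by exact: le_lt_trans ats.
have s0 : 0 < s by rewrite -(pmulr_rgt0 _ t0).
have tss : t * s < s by rewrite gtr_pMl.
have tvv : t * v < v by rewrite gtr_pMl.
have tv0 : 0 < t * v by rewrite mulr_gt0.
pose M' := 1 + `|b|; have M'0 : 0 <= M' by rewrite addr_ge0.
have MM : M' < M' + 1 by rewrite ltrDl.
have M0 : 0 < M' + 1 by exact: le_lt_trans MM.
have M1 : 1 <= M' ^+ 2 by rewrite exprn_ege1// lerDl.
have bM : b <= M' ^+ 2.
  by rewrite (le_trans (ler_norm b))// /M' expr2; have := normr_ge0 b; nra.
have sM : s <= M' ^+ 2 by exact: ltW (lt_le_trans sb bM).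
have vM : v <= M' ^+ 2 by exact: ltW (lt_le_trans v1 M1).
have nz : (n%:R : R) != 0 by rewrite pnatr_eq0 -lt0n.
have vt0 := vol_gt0 M0 t0 t1.
have Iw : mean (grid n 2 M0) (wcut (t * v) v) != 0.
  by rewrite (wcut_mean M0 MM M'0 tvv vM) oppr_eq0 mulf_neq0// gt_eqF// vol_gt0.
have usG : 0 < usq G Zs by have /andP[h _] := sc_range sc CZs; exact: le_lt_trans h.
have us0 : 0 < usq g0 Zs.
  by rewrite usq_g0// divr_gt0//; [exact: ip_gt0 (CVp CZs)|exact: ip_gt0 (sc_neq0 sc CZs)].
have av : -1 < t * v by lra.
have := push_compare M'0 MM n0 sc (ball_symp_coord n) CZs C0Zs ts0 ats sb (@wcut_supp (t * s) s) (wcut_cont tss)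
  tv0 av v1 (@wcut_supp (t * v) v) (wcut_cont tvv) usG us0 bM M1 Iw.
rewrite ballm_wcut// !(wcut_mean M0 MM M'0)//.
have -> : mu (ext0 C (fun Z => wcut (t * s) s (G Z))) = - (n%:R * mu (ext0 Vp (Phi C G (t * s) s Zs))).
  rewrite (mean_Phi sc ats tss sb a0 CVp CZs (ltW kap0) kap1 n2) opprK; apply: mu_eq => Z _.
  by have [CZ|CZ] := pselect (C Z); [rewrite (ell_in _ _ _ CZ) ext0_in|rewrite (ell_out _ _ _ CZ) ext0_out].
rewrite (vol_scale M0 MM M'0 ht M1 v0 vM) (vol_scale M0 MM M'0 ht M1 s0 sM) !mulrNN.
have aux (P B x y k N : R) : N != 0 -> k != 0 -> N * P * (N * (x * k)) = N * B * (N * (y * k)) -> P * x = B * y.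
  move=> hN hk h; apply: (mulfI (mulf_neq0 (mulf_neq0 hN hN) hk)).
  by rewrite -[LHS](_ : N * P * (N * (x * k)) = _); [rewrite h; ring|ring].
by apply: aux => //; rewrite gt_eqF.
Qed.

Lemma ext0_Phi_mbdd u1 u2 : a < u1 -> u1 < u2 -> u2 < b -> mbdd (ext0 Vp (Phi C G u1 u2 Zs)).
Proof. by move=> au u12 ub; exact: (Phi_mbdd sc au u12 ub a0 CVp CZs). Qed.

Lemma ext0_Phi_range u1 u2 Z : a < u1 -> u1 < u2 -> u2 < b -> 0 <= ext0 Vp (Phi C G u1 u2 Zs) Z <= 1.
Proof.
move=> au u12 ub; have [VZ|VZ] := pselect (Vp Z); last by rewrite ext0_out// lexx ler01.
by rewrite ext0_in//; exact: (Phi_ge0 sc au u12 ub a0 CVp CZs VZ).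
Qed.

Lemma cut_core v1 v2 Z : v1 < v2 -> C0 Z -> v2 <= kap -> cut v1 v2 (usq g0 Z) != 0 ->
  sq (del0 Z) <= kap * sq Z /\ ~ C Z.
Proof.
move=> v12 CZ vk h; have Z0 : Z != 0 by apply: contraNneq CZ => ->; rewrite /hN !mxE expr0n addr0.
have hk : sq (del0 Z) <= kap * sq Z.
  rewrite -ler_pdivrMr ?ip_gt0// -usq_g0// (le_trans _ vk)// leNgt; apply: contraNN h => h. by rewrite cut_right// ltW.
by split=> // /Ckap; rewrite ltNge hk.
Qed.

Lemma core_bound s : a < kap * s -> s < b -> 0 < s -> s ^+ n + kap ^+ n <= 1.
Proof.
move=> aks sb s0; rewrite leNgt; apply/negP => hs.
have [c c0 hc] := one_le_ballm; pose m := ballm (1 / 4) (1 / 2); have m0 : 0 < m := ballm_gt0.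
have as0 : a < s by apply: (lt_trans aks); rewrite gtr_pMl.
(* The excess to be contradicted: of the two volumes together if [s <= 1], of the bounded region
   alone otherwise. *)
pose g := if s <= 1 then s ^+ n + kap ^+ n - 1 else s ^+ n - 1.
have g0' : 0 < g.
  by rewrite /g; case: (lerP s 1) => h; rewrite subr_gt0// exprn_egt1// -lt0n.
(* The squared radius of an inner sphere on which [f] is still defined but which is smaller than
   [kap * s]. For [s <= 1] it encloses less volume than the removed ball. *)
pose s2 := (a + kap * s) / 2; have s2ks : s2 < kap * s by rewrite /s2; lra.
have as2 : s <= 1 -> a < s2 /\ s2 < kap.
  move=> h; have : kap * s <= kap by rewrite ler_piMr// ltW. rewrite /s2; split; lra.
(* [t] measures the sharpness of all cutoffs. [t >= 3/4] gives [t * t >= 1/2] and hence [m <= B];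
   the last condition makes the smoothing error smaller than [m * g]. *)
have [t [t0 t1]] : exists t : R, [/\ 0 < t < 1, 3 / 4 <= t, a < t * s, s <= 1 -> a < t * s2 & 2 * c * (1 - t) < m * g].
  have up (x : R) : a < x -> exists2 y, 0 < y < 1 & forall t, y < t -> a < t * x.
    move=> ax; have x0 : 0 < x by exact: le_lt_trans ax. exists ((a + x) / (2 * x)); last first.
      move=> t; rewrite ltr_pdivrMr ?mulr_gt0//; lra.
    have a0' := a0; have x2 : 0 < 2 * x by rewrite mulr_gt0. by rewrite divr_gt0 ?ltr_pdivrMr//=; lra.
  have [y1 /andP[y10 y11] hy1] := up s as0.
  have [y2 /andP[y20 y21] hy2] : exists2 y, 0 < y < 1 & forall t, y < t -> s <= 1 -> a < t * s2.
    have [s1|s1] := lerP s 1; last by exists (1 / 2); [lra|].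
    by have [h _] := as2 s1; have [y hy h'] := up _ h; exists y => // t ht _; exact: h'.
  pose y3 := Num.max 0 (1 - m * g / (4 * c)).
  have y31 : y3 < 1 by rewrite gt_max ltr01 ltrBlDr ltrDl divr_gt0// mulr_gt0.
  have y3c : 1 - m * g / (4 * c) <= y3 by rewrite /y3 le_max lexx orbT. clearbody y3.
  pose y := Num.max (3 / 4) (Num.max y1 (Num.max y2 y3)). have yy : y < 1 by rewrite !gt_max y11 y21 y31 !andbT; lra.
  have [q1 q2 q3 q4] : [/\ 3 / 4 <= y, y1 <= y, y2 <= y & y3 <= y] by rewrite /y !le_max !lexx !orbT.
  exists ((y + 1) / 2); split; [apply/andP; split; lra|lra|apply: hy1; lra|move=> s1; apply: hy2 => //; lra|].
  move: y3c; have e : 4 * c * (m * g / (4 * c)) = m * g by field; rewrite gt_eqF.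
  move=> h; have h2 : 1 - (y + 1) / 2 <= (m * g / (4 * c)) / 2 by lra. have mg : 0 < m * g by rewrite mulr_gt0.
  move: e h2; move: (m * g / (4 * c)) => z e h2; nra.
move=> ats ats2 hm; have t01 := t0; case/andP: t0 => t0 t1'.
have ht1 : 0 < t < 1 by [].
have tss : t * s < s by rewrite gtr_pMl.
have ttt : t * t < t by rewrite gtr_pMl.
have tn1 : t ^+ n <= 1 by rewrite exprn_ile1// ltW.
pose P := mu (ext0 Vp (Phi C G (t * s) s Zs)); pose B := ballm (t * t) t.
have PB : P * t ^+ n = B * s ^+ n by exact: Phi_ballm.
have tn0 : 0 < t ^+ n by rewrite exprn_gt0.
have sn0 : 0 < s ^+ n by rewrite exprn_gt0.
have mB : m <= B by apply: ballm_le => //; [lra|nra].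
have one : mu (fun _ : V => 1 : R) <= B + c * (1 - t * t) by apply: hc => //; rewrite mulr_gt0.
have ctt : c * (1 - t * t) < m * g.
  apply: le_lt_trans hm; have -> : 2 * c * (1 - t) = c * (2 * (1 - t)) by ring. by rewrite ler_wpM2l ?(ltW c0)//; nra.
have fin x : x = 0 \/ x = kap ^+ n -> g = s ^+ n + x - 1 -> P + B * x / t ^+ n <= mu (fun _ : V => 1 : R) -> False.
  move=> hx hg h; have B0 : 0 < B by exact: lt_le_trans mB.
  have P' : P = B * s ^+ n / t ^+ n by rewrite -PB mulfK// gt_eqF.
  have h3 : B * (s ^+ n + x) / t ^+ n <= B + c * (1 - t * t).
    by rewrite mulrDr mulrDl -P'; exact: le_trans h one.
  have h4 : B * (s ^+ n + x) <= B * (s ^+ n + x) / t ^+ n.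
    rewrite ler_peMr ?invr_ge1 ?unitfE ?gt_eqF ?posrE// mulr_ge0 ?(ltW B0)// addr_ge0 ?(ltW sn0)//.
    by case: hx => ->//; rewrite exprn_ge0// ltW.
  have : m * g <= B * g by rewrite ler_wpM2r// ltW. rewrite hg; nra.
have b1 := ext0_Phi_mbdd ats tss sb.
have cst1 : mbdd (fun _ : V => 1 : R) by exact: mbdd_cst.
have [s1|s1] := lerP s 1; last first.
  apply: (fin 0); [by left|by rewrite /g leNgt s1 addr0|]. rewrite mulr0 mul0r addr0; apply: mu_le => // Z _.
  by case/andP: (ext0_Phi_range Z ats tss sb).
have tkk : t * kap < kap by rewrite gtr_pMl.
have bk : ballm (t * kap) kap * t ^+ n = B * kap ^+ n.
  have h1 := Phi_ballm ht1 ats sb (_ : 0 < kap < 1); rewrite kap0 kap1 in h1; have {}h1 := h1 isT.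
  apply: (mulIf (lt0r_neq0 sn0)); rewrite mulrAC -h1 mulrAC PB; ring.
have [z|z] := pselect (Psi0 C G (t * s) s Zs = 0).
  apply: (fin (kap ^+ n)); [by right|by rewrite /g s1|].
  rewrite -bk mulfK ?gt_eqF// /ballm -muD//; last exact: ext0_cut_mbdd.
  apply: mu_le => // [|Z _]; first by apply: mbddD => //; exact: ext0_cut_mbdd.
  have /andP[p0 p1] := ext0_Phi_range Z ats tss sb.
  have [CZ|CZ] := pselect (C0 Z); last by rewrite [X in _ + X]ext0_out ?addr0.
  rewrite [X in _ + X]ext0_in//; have [->|h] := eqVneq (cut (t * kap) kap (usq g0 Z)) 0; first by rewrite addr0.
  have [hk _] := cut_core tkk CZ (lexx _) h. have -> : ext0 Vp (Phi C G (t * s) s Zs) Z = 0.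
    have [VZ|VZ] := pselect (Vp Z); last by rewrite ext0_out.
    by rewrite ext0_in// (Phi_core sc ats tss sb Zs (ltW kap0) Ckap kap1 VZ hk).
  by rewrite add0r cut_le1.
have [as2' s2k] := as2 s1; have ats2' := ats2 s1.
have s20 : 0 < s2 by exact: le_lt_trans as2'.
have ts2 : t * s2 < s2 by rewrite gtr_pMl.
have s2b : s2 < b by apply: (lt_trans s2ks); apply: lt_trans sb; rewrite gtr_pMl.
have PB2 := Phi_ballm ht1 ats2' s2b (_ : 0 < t < 1); have {}PB2 := PB2 ht1.
have lt_n : s2 ^+ n < kap ^+ n by rewrite ltrXn2r ?nnegrE ?(ltW s20) ?(ltW kap0)// -lt0n.
(* [Phi] is only known on [Vp], which lacks the line over the centre of the ball. A ball of squared
   radius [x] covers this line, and [x ^+ n] is at most half of the gap [kap ^+ n - s2 ^+ n]. *)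
pose x := Num.min (kap / 2) ((kap ^+ n - s2 ^+ n) / 2).
have x0 : 0 < x by rewrite lt_min !divr_gt0// subr_gt0.
have xk : x < kap by rewrite gt_min; apply/orP; left; lra.
have x1 : x < 1 by exact: lt_trans kap1.
have xn : x ^+ n <= (kap ^+ n - s2 ^+ n) / 2.
  apply: (@le_trans _ _ x); last by rewrite ge_min lexx orbT.
  by rewrite -[n]prednK// exprS ler_piMr ?(ltW x0)// exprn_ile1// ltW.
have txx : t * x < x by rewrite gtr_pMl.
have bx : ballm (t * x) x * t ^+ n = B * x ^+ n.
  have h1 := Phi_ballm ht1 ats sb (_ : 0 < x < 1); rewrite x0 x1 in h1; have {}h1 := h1 isT.
  apply: (mulIf (lt0r_neq0 sn0)); rewrite mulrAC -h1 mulrAC PB; ring.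
have b2 := ext0_Phi_mbdd ats2' ts2 s2b.
have : ballm (t * kap) kap <= mu (ext0 Vp (Phi C G (t * s2) s2 Zs)) + ballm (t * x) x.
  rewrite /ballm -muD//; last exact: ext0_cut_mbdd.
  apply: mu_le => [||Z _]; [exact: ext0_cut_mbdd|apply: mbddD => //; exact: ext0_cut_mbdd|].
  have /andP[p0 p1] := ext0_Phi_range Z ats2' ts2 s2b.
  have [CZ|CZ] := pselect (C0 Z); last by rewrite ![ext0 C0 _ _]ext0_out// addr0. rewrite ![ext0 C0 _ _]ext0_in//.
  have [->|h] := eqVneq (cut (t * kap) kap (usq g0 Z)) 0; first by rewrite addr_ge0// cut_ge0.
  have [hk nC] := cut_core tkk CZ (lexx _) h. have [VZ|VZ] := pselect (Vp Z).
    rewrite ext0_in// (Phi_indep ats2' ts2 s2b ats tss sb VZ nC). have -> : Phi C G (t * s) s Zs Z = 1.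
      have [h0|//] := Phi_out sc ats tss sb a0 CVp CZs VZ nC.
      by case: z; rewrite -(Phi_core sc ats tss sb Zs (ltW kap0) Ckap kap1 VZ hk).
    by rewrite (le_trans (cut_le1 _ _))// lerDl cut_ge0.
  rewrite ext0_out// add0r usq_g0//; move/negP: VZ; rewrite negbK => /eqP ->.
  rewrite ip0r mul0r !cut_left//; apply: ltW; exact: mulr_gt0.
move=> h; have B0 : 0 < B := lt_le_trans m0 mB.
have {}h := ler_wpM2r (ltW tn0) h; rewrite bk mulrDl bx PB2 -mulrDr ler_pM2l// in h.
lra.
Qed.

End CoreBound.

(** * The volume bound for embedded shells *)

Section ShellBound.
Context {R : realType} (n : nat).
Local Notation V := 'M[R]_(n.+1, 2).
Local Notation E := 'M[R]_(n, 2).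
Implicit Types (f : E -> CP R n).

Lemma Ck_subset (k : nat) (A B : set E) (F : E -> E) : A `<=` B -> Ck k B F -> Ck k A F.
Proof.
move=> AB; elim: k F => [|k IH] F /= [cF h]; split=> //; try by move=> x /set_mem Ax; apply: cF; exact/mem_set/AB.
by move=> v; have [h1 h2] := h v; split=> [x /AB/h1//|]; exact: IH.
Qed.

Lemma embedding_on_subset (W W' : set E) f : open W' -> W' `<=` W -> embedding_on W f -> embedding_on W' f.
Proof.
move=> oW' WW [sf injf df opf]; split.
- move=> j; have [oj kj] := sf j. have e : W' `&` f @^-1` chart_dom j = W' `&` (W `&` f @^-1` chart_dom j).
    by apply/seteqP; split=> x /= => [[h1 h2]|[h1 [h2 h3]]]; do !split=> //; exact: WW.
  split; first by rewrite e; exact: openI. by move=> k; apply: Ck_subset (kj k) => x [h1 h2]; split=> //; exact: WW.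
- by move=> x y /set_mem Wx /set_mem Wy; apply: injf; exact/mem_set/WW.
- by move=> p j /WW; exact: df.
- move=> A oA AW; have [Q oQ fQ] := opf A oA (subset_trans AW WW).
  exists Q => //; apply/seteqP; split=> [_ [x Ax <-]|_ [[x Wx <-] Qx]].
    split; first by exists x => //; exact: AW. by have : (f @` A) (f x); [exists x|rewrite fQ => -[]].
  suff : (f @` W `&` Q) (f x) by rewrite -fQ. by split=> //; exists x => //; exact: WW.
Qed.

(** The product [(|x|^2 - s) (|x|^2 - t)] is positive off [W], hence bounded below on the compact
    part of the complement near the shell. A thin enough enlargement keeps it below that bound. *)
Lemma shell_nbhs (W : set E) (s t : R) : 0 < s -> s < t -> open W -> [set x : E | s <= sq x <= t] `<=` W ->
  exists a b : R, [/\ 0 <= a, a < s, t < b & [set x : E | a < sq x < b] `<=` W].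
Proof.
move=> s0 st oW sW.
pose g (x : E) := (sq x - s) * (sq x - t).
have gc x : {for x, continuous g}.
  by apply: continuousM; apply: continuousB; [exact: ip_cont|exact: cont_cst|exact: ip_cont|exact: cont_cst].
have g0 x : ~ W x -> 0 < g x.
  move=> nW; rewrite ltNge; apply/negP => h; apply: nW; apply: sW => /=; move: h; rewrite /g. move: (sq x) => u; nra.
have cK : compact ([set x : E | 0 <= sq x <= t + 1] `&` ~` W).
  by apply: compact_closedI; [exact: compact_shell|rewrite closedC].
have [B B0 hB] : exists2 B : R, 0 < B & forall x, ([set x : E | 0 <= sq x <= t + 1] `&` ~` W) x -> `|(g x)^-1| <= B.
  apply: compact_bdd => // x [_ nW]; apply: continuousV => //; rewrite gt_eqF//; exact: g0.
pose e := Num.min (Num.min 1 s) (B^-1 / (t - s + 2)).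
have ts : 0 < t - s + 2 by lra.
have e0 : 0 < e by rewrite !lt_min ltr01 s0 divr_gt0// invr_gt0.
have [e1 es eB] : [/\ e <= 1, e <= s & e * (t - s + 2) <= B^-1].
  by rewrite -ler_pdivlMr// /e !ge_min !lexx !orbT.
clearbody e.
exists (s - e), (t + e); split; [lra|lra|lra|move=> x /= /andP[h1 h2]].
apply: contrapT => nW; have gx := g0 x nW.
have x1 : 0 <= sq x <= t + 1 by apply/andP; split; lra.
have := hB x (conj x1 nW); rewrite gtr0_norm ?invr_gt0// => h.
have : B^-1 <= g x by rewrite -[g x]invrK lef_pV2// posrE invr_gt0.
move: gx eB; rewrite /g; move: (sq x) (B^-1) h1 h2 => u v h1 h2 gx eB hv; nra.
Qed.

Lemma cone_outside_ball (W : set E) f (d : R) (Z : V) : 0 < d < 1 -> f @` W `<=` V_eps d -> cone W f Z ->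
  (1 - d) ^+ 2 * sq Z < sq (del0 Z).
Proof.
move=> /andP[d0 d1] fW [Z0 /fW]; rewrite ltNge => h; apply/negP => hZ; apply: h.
have Zp := ip_gt0 Z0.
have k1 : (1 - d) ^+ 2 < 1 by nra.
have hN0 : hN Z ord0 != 0.
  apply/eqP => h; have := ip_lift ord0 Z Z; rewrite -!expr2 -/(hN Z ord0) h add0r => e.
  by move: hZ; rewrite -e; move: Zp k1; move: (sq Z) ((1 - d) ^+ 2) => u v *; nra.
exists (g0 Z).
  rewrite closure_eball ?subr_gt0//= enorm_le ?subr_ge0 ?(ltW d1)//. by rewrite -/(usq g0 Z) usq_g0// ler_pdivrMr.
by rewrite ball_embedE sec_g0// cpt_cs// ph_neq0.
Qed.

(** The base point must lie in both coordinate domains; an arbitrarily small change of the zeroth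
    coordinate leaves the hyperplane at infinity. *)
Lemma nonzero_head (C : set V) (Z : V) : open C -> C Z -> exists2 Z', C Z' & hN Z' ord0 != 0.
Proof.
move=> oC CZ; have [h|] := eqVneq (hN Z ord0) 0; last by exists Z.
pose F (t : R) : V := Z + t *: delta_mx ord0 ord0.
have cF : {for (0 : R), continuous F}.
  by apply: cvgD; [exact: cvg_cst|apply: cvgZr_tmp; exact: cvg_id].
have h1 : \forall t \near (0 : R)^'+, C (F t).
  have : \forall t \near (0 : R), C (F t).
    by apply: (cF C); rewrite /F scale0r addr0; exact: open_nbhs_nbhs.
  by apply: filterS => t Ct _.
near (0 : R)^'+ => t; have Ct : C (F t) by near: t; exact: h1.
have t0 : 0 < t by near: t; exact: nbhs_right_gt.
exists (F t) => //; move/eqP: h; rewrite /hN paddr_eq0 ?sqr_ge0// !sqrf_eq0 => /andP[/eqP e0 /eqP e1].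
by rewrite !mxE e0 e1 /= !(add0r, mulr1, mulr0) expr0n addr0 sqrf_eq0 gt_eqF.
Unshelve. all: by end_near. Qed.

Lemma shell_bound (r d : R) : (2 <= n)%N -> 0 < r -> 0 < d < 1 ->
  shell_embeds r d (V_eps d : set (CP R n)) -> (r ^+ 2) ^+ n + ((1 - d) ^+ 2) ^+ n <= 1.
Proof.
move=> n2 r0 d01 [W [f [oW sW fW fe fs]]]; have d01' := d01; case/andP: d01' => d0 d1.
have k01 : 0 < (1 - d) ^+ 2 < 1 by rewrite exprn_gt0 ?subr_gt0//=; nra.
have [k0 k1] := andP k01; have r2 : 0 < r ^+ 2 by rewrite exprn_gt0.
have s0 : 0 < (r * (1 - d)) ^+ 2 by rewrite exprMn mulr_gt0.
have st : (r * (1 - d)) ^+ 2 < r ^+ 2 by rewrite exprMn gtr_pMr.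
rewrite shellE// in sW; have [a [b [a0 as_ tb abW]]] := shell_nbhs s0 st oW sW.
set W' := [set x : E | a < sq x < b] in abW.
have oW' : open W' by exact: open_shell.
have fe' := embedding_on_subset oW' abW fe.
have fs' : symplectic_on W' f by move=> p j /abW; exact: fs.
have sc := cone_symp_coord fe' fs'.
have [x xab] : exists x : E, a < sq x < b.
  pose j := Ordinal (ltnW n2). exists (r *: delta_mx j ord0).
  have -> : ip (r *: delta_mx j ord0 : E) (r *: delta_mx j ord0) = r ^+ 2.
    rewrite /ip (bigD1 j)//= big1 ?addr0 => [|k /negbTE kj].
      by rewrite !mxE eqxx/= !(mulr1, mulr0) addr0 expr2.
    by rewrite !mxE kj/= !(mulr0, addr0).
  by rewrite tb (lt_trans as_ st).
have [B [s [_ Bx _ /(_ x Bx)[Cs _]]]] := sc_lift sc xab.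
have [Zs CZs hZs] := nonzero_head (sc_open sc) Cs.
apply: (core_bound n2 sc a0 d01 CZs hZs) => //; last by rewrite mulrC -exprMn.
by move=> Z; apply: cone_outside_ball => // _ [y Wy <-]; apply: fW; exists y => //; exact: abW.
Qed.

(** Bernoulli's inequality turns [x ^+ n + k <= 1] into the linear bound [x <= 1 - k / n], with no
    root to extract. *)
Lemma one_sub_expr_le (x : R) m : 0 <= x <= 1 -> 1 - x ^+ m <= m%:R * (1 - x).
Proof.
move=> /andP[x0 x1]; elim: m => [|m IH]; first by rewrite expr0 subrr mul0r.
have y1 : x ^+ m <= 1 by exact: exprn_ile1.
have : 0 <= (1 - x) * (1 - x ^+ m) by rewrite mulr_ge0// subr_ge0.
by rewrite exprS -natr1; lra.
Qed.

End ShellBound.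

Theorem theorem1p3 (R : realType) (n : nat) (delta : R) : (2 <= n)%N -> 0 < delta < 1 ->
  ~ (shell_capacity delta (V_eps eps : set (CP R n)) @[eps --> within `]0, 1[ (nbhs delta)]
     --> shell_capacity delta (V_eps delta : set (CP R n))).
Proof.
move=> n2 d01 hcv; have /andP[d0 d1] := d01.
(* [rho] is the bound on the squared radius obtained from Bernoulli's inequality; here [k] is the
   normalized volume of the removed ball. *)
pose k := ((1 - delta) ^+ 2) ^+ n; pose rho := 1 - k / n%:R.
have n0 : 0 < n%:R :> R by rewrite ltr0n (leq_trans _ n2).
have k0 : 0 < k by rewrite !exprn_gt0// subr_gt0.
have k1 : k <= 1 by rewrite !exprn_ile1 ?exprn_ge0 ?subr_ge0 ?(ltW d1)//; lra.
have kn : k / n%:R <= 1 by rewrite ler_pdivrMr// mul1r (le_trans k1)// ler1n (leq_trans _ n2).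
have rho1 : rho < 1 by rewrite gtrBl divr_gt0.
have rho0 : 0 <= rho by rewrite subr_ge0.
have up : (shell_capacity delta (V_eps delta : set (CP R n)) <= (pi * rho)%:E)%E.
  apply/ereal_supP => _ [r [r0 /(shell_bound n2 r0 d01) hr] <-].
  rewrite lee_fin ler_pM2l ?pi_gt0//; move: hr; rewrite -/k; set x := r ^+ 2 => hr. have x0 : 0 <= x by exact: sqr_ge0.
  have x1 : x <= 1 by rewrite -(@expr_le1 _ n) ?(leq_trans _ n2)//; lra.
  have := one_sub_expr_le n (_ : 0 <= x <= 1); rewrite x0 x1 => /(_ isT) h.
  have {}h : k / n%:R <= 1 - x by rewrite ler_pdivrMr// mulrC; lra. by rewrite /rho; lra.
pose M := pi * ((1 + rho) / 2).
have lo eps : delta < eps < 1 -> (M%:E <= shell_capacity delta (V_eps eps : set (CP R n)))%E.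
  move=> /andP[de e1]; pose q := (1 - eps) / (1 - delta). have d1' : 0 < 1 - delta by rewrite subr_gt0.
  (* The first entry of the maximum gives [r^2 >= (1 + rho) / 2], since [(1 - y/4)^2 >= 1 - y/2]
     with [y = 1 - rho]. The second exceeds [q], which is the condition
     [1 - eps < r * (1 - delta)]. *)
  have q1 : q < 1 by rewrite ltr_pdivrMr// mul1r; lra. pose r := Num.max ((3 + rho) / 4) ((q + 1) / 2).
  have r1 : r < 1 by rewrite gt_max; apply/andP; split; lra.
  have [rr rq] : (3 + rho) / 4 <= r /\ (q + 1) / 2 <= r by rewrite !le_max !lexx orbT.
  clearbody r; have r0 : 0 < r by lra. apply: le_ereal_sup_tmp; exists (pi * r ^+ 2)%:E.
    exists r => //; split=> //; apply: shell_embeds_ball; rewrite ?r0 ?d0 ?d1 ?e1 ?andbT//=; first exact: lt_trans de.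
    by rewrite -ltr_pdivrMr// -/q; lra.
  by rewrite lee_fin ler_pM2l ?pi_gt0//; nra.
have cM : (shell_capacity delta (V_eps delta : set (CP R n)) < M%:E)%E.
  by rewrite (le_lt_trans up)// lte_fin ltr_pM2l ?pi_gt0//; lra.
have : \forall eps \near delta, (0 < eps < 1) -> (shell_capacity delta (V_eps eps : set (CP R n)) < M%:E)%E.
  have nM : nbhs (shell_capacity delta (V_eps delta : set (CP R n))) [set y | (y < M%:E)%E].
    by apply: open_nbhs_nbhs; split=> //; exact: open_ereal_lt_ereal.
  have : \forall eps \near within `]0, 1[ (nbhs delta), (shell_capacity delta (V_eps eps : set (CP R n)) < M%:E)%E := hcv _ nM.
  by rewrite near_withinE; apply: filterS => eps h e01; apply: h; rewrite /= in_itv.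
(* The jump is seen from the right: the capacity is at least [M] for every [eps] above [delta]. *)
move=> h; have {}h : \forall eps \near delta^'+, 0 < eps < 1 -> (shell_capacity delta (V_eps eps : set (CP R n)) < M%:E)%E.
  by move: h; apply: filterS => eps he _; exact: he.
near delta^'+ => eps.
have de : delta < eps by near: eps; exact: nbhs_right_gt.
have e1 : eps < 1 by near: eps; exact: nbhs_right_lt.
have : 0 < eps < 1 -> (shell_capacity delta (V_eps eps : set (CP R n)) < M%:E)%E by near: eps.
by rewrite e1 (lt_trans d0 de) => /(_ isT); rewrite ltNge lo ?de.
Unshelve. all: by end_near. Qed.
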